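(* Let $R=\mathbb C(q^{1/4})$ with $q$ generic. The Kauffman bracket skein algebra $\mathrm{Sk}_q(\Sigma_{0,5})$ of the five-punctured sphere, which is isomorphic to the rank $2$ Askey--Wilson algebra $\mathrm{AW}(4)$ (over $R$), has a presentation as an $R$-algebra with generators the simple loops $s_A$, $\emptyset\ne A\subseteq\{1,2,3,4\}$, and the following relations (write $s_{12}=s_{\{1,2\}}$ etc., and $s_\emptyset=-(q+q^{-1})$). **Commuting relations.** $s_A$ is central if $|A|\in\{1,4\}$; $s_As_B=s_Bs_A$ if $|A|=2$, $|B|=3$, $A\subset B$; $s_{12}s_{34}=s_{34}s_{12}$; $s_{23}s_{14}=s_{14}s_{23}$. **Commutator relations.** For all $A_1,A_2,A_3,A_4\subseteq\{1,2,3,4\}$ with $\max A_i<\min A_j$ whenever $i<j$ and $A_i,A_j\neq\emptyset$, and for $(A,B)$ equal to $(A_1\cup A_2\cup A_4,\,A_2\cup A_3)$, $(A_2\cup A_3,\,A_1\cup A_3\cup A_4)$ or $(A_1\cup A_3\cup A_4,\,A_1\cup A_2\cup A_4)$: $$qs_As_B-q^{-1}s_Bs_A=(q^2-q^{-2})s_{(A\cup B)\setminus(A\cap B)}+(q-q^{-1})\big(s_{A\cap B}s_{A\cup B}+s_{A\setminus(A\cap B)}s_{B\setminus(A\cap B)}\big).$$ **Cubic relations.** $$\begin{aligned} s_{12}s_{23}s_{13}&=-(q+2q^{-1}+q^{-3})+q^{-1}(s_1^2+s_2^2+s_3^2)+s_1s_2s_{12}+q^{-2}s_2s_3s_{23}+s_1s_3s_{13}+q^{-1}s_1s_2s_3s_{123}\\&\quad+qs_{12}^2+s_3s_{12}s_{123}+q^{-3}s_{23}^2+q^{-2}s_1s_{23}s_{123}+qs_{13}^2+s_2s_{13}s_{123}+q^{-1}s_{123}^2\\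 s_{23}s_{34}s_{24}&=-(q+2q^{-1}+q^{-3})+q^{-1}(s_2^2+s_3^2+s_4^2)+s_2s_3s_{23}+q^{-2}s_3s_4s_{34}+s_2s_4s_{24}+q^{-1}s_2s_3s_4s_{234}\\&\quad+qs_{23}^2+s_4s_{23}s_{234}+q^{-3}s_{34}^2+q^{-2}s_2s_{34}s_{234}+qs_{24}^2+s_3s_{24}s_{234}+q^{-1}s_{234}^2\\ s_{34}s_{14}s_{13}&=-(q+2q^{-1}+q^{-3})+q^{-1}(s_1^2+s_3^2+s_4^2)+s_3s_4s_{34}+q^{-2}s_1s_4s_{14}+s_1s_3s_{13}+q^{-1}s_1s_3s_4s_{134}\\&\quad+qs_{34}^2+s_1s_{34}s_{134}+q^{-3}s_{14}^2+q^{-2}s_3s_{14}s_{134}+qs_{13}^2+s_4s_{13}s_{134}+q^{-1}s_{134}^2\\ s_{12}s_{14}s_{24}&=-(q^3+2q+q^{-1})+q(s_1^2+s_2^2+s_4^2)+s_1s_2s_{12}+q^2s_1s_4s_{14}+s_2s_4s_{24}+qs_1s_2s_4s_{124}\\&\quad+q^{-1}s_{12}^2+s_4s_{12}s_{124}+q^3s_{14}^2+q^2s_2s_{14}s_{124}+q^{-1}s_{24}^2+s_1s_{24}s_{124}+qs_{124}^2 \end{aligned}$$ **Cubic relations with triples.** $$\begin{aligned} s_{12}s_{23}s_{134}&=(1+q^{-2})s_4-s_2^2s_4+q^{-1}s_1s_2s_3s_{1234}+s_3s_{1234}s_{12}+q^{-2}s_1s_{1234}s_{23}+q^{-1}s_3s_{34}+q^{-1}s_1s_{14}\\&\quad+s_2s_{1234}s_{13}-qs_2s_{24}+q^{-1}s_{1234}s_{123}+(q^{-2}-1)s_2s_3s_{234}+s_1s_3s_{134}+s_2s_{12}s_{14}\\&\quad+qs_{12}s_{124}+s_2s_{23}s_{34}+q^{-3}s_{23}s_{234}+qs_{13}s_{134}\\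 s_{23}s_{34}s_{124}&=(1+q^{-2})s_1-q^2s_1s_3^2+q^{-1}s_2s_3s_4s_{1234}+q^{-1}s_2s_{12}+s_4s_{1234}s_{23}+q^{-2}s_2s_{1234}s_{34}+q^{-1}s_4s_{14}\\&\quad+(-q^3-q+q^{-1})s_3s_{13}+s_3s_{1234}s_{24}+(1-q^2)s_2s_3s_{123}+q^{-1}s_{1234}s_{234}+(q^{-2}-1)s_3s_4s_{134}\\&\quad+s_2s_4s_{124}+q^2s_3s_{12}s_{23}+qs_{23}s_{123}+s_3s_{34}s_{14}+q^{-3}s_{34}s_{134}+qs_{24}s_{124}\\ s_{34}s_{14}s_{123}&=(1+q^{-2})s_2+(1-q^2-q^{-2})s_2s_4^2+q^{-1}s_1s_3s_4s_{1234}+q^{-1}s_1s_{12}+q^{-1}s_3s_{23}+s_1s_{1234}s_{34}\\&\quad+q^{-2}s_3s_{1234}s_{14}+s_4s_{1234}s_{13}+(-q^3+q^{-1}-q^{-3})s_4s_{24}+s_1s_3s_{123}+(1-q^2)s_3s_4s_{234}\\&\quad+q^{-1}s_{1234}s_{134}+q^{-2}s_4s_{12}s_{14}+q^2s_4s_{23}s_{34}+qs_{34}s_{234}+q^{-3}s_{14}s_{124}+qs_{13}s_{123}\\ s_{12}s_{14}s_{234}&=(q^2+1)s_3+qs_1s_2s_4s_{1234}-q^2s_1^2s_3+s_4s_{1234}s_{12}+qs_2s_{23}+qs_4s_{34}+q^2s_2s_{1234}s_{14}\\&\quad-q^3s_1s_{13}+s_1s_{1234}s_{24}+s_2s_4s_{234}+qs_{1234}s_{124}+s_1s_{12}s_{23}+q^{-1}s_{12}s_{123}\\&\quad+q^2s_1s_{34}s_{14}+q^3s_{14}s_{134}+q^{-1}s_{24}s_{234}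 \end{aligned}$$ **Quartic relation.** $$\begin{aligned} s_{12}s_{23}s_{34}s_{14}&=s_1s_3s_{12}s_{23}+s_2s_4s_{12}s_{14}+s_2s_4s_{23}s_{34}+s_1s_3s_{34}s_{14}\\ &+(qs_3s_{12}+qs_2s_{13}+q^{-1}s_1s_{23}+s_{123}+q^{-1}s_4s_{1234}+s_1s_2s_3)s_{123}\\ &+(qs_4s_{13}+qs_3s_{14}+q^{-1}s_1s_{34}+s_{134}+q^{-1}s_2s_{1234}+s_1s_3s_4)s_{134}\\ &+(qs_4s_{12}+qs_2s_{14}+q^{-1}s_1s_{24}+s_{124}+q^{-1}s_3s_{1234}+s_1s_2s_4)s_{124}\\ &+q^{-2}(q^{-1}s_4s_{23}+q^{-1}s_3s_{24}+q^{-1}s_2s_{34}+q^{-2}s_{234}+q^{-1}s_1s_{1234}+(2-q^2)s_2s_3s_4)s_{234}\\ &+(q^2s_{12}+(q+q^{-1})s_1s_2+s_3s_4s_{1234})s_{12}+(q^{-2}s_{23}+q^{-1}s_2s_3+q^{-2}s_1s_4s_{1234})s_{23}\\ &+(q^2s_{14}+(q+q^{-1})s_1s_4+s_2s_3s_{1234})s_{14}+(q^{-2}s_{34}+q^{-1}s_3s_4+q^{-2}s_1s_2s_{1234})s_{34}\\ &+(q^{-2}s_{24}+(q^{-1}-q)s_2s_4+q^{-2}s_1s_3s_{1234})s_{24}+(q^2s_{13}+s_2s_4s_{1234})s_{13}\\ &+q^{-2}s_{1234}^2-s_2^2s_4^2-s_1^2s_3^2+q^{-1}s_1s_2s_3s_4s_{1234}+(2+q^{-2})(s_1^2+s_2^2+s_3^2+s_4^2)\\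 &-2q^2-5-4q^{-2}-q^{-4} \end{aligned}$$ **Crossing relations.** $$\begin{aligned} s_{13}s_{24}&=(q+q^{-1})s_{1234}+s_1s_2s_3s_4+q^{-1}s_3s_4s_{12}+qs_1s_4s_{23}+q^{-1}s_1s_2s_{34}+qs_2s_3s_{14}\\&\quad+s_4s_{123}+s_1s_{234}+s_2s_{134}+s_3s_{124}+q^{-2}s_{12}s_{34}+q^2s_{23}s_{14}\\ s_{24}s_{13}&=(q+q^{-1})s_{1234}+s_1s_2s_3s_4+qs_3s_4s_{12}+q^{-1}s_1s_4s_{23}+qs_1s_2s_{34}+q^{-1}s_2s_3s_{14}\\&\quad+s_4s_{123}+s_1s_{234}+s_2s_{134}+s_3s_{124}+q^2s_{12}s_{34}+q^{-2}s_{23}s_{14} \end{aligned}$$ **Triple loop relations.** $$\begin{aligned} s_{123}s_{134}&=-s_2s_4+s_{1234}s_{13}-(q+q^{-1})s_{24}-s_3s_{234}-s_1s_{124}+s_{12}s_{14}+s_{23}s_{34}\\ s_{134}s_{123}&=(1-q^2-q^{-2})s_2s_4+s_{1234}s_{13}-(q^3+q^{-3})s_{24}-q^2s_3s_{234}-q^{-2}s_1s_{124}+q^{-2}s_{12}s_{14}+q^2s_{23}s_{34}\\ s_{234}s_{124}&=-q^2s_1s_3-(q^3+q)s_{13}+s_{1234}s_{24}-q^2s_2s_{123}-s_4s_{134}+q^2s_{12}s_{23}+s_{34}s_{14}\\ s_{124}s_{234}&=-q^2s_1s_3-(q^3+q)s_{13}+s_{1234}s_{24}-s_2s_{123}-q^2s_4s_{134}+s_{12}s_{23}+q^2s_{34}s_{14}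 \end{aligned}$$ **Triple link relations.** $$\begin{aligned} s_{123}s_{234}&=q^{-1}s_2s_3s_{1234}+s_1s_4+(q^{-1}-q)s_2s_4s_{12}+s_{1234}s_{23}+(q+q^{-1})s_{14}+s_3s_{134}+q^{-2}s_2s_{124}\\&\quad-q^2s_{12}s_{24}-qs_3s_{12}s_{234}-s_{34}s_{13}-q^{-1}s_2s_{34}s_{123}+qs_{12}s_{23}s_{34}\\ s_{234}s_{123}&=qs_2s_3s_{1234}+s_1s_4+(-q^3+q)s_2s_4s_{12}+s_{1234}s_{23}+(q+q^{-1})s_{14}+q^2s_3s_{134}+s_2s_{124}\\&\quad-q^4s_{12}s_{24}-q^3s_3s_{12}s_{234}-q^2s_{34}s_{13}-qs_2s_{34}s_{123}+q^3s_{12}s_{23}s_{34}\\ s_{234}s_{134}&=q^{-1}s_3s_4s_{1234}+s_1s_2+(q+q^{-1})s_{12}+(q^{-1}-q)s_1s_3s_{23}+s_{1234}s_{34}+q^{-2}s_3s_{123}+s_4s_{124}\\&\quad-q^2s_{23}s_{13}-qs_4s_{23}s_{134}-s_{14}s_{24}-q^{-1}s_3s_{14}s_{234}+qs_{23}s_{34}s_{14}\\ s_{134}s_{234}&=qs_3s_4s_{1234}+s_1s_2+(q+q^{-1})s_{12}+(-q^3+q)s_1s_3s_{23}+s_{1234}s_{34}+s_3s_{123}+q^2s_4s_{124}\\&\quad-q^4s_{23}s_{13}-q^3s_4s_{23}s_{134}-q^2s_{14}s_{24}-qs_3s_{14}s_{234}+q^3s_{23}s_{34}s_{14}\\ s_{134}s_{124}&=s_2s_3+q^{-1}s_1s_4s_{1234}+(q+q^{-1})s_{23}+s_{1234}s_{14}+s_1s_{123}+q^{-2}s_4s_{234}\\&\quad-s_{12}s_{13}-q^{-1}s_4s_{12}s_{134}-q^{-2}s_{34}s_{24}-q^{-1}s_1s_{34}s_{124}+q^{-1}s_{12}s_{34}s_{14}\\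 s_{124}s_{134}&=s_2s_3+qs_1s_4s_{1234}+(q+q^{-1})s_{23}+s_{1234}s_{14}+q^2s_1s_{123}+s_4s_{234}\\&\quad-q^2s_{12}s_{13}-qs_4s_{12}s_{134}-s_{34}s_{24}-qs_1s_{34}s_{124}+qs_{12}s_{34}s_{14}\\ s_{123}s_{124}&=(q^4-q^2+q^{-2})s_3s_4+(q^3-q+q^{-1})s_1s_2s_{1234}+s_{1234}s_{12}+(q^3-q)s_2s_4s_{23}\\&\quad+(q^5-q+q^{-1}+q^{-3})s_{34}+(q^{-1}-q)s_1s_3s_{14}+(q^4-1+q^{-2})s_2s_{234}+(q^4-q^2+q^{-2})s_1s_{134}\\&\quad-q^{-2}s_{23}s_{24}-q^{-1}s_1s_{23}s_{124}-q^4s_{14}s_{13}-q^3s_2s_{14}s_{123}+qs_{12}s_{23}s_{14}\\ s_{124}s_{123}&=(q^2-q^{-2}+q^{-4})s_3s_4+(q-q^{-1}+q^{-3})s_1s_2s_{1234}+s_{1234}s_{12}+(q-q^{-1})s_2s_4s_{23}\\&\quad+(q^3+q-q^{-1}+q^{-5})s_{34}+(q^{-3}-q^{-1})s_1s_3s_{14}+(q^2-q^{-2}+q^{-4})s_2s_{234}+(q^2-1+q^{-4})s_1s_{134}\\&\quad-q^{-4}s_{23}s_{24}-q^{-3}s_1s_{23}s_{124}-q^2s_{14}s_{13}-qs_2s_{14}s_{123}+q^{-1}s_{12}s_{23}s_{14} \end{aligned}$$ **Double and triple relations.** $$\begin{aligned} s_{24}s_{123}&=(1-q^2-q^{-2})s_2s_{1234}-qs_1s_3s_4-q^2s_1s_{34}-q^{-2}s_3s_{14}-q^2s_4s_{13}-qs_2s_4s_{123}\\&\quad-(q^3+q^{-3})s_{134}+qs_4s_{12}s_{23}+q^2s_{12}s_{234}+q^{-2}s_{23}s_{124}\\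 s_{123}s_{24}&=-s_2s_{1234}-qs_1s_3s_4-s_1s_{34}-s_3s_{14}-q^2s_4s_{13}-qs_2s_4s_{123}-(q+q^{-1})s_{134}\\&\quad+qs_4s_{12}s_{23}+s_{12}s_{234}+s_{23}s_{124}\\ s_{13}s_{234}&=(1-q^2-q^{-2})s_3s_{1234}-qs_1s_2s_4-q^{-2}s_4s_{12}-q^2s_2s_{14}-q^2s_1s_{24}-qs_1s_3s_{234}\\&\quad-(q^3+q^{-3})s_{124}+qs_1s_{23}s_{34}+q^2s_{23}s_{134}+q^{-2}s_{34}s_{123}\\ s_{234}s_{13}&=-s_3s_{1234}-qs_1s_2s_4-s_4s_{12}-s_2s_{14}-q^2s_1s_{24}-qs_1s_3s_{234}-(q+q^{-1})s_{124}\\&\quad+qs_1s_{23}s_{34}+s_{23}s_{134}+s_{34}s_{123}\\ s_{24}s_{134}&=(1-q^2-q^{-2})s_4s_{1234}-qs_1s_2s_3-q^2s_3s_{12}-q^{-2}s_1s_{23}-q^2s_2s_{13}-(q^3+q^{-3})s_{123}\\&\quad-qs_2s_4s_{134}+qs_2s_{34}s_{14}+q^2s_{34}s_{124}+q^{-2}s_{14}s_{234}\\ s_{134}s_{24}&=-s_4s_{1234}-qs_1s_2s_3-s_3s_{12}-s_1s_{23}-q^2s_2s_{13}-(q+q^{-1})s_{123}-qs_2s_4s_{134}\\&\quad+qs_2s_{34}s_{14}+s_{34}s_{124}+s_{14}s_{234}\\ s_{13}s_{124}&=-q^{-1}s_2s_3s_4+(1-q^2-q^{-2})s_1s_{1234}-q^2s_4s_{23}-q^{-2}s_2s_{34}-q^{-2}s_3s_{24}-(q^3+q^{-3})s_{234}\\&\quad-q^{-1}s_1s_3s_{124}+q^{-1}s_3s_{12}s_{14}+q^{-2}s_{12}s_{134}+q^2s_{14}s_{123}\\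 s_{124}s_{13}&=-q^{-1}s_2s_3s_4-s_1s_{1234}-s_4s_{23}-s_2s_{34}-q^{-2}s_3s_{24}-(q+q^{-1})s_{234}-q^{-1}s_1s_3s_{124}\\&\quad+q^{-1}s_3s_{12}s_{14}+s_{12}s_{134}+s_{14}s_{123} \end{aligned}$$
   Context: **Skein algebra.** $\Sigma_{0,5}$ is the five-punctured sphere, drawn as the plane with punctures $1,2,3,4$ on a horizontal line from left to right and the fifth puncture at infinity. $\mathrm{Sk}_q(\Sigma)$ is the $\mathbb C(q^{1/4})$-vector space spanned by isotopy classes of framed links in $\Sigma\times[0,1]$ (drawn with blackboard framing) modulo: a contractible circle equals $-q-q^{-1}$; and a crossing whose over-strand runs from lower right to upper left equals $q^{1/2}$ times the smoothing joining the two upper ends to each other and the two lower ends to each other, plus $q^{-1/2}$ times the smoothing joining the two left ends to each other and the two right ends to each other. The product $XY$ is obtained by stacking $Y$ above $X$. For non-empty $A\subseteq\{1,2,3,4\}$, $s_A$ is the simple closed curve enclosing exactly the punctures in $A$ among $1,\dots,4$ and passing below the punctures not in $A$ (equivalently, placing $1,2,3,4$ clockwise in convex position, the boundary of a neighbourhood of the convex hull of $A$). **Askey--Wilson algebra.** $U=\mathcal U_q(\mathfrak{sl}_2)$ is generated by $K^{\pm1},E,F$ with $KE=q^2EK$, $KF=q^{-2}FK$, $[E,F]=\frac{K-K^{-1}}{q-q^{-1}}$, $\Delta(K)=K\otimes K$, $\Delta(E)=E\otimes K+1\otimes E$, $\Delta(F)=F\otimes1+K^{-1}\otimes F$, Casimir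 $\Lambda=(q-q^{-1})^2FE+qK+q^{-1}K^{-1}$. Let $\mathcal I_L\subset U$ be the subalgebra generated by $E,FK,K,\Lambda$ and $\tau_L:\mathcal I_L\to U\otimes\mathcal I_L$ the algebra morphism $E\mapsto K\otimes E$, $FK\mapsto K^{-1}\otimes FK-qF\otimes\Lambda+q(q+q^{-1})F\otimes K-q^{-1}(q-q^{-1})^2F^2K\otimes E$, $K\mapsto1\otimes K-q^{-1}(q-q^{-1})^2FK\otimes E$, $\Lambda\mapsto1\otimes\Lambda$. $\mathrm{AW}(4)\subset U^{\otimes4}$ is the subalgebra generated by $\Lambda_A=\big((\mathrm{id}^{\otimes(i_k-2)}\otimes\alpha_{i_k-1})\circ\cdots\circ\alpha_1(\Lambda)\big)\otimes1^{\otimes(4-i_k)}$ for $\emptyset\neq A=\{i_1<\dots<i_k\}\subseteq\{1,2,3,4\}$, with $\alpha_i=\Delta$ if $i\in A$ and $\alpha_i=\tau_L$ otherwise; here its scalars are extended to $\mathbb C(q^{1/4})$. The isomorphism $\mathrm{Sk}_q(\Sigma_{0,5})\cong\mathrm{AW}(4)$ is the one with $s_A\mapsto-\Lambda_A$.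
   Formalization: In the quartic relation the coefficients of s_2s_3s_23, s_3s_4s_34 and s_1s_2s_3s_4s_1234 are 2q^{-1}, not q^{-1} (the printed relation fails at q=1); s_A -> -Λ_A is shown to be an anti-isomorphism onto AW(4), and an algebra isomorphism Sk ≅ AW(4) is proved separately. *)

(* Defs.v *)
From HB Require Import structures.
From mathcomp Require Import all_boot all_order all_algebra.
From mathcomp Require Import finmap.
From mathcomp.multinomials Require Import monalg.
From mathcomp Require Import boolp classical_sets reals.
From mathcomp Require Import complex.

Set Implicit Arguments.
Unset Strict Implicit.
Unset Printing Implicit Defensive.

Import GRing.Theory.
Local Open Scope ring_scope.
Local Open Scope quotient_scope.

(** * Algebras over a field *)

(* MathComp's [algType K] requires [1 != 0], which is not available for an
   algebra given by generators and relations.  A K-algebra is taken here to be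
   a possibly trivial ring with a central ring morphism from K. *)
HB.mixin Record PzRing_isKAlgebra (K : fieldType) A of GRing.PzRing A := {
  kscal : K -> A;
  kscal1 : kscal 1 = 1;
  kscalD : {morph kscal : a b / a + b};
  kscalM : {morph kscal : a b / a * b};
  kscalC : forall (a : K) (x : A), kscal a * x = x * kscal a
}.

#[short(type="kalgType")]
HB.structure Definition KAlgebra (K : fieldType) :=
  {A of GRing.PzRing A & PzRing_isKAlgebra K A}.

Notation "a %:K" := (kscal a)
  (at level 2, left associativity, format "a %:K") : ring_scope.

Definition alghom (K : fieldType) (A B : kalgType K) (f : A -> B) : Prop :=
  [/\ {morph f : x y / x + y}, monoid_morphism f
    & forall a : K, f a%:K = a%:K].

Definition alg_antihom (K : fieldType) (A B : kalgType K) (f : A -> B) : Prop :=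
  [/\ {morph f : x y / x + y}, {morph f : x y / x * y >-> y * x}
    & forall a : K, f a%:K = a%:K].

(* The algebra morphism with property [P]; only used where exactly one such
   morphism exists. *)
Definition the_alghom (K : fieldType) (A B : kalgType K) (P : set (A -> B)) :
    A -> B :=
  xget (fun=> 0) [set f | alghom f /\ P f]%classic.

(** ** Free algebras *)

Section FreeAlgebra.
Variables (K : fieldType) (I : choiceType).

Definition freealg : Type := {malg K[{fmonom I}]}.

HB.instance Definition _ := GRing.PzRing.copy freealg {malg K[{fmonom I}]}.

Let freealg_scal (a : K) : freealg := a%:MP.

Let freealg_scal1 : freealg_scal 1 = 1.
Proof. by []. Qed.

Let freealg_scalD : {morph freealg_scal : a b / a + b}.
Proof. by move=> a b; exact: (raddfD (@malgC {fmonom I} K)). Qed.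

Let freealg_scalM : {morph freealg_scal : a b / a * b}.
Proof. exact: (@mpolyCM {fmonom I} K). Qed.

Let freealg_scalC (a : K) (x : freealg) :
  freealg_scal a * x = x * freealg_scal a.
Proof.
rewrite [LHS](@fgmulUg {fmonom I} K) [RHS](@fgmulgU {fmonom I} K).
by apply: eq_bigr => i _; rewrite mul1m mulm1 mulrC.
Qed.

HB.instance Definition _ := PzRing_isKAlgebra.Build K freealg
  freealg_scal1 freealg_scalD freealg_scalM freealg_scalC.

Definition fgen (i : I) : freealg := << fmu i >>.

End FreeAlgebra.
Arguments fgen {K I} i.

(** ** Quotients by two-sided ideals *)

Section Ideal.
Variables (K : fieldType) (A : kalgType K) (S : set A).

Inductive ideal_gen : A -> Prop :=
| ideal_gen0 : ideal_gen 0
| ideal_genD a s b x : S s -> ideal_gen x -> ideal_gen (a * s * b + x).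

Lemma ideal_gen_add x y : ideal_gen x -> ideal_gen y -> ideal_gen (x + y).
Proof.
move=> Ix Iy; elim: Ix => [|a s b z Ss _ IH]; first by rewrite add0r.
by rewrite -addrA; constructor.
Qed.

Lemma ideal_gen_opp x : ideal_gen x -> ideal_gen (- x).
Proof.
elim=> [|a s b z Ss _ IH]; first by rewrite oppr0; constructor.
by rewrite opprD -!mulNr; constructor.
Qed.

Lemma ideal_gen_mul a b x : ideal_gen x -> ideal_gen (a * x * b).
Proof.
elim=> [|a' s b' z Ss _ IH]; first by rewrite mulr0 mul0r; constructor.
by rewrite mulrDr mulrDl !mulrA -[_ * b' * b]mulrA; constructor.
Qed.

Definition ideal_pred : {pred A} := fun x => `[< ideal_gen x >].

Lemma ideal_pred_zmod_closed : zmod_closed ideal_pred.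
Proof.
split=> [|x y]; rewrite !unfold_in; first by apply/asboolP; constructor.
move=> /asboolP Ix /asboolP Iy; apply/asboolP.
exact/ideal_gen_add/ideal_gen_opp.
Qed.

HB.instance Definition _ := GRing.isZmodClosed.Build A ideal_pred
  ideal_pred_zmod_closed.

Lemma ideal_predM a b x : x \in ideal_pred -> a * x * b \in ideal_pred.
Proof. by rewrite !unfold_in => /asboolP Ix; apply/asboolP/ideal_gen_mul. Qed.

Definition quotalg : Type := Quotient.quot ideal_pred.

HB.instance Definition _ :=
  GRing.Zmodule.copy quotalg (Quotient.quot ideal_pred).

Definition qpi (x : A) : quotalg := \pi_(Quotient.quot ideal_pred) x.
Definition qrepr (x : quotalg) : A := repr (x : Quotient.quot ideal_pred).

Lemma qreprK (x : quotalg) : qpi (qrepr x) = x.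
Proof. exact: reprK. Qed.

Lemma qpiP x y : (qpi x = qpi y) <-> (x - y \in ideal_pred).
Proof. by rewrite Quotient.idealrBE; split=> /eqP. Qed.

Lemma qpiD : {morph qpi : x y / x + y}.
Proof. by move=> x y; exact: Quotient.pi_add. Qed.

Let one : quotalg := qpi 1.
Let mul (x y : quotalg) : quotalg := qpi (qrepr x * qrepr y).
Let scal (a : K) : quotalg := qpi a%:K.

Let qpi_mul x y : qpi (x * y) = mul (qpi x) (qpi y).
Proof.
apply/qpiP; rewrite -(subrKA (qrepr (qpi x) * y)) -mulrBl -mulrBr.
rewrite rpredD //.
  by rewrite -[_ * y]mul1r mulrA ideal_predM //; apply/qpiP; rewrite qreprK.
by rewrite -[_ * _]mulr1 ideal_predM //; apply/qpiP; rewrite qreprK.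
Qed.

Let mulqA : associative mul.
Proof.
move=> x y z; rewrite -[x]qreprK -[y]qreprK -[z]qreprK.
by rewrite -!qpi_mul mulrA.
Qed.

Let mul1q : left_id one mul.
Proof. by move=> x; rewrite -[x]qreprK -qpi_mul mul1r. Qed.

Let mulq1 : right_id one mul.
Proof. by move=> x; rewrite -[x]qreprK -qpi_mul mulr1. Qed.

Let mulqDl : left_distributive mul +%R.
Proof.
move=> x y z; rewrite -[x]qreprK -[y]qreprK -[z]qreprK.
by rewrite -qpiD -!qpi_mul -qpiD mulrDl.
Qed.

Let mulqDr : right_distributive mul +%R.
Proof.
move=> x y z; rewrite -[x]qreprK -[y]qreprK -[z]qreprK.
by rewrite -qpiD -!qpi_mul -qpiD mulrDr.
Qed.

HB.instance Definition _ := GRing.Zmodule_isPzRing.Build quotalg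
  mulqA mul1q mulq1 mulqDl mulqDr.

Lemma qpiM : {morph qpi : x y / x * y}.
Proof. exact: qpi_mul. Qed.

Let scal1 : scal 1 = 1. Proof. by rewrite /scal kscal1. Qed.
Let scalD : {morph scal : a b / a + b}.
Proof. by move=> a b; rewrite /scal kscalD qpiD. Qed.
Let scalM : {morph scal : a b / a * b}.
Proof. by move=> a b; rewrite /scal kscalM qpiM. Qed.
Let scalC (a : K) (x : quotalg) : scal a * x = x * scal a.
Proof. by rewrite -[x]qreprK -!qpiM kscalC. Qed.

HB.instance Definition _ := PzRing_isKAlgebra.Build K quotalg
  scal1 scalD scalM scalC.

Lemma qpi_alghom : alghom qpi.
Proof. by split; [exact: qpiD | split; [|exact: qpiM] | ]. Qed.

End Ideal.

(* The algebra with generators [I] and relations [l = r] for [rel l r]. *)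
Definition presalg (K : fieldType) (I : choiceType)
    (rel : freealg K I -> freealg K I -> Prop) : kalgType K :=
  quotalg [set x | exists l r, rel l r /\ x = l - r]%classic.

Definition pgen (K : fieldType) (I : choiceType)
    (rel : freealg K I -> freealg K I -> Prop) (i : I) : presalg rel :=
  qpi _ (fgen i).

(** ** Subalgebras *)

Section Subalgebra.
Variables (K : fieldType) (A : kalgType K).

Definition is_subalg (B : set A) : Prop :=
  [/\ forall a : K, B a%:K, forall x y, B x -> B y -> B (x + y)
    & forall x y, B x -> B y -> B (x * y)].

Definition subalg_gen (S : set A) : set A :=
  [set x | forall B : set A, is_subalg B -> (S `<=` B -> B x)]%classic.

Variable S : set A.

Definition subalg_pred : {pred A} := fun x => `[< subalg_gen S x >].

Lemma subalg_pred_subring_closed : subring_closed subalg_pred.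
Proof.
have DP x y : subalg_gen S x -> subalg_gen S y -> subalg_gen S (x + y).
  move=> Bx By B sB SB; case: (sB) => [_ BD _].
  by apply: BD; [exact: Bx | exact: By].
have MP x y : subalg_gen S x -> subalg_gen S y -> subalg_gen S (x * y).
  move=> Bx By B sB SB; case: (sB) => [_ _ BM].
  by apply: BM; [exact: Bx | exact: By].
have KP (a : K) : subalg_gen S a%:K by move=> B [].
have N1E : (-1)%:K = -1 :> A.
  apply/(addrI 1); rewrite subrr -[X in X + _](kscal1 (s := A)) -kscalD subrr.
  by apply/(addrI 0%:K); rewrite -kscalD !addr0.
split=> [|x y|x y]; rewrite !unfold_in.
- by apply/asboolP; rewrite -(kscal1 (s := A)).
- move=> /asboolP Bx /asboolP By; apply/asboolP.
  have NBy : subalg_gen S (- y).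
    by rewrite -mulN1r -N1E; exact: (MP _ _ (KP _) By).
  exact: (DP _ _ Bx NBy).
- move=> /asboolP Bx /asboolP By; apply/asboolP.
  exact: (MP _ _ Bx By).
Qed.

HB.instance Definition _ := GRing.isSubringClosed.Build A subalg_pred
  subalg_pred_subring_closed.

Record subalg : Type := SubAlg {
  subalg_val :> A;
  subalg_valP : subalg_val \in subalg_pred
}.

HB.instance Definition _ := [isSub for subalg_val].
HB.instance Definition _ := [Choice of subalg by <:].
HB.instance Definition _ :=
  GRing.SubChoice_isSubPzRing.Build _ _ subalg subalg_pred_subring_closed.

Let scal_mem (a : K) : a%:K \in subalg_pred.
Proof. by rewrite unfold_in; apply/asboolP => B []. Qed.

Let scal (a : K) : subalg := SubAlg (scal_mem a).

Let scal1 : scal 1 = 1. Proof. by apply/val_inj; rewrite /= kscal1. Qed.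
Let scalD : {morph scal : a b / a + b}.
Proof. by move=> a b; apply/val_inj; rewrite /= kscalD. Qed.
Let scalM : {morph scal : a b / a * b}.
Proof. by move=> a b; apply/val_inj; rewrite /= kscalM. Qed.
Let scalC (a : K) (x : subalg) : scal a * x = x * scal a.
Proof. by apply/val_inj; rewrite /= kscalC. Qed.

HB.instance Definition _ := PzRing_isKAlgebra.Build K subalg
  scal1 scalD scalM scalC.

End Subalgebra.

(** ** Tensor products of algebras *)

(* Generated by the pure tensors, subject to bilinearity and to the rule
   multiplying pure tensors. *)
Section Tensor.
Variables (K : fieldType) (A B : kalgType K).

Let pure (a : A) (b : B) : freealg K (A * B)%type := fgen (a, b).

Inductive tensor_rel :
  freealg K (A * B)%type -> freealg K (A * B)%type -> Prop :=
| tensor_rel_addl a a' b : tensor_rel (pure (a + a') b) (pure a b + pure a' b)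
| tensor_rel_addr a b b' : tensor_rel (pure a (b + b')) (pure a b + pure a b')
| tensor_rel_scall c a b : tensor_rel (pure (c%:K * a) b) (c%:K * pure a b)
| tensor_rel_scalr c a b : tensor_rel (pure a (c%:K * b)) (c%:K * pure a b)
| tensor_rel_mul a a' b b' :
    tensor_rel (pure a b * pure a' b') (pure (a * a') (b * b'))
| tensor_rel_one : tensor_rel (pure 1 1) 1.

Definition tensor : kalgType K := presalg tensor_rel.

Definition tens (a : A) (b : B) : tensor := pgen tensor_rel (a, b).

End Tensor.

Definition tens_map (K : fieldType) (A A' B B' : kalgType K)
    (f : A -> A') (g : B -> B') : tensor A B -> tensor A' B' :=
  the_alghom (fun h => forall a b, h (tens a b) = tens (f a) (g b)).

(** * The quantum group and the Askey--Wilson algebra of rank two *)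

Variant Ugenerator := gK | gKi | gE | gF.

HB.instance Definition _ := gen_eqMixin Ugenerator.
HB.instance Definition _ := gen_choiceMixin Ugenerator.

Section AskeyWilson.
Variables (K : fieldType) (q : K).

Inductive U_rel :
  freealg K Ugenerator -> freealg K Ugenerator -> Prop :=
| U_rel_KKi : U_rel (fgen gK * fgen gKi) 1
| U_rel_KiK : U_rel (fgen gKi * fgen gK) 1
| U_rel_KE : U_rel (fgen gK * fgen gE) ((q ^+ 2)%:K * fgen gE * fgen gK)
| U_rel_KF : U_rel (fgen gK * fgen gF) ((q ^- 2)%:K * fgen gF * fgen gK)
| U_rel_EF :
    U_rel (fgen gE * fgen gF - fgen gF * fgen gE)
          (((q - q^-1)^-1)%:K * (fgen gK - fgen gKi)).

Definition U : kalgType K := presalg U_rel.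

Definition UK : U := pgen U_rel gK.
Definition UKi : U := pgen U_rel gKi.
Definition UE : U := pgen U_rel gE.
Definition UF : U := pgen U_rel gF.

Definition Casimir : U :=
  ((q - q^-1) ^+ 2)%:K * UF * UE + q%:K * UK + (q^-1)%:K * UKi.

Definition Delta : U -> tensor U U :=
  the_alghom (fun f => [/\ f UK = tens UK UK,
    f UE = tens UE UK + tens 1 UE & f UF = tens UF 1 + tens UKi UF]).

Definition IL_generators : set U :=
  [set x | [\/ x = UE, x = UF * UK, x = UK | x = Casimir]]%classic.

Definition IL : kalgType K := subalg IL_generators.

Let mem_IL x : IL_generators x -> x \in subalg_pred IL_generators.
Proof. by move=> Gx; rewrite unfold_in; apply/asboolP => B _; apply. Qed.

Definition ILE : IL := SubAlg (mem_IL (Or41 _ _ _ erefl)).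
Definition ILFK : IL := SubAlg (mem_IL (Or42 _ _ _ erefl)).
Definition ILK : IL := SubAlg (mem_IL (Or43 _ _ _ erefl)).
Definition ILCasimir : IL := SubAlg (mem_IL (Or44 _ _ _ erefl)).

Definition inclIL (x : IL) : U := subalg_val x.

(* The corestriction of the coproduct to the left coideal [IL]. *)
Definition DeltaL : IL -> tensor U IL :=
  the_alghom (fun f =>
    forall x, tens_map idfun inclIL (f x) = Delta (inclIL x)).

Definition tauL : IL -> tensor U IL :=
  the_alghom (fun f =>
  [/\ f ILE = tens UK ILE,
      f ILFK = tens UKi ILFK - q%:K * tens UF ILCasimir
               + (q * (q + q^-1))%:K * tens UF ILK
               - (q^-1 * (q - q^-1) ^+ 2)%:K * tens (UF ^+ 2 * UK) ILE,
      f ILK = tens 1 ILK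
              - (q^-1 * (q - q^-1) ^+ 2)%:K * tens (UF * UK) ILE
    & f ILCasimir = tens 1 ILCasimir]).

(* [tpow n B] is U (x) (U (x) ... (U (x) B)) with n factors U. *)
Fixpoint tpow (n : nat) (B : kalgType K) : kalgType K :=
  if n is n'.+1 then tensor U (tpow n' B) else B.

Definition U4 : kalgType K := tpow 3 U.

(* id^(x)n (x) alpha *)
Fixpoint coact (alpha : IL -> tensor U IL) (n : nat) :
    tpow n IL -> tpow n.+1 IL :=
  if n is n'.+1 then tens_map idfun (coact alpha (n := n')) else alpha.

(* x |-> x (x) 1^(x)m *)
Fixpoint pad1 (m : nat) : IL -> tpow m U :=
  if m is m'.+1 then fun x => tens (inclIL x) 1 else inclIL.

Fixpoint pad (n m : nat) : tpow n IL -> tpow (n + m) U :=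
  if n is n'.+1 then tens_map idfun (pad (n := n') m) else pad1 m.

(* Elements of ['I_4] start at 0: alpha_1, ..., alpha_n in the usual numbering
   are applied in turn to the Casimir element, alpha_(j+1) being the coproduct
   if [inord j \in X] and tau_L otherwise. *)
Fixpoint iter_coact (X : {set 'I_4}) (n : nat) : tpow n IL :=
  if n is j.+1 then
    coact (if inord j \in X then DeltaL else tauL) (iter_coact X j)
  else ILCasimir.

Definition Lambda (X : {set 'I_4}) : U4 :=
  match (\max_(i in X) i)%N with
  | 0 => pad (n := 0) 3 (iter_coact X 0)
  | 1 => pad (n := 1) 2 (iter_coact X 1)
  | 2 => pad (n := 2) 1 (iter_coact X 2)
  | _ => pad (n := 3) 0 (iter_coact X 3)
  end.

Definition AW4 : set U4 :=
  subalg_gen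
    [set x | exists2 X : {set 'I_4}, X != finset.set0 & x = Lambda X]%classic.

End AskeyWilson.
Arguments Lambda {K} q X.
Arguments AW4 {K} q.

(** * Framed link diagrams in the four-punctured plane *)

(* A link diagram with blackboard framing is cut by vertical lines into
   elementary pieces, listed from left to right.  [(p, i)] is the piece [p]
   having exactly [i] strands below it (strands are counted from the bottom):
   - [Cup] opens, and [Cap] closes, a pair of adjacent strands;
   - [Cross true] is a crossing of two adjacent strands whose over-strand runs
     from upper left to lower right; in [Cross false] it runs from lower left
     to upper right;
   - [Puncture] is a puncture of the plane, lying between two strands.
   The punctures 1, 2, 3, 4 are met in this order. *)
Variant piece := Cup | Cap | Cross of bool | Puncture.

HB.instance Definition _ := gen_eqMixin piece.
HB.instance Definition _ := gen_choiceMixin piece.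

Definition ends_left (p : piece) : nat :=
  match p with Cap | Cross _ => 2 | Cup | Puncture => 0 end.

Definition ends_right (p : piece) : nat :=
  match p with Cup | Cross _ => 2 | Cap | Puncture => 0 end.

Definition is_puncture (p : piece) : bool :=
  if p is Puncture then true else false.

Definition word := seq (piece * nat).

Fixpoint strands (n : nat) (w : word) : option nat :=
  if w is (p, i) :: w' then
    if (i + ends_left p <= n)%N
    then strands (n - ends_left p + ends_right p) w' else None
  else Some n.

Definition is_diagram (w : word) : bool :=
  (strands 0 w == Some 0%N) && (count (fun s => is_puncture s.1) w == 4).

Definition diagram := {w : word | is_diagram w}.

(* Planar isotopies fixing the punctures, and the Reidemeister moves for
   framed links.  In [move_far] the piece [a] lies below the piece [b]; two
   punctures are not interchanged. *)
Inductive move : word -> word -> Prop :=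
| move_zigzag1 i : move [:: (Cup, i); (Cap, i.+1)] [::]
| move_zigzag2 i : move [:: (Cup, i.+1); (Cap, i)] [::]
| move_far a i b j :
    ~~ (is_puncture a && is_puncture b) -> (i + ends_left a <= j)%N ->
    move [:: (b, j); (a, i)]
         [:: (a, i); (b, (j - ends_left a + ends_right a)%N)]
| move_cross_cup c i :
    move [:: (Cup, i); (Cross c, i.+1)] [:: (Cup, i.+1); (Cross (~~ c), i)]
| move_cross_cap c i :
    move [:: (Cross c, i.+1); (Cap, i)] [:: (Cross (~~ c), i); (Cap, i.+1)]
| move_R1 c i :
    move [:: (Cup, i.+1); (Cross c, i); (Cap, i.+1)]
         [:: (Cup, i); (Cross c, i.+1); (Cap, i)]
| move_R2 c i : move [:: (Cross c, i); (Cross (~~ c), i)] [::]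
| move_R3 c i :
    move [:: (Cross c, i); (Cross c, i.+1); (Cross c, i)]
         [:: (Cross c, i.+1); (Cross c, i); (Cross c, i.+1)].

(* [stack h x y w]: to the right of a vertical line whose strands have the
   levels [h] (from bottom to top; [false] for the lower and [true] for the
   upper level), [w] is a superposition of [x] (lower level) and [y] (upper
   level), the strands of [y] being over those of [x] at every crossing. *)
Inductive stack : seq bool -> word -> word -> word -> Prop :=
| stack_nil : stack [::] [::] [::] [::]
| stack_lower h1 h2 p x y w :
    ~~ is_puncture p ->
    stack (h1 ++ nseq (ends_right p) false ++ h2) x y w ->
    stack (h1 ++ nseq (ends_left p) false ++ h2)
      ((p, count_mem false h1) :: x) y ((p, size h1) :: w)
| stack_upper h1 h2 p x y w :
    ~~ is_puncture p ->
    stack (h1 ++ nseq (ends_right p) true ++ h2) x y w ->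
    stack (h1 ++ nseq (ends_left p) true ++ h2)
      x ((p, count_mem true h1) :: y) ((p, size h1) :: w)
| stack_cross_down h1 h2 x y w :
    stack (h1 ++ [:: true; false] ++ h2) x y w ->
    stack (h1 ++ [:: false; true] ++ h2) x y ((Cross true, size h1) :: w)
| stack_cross_up h1 h2 x y w :
    stack (h1 ++ [:: false; true] ++ h2) x y w ->
    stack (h1 ++ [:: true; false] ++ h2) x y ((Cross false, size h1) :: w)
| stack_puncture h1 h2 x y w :
    stack (h1 ++ h2) x y w ->
    stack (h1 ++ h2) ((Puncture, count_mem false h1) :: x)
      ((Puncture, count_mem true h1) :: y) ((Puncture, size h1) :: w).

(* The curve enclosing the punctures in [X] and passing below the others. *)
Definition loop_word (X : {set 'I_4}) : word :=
  (Cup, 0%N) ::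
    rcons [seq (Puncture, if k \in X then 1%N else 2%N) | k <- enum 'I_4]
      (Cap, 0%N).

Lemma loop_wordP X : is_diagram (loop_word X).
Proof.
rewrite /is_diagram /loop_word /= -cats1 count_cat /= count_map addn0 add0n.
have -> : count (preim (fun k : 'I_4 => (Puncture,
    if k \in X then 1%N else 2%N)) (fun s : piece * nat => is_puncture s.1))
    (enum 'I_4) = 4%N.
  by rewrite (eq_count (a2 := predT)) ?count_predT ?size_enum_ord.
rewrite eqxx andbT.
by elim: (enum 'I_4) => [|k e IH] //=; case: (k \in X); rewrite /= IH.
Qed.

Definition loop (X : {set 'I_4}) : diagram :=
  exist (fun w => is_diagram w) (loop_word X) (loop_wordP X).

(** * The Kauffman bracket skein algebra *)

Section Skein.
(* [h] is the square root of [q]. *)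
Variables (K : fieldType) (h : K).
Let q : K := h ^+ 2.

Let lk (D : diagram) : freealg K diagram := fgen D.

(* Products of diagrams are diagrams, so that the algebra generated by the
   diagrams with these relations is their linear span modulo isotopy and the
   skein relations, multiplied by stacking. *)
Inductive skein_rel : freealg K diagram -> freealg K diagram -> Prop :=
| skein_isotopy (D D' : diagram) u l r v :
    move l r -> val D = u ++ l ++ v -> val D' = u ++ r ++ v ->
    skein_rel (lk D) (lk D')
| skein_circle (D D' : diagram) u i v :
    val D = u ++ [:: (Cup, i); (Cap, i)] ++ v -> val D' = u ++ v ->
    skein_rel (lk D) ((- q - q^-1)%:K * lk D')
| skein_cross (D D1 D2 : diagram) u i v :
    val D = u ++ [:: (Cross true, i)] ++ v ->
    val D1 = u ++ v ->
    val D2 = u ++ [:: (Cap, i); (Cup, i)] ++ v ->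
    skein_rel (lk D) (h%:K * lk D1 + (h^-1)%:K * lk D2)
(* the same relation, with the crossing turned by a right angle *)
| skein_cross_turned (D D1 D2 : diagram) u i v :
    val D = u ++ [:: (Cross false, i)] ++ v ->
    val D1 = u ++ v ->
    val D2 = u ++ [:: (Cap, i); (Cup, i)] ++ v ->
    skein_rel (lk D) (h%:K * lk D2 + (h^-1)%:K * lk D1)
| skein_empty (D : diagram) :
    val D = nseq 4 (Puncture, 0%N) -> skein_rel (lk D) 1
| skein_stack (D D' D'' : diagram) :
    stack [::] (val D) (val D') (val D'') ->
    skein_rel (lk D * lk D') (lk D'').

Definition Sk : kalgType K := presalg skein_rel.

Definition sk_loop (X : {set 'I_4}) : Sk := pgen skein_rel (loop X).

End Skein.

(** * The relations between the simple loops *)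

Section LoopRelations.
Variables (K : fieldType) (q : K) (A : kalgType K) (s : {set 'I_4} -> A).

Local Notation p1 := (@Ordinal 4 0 isT).
Local Notation p2 := (@Ordinal 4 1 isT).
Local Notation p3 := (@Ordinal 4 2 isT).
Local Notation p4 := (@Ordinal 4 3 isT).

Local Notation s1 := (s [set p1]).
Local Notation s2 := (s [set p2]).
Local Notation s3 := (s [set p3]).
Local Notation s4 := (s [set p4]).
Local Notation s12 := (s [set p1; p2]).
Local Notation s13 := (s [set p1; p3]).
Local Notation s14 := (s [set p1; p4]).
Local Notation s23 := (s [set p2; p3]).
Local Notation s24 := (s [set p2; p4]).
Local Notation s34 := (s [set p3; p4]).
Local Notation s123 := (s [set p1; p2; p3]).
Local Notation s124 := (s [set p1; p2; p4]).
Local Notation s134 := (s [set p1; p3; p4]).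
Local Notation s234 := (s [set p2; p3; p4]).
Local Notation s1234 := (s [set p1; p2; p3; p4]).

Definition cubic_relations : seq (A * A) := [::
  (s12 * s23 * s13,
    - (q + 2 * q^-1 + q ^- 3)%:K + (q^-1)%:K * (s1 ^+ 2 + s2 ^+ 2 + s3 ^+ 2)
    + s1 * s2 * s12 + (q ^- 2)%:K * s2 * s3 * s23 + s1 * s3 * s13
    + (q^-1)%:K * s1 * s2 * s3 * s123 + q%:K * s12 ^+ 2 + s3 * s12 * s123
    + (q ^- 3)%:K * s23 ^+ 2 + (q ^- 2)%:K * s1 * s23 * s123
    + q%:K * s13 ^+ 2 + s2 * s13 * s123 + (q^-1)%:K * s123 ^+ 2);
  (s23 * s34 * s24,
    - (q + 2 * q^-1 + q ^- 3)%:K + (q^-1)%:K * (s2 ^+ 2 + s3 ^+ 2 + s4 ^+ 2)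
    + s2 * s3 * s23 + (q ^- 2)%:K * s3 * s4 * s34 + s2 * s4 * s24
    + (q^-1)%:K * s2 * s3 * s4 * s234 + q%:K * s23 ^+ 2 + s4 * s23 * s234
    + (q ^- 3)%:K * s34 ^+ 2 + (q ^- 2)%:K * s2 * s34 * s234
    + q%:K * s24 ^+ 2 + s3 * s24 * s234 + (q^-1)%:K * s234 ^+ 2);
  (s34 * s14 * s13,
    - (q + 2 * q^-1 + q ^- 3)%:K + (q^-1)%:K * (s1 ^+ 2 + s3 ^+ 2 + s4 ^+ 2)
    + s3 * s4 * s34 + (q ^- 2)%:K * s1 * s4 * s14 + s1 * s3 * s13
    + (q^-1)%:K * s1 * s3 * s4 * s134 + q%:K * s34 ^+ 2 + s1 * s34 * s134
    + (q ^- 3)%:K * s14 ^+ 2 + (q ^- 2)%:K * s3 * s14 * s134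
    + q%:K * s13 ^+ 2 + s4 * s13 * s134 + (q^-1)%:K * s134 ^+ 2);
  (s12 * s14 * s24,
    - (q ^+ 3 + 2 * q + q^-1)%:K + q%:K * (s1 ^+ 2 + s2 ^+ 2 + s4 ^+ 2)
    + s1 * s2 * s12 + (q ^+ 2)%:K * s1 * s4 * s14 + s2 * s4 * s24
    + q%:K * s1 * s2 * s4 * s124 + (q^-1)%:K * s12 ^+ 2 + s4 * s12 * s124
    + (q ^+ 3)%:K * s14 ^+ 2 + (q ^+ 2)%:K * s2 * s14 * s124
    + (q^-1)%:K * s24 ^+ 2 + s1 * s24 * s124 + q%:K * s124 ^+ 2)
].

Definition cubic_triple_relations : seq (A * A) := [::
  (s12 * s23 * s134,
    (1 + q ^- 2)%:K * s4 - s2 ^+ 2 * s4 + (q^-1)%:K * s1 * s2 * s3 * s1234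
    + s3 * s1234 * s12 + (q ^- 2)%:K * s1 * s1234 * s23
    + (q^-1)%:K * s3 * s34 + (q^-1)%:K * s1 * s14 + s2 * s1234 * s13
    - q%:K * s2 * s24 + (q^-1)%:K * s1234 * s123
    + (q ^- 2 - 1)%:K * s2 * s3 * s234 + s1 * s3 * s134 + s2 * s12 * s14
    + q%:K * s12 * s124 + s2 * s23 * s34 + (q ^- 3)%:K * s23 * s234
    + q%:K * s13 * s134);
  (s23 * s34 * s124,
    (1 + q ^- 2)%:K * s1 - (q ^+ 2)%:K * s1 * s3 ^+ 2
    + (q^-1)%:K * s2 * s3 * s4 * s1234 + (q^-1)%:K * s2 * s12
    + s4 * s1234 * s23 + (q ^- 2)%:K * s2 * s1234 * s34
    + (q^-1)%:K * s4 * s14 + (- q ^+ 3 - q + q^-1)%:K * s3 * s13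
    + s3 * s1234 * s24 + (1 - q ^+ 2)%:K * s2 * s3 * s123
    + (q^-1)%:K * s1234 * s234 + (q ^- 2 - 1)%:K * s3 * s4 * s134
    + s2 * s4 * s124 + (q ^+ 2)%:K * s3 * s12 * s23 + q%:K * s23 * s123
    + s3 * s34 * s14 + (q ^- 3)%:K * s34 * s134 + q%:K * s24 * s124);
  (s34 * s14 * s123,
    (1 + q ^- 2)%:K * s2 + (1 - q ^+ 2 - q ^- 2)%:K * s2 * s4 ^+ 2
    + (q^-1)%:K * s1 * s3 * s4 * s1234 + (q^-1)%:K * s1 * s12
    + (q^-1)%:K * s3 * s23 + s1 * s1234 * s34
    + (q ^- 2)%:K * s3 * s1234 * s14 + s4 * s1234 * s13
    + (- q ^+ 3 + q^-1 - q ^- 3)%:K * s4 * s24 + s1 * s3 * s123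
    + (1 - q ^+ 2)%:K * s3 * s4 * s234 + (q^-1)%:K * s1234 * s134
    + (q ^- 2)%:K * s4 * s12 * s14 + (q ^+ 2)%:K * s4 * s23 * s34
    + q%:K * s34 * s234 + (q ^- 3)%:K * s14 * s124 + q%:K * s13 * s123);
  (s12 * s14 * s234,
    (q ^+ 2 + 1)%:K * s3 + q%:K * s1 * s2 * s4 * s1234
    - (q ^+ 2)%:K * s1 ^+ 2 * s3 + s4 * s1234 * s12 + q%:K * s2 * s23
    + q%:K * s4 * s34 + (q ^+ 2)%:K * s2 * s1234 * s14
    - (q ^+ 3)%:K * s1 * s13 + s1 * s1234 * s24 + s2 * s4 * s234
    + q%:K * s1234 * s124 + s1 * s12 * s23 + (q^-1)%:K * s12 * s123
    + (q ^+ 2)%:K * s1 * s34 * s14 + (q ^+ 3)%:K * s14 * s134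
    + (q^-1)%:K * s24 * s234)
].

(* s2 s3 s23, s3 s4 s34 and s1 s2 s3 s4 s1234 occur with coefficient 2 q^-1.
   The value q^-1 found in print is a misprint: the relation would then fail
   even at q = 1, where s_X is minus the trace of the ordered product of
   matrices M_i in SL_2, i in X. *)
Definition quartic_relations : seq (A * A) := [::
  (s12 * s23 * s34 * s14,
    s1 * s3 * s12 * s23 + s2 * s4 * s12 * s14 + s2 * s4 * s23 * s34
    + s1 * s3 * s34 * s14
    + (q%:K * s3 * s12 + q%:K * s2 * s13 + (q^-1)%:K * s1 * s23 + s123
        + (q^-1)%:K * s4 * s1234 + s1 * s2 * s3) * s123
    + (q%:K * s4 * s13 + q%:K * s3 * s14 + (q^-1)%:K * s1 * s34 + s134
        + (q^-1)%:K * s2 * s1234 + s1 * s3 * s4) * s134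
    + (q%:K * s4 * s12 + q%:K * s2 * s14 + (q^-1)%:K * s1 * s24 + s124
        + (q^-1)%:K * s3 * s1234 + s1 * s2 * s4) * s124
    + (q ^- 2)%:K * ((q^-1)%:K * s4 * s23 + (q^-1)%:K * s3 * s24
        + (q^-1)%:K * s2 * s34 + (q ^- 2)%:K * s234
        + (q^-1)%:K * s1 * s1234 + (2 - q ^+ 2)%:K * s2 * s3 * s4) * s234
    + ((q ^+ 2)%:K * s12 + (q + q^-1)%:K * s1 * s2 + s3 * s4 * s1234) * s12
    + ((q ^- 2)%:K * s23 + (2 * q^-1)%:K * s2 * s3
        + (q ^- 2)%:K * s1 * s4 * s1234) * s23
    + ((q ^+ 2)%:K * s14 + (q + q^-1)%:K * s1 * s4 + s2 * s3 * s1234) * s14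
    + ((q ^- 2)%:K * s34 + (2 * q^-1)%:K * s3 * s4
        + (q ^- 2)%:K * s1 * s2 * s1234) * s34
    + ((q ^- 2)%:K * s24 + (q^-1 - q)%:K * s2 * s4
        + (q ^- 2)%:K * s1 * s3 * s1234) * s24
    + ((q ^+ 2)%:K * s13 + s2 * s4 * s1234) * s13 + (q ^- 2)%:K * s1234 ^+ 2
    - s2 ^+ 2 * s4 ^+ 2 - s1 ^+ 2 * s3 ^+ 2
    + (2 * q^-1)%:K * s1 * s2 * s3 * s4 * s1234
    + (2 + q ^- 2)%:K * (s1 ^+ 2 + s2 ^+ 2 + s3 ^+ 2 + s4 ^+ 2)
    - (2 * q ^+ 2 + 5 + 4 * q ^- 2 + q ^- 4)%:K)
].

Definition crossing_relations : seq (A * A) := [::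
  (s13 * s24,
    (q + q^-1)%:K * s1234 + s1 * s2 * s3 * s4 + (q^-1)%:K * s3 * s4 * s12
    + q%:K * s1 * s4 * s23 + (q^-1)%:K * s1 * s2 * s34 + q%:K * s2 * s3 * s14
    + s4 * s123 + s1 * s234 + s2 * s134 + s3 * s124 + (q ^- 2)%:K * s12 * s34
    + (q ^+ 2)%:K * s23 * s14);
  (s24 * s13,
    (q + q^-1)%:K * s1234 + s1 * s2 * s3 * s4 + q%:K * s3 * s4 * s12
    + (q^-1)%:K * s1 * s4 * s23 + q%:K * s1 * s2 * s34
    + (q^-1)%:K * s2 * s3 * s14 + s4 * s123 + s1 * s234 + s2 * s134
    + s3 * s124 + (q ^+ 2)%:K * s12 * s34 + (q ^- 2)%:K * s23 * s14)
].

Definition triple_loop_relations : seq (A * A) := [::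
  (s123 * s134,
    - s2 * s4 + s1234 * s13 - (q + q^-1)%:K * s24 - s3 * s234 - s1 * s124
    + s12 * s14 + s23 * s34);
  (s134 * s123,
    (1 - q ^+ 2 - q ^- 2)%:K * s2 * s4 + s1234 * s13
    - (q ^+ 3 + q ^- 3)%:K * s24 - (q ^+ 2)%:K * s3 * s234
    - (q ^- 2)%:K * s1 * s124 + (q ^- 2)%:K * s12 * s14
    + (q ^+ 2)%:K * s23 * s34);
  (s234 * s124,
    - (q ^+ 2)%:K * s1 * s3 - (q ^+ 3 + q)%:K * s13 + s1234 * s24
    - (q ^+ 2)%:K * s2 * s123 - s4 * s134 + (q ^+ 2)%:K * s12 * s23
    + s34 * s14);
  (s124 * s234,
    - (q ^+ 2)%:K * s1 * s3 - (q ^+ 3 + q)%:K * s13 + s1234 * s24 - s2 * s123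
    - (q ^+ 2)%:K * s4 * s134 + s12 * s23 + (q ^+ 2)%:K * s34 * s14)
].

Definition triple_link_relations : seq (A * A) := [::
  (s123 * s234,
    (q^-1)%:K * s2 * s3 * s1234 + s1 * s4 + (q^-1 - q)%:K * s2 * s4 * s12
    + s1234 * s23 + (q + q^-1)%:K * s14 + s3 * s134 + (q ^- 2)%:K * s2 * s124
    - (q ^+ 2)%:K * s12 * s24 - q%:K * s3 * s12 * s234 - s34 * s13
    - (q^-1)%:K * s2 * s34 * s123 + q%:K * s12 * s23 * s34);
  (s234 * s123,
    q%:K * s2 * s3 * s1234 + s1 * s4 + (- q ^+ 3 + q)%:K * s2 * s4 * s12
    + s1234 * s23 + (q + q^-1)%:K * s14 + (q ^+ 2)%:K * s3 * s134 + s2 * s124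
    - (q ^+ 4)%:K * s12 * s24 - (q ^+ 3)%:K * s3 * s12 * s234
    - (q ^+ 2)%:K * s34 * s13 - q%:K * s2 * s34 * s123
    + (q ^+ 3)%:K * s12 * s23 * s34);
  (s234 * s134,
    (q^-1)%:K * s3 * s4 * s1234 + s1 * s2 + (q + q^-1)%:K * s12
    + (q^-1 - q)%:K * s1 * s3 * s23 + s1234 * s34 + (q ^- 2)%:K * s3 * s123
    + s4 * s124 - (q ^+ 2)%:K * s23 * s13 - q%:K * s4 * s23 * s134
    - s14 * s24 - (q^-1)%:K * s3 * s14 * s234 + q%:K * s23 * s34 * s14);
  (s134 * s234,
    q%:K * s3 * s4 * s1234 + s1 * s2 + (q + q^-1)%:K * s12
    + (- q ^+ 3 + q)%:K * s1 * s3 * s23 + s1234 * s34 + s3 * s123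
    + (q ^+ 2)%:K * s4 * s124 - (q ^+ 4)%:K * s23 * s13
    - (q ^+ 3)%:K * s4 * s23 * s134 - (q ^+ 2)%:K * s14 * s24
    - q%:K * s3 * s14 * s234 + (q ^+ 3)%:K * s23 * s34 * s14);
  (s134 * s124,
    s2 * s3 + (q^-1)%:K * s1 * s4 * s1234 + (q + q^-1)%:K * s23 + s1234 * s14
    + s1 * s123 + (q ^- 2)%:K * s4 * s234 - s12 * s13
    - (q^-1)%:K * s4 * s12 * s134 - (q ^- 2)%:K * s34 * s24
    - (q^-1)%:K * s1 * s34 * s124 + (q^-1)%:K * s12 * s34 * s14);
  (s124 * s134,
    s2 * s3 + q%:K * s1 * s4 * s1234 + (q + q^-1)%:K * s23 + s1234 * s14
    + (q ^+ 2)%:K * s1 * s123 + s4 * s234 - (q ^+ 2)%:K * s12 * s13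
    - q%:K * s4 * s12 * s134 - s34 * s24 - q%:K * s1 * s34 * s124
    + q%:K * s12 * s34 * s14);
  (s123 * s124,
    (q ^+ 4 - q ^+ 2 + q ^- 2)%:K * s3 * s4
    + (q ^+ 3 - q + q^-1)%:K * s1 * s2 * s1234 + s1234 * s12
    + (q ^+ 3 - q)%:K * s2 * s4 * s23 + (q ^+ 5 - q + q^-1 + q ^- 3)%:K * s34
    + (q^-1 - q)%:K * s1 * s3 * s14 + (q ^+ 4 - 1 + q ^- 2)%:K * s2 * s234
    + (q ^+ 4 - q ^+ 2 + q ^- 2)%:K * s1 * s134 - (q ^- 2)%:K * s23 * s24
    - (q^-1)%:K * s1 * s23 * s124 - (q ^+ 4)%:K * s14 * s13
    - (q ^+ 3)%:K * s2 * s14 * s123 + q%:K * s12 * s23 * s14);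
  (s124 * s123,
    (q ^+ 2 - q ^- 2 + q ^- 4)%:K * s3 * s4
    + (q - q^-1 + q ^- 3)%:K * s1 * s2 * s1234 + s1234 * s12
    + (q - q^-1)%:K * s2 * s4 * s23 + (q ^+ 3 + q - q^-1 + q ^- 5)%:K * s34
    + (q ^- 3 - q^-1)%:K * s1 * s3 * s14
    + (q ^+ 2 - q ^- 2 + q ^- 4)%:K * s2 * s234
    + (q ^+ 2 - 1 + q ^- 4)%:K * s1 * s134 - (q ^- 4)%:K * s23 * s24
    - (q ^- 3)%:K * s1 * s23 * s124 - (q ^+ 2)%:K * s14 * s13
    - q%:K * s2 * s14 * s123 + (q^-1)%:K * s12 * s23 * s14)
].

Definition double_triple_relations : seq (A * A) := [::
  (s24 * s123,
    (1 - q ^+ 2 - q ^- 2)%:K * s2 * s1234 - q%:K * s1 * s3 * s4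
    - (q ^+ 2)%:K * s1 * s34 - (q ^- 2)%:K * s3 * s14
    - (q ^+ 2)%:K * s4 * s13 - q%:K * s2 * s4 * s123
    - (q ^+ 3 + q ^- 3)%:K * s134 + q%:K * s4 * s12 * s23
    + (q ^+ 2)%:K * s12 * s234 + (q ^- 2)%:K * s23 * s124);
  (s123 * s24,
    - s2 * s1234 - q%:K * s1 * s3 * s4 - s1 * s34 - s3 * s14
    - (q ^+ 2)%:K * s4 * s13 - q%:K * s2 * s4 * s123 - (q + q^-1)%:K * s134
    + q%:K * s4 * s12 * s23 + s12 * s234 + s23 * s124);
  (s13 * s234,
    (1 - q ^+ 2 - q ^- 2)%:K * s3 * s1234 - q%:K * s1 * s2 * s4
    - (q ^- 2)%:K * s4 * s12 - (q ^+ 2)%:K * s2 * s14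
    - (q ^+ 2)%:K * s1 * s24 - q%:K * s1 * s3 * s234
    - (q ^+ 3 + q ^- 3)%:K * s124 + q%:K * s1 * s23 * s34
    + (q ^+ 2)%:K * s23 * s134 + (q ^- 2)%:K * s34 * s123);
  (s234 * s13,
    - s3 * s1234 - q%:K * s1 * s2 * s4 - s4 * s12 - s2 * s14
    - (q ^+ 2)%:K * s1 * s24 - q%:K * s1 * s3 * s234 - (q + q^-1)%:K * s124
    + q%:K * s1 * s23 * s34 + s23 * s134 + s34 * s123);
  (s24 * s134,
    (1 - q ^+ 2 - q ^- 2)%:K * s4 * s1234 - q%:K * s1 * s2 * s3
    - (q ^+ 2)%:K * s3 * s12 - (q ^- 2)%:K * s1 * s23
    - (q ^+ 2)%:K * s2 * s13 - (q ^+ 3 + q ^- 3)%:K * s123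
    - q%:K * s2 * s4 * s134 + q%:K * s2 * s34 * s14
    + (q ^+ 2)%:K * s34 * s124 + (q ^- 2)%:K * s14 * s234);
  (s134 * s24,
    - s4 * s1234 - q%:K * s1 * s2 * s3 - s3 * s12 - s1 * s23
    - (q ^+ 2)%:K * s2 * s13 - (q + q^-1)%:K * s123 - q%:K * s2 * s4 * s134
    + q%:K * s2 * s34 * s14 + s34 * s124 + s14 * s234);
  (s13 * s124,
    - (q^-1)%:K * s2 * s3 * s4 + (1 - q ^+ 2 - q ^- 2)%:K * s1 * s1234
    - (q ^+ 2)%:K * s4 * s23 - (q ^- 2)%:K * s2 * s34
    - (q ^- 2)%:K * s3 * s24 - (q ^+ 3 + q ^- 3)%:K * s234
    - (q^-1)%:K * s1 * s3 * s124 + (q^-1)%:K * s3 * s12 * s14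
    + (q ^- 2)%:K * s12 * s134 + (q ^+ 2)%:K * s14 * s123);
  (s124 * s13,
    - (q^-1)%:K * s2 * s3 * s4 - s1 * s1234 - s4 * s23 - s2 * s34
    - (q ^- 2)%:K * s3 * s24 - (q + q^-1)%:K * s234
    - (q^-1)%:K * s1 * s3 * s124 + (q^-1)%:K * s3 * s12 * s14 + s12 * s134
    + s14 * s123)
].

Definition precedes (X Y : {set 'I_4}) : Prop :=
  forall i j, i \in X -> j \in Y -> (i < j)%N.

Inductive loop_rel : A -> A -> Prop :=
| loop_rel_central (X Y : {set 'I_4}) :
    (#|X| == 1%N) || (#|X| == 4%N) -> Y != finset.set0 ->
    loop_rel (s X * s Y) (s Y * s X)
| loop_rel_nested (X Y : {set 'I_4}) :
    #|X| = 2%N -> #|Y| = 3%N -> X \subset Y ->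
    loop_rel (s X * s Y) (s Y * s X)
| loop_rel_12_34 : loop_rel (s12 * s34) (s34 * s12)
| loop_rel_23_14 : loop_rel (s23 * s14) (s14 * s23)
| loop_rel_commutator (A1 A2 A3 A4 X Y : {set 'I_4}) :
    precedes A1 A2 -> precedes A1 A3 -> precedes A1 A4 ->
    precedes A2 A3 -> precedes A2 A4 -> precedes A3 A4 ->
    [\/ (X, Y) = (A1 :|: A2 :|: A4, A2 :|: A3),
        (X, Y) = (A2 :|: A3, A1 :|: A3 :|: A4)
      | (X, Y) = (A1 :|: A3 :|: A4, A1 :|: A2 :|: A4)] ->
    loop_rel (q%:K * s X * s Y - (q^-1)%:K * s Y * s X)
      ((q ^+ 2 - q ^- 2)%:K * s ((X :|: Y) :\: (X :&: Y))
       + (q - q^-1)%:K * (s (X :&: Y) * s (X :|: Y)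
                          + s (X :\: (X :&: Y)) * s (Y :\: (X :&: Y))))
| loop_rel_cubic l r : (l, r) \in cubic_relations -> loop_rel l r
| loop_rel_cubic_triple l r : (l, r) \in cubic_triple_relations -> loop_rel l r
| loop_rel_quartic l r : (l, r) \in quartic_relations -> loop_rel l r
| loop_rel_crossing l r : (l, r) \in crossing_relations -> loop_rel l r
| loop_rel_triple_loop l r : (l, r) \in triple_loop_relations -> loop_rel l r
| loop_rel_triple_link l r : (l, r) \in triple_link_relations -> loop_rel l r
| loop_rel_double_triple l r :
    (l, r) \in double_triple_relations -> loop_rel l r.

End LoopRelations.

Definition loop_index := {X : {set 'I_4} | X != finset.set0}.

(* The generator s_X of the free algebra, with s_X = -(q + q^-1) for X empty. *)
Definition free_loop (K : fieldType) (q : K) (X : {set 'I_4}) :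
    freealg K loop_index :=
  if insub X is Some i then fgen i else - (q + q^-1)%:K.

Definition loop_presentation (K : fieldType) (q : K) : kalgType K :=
  presalg (loop_rel q (free_loop q)).

Definition loop_gen (K : fieldType) (q : K) (i : loop_index) :
    loop_presentation q :=
  pgen (loop_rel q (free_loop q)) i.

(** * The ground field *)

Definition Cq (R : realType) : fieldType := {fraction {poly R[i]}}.

(* The fourth root of [q]. *)
Definition q4 (R : realType) : Cq R := tofrac 'X.

(* Main.v *)
(** A link diagram is sent to its state sum in a quantum torus generated, for
    each of the four punctures, by a Casimir element, F and K^(1/2): a strand
    passing below, resp. above, a puncture acts by a lower, resp. upper,
    triangular L-operator.  This is invariant under the moves and turns stacking
    into the opposite product, hence defines a morphism theta0 from the skein
    algebra to the opposite of the torus.  The skein algebra is spanned by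
    diagrams without crossings in a normal form (all arcs nested next to the
    punctures), and their state sums have distinct leading monomials.  So theta0
    is injective, and the relations between the loops can be verified by
    computation in the torus.

    The relations allow one to rewrite every monomial in the loops as a
    combination of monomials supported on the faces of a simplicial complex;
    these have distinct leading monomials as well, hence the presented algebra
    embeds in the skein algebra.  The loops generate the latter because the
    leading monomials of normal diagrams form a cone generated by those of the
    loops and of a few twisted loops, which are polynomials in the loops.

    On the quantum side, PBW bases show that U and its coideal subalgebra embed
    in one block of the torus, with (q - q^-1) E going to
    F'^-1 (Lambda - q K - q^-1 K^-1) for F' = (q - q^-1) F, and that their tensor
    products embed in several blocks.  Computation in the torus gives the
    coactions, and the image of -Lambda_X is the state sum of the loop s_X.
    Finally, reversing the order of the punctures is seen on the presentation to
    be an antiautomorphism of the skein algebra, which turns the antimorphism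
    onto AW(4) into a morphism. *)

(* Independence always comes from [tlead_max]: elements with pairwise distinct leading exponents are
   independent. A spanning set together with a map to the torus giving distinct leading exponents
   therefore yields at once a basis and the injectivity of the map. No basis theorem is assumed: the
   normal diagrams, the monomials on faces, the PBW monomials of U and a complete set of relations
   for its coideal subalgebra are all obtained in this way, and spanning is the only part that needs
   rewriting.

   Two weights on exponents are used. [wts] decreases from each puncture to the next, so that the
   leading term of a state sum can be found puncture by puncture. [wsr] selects in each loop a term
   for which the monomials on faces are told apart.

   Elements are computed as lists of monomials with integer coefficients and powers of h; an
   identity holds when a list cancels. The one restriction on q is that q^4, which is h^8, differs
   from 1: the polynomials in the loops that realize twisted loops may have as leading coefficient a
   difference of two powers of h with ratio h^8. *)
From HB Require Import structures.
From Stdlib Require Import ZArith Lia.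
Require Import Defs.
From mathcomp Require Import all_boot all_order all_algebra.
From mathcomp Require Import finmap zify ssrZ ring.
From mathcomp.multinomials Require Import monalg.
From mathcomp Require Import boolp classical_sets reals.

Set Implicit Arguments.
Unset Strict Implicit.
Unset Printing Implicit Defensive.

Import GRing.Theory.
Local Open Scope ring_scope.
Delimit Scope Z_scope with Z.

(** * Algebras, morphisms and presentations *)

Section KAlgTheory.
Variables (K : fieldType).
Implicit Types A B C : kalgType K.

Lemma kscal0 A : (0%:K : A) = 0.
Proof. by apply: (addrI (0%:K : A)); rewrite -kscalD !addr0. Qed.

Lemma kscalN A a : (- a)%:K = - a%:K :> A.
Proof. by apply: (addrI (a%:K : A)); rewrite -kscalD !subrr kscal0. Qed.

Lemma kscalAC A a (x y : A) : x * (a%:K * y) = a%:K * (x * y).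
Proof. by rewrite mulrA -kscalC mulrA. Qed.

Lemma kscalMM A a b (x y : A) :
  (a%:K * x) * (b%:K * y) = (a * b)%:K * (x * y).
Proof. by rewrite -mulrA kscalAC mulrA -kscalM. Qed.

Lemma kscal_cancel A a (x : A) : a != 0 -> a%:K * ((a^-1)%:K * x) = x.
Proof. by move=> a0; rewrite mulrA -kscalM divff // kscal1 mul1r. Qed.

Section Alghom.
Variables (A B : kalgType K) (f : A -> B) (hf : alghom f).
Lemma alghomD x y : f (x + y) = f x + f y. Proof. by case: hf. Qed.
Lemma alghom1 : f 1 = 1. Proof. by case: hf => _ []. Qed.
Lemma alghomM x y : f (x * y) = f x * f y. Proof. by case: hf => _ [_]. Qed.
Lemma alghomK a : f a%:K = a%:K. Proof. by case: hf. Qed.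
Lemma alghom0 : f 0 = 0. Proof. by rewrite -(kscal0 A) alghomK kscal0. Qed.
Lemma alghomN x : f (- x) = - f x.
Proof. by apply: (addrI (f x)); rewrite -alghomD !subrr alghom0. Qed.
Lemma alghomB x y : f (x - y) = f x - f y.
Proof. by rewrite alghomD alghomN. Qed.
Lemma alghomX x n : f (x ^+ n) = f x ^+ n.
Proof. by elim: n => [|n IH]; rewrite ?expr0 ?alghom1 // !exprS alghomM IH. Qed.
Lemma alghom_sum (I : Type) (r : seq I) (P : pred I) (F : I -> A) :
  f (\sum_(i <- r | P i) F i) = \sum_(i <- r | P i) f (F i).
Proof. exact: (big_morph f alghomD alghom0). Qed.
End Alghom.

Definition alghomE A B (f : A -> B) (hf : alghom f) :=
  (alghomB hf, alghomD hf, alghomN hf, alghomM hf, alghomX hf,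
   alghomK hf, alghom1 hf, alghom0 hf).

Lemma alghom_comp A B C (f : A -> B) (g : B -> C) :
  alghom f -> alghom g -> alghom (g \o f).
Proof.
move=> hf hg; split=> [x y|| a] /=; rewrite ?alghomE //.
by split=> [|x y] /=; rewrite ?alghomE.
Qed.

Lemma alghom_id A : alghom (idfun : A -> A).
Proof. by split. Qed.

Lemma alghom_inj0 A B (f : A -> B) : alghom f ->
  (forall x, f x = 0 -> x = 0) -> injective f.
Proof.
move=> hf f0 x y /eqP; rewrite -subr_eq0 -alghomB // => /eqP/f0/eqP.
by rewrite subr_eq0 => /eqP.
Qed.

(** Preimages under an injective g are unique, so any choice of them is compatible with the
    operations. Used to corestrict morphisms to a subalgebra and to invert bijective ones. *)
Lemma alghom_lift A B C (f : A -> C) (g : B -> C) :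
  alghom f -> alghom g -> injective g -> (forall x, exists y, g y = f x) ->
  exists2 k : A -> B, alghom k & forall x, g (k x) = f x.
Proof.
move=> hf hg ig H; have [k hk] := choice H; exists k => //.
split=> [x y||a].
- by apply: ig; rewrite (alghomD hg) !hk (alghomD hf).
- split=> [|x y]; first by apply: ig; rewrite (alghom1 hg) hk (alghom1 hf).
  by apply: ig; rewrite (alghomM hg) !hk (alghomM hf).
- by apply: ig; rewrite hk (alghomK hf) (alghomK hg).
Qed.

(** Existence alone makes the chosen map meet its specification; its further values are found by
    comparing it on generators with a constructed morphism. *)
Lemma the_alghomP A B (P : set (A -> B)) :
  (exists2 f, alghom f & P f) -> alghom (the_alghom P) /\ P (the_alghom P).
Proof.
move=> [f hf Pf]; rewrite /the_alghom.
by case: xgetP => [g -> //|/(_ f)[]].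
Qed.

Inductive gens A (S : A -> Prop) : A -> Prop :=
| gens_scal a : gens S a%:K
| gens_in x : S x -> gens S x
| gens_add x y : gens S x -> gens S y -> gens S (x + y)
| gens_mul x y : gens S x -> gens S y -> gens S (x * y).

Lemma gens1 A (S : A -> Prop) : gens S 1.
Proof. by rewrite -(kscal1 (s := A)); constructor. Qed.

Lemma gens0 A (S : A -> Prop) : gens S 0.
Proof. by rewrite -(kscal0 A); constructor. Qed.

Lemma gens_opp A (S : A -> Prop) x : gens S x -> gens S (- x).
Proof.
move=> Sx; rewrite -mulN1r -(kscal1 (s := A)) -kscalN.
by apply: gens_mul Sx; constructor.
Qed.

Lemma gens_sum A (S : A -> Prop) (I : Type) (r : seq I) (F : I -> A) :
  (forall i, gens S (F i)) -> gens S (\sum_(i <- r) F i).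
Proof.
move=> HF; elim: r => [|i r IH]; first by rewrite big_nil; exact: gens0.
by rewrite big_cons; apply: gens_add.
Qed.

Lemma gens_exp A (S : A -> Prop) x n : gens S x -> gens S (x ^+ n).
Proof.
move=> Sx; elim: n => [|n IH]; first by rewrite expr0; exact: gens1.
by rewrite exprS; apply: gens_mul.
Qed.

Lemma gensW A (S S' : A -> Prop) x :
  (forall y, S y -> gens S' y) -> gens S x -> gens S' x.
Proof.
move=> H; elim=> [a|y /H //|y z _ Sy _ Sz|y z _ Sy _ Sz].
- exact: gens_scal.
- exact: gens_add.
- exact: gens_mul.
Qed.

Lemma gens_ext A B (f g : A -> B) (S : A -> Prop) : alghom f -> alghom g ->
  (forall x, S x -> f x = g x) -> forall x, gens S x -> f x = g x.
Proof.
move=> hf hg fg x; elim=> [a|y /fg //|y z _ e1 _ e2|y z _ e1 _ e2].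
- by rewrite !alghomK.
- by rewrite !alghomD // e1 e2.
- by rewrite !alghomM // e1 e2.
Qed.

Lemma subalg_genE A (S : set A) x : subalg_gen S x <-> gens S x.
Proof.
split=> [H|Sx B [BK BD BM] SB].
  apply: H; last by move=> y Sy; apply: gens_in.
  by split=> *; [apply: gens_scal | apply: gens_add | apply: gens_mul].
by elim: Sx => *; [apply: BK | apply: SB | apply: BD | apply: BM].
Qed.

(** ** Linear spans *)

Inductive lspan A (S : A -> Prop) : A -> Prop :=
| lspan0 : lspan S 0
| lspanDZ a x y : S x -> lspan S y -> lspan S (a%:K * x + y).

Section Lspan.
Variables (A : kalgType K) (S : A -> Prop).

Lemma lspanD x y : lspan S x -> lspan S y -> lspan S (x + y).
Proof.
move=> Sx Sy; elim: Sx => [|a z t Sz _ IH]; first by rewrite add0r.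
by rewrite -addrA; constructor.
Qed.

Lemma lspanZ a x : lspan S x -> lspan S (a%:K * x).
Proof.
elim=> [|b z t Sz _ IH]; first by rewrite mulr0; constructor.
by rewrite mulrDr mulrA -kscalM; constructor.
Qed.

Lemma lspan_in x : S x -> lspan S x.
Proof.
move=> Sx; rewrite -[x]addr0 -[x]mul1r -(kscal1 (s := A)).
by constructor => //; constructor.
Qed.

Lemma lspanN x : lspan S x -> lspan S (- x).
Proof. by move=> Sx; rewrite -mulN1r -(kscal1 (s := A)) -kscalN; apply: lspanZ. Qed.

Lemma lspanB x y : lspan S x -> lspan S y -> lspan S (x - y).
Proof. by move=> Sx Sy; apply: lspanD => //; apply: lspanN. Qed.

Lemma lspan_sum (I : Type) (r : seq I) (P : pred I) (F : I -> A) :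
  (forall i, P i -> lspan S (F i)) -> lspan S (\sum_(i <- r | P i) F i).
Proof.
by move=> HF; apply: big_ind => //; [constructor | exact: lspanD].
Qed.
End Lspan.

Lemma lspan_lin A B (f : A -> B) (S : A -> Prop) (T : B -> Prop) :
  f 0 = 0 -> (forall a x y, f (a%:K * x + y) = a%:K * f x + f y) ->
  (forall x, S x -> lspan T (f x)) -> forall x, lspan S x -> lspan T (f x).
Proof.
move=> f0 fL H x; elim=> [|a y z /H Ty _ Tz]; first by rewrite f0; constructor.
by rewrite fL; apply: lspanD => //; apply: lspanZ.
Qed.

Lemma lspanW A (S T : A -> Prop) x :
  (forall x, S x -> lspan T x) -> lspan S x -> lspan T x.
Proof.
by move=> H; exact: (@lspan_lin A A (fun x => x) S T erefl
  (fun _ _ _ => erefl) H x).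
Qed.

Lemma lspanM A (S T R : A -> Prop) :
  (forall x y, S x -> T y -> lspan R (x * y)) ->
  forall x y, lspan S x -> lspan T y -> lspan R (x * y).
Proof.
move=> H x y Sx Ty; move: x Sx; apply: (@lspan_lin _ _ ( *%R^~ y)).
- by rewrite mul0r.
- by move=> a x z; rewrite mulrDl mulrA.
move=> x Sx; move: y Ty; apply: (@lspan_lin _ _ ( *%R x)).
- by rewrite mulr0.
- by move=> a y z; rewrite mulrDr kscalAC.
by move=> y Ty; apply: H.
Qed.

(** The induction is on x acting on an arbitrary element of the span, not on x itself: a product
    acts one factor at a time, so stability under left multiplication by generators suffices. *)
Lemma gens_lspan A (S T : A -> Prop) : lspan T 1 ->
  (forall x y, S x -> T y -> lspan T (x * y)) ->
  forall x, gens S x -> lspan T x.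
Proof.
move=> T1 H x Sx; rewrite -[x]mulr1; elim: Sx (1) T1 => {x}.
- by move=> a y Ty; apply: lspanZ.
- by move=> x Sx y; apply: (lspanM (S := S)) => //; apply: lspan_in.
- by move=> x y _ IHx _ IHy z Tz; rewrite mulrDl; apply: lspanD; auto.
- by move=> x y _ IHx _ IHy z Tz; rewrite -mulrA; auto.
Qed.

Lemma lspan_uniq A (I : eqType) (b : I -> A) x :
  lspan (fun y => exists i, y = b i) x ->
  exists (s : seq I) (a : I -> K),
    [/\ uniq s, (forall i, i \in s -> a i != 0)
      & x = \sum_(i <- s) (a i)%:K * b i].
Proof.
elim=> [|c y z [i ->] _ [s [a [us a0 ->]]]].
  by exists [::], (fun=> 0); rewrite big_nil.
pose a' j := if j == i then c + (if i \in s then a i else 0) else a j.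
pose s' := if i \in s then s else i :: s.
exists [seq j <- s' | a' j != 0], a'; split.
- by rewrite filter_uniq // /s'; case: ifP => //= ->.
- by move=> j; rewrite mem_filter => /andP[].
rewrite big_filter.
rewrite [RHS](_ : _ = \sum_(j <- s') (a' j)%:K * b j); last first.
  rewrite big_mkcond; apply: eq_bigr => j _; case: eqP => //= ->.
  by rewrite kscal0 mul0r.
rewrite /s' /a'; case: ifPn => si.
  rewrite !(bigD1_seq i) //= eqxx kscalD mulrDl addrA; congr (_ + _).
  by apply: eq_bigr => j /negPf ->.
rewrite big_cons eqxx addr0; congr (_ + _); apply: eq_big_seq => j sj.
by case: eqP sj si => // -> ->.
Qed.

(** ** Presented algebras *)

Section Free.
Variables (I : choiceType) (A : kalgType K) (g : I -> A).

Definition fmev (m : {fmonom I}) : A := \prod_(i <- (m : seq I)) g i.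

Definition fev (x : freealg K I) : A :=
  \sum_(m <- msupp (x : {malg K[{fmonom I}]}))
    (mcoeff m (x : {malg K[{fmonom I}]}))%:K * fmev m.

Lemma fevEw (d : {fset {fmonom I}}) (x : {malg K[{fmonom I}]}) :
  (msupp x `<=` d)%fset -> fev x = \sum_(m <- d) (mcoeff m x)%:K * fmev m.
Proof.
move=> le; rewrite [LHS](big_fset_incl _ le) => //= m _ /mcoeff_outdom ->.
by rewrite kscal0 mul0r.
Qed.

Lemma fevD x y : fev (x + y) = fev x + fev y.
Proof.
pose d := (msupp (x : {malg K[{fmonom I}]}) `|` msupp (y : {malg K[{fmonom I}]})
  `|` msupp (x + y : {malg K[{fmonom I}]}))%fset.
rewrite !(@fevEw d).
- rewrite -big_split /=; apply: eq_bigr => m _.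
  by rewrite mcoeffD kscalD mulrDl.
- by rewrite /d -fsetUA; apply: fsubset_trans (fsubsetUr _ _); apply: fsubsetUl.
- by rewrite /d -fsetUA; apply: fsubsetUl.
- exact: fsubsetUr.
Qed.

Lemma fevU (c : K) (m : {fmonom I}) : fev << c *g m >> = c%:K * fmev m.
Proof.
by rewrite (fevEw (msuppU_le)) big_seq_fset1 mcoeffUU.
Qed.

Lemma fmevM m1 m2 : fmev (mmul m1 m2) = fmev m1 * fmev m2.
Proof. by rewrite /fmev fmM big_cat. Qed.

Lemma fev0 : fev 0 = 0.
Proof. by apply: (addrI (fev 0)); rewrite -fevD !addr0. Qed.

Lemma fev_sum (J : Type) (r : seq J) (F : J -> freealg K I) :
  fev (\sum_(i <- r) F i) = \sum_(i <- r) fev (F i).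
Proof. exact: (big_morph fev fevD fev0). Qed.

Lemma fevM x y : fev (x * y) = fev x * fev y.
Proof.
rewrite [x * y](@malgME {fmonom I} K) /= fev_sum {2}/fev mulr_suml.
apply: eq_bigr => i _; rewrite [LHS]fev_sum {2}/fev mulr_sumr.
apply: eq_bigr => j _; rewrite fevU kscalM fmevM.
by rewrite -!mulrA; congr (_ * _); rewrite !mulrA; congr (_ * _); rewrite kscalC.
Qed.

Lemma fev_alghom : alghom fev.
Proof.
have fK a : fev a%:K = a%:K.
  by rewrite [LHS]fevU /fmev fm1 big_nil mulr1.
split=> //; first exact: fevD.
by split; [rewrite -(kscal1 (s := freealg K I)) fK kscal1 | exact: fevM].
Qed.

Lemma fevZ a x : fev (a%:K * x) = a%:K * fev x.
Proof. by rewrite (alghomM fev_alghom) (alghomK fev_alghom). Qed.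

Lemma fevZD a b x y : fev (a%:K * x + b%:K * y) = a%:K * fev x + b%:K * fev y.
Proof.
exact: (etrans (alghomD fev_alghom _ _) (congr2 +%R (fevZ _ _) (fevZ _ _))).
Qed.

Lemma fev_gen i : fev (fgen i) = g i.
Proof. by rewrite /fgen [LHS]fevU kscal1 mul1r /fmev fmuE /= big_seq1. Qed.

End Free.

Lemma freealg_gens (I : choiceType) (x : freealg K I) :
  gens (fun y => exists i, y = fgen i) x.
Proof.
pose mon (c : K) (m : {fmonom I}) : freealg K I := << c *g m >>.
rewrite [x](@monalgE {fmonom I} K); apply: gens_sum => m.
have monM c c' m1 m2 : mon c m1 * mon c' m2 = mon (c * c') (mmul m1 m2).
  exact: (@fgmulUU {fmonom I} K).
rewrite -/(mon _ m) -[mcoeff _ _]mulr1 -[m in mon _ m]mul1m -monM.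
apply: gens_mul; first exact: gens_scal.
case: m => s; elim: s => [|i s IH].
  have -> : FMonom [::] = mone :> {fmonom I} by apply: val_inj; rewrite /= fm1.
  exact: gens1.
have -> : FMonom (i :: s) = mmul (fmu i) (FMonom s) :> {fmonom I}.
  by apply: val_inj; rewrite /= fmM fmuE.
rewrite -[1]mulr1 -monM; apply: gens_mul => //.
by apply: gens_in; exists i.
Qed.

Section Presented.
Variables (I : choiceType) (rel : freealg K I -> freealg K I -> Prop).

Lemma presalg_gens (x : presalg rel) :
  gens (fun y => exists i, y = pgen rel i) x.
Proof.
rewrite -[x]qreprK; set y := qrepr x.
have hq := qpi_alghom [set x | exists l r, rel l r /\ x = l - r]%classic.
elim: (freealg_gens y) => [a|_ [i ->]|u v _ Hu _ Hv|u v _ Hu _ Hv].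
- by rewrite (alghomK hq); exact: gens_scal.
- by apply: gens_in; exists i.
- by rewrite (alghomD hq); exact: gens_add.
- by rewrite (alghomM hq); exact: gens_mul.
Qed.

Lemma presalg_ext (A : kalgType K) (f g : presalg rel -> A) :
  alghom f -> alghom g -> (forall i, f (pgen rel i) = g (pgen rel i)) ->
  f =1 g.
Proof.
by move=> hf hg fg x; apply: (gens_ext hf hg) (presalg_gens x) => _ [i ->].
Qed.

Lemma presalg_rel l r : rel l r ->
  fev (pgen rel) l = fev (pgen rel) r.
Proof.
have hq := qpi_alghom [set x | exists l r, rel l r /\ x = l - r]%classic.
have E x : fev (pgen rel) x = qpi _ x.
  apply: (gens_ext (fev_alghom _) hq) (freealg_gens x) => _ [i ->].
  exact: fev_gen.
move=> lr; rewrite !E; apply/qpiP; rewrite unfold_in; apply/asboolP.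
rewrite -[l - r]mul1r -[1 * _]mulr1 -[X in ideal_gen _ X]addr0.
by constructor; [exists l, r | constructor].
Qed.

Lemma presalg_hom (A : kalgType K) (g : I -> A) :
  (forall l r, rel l r -> fev g l = fev g r) ->
  exists2 f : presalg rel -> A, alghom f & forall i, f (pgen rel i) = g i.
Proof.
move=> H; pose S := [set x | exists l r, rel l r /\ x = l - r]%classic.
have hev := fev_alghom g.
have ev0 x : ideal_gen S x -> fev g x = 0.
  elim=> [|a s b y [l [r [/H lr ->]]] _ IH]; first exact: (alghom0 hev).
  rewrite (alghomD hev) !(alghomM hev) (alghomB hev).
  by rewrite IH addr0 lr subrr mulr0 mul0r.
have evpi x y : qpi S x = qpi S y -> fev g x = fev g y.
  move/qpiP; rewrite unfold_in => /asboolP/ev0; rewrite (alghomB hev).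
  by move/eqP; rewrite subr_eq0 => /eqP.
pose f (x : presalg rel) := fev g (qrepr (x : quotalg S)).
have fpi x : f (qpi S x) = fev g x by apply: evpi; rewrite qreprK.
have hq := qpi_alghom S.
exists f; last by move=> i; rewrite /pgen fpi fev_gen.
split=> [x y||a].
- by rewrite -[x]qreprK -[y]qreprK -qpiD !fpi alghomD.
- split=> [|x y]; first by rewrite -(alghom1 hq) fpi alghom1.
  by rewrite -[x]qreprK -[y]qreprK -qpiM !fpi alghomM.
- by rewrite -(alghomK hq) fpi alghomK.
Qed.

End Presented.
End KAlgTheory.

(** * The quantum torus *)

Section Endo.
Variables (K : fieldType) (W : Type).

Record endo := Endo {
  eap :> (W -> K) -> W -> K;
  eapL : forall a f g,
    eap (fun w => a * f w + g w) = (fun w => a * eap f w + eap g w)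
}.

Lemma endoP (x y : endo) : (forall f w, x f w = y f w) -> x = y.
Proof.
case: x y => [x xL] [y yL] /= xy.
have E : x = y by apply: funext => f; apply: funext => w.
by subst y; congr Endo; exact: Prop_irrelevance.
Qed.

HB.instance Definition _ := gen_eqMixin endo.
HB.instance Definition _ := gen_choiceMixin endo.

Let eapE (x : endo) a f g w :
  x (fun w => a * f w + g w) w = a * x f w + x g w.
Proof. by rewrite eapL. Qed.

Let zero_L a (f g : W -> K) : (fun _ : W => 0 : K) = (fun _ => a * 0 + 0).
Proof. by apply: funext => w; rewrite mulr0 addr0. Qed.
Definition endo0 := Endo (eap := fun _ _ => 0) zero_L.

Let opp_L (x : endo) a f g : (fun w => - x (fun w => a * f w + g w) w) =
  (fun w => a * - x f w + - x g w).
Proof. by apply: funext => w; rewrite eapE opprD mulrN. Qed.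
Definition endo_opp (x : endo) := Endo (opp_L x).

Let add_L (x y : endo) a f g :
  (fun w => x (fun w => a * f w + g w) w + y (fun w => a * f w + g w) w) =
  (fun w => a * (x f w + y f w) + (x g w + y g w)).
Proof. by apply: funext => w; rewrite !eapE mulrDr addrACA. Qed.
Definition endo_add (x y : endo) :=
  Endo (eap := fun f w => x f w + y f w) (add_L x y).

Let one_L a (f g : W -> K) :
  (fun w => a * f w + g w) = (fun w => a * f w + g w).
Proof. by []. Qed.
Definition endo1 := Endo (eap := fun f => f) one_L.

Let mul_L (x y : endo) a f g :
  x (y (fun w => a * f w + g w)) = (fun w => a * x (y f) w + x (y g) w).
Proof. by rewrite !eapL. Qed.
Definition endo_mul (x y : endo) := Endo (eap := fun f => x (y f)) (mul_L x y).

Let scal_L c a (f g : W -> K) :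
  (fun w => c * (a * f w + g w)) = (fun w => a * (c * f w) + c * g w).
Proof. by apply: funext => w; rewrite mulrDr mulrCA. Qed.
Definition endo_scal c := Endo (eap := fun f w => c * f w) (scal_L c).

Let addA : associative endo_add.
Proof. by move=> x y z; apply: endoP => f w /=; rewrite addrA. Qed.
Let addC : commutative endo_add.
Proof. by move=> x y; apply: endoP => f w /=; rewrite addrC. Qed.
Let add0 : left_id endo0 endo_add.
Proof. by move=> x; apply: endoP => f w /=; rewrite add0r. Qed.
Let addN : left_inverse endo0 endo_opp endo_add.
Proof. by move=> x; apply: endoP => f w /=; rewrite addNr. Qed.

HB.instance Definition _ := GRing.isZmodule.Build endo addA addC add0 addN.

Let mulA : associative endo_mul.
Proof. by move=> x y z; apply: endoP. Qed.
Let mul1 : left_id endo1 endo_mul.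
Proof. by move=> x; apply: endoP. Qed.
Let mulx1 : right_id endo1 endo_mul.
Proof. by move=> x; apply: endoP. Qed.
Let mulDl : left_distributive endo_mul endo_add.
Proof. by move=> x y z; apply: endoP. Qed.
Let mulDr : right_distributive endo_mul endo_add.
Proof.
move=> x y z; apply: endoP => f w /=; rewrite -[RHS]/(_ + _).
have -> : (fun w0 => y f w0 + z f w0) = (fun w0 => 1 * y f w0 + z f w0).
  by apply: funext => v; rewrite mul1r.
by rewrite eapE mul1r.
Qed.

HB.instance Definition _ := GRing.Zmodule_isPzRing.Build endo
  mulA mul1 mulx1 mulDl mulDr.

Let scal1 : endo_scal 1 = 1 :> endo.
Proof. by apply: endoP => f w /=; rewrite mul1r. Qed.
Let scalD : {morph endo_scal : a b / a + b >-> (a + b : endo)}.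
Proof. by move=> a b; apply: endoP => f w /=; rewrite mulrDl. Qed.
Let scalM : {morph endo_scal : a b / a * b >-> (a * b : endo)}.
Proof. by move=> a b; apply: endoP => f w /=; rewrite mulrA. Qed.
Let scalC c (x : endo) : endo_scal c * x = x * endo_scal c.
Proof.
apply: endoP => f w /=.
have -> : (fun w0 => c * f w0) = (fun w0 => (c - 1) * f w0 + f w0).
  by apply: funext => v; rewrite mulrBl mul1r subrK.
by rewrite eapE mulrBl mul1r subrK.
Qed.

HB.instance Definition _ := PzRing_isKAlgebra.Build K endo
  scal1 scalD scalM scalC.

End Endo.

Lemma endo_mulE (K : fieldType) W (x y : endo K W) f : (x * y) f = x (y f).
Proof. by []. Qed.
Definition vadd (u v : nat -> Z) : nat -> Z := fun i => (u i + v i)%Z.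

Lemma vaddA : associative vadd.
Proof. by move=> u v w; apply: funext => i; rewrite /vadd Z.add_assoc. Qed.
Lemma vadd0 u : vadd (fun=> 0%Z) u = u.
Proof. exact: funext. Qed.
Lemma vaddv0 u : vadd u (fun=> 0%Z) = u.
Proof. by apply: funext => i; rewrite /vadd Z.add_0_r. Qed.

(* The exponents of the k-th puncture are those of Lambda, (q - q^-1) F and
   K^(1/2), in this order, at places 3k, 3k+1, 3k+2; here
   K^(1/2) F = q^-1 F K^(1/2) and q = h^2. *)
Fixpoint vbil (n : nat) (u v : nat -> Z) : Z :=
  if n is n'.+1 then
    (u (3 * n' + 2)%N * v (3 * n' + 1)%N * -2 + vbil n' u v)%Z
  else 0%Z.

Lemma vbilDl n u v w : vbil n (vadd u v) w = (vbil n u w + vbil n v w)%Z.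
Proof. by elim: n => //= n ->; rewrite /vadd; lia. Qed.
Lemma vbilDr n u v w : vbil n u (vadd v w) = (vbil n u v + vbil n u w)%Z.
Proof. by elim: n => //= n ->; rewrite /vadd; lia. Qed.
Lemma vbil0 n u : vbil n (fun=> 0%Z) u = 0%Z.
Proof. by elim: n => //= n ->; lia. Qed.

Lemma vbilr0 n u : vbil n u (fun=> 0%Z) = 0%Z.
Proof. by elim: n => //= n ->; lia. Qed.
Arguments vbil : simpl never.

Fixpoint vdot (c : seq Z) (v : nat -> Z) : Z :=
  if c is a :: c' then (a * v 0%N + vdot c' (fun i => v i.+1))%Z else 0%Z.

Lemma vdotD c u v : vdot c (vadd u v) = (vdot c u + vdot c v)%Z.
Proof.
elim: c u v => //= a c IH u v; rewrite -[X in vdot c X]/(vadd _ _) IH /vadd.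
by lia.
Qed.

Section Torus.
Variables (K : fieldType) (h : K).
Hypothesis h0 : h != 0.

Definition hz (z : Z) : K := h ^ (int_of_Z z).

Lemma hzD a b : hz (a + b) = hz a * hz b.
Proof. by rewrite /hz rmorphD /= expfzDr. Qed.
Lemma hz0 : hz 0 = 1. Proof. by []. Qed.
Lemma hz_neq0 a : hz a != 0. Proof. exact: expfz_neq0. Qed.
Lemma hzN a : hz (- a) = (hz a)^-1.
Proof. by rewrite /hz rmorphN /= invr_expz. Qed.

(** All linear operators on functions of the exponents: the ring laws are those of composition, and
    the span of the monomials is singled out only where it matters, by [tfil] and [tsupp]. *)
Definition torus := endo K (nat -> Z).

HB.instance Definition _ := KAlgebra.on torus.

Let tmon_L u a (f g : (nat -> Z) -> K) :
  (fun n => hz (vbil 4 n u) * (a * f (vadd n u) + g (vadd n u))) =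
  (fun n => a * (hz (vbil 4 n u) * f (vadd n u)) +
            hz (vbil 4 n u) * g (vadd n u)).
Proof. by apply: funext => n; ring. Qed.

(** The twisted regular representation. The operator stands for the monomial whose factors in each
    block are ordered as Lambda, F, K^(1/2). *)
Definition tmon (u : nat -> Z) : torus :=
  Endo (eap := fun f n => hz (vbil 4 n u) * f (vadd n u)) (tmon_L u).

Lemma tmonM u v : tmon u * tmon v = (hz (vbil 4 u v))%:K * tmon (vadd u v).
Proof.
apply: endoP => f n; rewrite !endo_mulE /= !vbilDl !vbilDr !hzD vaddA.
by ring.
Qed.

Lemma tmon0 : tmon (fun=> 0%Z) = 1.
Proof.
apply: endoP => f n /=; rewrite vaddv0.
by rewrite vbilr0 hz0 mul1r.
Qed.

(** The twist of [tmon] is trivial at the exponent 0, so evaluating there the image of the indicator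
    of u reads off a coefficient. *)
Definition tcoef (u : nat -> Z) (x : torus) : K :=
  x (fun v => (`[< v = u >])%:R) (fun=> 0%Z).

Lemma tcoefD u x y : tcoef u (x + y) = tcoef u x + tcoef u y.
Proof. by []. Qed.
Lemma tcoefZ u a x : tcoef u (a%:K * x) = a * tcoef u x.
Proof. by []. Qed.
Lemma tcoef0 u : tcoef u 0 = 0. Proof. by []. Qed.
Lemma tcoef_sum u (I : Type) (r : seq I) (F : I -> torus) :
  tcoef u (\sum_(i <- r) F i) = \sum_(i <- r) tcoef u (F i).
Proof. exact: (big_morph _ (tcoefD u) (tcoef0 u)). Qed.

Lemma tcoef_mon u v : tcoef u (tmon v) = (`[< v = u >])%:R.
Proof. by rewrite /tcoef /= vadd0 vbil0 hz0 mul1r. Qed.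

Arguments tcoef : simpl never.
Arguments tmon : simpl never.

(** ** Leading monomials *)

Section Lead.
Variable c : seq Z.
Let w := vdot c.

Definition tfil (n : Z) : torus -> Prop :=
  lspan (fun x => exists2 v, x = tmon v & (w v <= n)%Z).

Definition tlead (x : torus) (v : nat -> Z) : Prop :=
  exists2 a : K, a != 0 & tfil (w v - 1) (x - a%:K * tmon v).

Lemma tfil_mon n v : (w v <= n)%Z -> tfil n (tmon v).
Proof. by move=> vn; apply: lspan_in; exists v. Qed.

Lemma tfilW m n x : (m <= n)%Z -> tfil m x -> tfil n x.
Proof.
move=> mn; apply: lspanW => _ [v -> vm].
by apply: tfil_mon; lia.
Qed.

Lemma tfilM m n x y : tfil m x -> tfil n y -> tfil (m + n) (x * y).
Proof.
apply: lspanM => _ _ [u -> um] [v -> vn].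
rewrite tmonM; apply/lspanZ/tfil_mon; rewrite /w vdotD -/w; lia.
Qed.

Lemma tfil_scal a : tfil 0 a%:K.
Proof.
rewrite -[_%:K]mulr1 -tmon0; apply/lspanZ/tfil_mon.
rewrite (_ : w _ = 0%Z); first lia.
rewrite /w; elim: c => //= b s IH; rewrite IH; lia.
Qed.

Lemma tlead_mon a v : a != 0 -> tlead (a%:K * tmon v) v.
Proof. by move=> a0; exists a => //; rewrite subrr; constructor. Qed.

Lemma tlead_fil x v : tlead x v -> tfil (w v) x.
Proof.
move=> [a _ H]; rewrite -[x](subrK (a%:K * tmon v)); apply: lspanD.
  by apply: tfilW H; lia.
by apply/lspanZ/tfil_mon; lia.
Qed.

Lemma tleadM x y u v : tlead x u -> tlead y v -> tlead (x * y) (vadd u v).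
Proof.
move=> lx ly; have fy := tlead_fil ly; case: lx ly => [a a0 Hx] [b b0 Hy].
exists (a * b * hz (vbil 4 u v)); first by rewrite !mulf_neq0 ?hz_neq0.
have -> : x * y - (a * b * hz (vbil 4 u v))%:K * tmon (vadd u v) =
   (x - a%:K * tmon u) * y + a%:K * tmon u * (y - b%:K * tmon v).
  rewrite mulrBl mulrBr addrA subrK; congr (_ - _).
  by rewrite -!mulrA kscalAC tmonM !kscalM !mulrA.
rewrite {1}/w vdotD -/w; apply: lspanD.
  by rewrite (_ : (_ - 1 = w u - 1 + w v)%Z); [exact: tfilM | lia].
rewrite (_ : (_ - 1 = w u + (w v - 1))%Z); last lia.
by apply: tfilM => //; apply/lspanZ/tfil_mon; lia.
Qed.

Lemma tleadD x y v : tlead x v -> tfil (w v - 1) y -> tlead (x + y) v.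
Proof. by move=> [a a0 H] Hy; exists a => //; rewrite addrAC; exact: lspanD. Qed.

Lemma tleadZ a x v : a != 0 -> tlead x v -> tlead (a%:K * x) v.
Proof.
move=> a0 [b b0 H]; exists (a * b); first exact: mulf_neq0.
by rewrite kscalM -mulrA -mulrBr; apply: lspanZ.
Qed.

Lemma tlead1 : tlead 1 (fun=> 0%Z).
Proof.
by rewrite -tmon0 -[X in tlead X]mul1r -(kscal1 (s := torus)); apply: tlead_mon (oner_neq0 _).
Qed.

Lemma tleadX x v n : tlead x v -> tlead (x ^+ n) (fun i => (Z.of_nat n * v i)%Z).
Proof.
move=> lx; elim: n => [|n IH].
  by rewrite expr0 (_ : (fun i => _) = (fun=> 0%Z)) //; exact: tlead1.
rewrite exprS (_ : (fun i => _) = vadd v (fun i => (Z.of_nat n * v i)%Z)).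
  exact: tleadM.
by apply: funext => i; rewrite /vadd; lia.
Qed.

Lemma tcoef_fil n x u : tfil n x -> (n < w u)%Z -> tcoef u x = 0.
Proof.
elim=> // a _ z [v -> vn] _ IH nu; rewrite tcoefD tcoefZ IH // addr0 tcoef_mon.
by case: asboolP => [e|]; [move: nu; rewrite -e; lia | rewrite mulr0].
Qed.

Lemma tcoef_lead x u v : tlead x v -> (w v <= w u)%Z ->
  (tcoef u x != 0) = `[< v = u >].
Proof.
move=> [a a0 H] vu.
rewrite -[x](subrK (a%:K * tmon v)) tcoefD (tcoef_fil H) ?add0r; last lia.
by rewrite tcoefZ tcoef_mon; case: asboolP => _; rewrite ?mulr1 ?mulr0 ?eqxx.
Qed.

(** Take an index of largest weight. An element of the same weight does not meet its monomial: its
    leading exponent is another one and its other terms are lighter. Ties between weights are thus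
    harmless. *)
Lemma tlead_max (I : eqType) (e : I -> torus) (v : I -> nat -> Z)
    (s : seq I) (a : I -> K) :
  injective v -> (forall i, tlead (e i) (v i)) ->
  uniq s -> (forall i, i \in s -> a i != 0) -> s != [::] ->
  exists i, [/\ i \in s, tcoef (v i) (\sum_(i <- s) (a i)%:K * e i) != 0 &
    forall j, j \in s -> (w (v j) <= w (v i))%Z].
Proof.
move=> iv le us sa s0.
have [i [si mi]] : exists i, i \in s /\
    forall j, j \in s -> (w (v j) <= w (v i))%Z.
  elim: s s0 {us sa} => // j s IH _.
  case: s IH => [|k s] IH.
    by exists j; split=> [|l]; rewrite !inE // => /eqP->; lia.
  have [i [si mi]] := IH isT.
  case: (Z.le_gt_cases (w (v i)) (w (v j))) => ij.
    exists j; split=> [|l]; first exact: mem_head.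
    by rewrite inE => /predU1P[->|/mi]; lia.
  exists i; split=> [|l]; first by rewrite inE si orbT.
  by rewrite inE => /predU1P[->|/mi //]; lia.
exists i; split=> //; rewrite tcoef_sum (bigD1_seq i) //= big1_seq ?addr0; last first.
  move=> k /andP[ki ks]; rewrite tcoefZ; apply/eqP.
  rewrite mulf_eq0; apply/orP; right; apply/negPn.
  rewrite (tcoef_lead (le k) (mi k ks)); apply/asboolP => /iv ik.
  by rewrite ik eqxx in ki.
rewrite tcoefZ mulf_neq0 ?sa //.
by rewrite (tcoef_lead (le i) (Z.le_refl _)); case: asboolP.
Qed.

(** The leading terms of a family with distinct leading exponents cannot cancel, so a bound on a
    combination bounds every element occurring in it. *)
Lemma tlead_family (I : eqType) (e : I -> torus) (v : I -> nat -> Z) n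
    (s : seq I) (a : I -> K) :
  injective v -> (forall i, tlead (e i) (v i)) ->
  uniq s -> (forall i, i \in s -> a i != 0) ->
  tfil n (\sum_(i <- s) (a i)%:K * e i) ->
  forall i, i \in s -> (w (v i) <= n)%Z.
Proof.
move=> iv le us sa fn j js.
have s0 : s != [::] by case: (s) js.
have [i [si ci mi]] := tlead_max iv le us sa s0.
apply: (Z.le_trans _ _ _ (mi j js)).
by case: (Z.le_gt_cases (w (v i)) n) => // /(tcoef_fil fn) z; rewrite z eqxx in ci.
Qed.

(** Only coefficients at leading exponents are tested; this is what permits dropping most terms when
    the relations are checked. *)
Lemma tlead_coef (A : kalgType K) (f : A -> torus) (I : eqType) (b : I -> A)
    (v : I -> nat -> Z) :
  f 0 = 0 -> (forall a x y, f (a%:K * x + y) = a%:K * f x + f y) ->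
  (forall x, lspan (fun y => exists i, y = b i) x) ->
  injective v -> (forall i, tlead (f (b i)) (v i)) ->
  forall x, (forall i, tcoef (v i) (f x) = 0) -> x = 0.
Proof.
move=> f0 fL sp iv lf x; have [s [a [us sa ->]]] := lspan_uniq (sp x) => fx.
have fs : f (\sum_(i <- s) (a i)%:K * b i) = \sum_(i <- s) (a i)%:K * f (b i).
  elim: (s) => [|i r IH]; first by rewrite !big_nil.
  by rewrite !big_cons fL IH.
case: (altP (s =P [::])) => [->|s0]; first by rewrite big_nil.
have [i [_ ci _]] := tlead_max iv lf us sa s0.
by move: ci; rewrite -fs fx eqxx.
Qed.

Lemma tlead_inj (A : kalgType K) (f : A -> torus) (I : eqType) (b : I -> A)
    (v : I -> nat -> Z) :
  f 0 = 0 -> (forall a x y, f (a%:K * x + y) = a%:K * f x + f y) ->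
  (forall x, lspan (fun y => exists i, y = b i) x) ->
  injective v -> (forall i, tlead (f (b i)) (v i)) ->
  forall x, f x = 0 -> x = 0.
Proof.
move=> f0 fL sp iv lf x fx; apply: (tlead_coef f0 fL sp iv lf) => i.
by rewrite fx tcoef0.
Qed.

End Lead.
End Torus.

(** * Computing in the quantum torus *)

Definition vec (l : seq Z) : nat -> Z := fun i => nth 0%Z l i.

Fixpoint addl (u v : seq Z) : seq Z :=
  match u, v with
  | [::], _ => v
  | _, [::] => u
  | a :: u', b :: v' => (a + b)%Z :: addl u' v'
  end.

Lemma vec_addl u v : vec (addl u v) = vadd (vec u) (vec v).
Proof.
apply: funext => i; rewrite /vec /vadd.
elim: u v i => [|a u IH] [|b v] [|i] //=; rewrite ?nth_nil; lia.
Qed.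

Fixpoint bill (n : nat) (u v : seq Z) : Z :=
  if n is n'.+1 then
    if u is _ :: _ :: k :: u' then
      if v is _ :: y :: v' then (k * y * -2 + bill n' u' (behead v'))%Z
      else 0%Z
    else 0%Z
  else 0%Z.

Lemma vbil_shift n u v : vbil n.+1 u v =
  (u 2%N * v 1%N * -2 + vbil n (fun i => u i.+3) (fun i => v i.+3))%Z.
Proof.
elim: n => [|n IH]; first by rewrite /vbil muln0.
rewrite -[LHS]/(u (3 * n.+1 + 2)%N * v (3 * n.+1 + 1)%N * -2 + vbil n.+1 u v)%Z.
rewrite IH -[vbil n.+1 (fun=> _) _]/(u (3 * n + 2).+3 * v (3 * n + 1).+3 * -2 +
  vbil n (fun i => u i.+3) (fun i => v i.+3))%Z.
by rewrite !mulnS -!addnA !add3n; lia.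
Qed.

Lemma billE n u v : bill n u v = vbil n (vec u) (vec v).
Proof.
have vnil m f w : f =1 (fun=> 0%Z) -> vbil m f w = 0%Z.
  by move=> /funext->; exact: vbil0.
have nilv m f w : f =1 (fun=> 0%Z) -> vbil m w f = 0%Z.
  by move=> /funext->; exact: vbilr0.
elim: n u v => // n IH u v; rewrite vbil_shift /vec.
case: u => [|a [|b [|k u]]]; rewrite /=.
- by rewrite vnil // => i; rewrite ?nth_nil.
- by rewrite vnil // => i; rewrite ?nth_nil.
- by rewrite vnil // => i; rewrite ?nth_nil.
case: v => [|c [|y v]]; rewrite /=.
- by rewrite nilv => [|i]; rewrite ?nth_nil //; lia.
- by rewrite nilv => [|i]; rewrite ?nth_nil //; lia.
rewrite IH; case: v => [|d v] //=.
rewrite /vec; congr (_ + vbil _ _ _)%Z.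
by apply: funext => i; rewrite ?nth_nil.
Qed.

Arguments bill : simpl never.

(** Exponents, a power of h, and an integer coefficient. *)
Definition term : Type := (seq Z * Z * Z)%type.

Fixpoint lcmp (u v : seq Z) : comparison :=
  match u, v with
  | [::], [::] => Eq
  | [::], _ => Lt
  | _, [::] => Gt
  | a :: u', b :: v' => if Z.compare a b is Eq then lcmp u' v' else Z.compare a b
  end.

Lemma lcmpP u v : lcmp u v = Eq -> u = v.
Proof.
elim: u v => [|a u IH] [|b v] //=.
by case: Z.compare_spec => // -> /IH ->.
Qed.

Definition tcmp (s t : term) : comparison :=
  if lcmp s.1.1 t.1.1 is Eq then Z.compare s.1.2 t.1.2 else lcmp s.1.1 t.1.1.

Lemma tcmpP s t : tcmp s t = Eq -> s.1 = t.1.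
Proof.
rewrite /tcmp; case e: lcmp => // /Z.compare_eq e2.
by case: s t e e2 => [[u a] c] [[v b] d] /= /lcmpP -> ->.
Qed.

(** A merge. Its value is the sum for arbitrary lists; order only makes terms with the same
    exponents and power of h meet and cancel. *)
Fixpoint addp (p q : seq term) : seq term :=
  if p is s :: p' then
    (fix aux q := if q is t :: q' then
       match tcmp s t with
       | Lt => s :: addp p' q
       | Gt => t :: aux q'
       | Eq => let c := (s.2 + t.2)%Z in
               if Z.eqb c 0 then addp p' q' else (s.1, c) :: addp p' q'
       end else p) q
  else q.

Definition negp (p : seq term) : seq term := [seq (t.1, (- t.2)%Z) | t <- p].

Definition mult (s t : term) : term :=
  (addl s.1.1 t.1.1, (s.1.2 + t.1.2 + bill 4 s.1.1 t.1.1)%Z, (s.2 * t.2)%Z).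

Definition mulp (p q : seq term) : seq term :=
  foldr (fun s r => addp [seq mult s t | t <- q] r) [::] p.

Definition spoly : Type := seq (Z * Z).
Definition smul (p q : spoly) : spoly :=
  [seq ((s.1 + t.1)%Z, (s.2 * t.2)%Z) | s <- p, t <- q].
Definition sopp (p : spoly) : spoly := [seq (t.1, (- t.2)%Z) | t <- p].
Definition constp (p : spoly) : seq term :=
  foldr (fun s r => addp [:: (nseq 12 0%Z, s.1, s.2)] r) [::] p.

Section Eval.
Variables (K : fieldType) (h : K).
Hypothesis h0 : h != 0.
Notation hz := (hz h).
Notation tmon := (tmon h).
Notation torus := (torus K).

Definition zk (z : Z) : K := (int_of_Z z)%:~R.
Lemma zkD a b : zk (a + b) = zk a + zk b.
Proof. by rewrite /zk rmorphD /= intrD. Qed.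
Lemma zkM a b : zk (a * b) = zk a * zk b.
Proof. by rewrite /zk rmorphM /= intrM. Qed.
Lemma zkN a : zk (- a) = - zk a.
Proof. by rewrite /zk rmorphN /= intrN. Qed.

Definition sev (p : spoly) : K := \sum_(t <- p) zk t.2 * hz t.1.

Lemma sev_add a b p q : a = sev p -> b = sev q -> a + b = sev (p ++ q).
Proof. by move=> -> ->; rewrite /sev big_cat. Qed.
Lemma sev_opp a p : a = sev p -> - a = sev (sopp p).
Proof.
move=> ->; rewrite /sev big_map -sumrN; apply: eq_bigr => t _.
by rewrite zkN mulNr.
Qed.
Lemma sev_mul a b p q : a = sev p -> b = sev q -> a * b = sev (smul p q).
Proof.
move=> -> ->; rewrite /sev big_allpairs_dep mulr_suml; apply: eq_bigr => s _.
rewrite mulr_sumr; apply: eq_bigr => t _.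
by rewrite zkM (hzD h0) mulrACA.
Qed.
Lemma sev_nat n : n%:R = sev [:: (0%Z, Z.of_nat n)].
Proof.
rewrite /sev big_seq1 /= hz0 mulr1 /zk.
suff -> : int_of_Z (Z.of_nat n) = n :> int by rewrite -pmulrn.
lia.
Qed.
Lemma sev1 : 1 = sev [:: (0%Z, 1%Z)].
Proof. by rewrite /sev big_seq1 /= mulr1. Qed.
Lemma sev_hz e : hz e = sev [:: (e, 1%Z)].
Proof. by rewrite /sev big_seq1 mul1r. Qed.

Definition tev (t : term) : torus := (zk t.2 * hz t.1.2)%:K * tmon (vec t.1.1).
Definition pev (p : seq term) : torus := \sum_(t <- p) tev t.

Lemma pev_cons t p : pev (t :: p) = tev t + pev p.
Proof. by rewrite /pev big_cons. Qed.

Lemma pev_addp p q : pev (addp p q) = pev p + pev q.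
Proof.
elim: p q => [|s p IH] q; first by rewrite /pev big_nil add0r.
elim: q => [|t q IHq]; first by rewrite /pev big_nil addr0.
rewrite /= -/(addp (s :: p) q); case e: (tcmp s t).
- have e1 := tcmpP e.
  have E : tev s + tev t = tev (s.1, (s.2 + t.2)%Z).
    by rewrite /tev -e1 /= zkD mulrDl kscalD mulrDl.
  rewrite !pev_cons addrACA E; case: Z.eqb_spec => [z|_]; last by rewrite pev_cons IH.
  by rewrite IH /tev /= z /zk mul0r kscal0 mul0r add0r.
- by rewrite pev_cons IH !pev_cons !addrA.
- by rewrite pev_cons -[X in pev X]/(addp (s :: p) q) IHq !pev_cons addrCA.
Qed.

Lemma pev_negp p : pev (negp p) = - pev p.
Proof.
rewrite /pev big_map -sumrN; apply: eq_bigr => t _.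
by rewrite /tev /= zkN mulNr kscalN mulNr.
Qed.

Lemma tev_mult s t : tev (mult s t) = tev s * tev t.
Proof.
rewrite /tev /mult /= vec_addl billE !zkM (hzD h0 (_ + _)) (hzD h0 s.1.2).
rewrite kscalMM (tmonM h0) [RHS]mulrA -[in RHS]kscalM; congr (_%:K * _).
by ring.
Qed.

Lemma pev_mulp p q : pev (mulp p q) = pev p * pev q.
Proof.
elim: p => [|s p IH]; first by rewrite /pev !big_nil mul0r.
rewrite /= pev_addp IH pev_cons mulrDl; congr (_ + _).
rewrite /pev big_map mulr_sumr; apply: eq_bigr => t _; exact: tev_mult.
Qed.

Lemma pevM x y p q : x = pev p -> y = pev q -> x * y = pev (mulp p q).
Proof. by move=> -> ->; rewrite pev_mulp. Qed.
Lemma pev_const a p : a = sev p -> a%:K = pev (constp p).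
Proof.
move=> ->; elim: p => [|s p IH]; first by rewrite /sev /pev !big_nil kscal0.
rewrite -[constp _]/(addp [:: (nseq 12 0%Z, s.1, s.2)] (constp p)).
rewrite pev_addp -IH /sev big_cons kscalD; congr (_ + _).
rewrite /pev big_seq1 /tev /= (_ : vec _ = fun=> 0%Z) ?tmon0 ?mulr1 //.
apply: funext => i; rewrite /vec -[LHS]/(nth 0%Z (nseq 12 0%Z) i).
by rewrite nth_nseq if_same.
Qed.
Lemma pev1 : 1 = pev [:: (nseq 12 0%Z, 0%Z, 1%Z)].
Proof.
rewrite -(kscal1 (s := torus)) (pev_const sev1) /constp /=.
by rewrite /addp.
Qed.

Lemma pev_eq x y p q :
  x = pev p -> y = pev q -> addp p (negp q) = [::] -> x = y.
Proof.
move=> -> -> e; apply/eqP; rewrite -subr_eq0 -pev_negp -pev_addp e.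
by rewrite /pev big_nil.
Qed.

End Eval.

(** * The state sum of a diagram *)

(* Finite linear combinations of states, with coefficients in the torus. *)
Definition lc : Type := seq (seq term * seq bool).

Definition lcbind (l : lc) (f : seq bool -> lc) : lc :=
  flatten [seq [seq (mulp t.1 u.1, u.2) | u <- f t.2] | t <- l].

Definition lcoef (o : seq bool) (l : lc) : seq term :=
  foldr (fun t r => if t.2 == o then addp t.1 r else r) [::] l.

Definition lccheck (l1 l2 : lc) : bool :=
  all (fun o => addp (lcoef o l1) (negp (lcoef o l2)) == [::])
      (map snd l1 ++ map snd l2).

Definition tone : seq term := [:: (nseq 12 0%Z, 0%Z, 1%Z)].
Definition tscal (e c : Z) : seq term := [:: (nseq 12 0%Z, e, c)].

(* The entries of the two triangular matrices of a puncture: strands passing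
   below it act by the lower triangular one ([e = true]), strands passing above
   it by the upper triangular one. *)
Definition blk (k : nat) (l y c : Z) : seq Z :=
  nseq (3 * k) 0%Z ++ [:: l; y; c] ++ nseq (9 - 3 * k) 0%Z.

Definition tLp (k : nat) (e a c : bool) : seq term :=
  (* Truncating the block number makes statements about every k a finite check over four blocks. *)
  let k := minn k 3 in
  match e, a, c with
  | true, false, false | false, true, true => [:: (blk k 0 0 1, 0, 1)%Z]
  | true, true, true | false, false, false => [:: (blk k 0 0 (-1), 0, 1)%Z]
  | true, true, false => [:: (blk k 0 1 1, 0, 1)%Z]
  (* This is -q^-1 (q - q^-1) E K^(-1/2), with (q - q^-1) E replaced by its value in the torus. *)
  | false, false, true => [:: (blk k 0 (-1) (-3), -4, 1)%Z;
      (blk k 0 (-1) 1, 0, 1)%Z; (blk k 1 (-1) (-1), -2, -1)%Z]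
  | true, false, true | false, true, false => [::]
  end.

(** A crossing is its Kauffman resolution with the terms left uncollected: [Cross true] is h times
    the identity plus h^-1 times a cap followed by a cup, and [Cross false] has h and h^-1
    exchanged. Cups and caps are normalized so that zigzags straighten and a circle is -q - q^-1. *)
Definition loc (p : piece) (x : seq bool) : lc :=
  match p, x with
  | Cup, _ => [:: (tone, [:: false; true]); (tscal (-2) (-1), [:: true; false])]
  | Cap, [:: false; true] => [:: (tscal 2 (-1), [::])]
  | Cap, [:: true; false] => [:: (tone, [::])]
  | Cross true, [:: false; true] =>
      [:: (tscal 1 1, x); (tscal 1 (-1), x); (tscal (-1) 1, [:: true; false])]
  | Cross true, [:: true; false] =>
      [:: (tscal 1 1, x); (tscal (-1) 1, [:: false; true]);
          (tscal (-3) (-1), x)]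
  | Cross true, _ => [:: (tscal 1 1, x)]
  | Cross false, [:: false; true] =>
      [:: (tscal (-1) 1, x); (tscal 3 (-1), x); (tscal 1 1, [:: true; false])]
  | Cross false, [:: true; false] =>
      [:: (tscal (-1) 1, x); (tscal 1 1, [:: false; true]);
          (tscal (-1) (-1), x)]
  | Cross false, _ => [:: (tscal (-1) 1, x)]
  | _, _ => [::]
  end.

Fixpoint run (w : word) (x : seq bool) : lc :=
  if w is (p, i) :: w' then
    lcbind (loc p (take (ends_left p) (drop i x)))
      (fun o => run w' (take i x ++ o ++ drop (i + ends_left p) x))
  else [:: (tone, x)].

(** Transfer of a state through a puncture. The flags [es] tell which strands are below it; a
    missing flag means above. *)
Fixpoint rowl (k : nat) (es x : seq bool) : lc :=
  if x is a :: x' then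
    flatten [seq [seq (mulp (tLp k (head false es) a c) u.1, c :: u.2)
                 | u <- rowl k (behead es) x'] | c <- [:: false; true]]
  else [:: (tone, [::])].

Definition wshift (i : nat) (w : word) : word := [seq (s.1, i + s.2)%N | s <- w].

Definition states (n : nat) : seq (seq bool) :=
  iter n (fun l => [seq a :: x | a <- [:: false; true], x <- l]) [:: [::]].

Definition intertwine_check : bool :=
  all (fun k => all (fun e => all (fun p => all (fun x =>
    lccheck (lcbind (loc p x) (rowl k (nseq (ends_right p) e)))
            (lcbind (rowl k (nseq (ends_left p) e) x) (loc p)))
    (states (ends_left p)))
    [:: Cup; Cap; Cross true; Cross false]) [:: false; true]) (iota 0 4).

Section StateSum.
Variables (K : fieldType) (h : K).
Hypothesis h0 : h != 0.
Notation torus := (torus K).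
Notation pev := (pev h).
Implicit Types (F G : seq bool -> torus).

Definition lev (l : lc) F : torus := \sum_(t <- l) pev t.1 * F t.2.

Lemma lev_nil F : lev [::] F = 0. Proof. by rewrite /lev big_nil. Qed.
Lemma lev_cons t l F : lev (t :: l) F = pev t.1 * F t.2 + lev l F.
Proof. by rewrite /lev big_cons. Qed.

Lemma pev_tone : pev tone = 1. Proof. by rewrite -pev1. Qed.
Lemma pev_tscal e c : pev (tscal e c) = (zk K c * hz h e)%:K.
Proof.
rewrite (pev_const (h := h) (p := [:: (e, c)])) //.
by rewrite /sev big_seq1.
Qed.

Lemma lev_unit x F : lev [:: (tone, x)] F = F x.
Proof. by rewrite lev_cons lev_nil addr0 pev_tone mul1r. Qed.

Lemma lev_bind l f F : lev (lcbind l f) F = lev l (fun o => lev (f o) F).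
Proof.
rewrite /lev big_flatten big_map; apply: eq_bigr => t _.
rewrite big_map mulr_sumr; apply: eq_bigr => u _.
by rewrite (pev_mulp h0) mulrA.
Qed.

Lemma lev_part l (r : seq (seq bool)) F : uniq r -> {subset map snd l <= r} ->
  lev l F = \sum_(o <- r) pev (lcoef o l) * F o.
Proof.
move=> ur; elim: l => [|t l IH] lr.
  by rewrite lev_nil big1 // => o _; rewrite /pev big_nil mul0r.
have tr : t.2 \in r by apply: lr; exact: mem_head.
rewrite lev_cons IH => [|o ol]; last by apply: lr; rewrite inE ol orbT.
rewrite !(bigD1_seq t.2) //= eqxx pev_addp mulrDl addrA; congr (_ + _).
by apply: eq_bigr => o /negPf; rewrite eq_sym => ->.
Qed.

Lemma lev_check l1 l2 F : lccheck l1 l2 -> lev l1 F = lev l2 F.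
Proof.
move=> /allP H; have ur := undup_uniq (map snd l1 ++ map snd l2).
rewrite !(lev_part _ ur).
- apply: eq_big_seq => o; rewrite mem_undup => /H/eqP e; congr (_ * _).
  exact: pev_eq e.
- by move=> o ol; rewrite mem_undup mem_cat ol orbT.
- by move=> o ol; rewrite mem_undup mem_cat ol.
Qed.

Lemma lev_ext l F G : {in map snd l, F =1 G} -> lev l F = lev l G.
Proof.
move=> FG; apply: eq_big_seq => t tl; congr (_ * _).
by apply: FG; exact: map_f.
Qed.

Lemma levD l F G : lev l (fun o => F o + G o) = lev l F + lev l G.
Proof. by rewrite /lev -big_split; apply: eq_bigr => t _; rewrite mulrDr. Qed.

Lemma lev_comm l F x : (forall t, t \in l -> GRing.comm x (pev t.1)) ->
  x * lev l F = lev l (fun o => x * F o).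
Proof.
move=> c; rewrite /lev mulr_sumr; apply: eq_big_seq => t tl.
by rewrite !mulrA c.
Qed.

Lemma loc_scal p x t : t \in loc p x -> exists a, pev t.1 = a%:K.
Proof.
have tonek : exists a, pev tone = a%:K :> torus by exists 1; rewrite pev_tone kscal1.
have tscalk e c : exists a, pev (tscal e c) = a%:K :> torus.
  by exists (zk K c * hz h e); rewrite pev_tscal.
case: p => [||[]|] //=; case: x => [|[] [|[] [|? ?]]] //=; rewrite !inE;
  (move=> /or3P[]/eqP-> || move=> /orP[]/eqP-> || move=> /eqP->);
  (exact: tonek || exact: tscalk).
Qed.

Lemma loc_comm p x y t : t \in loc p x -> GRing.comm y (pev t.1).
Proof. by move=> /loc_scal[a ->]; rewrite /GRing.comm kscalC. Qed.

Lemma loc_size p x t : t \in loc p x -> size x = ends_left p ->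
  size t.2 = ends_right p.
Proof.
case: p => [||[]|] //=; case: x => [|[] [|[] [|? ?]]] //=; rewrite !inE;
  by (move=> /or3P[]/eqP-> || move=> /orP[]/eqP-> || move=> /eqP->).
Qed.

Lemma lev_exch l l' (F : seq bool -> seq bool -> torus) :
  (forall t y, t \in l -> GRing.comm y (pev t.1)) ->
  lev l (fun o => lev l' (F o)) = lev l' (fun o' => lev l (F^~ o')).
Proof.
move=> c; rewrite /lev.
under eq_bigr do rewrite mulr_sumr; rewrite exchange_big; apply: eq_bigr => t' _.
rewrite mulr_sumr; apply: eq_big_seq => t tl.
by rewrite mulrA -(c t _ tl) mulrA.
Qed.

Definition tL (k : nat) (e a c : bool) : torus := pev (tLp k e a c).

Fixpoint rowt (k : nat) (es s : seq bool) F : torus :=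
  if s is a :: s' then
    tL k (head false es) a false *
      rowt k (behead es) s' (fun t => F (false :: t)) +
    tL k (head false es) a true *
      rowt k (behead es) s' (fun t => F (true :: t))
  else F [::].

Definition lop (p : piece) (i : nat) F (s : seq bool) : torus :=
  lev (loc p (take (ends_left p) (drop i s)))
    (fun o => F (take i s ++ o ++ drop (i + ends_left p) s)).

Fixpoint Zw (k : nat) (w : word) (s : seq bool) : torus :=
  match w with
  | [::] => if s is [::] then 1 else 0
  | (p, i) :: w' =>
      if is_puncture p then rowt k (nseq i true) s (Zw k.+1 w')
      else lop p i (Zw k w') s
  end.

Lemma rowt_ext k es s F G :
  (forall t, size t = size s -> F t = G t) -> rowt k es s F = rowt k es s G.
Proof.
elim: s es F G => [|a s IH] es F G FG /=; first exact: FG.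
by congr (_ * _ + _ * _); apply: IH => t st; apply: FG; rewrite /= st.
Qed.

Lemma rowtD k es s F G :
  rowt k es s (fun t => F t + G t) = rowt k es s F + rowt k es s G.
Proof.
by elim: s es F G => //= a s IH es F G; rewrite !IH !mulrDr addrACA.
Qed.

Lemma rowt0 k es s : rowt k es s (fun=> 0) = 0.
Proof. by elim: s es => //= a s IH es; rewrite !IH !mulr0 addr0. Qed.

Lemma rowt_mull k es s F x : (forall e a c, GRing.comm x (tL k e a c)) ->
  rowt k es s (fun t => x * F t) = x * rowt k es s F.
Proof.
move=> cx; elim: s es F => //= a s IH es F.
by rewrite !IH mulrDr !mulrA !cx.
Qed.

Lemma rowt_mulr k es s F x : rowt k es s (fun t => F t * x) = rowt k es s F * x.
Proof.
by elim: s es F => //= a s IH es F; rewrite !IH mulrDl !mulrA.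
Qed.

Lemma rowt_cat k es s1 s2 F : rowt k es (s1 ++ s2) F =
  rowt k es s1 (fun t1 => rowt k (drop (size s1) es) s2 (fun t2 => F (t1 ++ t2))).
Proof.
elim: s1 es F => [|a s1 IH] es F /=; first by rewrite drop0.
by rewrite !IH; case: es => [|e es].
Qed.

Lemma rowt_es k es es' s F :
  (forall i, (i < size s)%N -> nth false es i = nth false es' i) ->
  rowt k es s F = rowt k es' s F.
Proof.
elim: s es es' F => //= a s IH es es' F H.
have -> : head false es = head false es' by have := H 0%N isT; rewrite !nth0.
by congr (_ * _ + _ * _); apply: IH => i si; rewrite !nth_behead; apply: H.
Qed.

Lemma rowl_rowt k es x F : rowt k es x F = lev (rowl k es x) F.
Proof.
elim: x es F => [|a x IH] es F /=; first by rewrite lev_unit.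
have E c : tL k (head false es) a c * rowt k (behead es) x (fun t => F (c :: t)) =
  lev [seq (mulp (tLp k (head false es) a c) u.1, c :: u.2)
      | u <- rowl k (behead es) x] F.
  rewrite IH /lev big_map mulr_sumr; apply: eq_bigr => u _.
  by rewrite (pev_mulp h0) mulrA.
by rewrite !E /lev !big_cat big_nil /= addr0.
Qed.

Lemma lev_rowt k es s l (F : seq bool -> seq bool -> torus) :
  (forall t y, t \in l -> GRing.comm y (pev t.1)) ->
  lev l (fun o => rowt k es s (F o)) = rowt k es s (fun u => lev l (F^~ u)).
Proof.
move=> c; elim: s es F => //= a s IH es F.
rewrite levD -!(IH (behead es)) !lev_comm //;
  by move=> t tl; exact: c.
Qed.

Lemma states_mem n x : size x = n -> x \in states n.
Proof.
move=> <-; elim: x => // a x IH; rewrite /states iterS -/(states (size x)).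
by apply/allpairsP; exists (a, x); split=> //; case: a.
Qed.

Lemma tLp_min k e a c : tLp k e a c = tLp (minn k 3) e a c.
Proof. by rewrite /tLp -minnA minnn. Qed.

Lemma rowl_min k es x : rowl k es x = rowl (minn k 3) es x.
Proof. by elim: x es => //= a x IH es; rewrite IH !(tLp_min k). Qed.

(* The matrices of a puncture commute with cups, caps and crossings. *)
Lemma intertwine p k e x F : ~~ is_puncture p -> size x = ends_left p ->
  lev (loc p x) (fun o => rowt k (nseq (ends_right p) e) o F) =
  rowt k (nseq (ends_left p) e) x (fun y => lev (loc p y) F).
Proof.
move=> np sx; rewrite rowl_rowt.
under lev_ext => o _ do rewrite rowl_rowt rowl_min.
rewrite rowl_min -!lev_bind; apply: lev_check.
have : intertwine_check by vm_compute.
move=> /allP/(_ (minn k 3)); rewrite mem_iota add0n ltnS geq_minr.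
move=> /(_ isT)/allP/(_ e); rewrite (_ : e \in _); last by case: e.
move=> /(_ isT)/allP/(_ p); rewrite (_ : p \in _); last first.
  by move: np; case: (p) => [||[]|] //=; rewrite !inE eqxx ?orbT.
by move=> /(_ isT)/allP; apply; apply: states_mem.
Qed.

Lemma lopE p F s1 x s2 : size x = ends_left p ->
  lop p (size s1) F (s1 ++ x ++ s2) = lev (loc p x) (fun o => F (s1 ++ o ++ s2)).
Proof.
move=> sx; rewrite /lop take_size_cat // drop_size_cat // -sx take_size_cat //.
by rewrite -size_cat catA drop_size_cat.
Qed.

Lemma lop_ext p i F G n s : size s = n -> (i + ends_left p <= n)%N ->
  (forall t, size t = (n - ends_left p + ends_right p)%N -> F t = G t) ->
  lop p i F s = lop p i G s.
Proof.
move=> sn ip FG; apply: lev_ext => _ /mapP[t tl ->]; apply: FG.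
have := loc_size tl; rewrite size_takel ?size_drop; last by lia.
by move=> /(_ erefl) e; rewrite !size_cat e size_takel ?size_drop; lia.
Qed.

(** A word without punctures changes only the states of its own strands, so it can be run on a
    window x while s1 and s2 stay as they are. *)
Lemma Zw_run k w i v s1 x s2 m : ~~ has (fun s => is_puncture s.1) w ->
  strands (size x) w = Some m -> size s1 = i ->
  Zw k (wshift i w ++ v) (s1 ++ x ++ s2) =
  lev (run w x) (fun o => Zw k v (s1 ++ o ++ s2)).
Proof.
move=> nw sw si; elim: w x nw sw => [|[p j] w IH] x /=; first by rewrite lev_unit.
rewrite negb_or => /andP[np nw]; case: ifP => // jx sw.
rewrite (negPf np) lev_bind.
have sx : size (take (ends_left p) (drop j x)) = ends_left p.
  by rewrite size_takel // size_drop; lia.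
have {1}-> : x = take j x ++ take (ends_left p) (drop j x) ++
    drop (j + ends_left p) x.
  by rewrite addnC -drop_drop !cat_take_drop.
have -> : (i + j)%N = size (s1 ++ take j x).
  by rewrite size_cat si size_takel //; lia.
rewrite -!catA catA lopE //; apply: lev_ext => _ /mapP[t tl ->].
rewrite -IH //; first by rewrite -!catA.
rewrite !size_cat size_takel ?size_drop; last by lia.
by rewrite (loc_size tl sx) -sw; congr strands; lia.
Qed.

End StateSum.

(** * Invariance of the state sum under the moves and the skein relations *)

Definition scall (a : spoly) (l : lc) : lc :=
  [seq (mulp (constp a) t.1, t.2) | t <- l].

Definition local_check (n : nat) (l : word) (rs : seq (spoly * word)) : bool :=
  all (fun x => lccheck (run l x) (flatten [seq scall r.1 (run r.2 x) | r <- rs]))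
      (states n).

Section Moves.
Variables (K : fieldType) (h : K).
Hypothesis h0 : h != 0.
Notation torus := (torus K).
Notation pev := (pev h).
Notation Zw := (Zw h).
Notation lop := (lop h).
Notation lev := (lev h).
Notation rowt := (rowt h).
Implicit Types (F G : seq bool -> torus).

Lemma lev_scall a l F : lev (scall a l) F = (sev h a)%:K * lev l F.
Proof.
rewrite /lev big_map mulr_sumr; apply: eq_bigr => t _.
by rewrite (pev_mulp h0) -(pev_const (erefl _)) mulrA.
Qed.

Lemma lev_flatten ls F : lev (flatten ls) F = \sum_(l <- ls) lev l F.
Proof. by rewrite /lev big_flatten. Qed.

Lemma lev_sum (I : Type) (r : seq I) l (F : I -> seq bool -> torus) :
  lev l (fun o => \sum_(i <- r) F i o) = \sum_(i <- r) lev l (F i).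
Proof.
rewrite /lev exchange_big; apply: eq_bigr => t _.
by rewrite mulr_sumr.
Qed.

Lemma levZ a l F : lev l (fun o => a%:K * F o) = a%:K * lev l F.
Proof.
by rewrite -lev_comm // => t _; rewrite /GRing.comm kscalC.
Qed.

Lemma rowt_sum (I : Type) (r : seq I) k es s (F : I -> seq bool -> torus) :
  rowt k es s (fun o => \sum_(i <- r) F i o) = \sum_(i <- r) rowt k es s (F i).
Proof.
elim: r => [|i r IH].
  rewrite big_nil -[RHS](rowt0 h k es s).
  by apply: rowt_ext => t _; rewrite big_nil.
rewrite big_cons -IH -rowtD; apply: rowt_ext => t _.
by rewrite big_cons.
Qed.

Lemma rowtZ a k es s F : rowt k es s (fun o => a%:K * F o) = a%:K * rowt k es s F.
Proof. by apply: rowt_mull => e b c; rewrite /GRing.comm kscalC. Qed.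

(** Pieces placed on the left act linearly over K on what follows. A relation with scalar
    coefficients that holds to the right of some vertical line therefore holds for the whole
    diagram. *)
Lemma Zw_sub (l v : word) (rs : seq (K * word)) :
  (forall k s, strands (size s) (l ++ v) != None ->
     Zw k (l ++ v) s = \sum_(r <- rs) (r.1)%:K * Zw k (r.2 ++ v) s) ->
  forall u k s, strands (size s) (u ++ l ++ v) != None ->
    Zw k (u ++ l ++ v) s = \sum_(r <- rs) (r.1)%:K * Zw k (u ++ r.2 ++ v) s.
Proof.
move=> H; elim=> [|[p i] u IH] k s //=; first exact: H.
case: ifP => // ip ns; case pp: (is_puncture p).
  under [RHS]eq_bigr do rewrite -rowtZ.
  rewrite -rowt_sum; apply: rowt_ext => t st; apply: IH.
  by case: p pp ip ns => //= _ _; rewrite subn0 addn0 st.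
transitivity (lop p i (fun t => \sum_(r <- rs) (r.1)%:K * Zw k (u ++ r.2 ++ v) t) s).
  by apply: (lop_ext h0 (erefl (size s)) ip) => t st; apply: IH; rewrite st.
by rewrite /lop lev_sum; apply: eq_bigr => r _; rewrite levZ.
Qed.

Lemma Zw_local n i l rs v m k s :
  local_check n l rs ->
  all (fun w => ~~ has (fun s => is_puncture s.1) w && (strands n w == Some m))
      (l :: map snd rs) ->
  (i + n <= size s)%N ->
  Zw k (wshift i l ++ v) s =
  \sum_(r <- rs) (sev h r.1)%:K * Zw k (wshift i r.2 ++ v) s.
Proof.
move=> ck np ins; set x := take n (drop i s).
have sx : size x = n by rewrite size_takel // size_drop; lia.
have si : size (take i s) = i by rewrite size_takel //; lia.
have -> : s = take i s ++ x ++ drop (i + n) s.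
  by rewrite addnC -drop_drop !cat_take_drop.
move: np => /= /andP[/andP[npl /eqP sl] nr].
rewrite (Zw_run h0 _ _ _ npl _ si (m := m)) ?sx //.
move/allP: ck => /(_ x (states_mem sx)) /(lev_check h) ->.
rewrite lev_flatten big_map; apply: eq_big_seq => r rr; rewrite lev_scall.
have /allP/(_ r.2 (map_f _ rr))/andP[npr /eqP sr] := nr.
by rewrite (Zw_run h0 _ _ _ npr _ si (m := m)) ?sx.
Qed.

Lemma Zw_move_local n i l r v m k s :
  local_check n l [:: ([:: (0, 1)%Z], r)] ->
  all (fun w => ~~ has (fun s => is_puncture s.1) w && (strands n w == Some m))
      [:: l; r] ->
  (i + n <= size s)%N ->
  Zw k (wshift i l ++ v) s = Zw k (wshift i r ++ v) s.
Proof.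
move=> ck np ins; rewrite (Zw_local _ _ ck np ins) big_seq1 -sev1.
by rewrite kscal1 mul1r.
Qed.

Lemma rowt_cat3 k e1 e2 e3 s1 s2 s3 F : size e1 = size s1 -> size e2 = size s2 ->
  rowt k (e1 ++ e2 ++ e3) (s1 ++ s2 ++ s3) F =
  rowt k e1 s1 (fun t1 => rowt k e2 s2 (fun t2 => rowt k e3 s3 (fun t3 =>
    F (t1 ++ t2 ++ t3)))).
Proof.
move=> z1 z2; rewrite rowt_cat drop_size_cat //.
rewrite (@rowt_es _ _ k _ e1); last by move=> i i1; rewrite nth_cat z1 i1.
apply: rowt_ext => t1 _; rewrite rowt_cat drop_size_cat //.
by apply: rowt_es => i i2; rewrite nth_cat z2 i2.
Qed.

(** The strands of a piece lying on one side of a puncture all see the same triangular matrix, so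
    [intertwine] carries the piece across while the remaining strands keep theirs. *)
Lemma rowt_window p k e e1 e3 s1 x s3 F : ~~ is_puncture p ->
  size x = ends_left p -> size e1 = size s1 ->
  lev (loc p x) (fun o =>
    rowt k (e1 ++ nseq (ends_right p) e ++ e3) (s1 ++ o ++ s3) F) =
  rowt k (e1 ++ nseq (ends_left p) e ++ e3) (s1 ++ x ++ s3) (lop p (size s1) F).
Proof.
move=> np sx z1; rewrite rowt_cat3 ?size_nseq //.
transitivity (lev (loc p x) (fun o => rowt k e1 s1 (fun t1 =>
    rowt k (nseq (ends_right p) e) o (fun t2 => rowt k e3 s3 (fun t3 =>
      F (t1 ++ t2 ++ t3)))))).
  apply: lev_ext => _ /mapP[t tl ->].
  by rewrite rowt_cat3 // size_nseq (loc_size tl sx).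
rewrite lev_rowt; last by move=> t y; exact: loc_comm.
apply: rowt_ext => t1 st1; rewrite intertwine //.
apply: rowt_ext => y sy; rewrite lev_rowt; last by move=> t z; exact: loc_comm.
apply: rowt_ext => t3 _; rewrite -st1 lopE // sy //.
Qed.

Lemma drop_nseq (T : Type) m n (x : T) : drop m (nseq n x) = nseq (n - m) x.
Proof. by elim: m n => [|m IH] [|n] //=; rewrite IH subSS. Qed.

(** If neither piece is a puncture, their scalar coefficients act on disjoint windows. Otherwise the
    other piece lies wholly on one side of the puncture, and [rowt_window] applies. *)
Lemma Zw_far a i b j v k s :
  ~~ (is_puncture a && is_puncture b) -> (i + ends_left a <= j)%N ->
  strands (size s) ([:: (b, j); (a, i)] ++ v) != None ->
  Zw k ([:: (b, j); (a, i)] ++ v) s =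
  Zw k ([:: (a, i); (b, (j - ends_left a + ends_right a)%N)] ++ v) s.
Proof.
move=> nab ij /=; case: ifP => // jb; case: ifP => // ia _.
pose s1 := take i s; pose xa := take (ends_left a) (drop i s).
pose s2 := take (j - i - ends_left a) (drop (i + ends_left a) s).
pose xb := take (ends_left b) (drop j s); pose s3 := drop (j + ends_left b) s.
have z1 : size s1 = i by rewrite size_takel //; lia.
have za : size xa = ends_left a by rewrite size_takel // size_drop; lia.
have z2 : size s2 = (j - i - ends_left a)%N by rewrite size_takel // size_drop; lia.
have zb : size xb = ends_left b by rewrite size_takel // size_drop; lia.
have -> : s = s1 ++ xa ++ s2 ++ xb ++ s3.
  have e : drop (j - i - ends_left a) (drop (i + ends_left a) s) = drop j s.
    by rewrite drop_drop; congr drop; lia.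
  rewrite /s3 addnC -drop_drop cat_take_drop -e cat_take_drop addnC -drop_drop.
  by rewrite !cat_take_drop.
have zj : size (s1 ++ xa ++ s2) = j by rewrite !size_cat z1 z2 za; lia.
have zi o : size o = ends_right a ->
    size (s1 ++ o ++ s2) = (j - ends_left a + ends_right a)%N.
  by move=> so; rewrite !size_cat z1 z2 so; lia.
have Eb : s1 ++ xa ++ s2 ++ xb ++ s3 = (s1 ++ xa ++ s2) ++ xb ++ s3.
  by rewrite !catA.
case pa: (is_puncture a) nab => /= pb.
  have ea : xa = [::] by apply: size0nil; rewrite za; case: (a) pa.
  have [el er] : ends_left a = 0%N /\ ends_right a = 0%N by case: (a) pa.
  rewrite (negPf pb) Eb -{1}zj lopE // el er subn0 addn0.
  (* The flags above the puncture are [false] by default; writing them out exhibits the constant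
     window occupied by b. *)
  pose e1 := nseq i true ++ nseq (j - i) false.
  have es n s' : size s' = size s' -> forall F,
      rowt k (nseq i true) s' F = rowt k (e1 ++ nseq n false ++ [::]) s' F.
    move=> _ F; apply: rowt_es => q _; rewrite cats0 /e1 -catA -nseqD !nth_cat.
    rewrite size_nseq !nth_nseq; case: ifP => //; case: ifP => //.
  transitivity (lev (loc b xb) (fun o =>
      rowt k (e1 ++ nseq (ends_right b) false ++ [::])
        ((s1 ++ xa ++ s2) ++ o ++ s3) (Zw k.+1 v))).
    by apply: lev_ext => o _; rewrite -es.
  rewrite rowt_window //; last first.
    by rewrite zj size_cat !size_nseq; rewrite el in ij; lia.
  by rewrite -es // zj.
have np : ~~ is_puncture a by rewrite pa.
have E2 G s' : lop a i G (s1 ++ xa ++ s') =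
    lev (loc a xa) (fun o => G (s1 ++ o ++ s')) by rewrite -z1 lopE.
rewrite [RHS]E2; case pb': (is_puncture b) pb => pb; last first.
  rewrite Eb -{1}zj lopE // ?pb' //.
  transitivity (lev (loc b xb) (fun ob => lev (loc a xa) (fun oa =>
      Zw k v (s1 ++ oa ++ s2 ++ ob ++ s3)))).
    by apply: lev_ext => o _; rewrite -!catA E2.
  rewrite lev_exch; last by move=> t y; exact: loc_comm.
  apply: lev_ext => _ /mapP[t tl ->].
  have so := loc_size tl za.
  rewrite -(zi _ so) (_ : s1 ++ t.2 ++ s2 ++ xb ++ s3 = (s1 ++ t.2 ++ s2) ++ xb ++ s3).
    by rewrite lopE //; apply: lev_ext => o _; rewrite !catA.
  by rewrite !catA.
have ns n : (i + ends_left a <= j)%N ->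
   nseq (j - ends_left a + n) true =
   nseq i true ++ nseq n true ++ nseq (j - i - ends_left a) true.
  by move=> _; rewrite -!nseqD; congr nseq; lia.
rewrite ns // (_ : nseq j true = nseq i true ++ nseq (ends_left a) true ++
   nseq (j - i - ends_left a) true); last by rewrite -ns //; congr nseq; lia.
by rewrite rowt_window // ?size_nseq // z1.
Qed.

Lemma Zw_move l r v k s : move l r -> strands (size s) (l ++ v) != None ->
  Zw k (l ++ v) s = Zw k (r ++ v) s.
Proof.
have loc1 i l' r' n m : local_check n l' [:: ([:: (0, 1)%Z], r')] ->
    all (fun w => ~~ has (fun s => is_puncture s.1) w && (strands n w == Some m))
      [:: l'; r'] ->
    (strands (size s) (wshift i l' ++ v) != None -> (i + n <= size s)%N) ->
    strands (size s) (wshift i l' ++ v) != None ->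
    Zw k (wshift i l' ++ v) s = Zw k (wshift i r' ++ v) s.
  by move=> ck np H /H ins; apply: (Zw_move_local _ _ ck np ins).
move=> lr; case: l r / lr => [i|i|a i b j nab ij|c i|c i|c i|c i|c i].
- have := @loc1 i [:: (Cup, 0); (Cap, 1)]%N [::] 1%N 1%N.
  rewrite /wshift /= !(addn0, addn1); apply=> //.
  by case: ifP => // _; case: ifP => // ? _; lia.
- have := @loc1 i [:: (Cup, 1); (Cap, 0)]%N [::] 1%N 1%N.
  rewrite /wshift /= !(addn0, addn1); apply=> //.
  by case: ifP => // ? _; lia.
- exact: Zw_far.
- have := @loc1 i [:: (Cup, 0); (Cross c, 1)]%N [:: (Cup, 1); (Cross (~~ c), 0)]%N 1%N 3%N.
  rewrite /wshift /= !(addn0, addn1); apply=> //; first by case: c.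
  by case: ifP => // _; case: ifP => // ? _; lia.
- have := @loc1 i [:: (Cross c, 1); (Cap, 0)]%N [:: (Cross (~~ c), 0); (Cap, 1)]%N 3%N 1%N.
  rewrite /wshift /= !(addn0, addn1); apply=> //; first by case: c.
  by case: ifP => // ? _; lia.
- have := @loc1 i [:: (Cup, 1); (Cross c, 0); (Cap, 1)]%N
    [:: (Cup, 0); (Cross c, 1); (Cap, 0)]%N 1%N 1%N.
  rewrite /wshift /= !(addn0, addn1); apply=> //; first by case: c.
  by case: ifP => // ? _; lia.
- have := @loc1 i [:: (Cross c, 0); (Cross (~~ c), 0)]%N [::] 2%N 2%N.
  rewrite /wshift /= !addn0; apply=> //; first by case: c.
  by case: ifP => // ? _; lia.
- have := @loc1 i [:: (Cross c, 0); (Cross c, 1); (Cross c, 0)]%N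
    [:: (Cross c, 1); (Cross c, 0); (Cross c, 1)]%N 3%N 3%N.
  rewrite /wshift /= !(addn0, addn1); apply=> //; first by case: c.
  by case: ifP => // _; case: ifP => // ? _; lia.
Qed.

Lemma Zw_circle i v k s : (i <= size s)%N ->
  Zw k ([:: (Cup, i); (Cap, i)] ++ v) s =
  (- h ^+ 2 - (h ^+ 2)^-1)%:K * Zw k v s.
Proof.
move=> si; have := @Zw_local 0 i [:: (Cup, 0); (Cap, 0)]%N
  [:: ([:: (2, -1); (-2, -1)]%Z, [::])] v 0 k s.
rewrite /wshift /= !addn0 big_seq1 /= => -> //.
rewrite /sev !big_cons big_nil addr0 /=; congr (_%:K * _).
by rewrite /hz /zk /= !mulN1r.
Qed.

Lemma Zw_cross c i v k s : (i + 2 <= size s)%N ->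
  Zw k ([:: (Cross c, i)] ++ v) s =
  (if c then h else h^-1)%:K * Zw k v s +
  (if c then h^-1 else h)%:K * Zw k ([:: (Cap, i); (Cup, i)] ++ v) s.
Proof.
move=> si; have := @Zw_local 2 i [:: (Cross c, 0)]%N
  [:: ([:: (if c then 1%Z else (-1)%Z, 1%Z)], [::]);
      ([:: (if c then (-1)%Z else 1%Z, 1%Z)], [:: (Cap, 0); (Cup, 0)]%N)] v 2 k s.
rewrite /wshift /= !addn0 !big_cons big_nil addr0 /= => -> //; last by case: c.
by rewrite /sev !big_seq1 /= addn0; case: c; rewrite /hz /zk /= !mul1r.
Qed.
End Moves.

(** ** Superpositions of two diagrams *)

Definition crosses (n : nat) : word := rev [seq (Cross true, i) | i <- iota 0 n].

(** The exchange relation of a puncture with a crossing. The flags [[:: false; true]] do not occur,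
    as strands below a puncture precede those above it. *)
Definition exch_check : bool :=
  all (fun k => all (fun es => all (fun x =>
    lccheck (lcbind (rowl k es x) (loc (Cross true)))
            (lcbind (loc (Cross true) x) (rowl k (rev es))))
    (states 2))
    [:: [:: true; true]; [:: true; false]; [:: false; false]]) (iota 0 4).

(** Naturality of the braiding with respect to one strand: here the piece passes under it, in
    [over_check] over it. Several strands are treated one at a time. *)
Definition under_check : bool :=
  all (fun p => all (fun x =>
    lccheck (run ((p, 0)%N :: crosses (ends_right p)) x)
            (run (crosses (ends_left p) ++ [:: (p, 1)%N]) x))
    (states (ends_left p).+1)) [:: Cup; Cap; Cross true; Cross false].

Definition over_check : bool :=
  all (fun p => all (fun x =>
    lccheck (run ((p, 1)%N :: rev (crosses (ends_right p))) x)
            (run (rev (crosses (ends_left p)) ++ [:: (p, 0)%N]) x))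
    (states (ends_left p).+1)) [:: Cup; Cap; Cross true; Cross false].

Arguments loc : simpl never.

Section Stack.
Variables (K : fieldType) (h : K).
Hypothesis h0 : h != 0.
Notation torus := (torus K).
Notation pev := (pev h).
Notation Zw := (Zw h).
Notation lop := (lop h).
Notation lev := (lev h).
Notation rowt := (rowt h).
Notation tL := (tL h).

(** Pieces other than punctures have scalar coefficients and so commute with left multiplication by
    the torus; the transfer through a puncture is only linear over K, which is [klin]. *)
Definition mlin (X : Type) (Phi : (X -> torus) -> torus) :=
  forall x F G, Phi (fun y => x * F y + G y) = x * Phi F + Phi G.

Definition klin (X : Type) (Phi : (X -> torus) -> torus) :=
  forall a F G, Phi (fun y => a%:K * F y + G y) = a%:K * Phi F + Phi G.

Lemma mlin_klin X (Phi : (X -> torus) -> torus) : mlin Phi -> klin Phi.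
Proof. by move=> H a; exact: H. Qed.

Definition scal_lc (l : lc) := forall t, t \in l -> exists a, pev t.1 = a%:K.

Lemma lev_mlin l : scal_lc l -> mlin (lev l).
Proof.
move=> sl x F G; rewrite levD lev_comm // => t /sl[a ->].
by rewrite /GRing.comm kscalC.
Qed.

Lemma klin0 X (Phi : (X -> torus) -> torus) : klin Phi -> Phi (fun=> 0) = 0.
Proof.
move=> H; have := H 1 (fun=> 0) (fun=> 0).
rewrite (_ : (fun _ : X => _) = (fun=> 0)); last first.
  by apply: funext => y; rewrite mulr0 addr0.
rewrite kscal1 mul1r => /eqP; rewrite -subr_eq0 opprD addrA subrr sub0r oppr_eq0.
by move/eqP.
Qed.

Lemma lev_klin X l (Phi : (X -> torus) -> torus) (F : seq bool -> X -> torus) :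
  scal_lc l -> klin Phi ->
  lev l (fun o => Phi (F o)) = Phi (fun x => lev l (F^~ x)).
Proof.
move=> sl kP; elim: l sl => [|t l IH] sl.
  rewrite lev_nil -[LHS](klin0 kP); congr Phi.
  by apply: funext => x; rewrite lev_nil.
rewrite lev_cons IH => [|u ul]; last by apply: sl; rewrite inE ul orbT.
have [a ea] := sl t (mem_head _ _); rewrite ea -kP; congr Phi.
by apply: funext => x; rewrite lev_cons ea.
Qed.

Lemma loc_slc p x : scal_lc (loc p x).
Proof. by move=> t; exact: loc_scal. Qed.

Lemma lop_mlin p i s : mlin (fun F => lop p i F s).
Proof.
by move=> x F G; rewrite /lop (lev_mlin (@loc_slc _ _)).
Qed.

Lemma rowt_klin k es s : klin (rowt k es s).
Proof. by move=> a F G; rewrite rowtD rowtZ. Qed.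

Lemma mlin2 X (Phi : (X -> torus) -> torus) x y F G : mlin Phi ->
  Phi (fun z => x * F z + y * G z) = x * Phi F + y * Phi G.
Proof.
move=> H; rewrite H; congr (_ + _).
have := H y G (fun=> 0); rewrite (klin0 (mlin_klin H)) addr0 => <-.
by congr Phi; apply: funext => z; rewrite addr0.
Qed.

(** A strand of the lower level in state a, lying in the plane below the strands t of the upper
    level, is pulled under them until it lies above them in the plane. *)
Fixpoint slide (a : bool) (t : seq bool) (G : seq bool -> bool -> torus) : torus :=
  if t is b :: t' then
    lev (loc (Cross true) [:: a; b])
      (fun o => slide (nth false o 1) t' (fun t'' => G (nth false o 0 :: t'')))
  else G [::] a.

(* The braid bringing all upper strands below (in the plane) all lower ones. *)
Fixpoint sepa (l s : seq bool) (G : seq bool -> seq bool -> torus) : torus :=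
  match l, s with
  | e :: l', a :: s' =>
      if e then sepa l' s' (fun t => G (a :: t))
      else sepa l' s' (fun t u => slide a t (fun t' a' => G t' (a' :: u)))
  | _, _ => G [::] [::]
  end.

Lemma slide_ext a t G G' :
  (forall t' a', size t' = size t -> G t' a' = G' t' a') ->
  slide a t G = slide a t G'.
Proof.
elim: t a G G' => [|b t IH] a G G' GG /=; first exact: GG.
by apply: lev_ext => o _; apply: IH => t' a' st; apply: GG; rewrite /= st.
Qed.

Lemma slide_mlin a t :
  mlin (fun G : seq bool * bool -> torus => slide a t (fun t' a' => G (t', a'))).
Proof.
elim: t a => [|b t IH] a x F G //=.
rewrite -(lev_mlin (@loc_slc (Cross true) [:: a; b])).
apply: lev_ext => o _; exact: (IH (nth false o 1) x
  (fun y => F (nth false o 0 :: y.1, y.2)) (fun y => G (nth false o 0 :: y.1, y.2))).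
Qed.

Lemma sepa_ext l s G G' : size l = size s ->
  (forall t u, size t = count_mem true l -> size u = count_mem false l ->
     G t u = G' t u) ->
  sepa l s G = sepa l s G'.
Proof.
elim: l s G G' => [|e l IH] [|a s] G G' //= => [_ H|[z] H]; first exact: H.
case: e H => H; apply: IH => // t u st su; first by apply: H; rewrite //= st.
apply: slide_ext => t' a' st'; apply: H; first by rewrite st' st.
by rewrite /= su.
Qed.

Lemma sepa_mlin l s :
  mlin (fun G : seq bool * seq bool -> torus => sepa l s (fun t u => G (t, u))).
Proof.
elim: l s => [|e l IH] [|a s] x F G //=; case: e.
  exact: (IH s x (fun y => F (a :: y.1, y.2)) (fun y => G (a :: y.1, y.2))).
rewrite -(IH s x (fun y => slide a y.1 (fun t' a' => F (t', a' :: y.2)))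
  (fun y => slide a y.1 (fun t' a' => G (t', a' :: y.2)))) /=.
congr (sepa l s); apply: funext => t; apply: funext => u.
by rewrite -(@slide_mlin a t x (fun y => F (y.1, y.2 :: u))
  (fun y => G (y.1, y.2 :: u))).
Qed.

Lemma slide2 a t x y F G :
  slide a t (fun t' a' => x * F t' a' + y * G t' a') =
  x * slide a t F + y * slide a t G.
Proof.
exact: (mlin2 x y (fun z => F z.1 z.2) (fun z => G z.1 z.2) (@slide_mlin a t)).
Qed.

Lemma sepa2 l s x y F G :
  sepa l s (fun t u => x * F t u + y * G t u) =
  x * sepa l s F + y * sepa l s G.
Proof.
exact: (mlin2 x y (fun z => F z.1 z.2) (fun z => G z.1 z.2) (@sepa_mlin l s)).
Qed.

Lemma lev_slide l a t F : scal_lc l ->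
  lev l (fun o => slide a t (F o)) = slide a t (fun t' a' => lev l (fun o => F o t' a')).
Proof.
move=> sl; exact: (lev_klin (fun o y => F o y.1 y.2) sl (mlin_klin (@slide_mlin a t))).
Qed.

Lemma lev_sepa l l' s F : scal_lc l ->
  lev l (fun o => sepa l' s (F o)) = sepa l' s (fun t u => lev l (fun o => F o t u)).
Proof.
move=> sl; exact: (lev_klin (fun o y => F o y.1 y.2) sl (mlin_klin (@sepa_mlin l' s))).
Qed.

Lemma slide_klin X a t (Phi : (X -> torus) -> torus)
    (F : seq bool -> bool -> X -> torus) : klin Phi ->
  slide a t (fun t' a' => Phi (F t' a')) = Phi (fun x => slide a t (fun t' a' => F t' a' x)).
Proof.
move=> kP; elim: t a F => [|b t IH] a F //=.
transitivity (lev (loc (Cross true) [:: a; b]) (fun o => Phi (fun x =>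
  slide (nth false o 1) t (fun t' a' => F (nth false o 0 :: t') a' x)))).
  by apply: lev_ext => o _; rewrite IH.
exact: (lev_klin (fun o x => slide (nth false o 1) t
  (fun t' a' => F (nth false o 0 :: t') a' x)) (@loc_slc _ _) kP).
Qed.

Lemma lop_peel p i F a s : (i + ends_left p <= size s)%N ->
  lop p i.+1 F (a :: s) = lop p i (fun r => F (a :: r)) s.
Proof. by []. Qed.

Lemma lop0E p F x s : size x = ends_left p ->
  lop p 0 F (x ++ s) = lev (loc p x) (fun o => F (o ++ s)).
Proof. by move=> sx; exact: (@lopE _ _ p F [::] x s sx). Qed.

(** *** Crossings between the two levels *)

Lemma sepa_ft l a b s G : sepa [:: false, true & l] [:: a, b & s] G =
  lev (loc (Cross true) [:: a; b])
    (fun o => sepa [:: true, false & l] [:: nth false o 0, nth false o 1 & s] G).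
Proof.
symmetry; exact: (lev_sepa l s (fun o t u => slide (nth false o 1) t
  (fun t' a' => G (nth false o 0 :: t') (a' :: u))) (@loc_slc _ _)).
Qed.

Lemma nth01 (o : seq bool) : size o = 2%N -> [:: nth false o 0; nth false o 1] = o.
Proof. by case: o => [|? [|? []]]. Qed.

(** The crossing is one of those of the separating braid and is absorbed by it. *)
Lemma sepa_cross_down l1 l2 s G : (size l1 + 2 <= size s)%N ->
  lop (Cross true) (size l1) (fun r => sepa (l1 ++ [:: true; false] ++ l2) r G) s =
  sepa (l1 ++ [:: false; true] ++ l2) s G.
Proof.
elim: l1 s G => [|e l1 IH] s G.
  case: s => [|a [|b s]] // _; rewrite (@lop0E (Cross true) _ [:: a; b]) // sepa_ft.
  apply: lev_ext => _ /mapP[t /loc_size/(_ erefl) z ->].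
  by rewrite -{1}(nth01 z).
case: s => [|a s] //; rewrite /= addSn ltnS => sz; rewrite lop_peel //.
by case: e => /=; rewrite -IH.
Qed.

(** Here the crossing cancels against one of the separating braid, by the second Reidemeister
    move. *)
Lemma sepa_cross_up l1 l2 s G : (size l1 + 2 <= size s)%N ->
  lop (Cross false) (size l1) (fun r => sepa (l1 ++ [:: false; true] ++ l2) r G) s =
  sepa (l1 ++ [:: true; false] ++ l2) s G.
Proof.
elim: l1 s G => [|e l1 IH] s G.
  case: s => [|a [|b s]] // _; rewrite (@lop0E (Cross false) _ [:: a; b]) //.
  transitivity (lev (loc (Cross false) [:: a; b]) (fun o =>
    lev (loc (Cross true) o) (fun o => sepa [:: true, false & l2]
      [:: nth false o 0, nth false o 1 & s] G))).
    apply: lev_ext => _ /mapP[t /loc_size/(_ erefl) z ->].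
    by rewrite -{1 2}(nth01 z) sepa_ft.
  rewrite -lev_bind // (@lev_check _ h _ [:: (tone, [:: a; b])]) ?lev_unit //.
  by case: a; case: b; vm_compute.
case: s => [|a s] //; rewrite /= addSn ltnS => sz; rewrite lop_peel //.
by case: e => /=; rewrite -IH.
Qed.

(** *** Pieces at one of the two levels *)

(** The same crossings as iterating [slide] over x, but grouped by the strands of t: in this order a
    piece applied to x can be moved past one strand of t at a time. *)
Fixpoint slidew (x t : seq bool) (G : seq bool -> seq bool -> torus) : torus :=
  if t is b :: t' then
    lev (run (crosses (size x)) (rcons x b)) (fun o =>
      slidew (behead o) t' (fun t'' => G (head false o :: t'')))
  else G [::] x.

Lemma run_cat w1 w2 x F :
  lev (run (w1 ++ w2) x) F = lev (run w1 x) (fun o => lev (run w2 o) F).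
Proof.
elim: w1 x => [|[p i] w1 IH] x /=; first by rewrite lev_unit.
by rewrite !lev_bind //; apply: lev_ext => o _; rewrite IH.
Qed.

Lemma run_size w x m : ~~ has (fun s => is_puncture s.1) w ->
  strands (size x) w = Some m -> {in map snd (run w x), forall o, size o = m}.
Proof.
elim: w x => [|[p i] w IH] x /=.
  by move=> _ [<-] o; rewrite inE => /eqP->.
rewrite negb_or => /andP[np nw]; case: ifP => // ix sw o.
move=> /mapP[t /flattenP[_ /mapP[u ul ->]] /mapP[v vl ->] ->] /=.
apply: (IH _ nw) (map_f snd vl).
have := loc_size ul; rewrite size_takel ?size_drop; last by lia.
move=> /(_ erefl) z; rewrite !size_cat z size_takel ?size_drop; last by lia.
by rewrite -sw; congr strands; lia.
Qed.

Lemma crosses_np n : ~~ has (fun s => is_puncture s.1) (crosses n).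
Proof. by rewrite /crosses has_rev has_map; apply/hasPn. Qed.

Lemma crosses_strands n m : (n <= m)%N -> strands m.+1 (crosses n) = Some m.+1.
Proof.
rewrite /crosses; elim: n => // n IH nm.
rewrite -[n.+1]addn1 iotaD map_cat rev_cat /= add0n ifT; last by lia.
by rewrite (_ : m.+1 - 2 + 2 = m.+1)%N ?IH //; lia.
Qed.

Lemma under_natural p x t G : ~~ is_puncture p -> size x = ends_left p ->
  lev (loc p x) (fun o => slidew o t G) =
  slidew x t (fun t' x' => lev (loc p x') (G t')).
Proof.
move=> np; elim: t x G => [|b t IH] x G sx //=.
pose F r := slidew (behead r) t (fun t'' => G (head false r :: t'')).
transitivity (lev (run ((p, 0)%N :: crosses (ends_right p)) (rcons x b)) F).
  rewrite /= lev_bind // -cats1 drop0 take0 add0n take_size_cat // drop_size_cat //.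
  apply: lev_ext => _ /mapP[u /loc_size/(_ sx) z ->].
  by rewrite z cats1.
rewrite (@lev_check _ h _ (run (crosses (size x) ++ [:: (p, 1)%N]) (rcons x b))); last first.
  have : under_check by vm_compute.
  move=> /allP/(_ p); rewrite (_ : p \in _); last first.
    by move: np; case: (p) => [||[]|] //=; rewrite !inE eqxx ?orbT.
  by rewrite sx => /(_ isT)/allP; apply; apply: states_mem; rewrite size_rcons sx.
rewrite run_cat; apply: lev_ext => r rr.
have : size r = (ends_left p).+1.
  apply: run_size rr; first exact: crosses_np.
  by rewrite size_rcons sx crosses_strands.
case: r {rr} => [|c r] //= [sr]; rewrite lev_bind // drop0 take_oversize ?sr //.
rewrite -IH //; apply: lev_ext => o _.
by rewrite lev_unit /F /= take0 drop_oversize ?cats0 // sr.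
Qed.

Lemma slidew_ext x t G G' :
  (forall t' x', size t' = size t -> size x' = size x -> G t' x' = G' t' x') ->
  slidew x t G = slidew x t G'.
Proof.
elim: t x G G' => [|b t IH] x G G' GG /=; first exact: GG.
apply: lev_ext => o oo; apply: IH => t' x' st sx; apply: GG; rewrite /= ?st //.
rewrite sx size_behead (run_size _ _ oo (m := (size x).+1)) //.
  exact: crosses_np.
by rewrite size_rcons crosses_strands.
Qed.

Lemma slidew2 a b t G : slidew [:: a; b] t G =
  slide b t (fun t1 b' => slide a t1 (fun t' a' => G t' [:: a'; b'])).
Proof.
elim: t a b G => [|c t IH] a b G //=.
rewrite !lev_bind //=; apply: lev_ext => _ /mapP[u /loc_size/(_ erefl) z ->].
case: u.2 z => [|c' [|b' []]] //= _; rewrite lev_bind //=.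
rewrite -lev_slide; last exact: loc_slc.
apply: lev_ext => _ /mapP[v /loc_size/(_ erefl) z ->].
case: v.2 z => [|c'' [|a' []]] //= _.
by rewrite lev_unit /= IH.
Qed.

Lemma sepa_nseqF n l o s G : size o = n -> (n == 0) || (n == 2) ->
  sepa (nseq n false ++ l) (o ++ s) G =
  sepa l s (fun t u => slidew o t (fun t' o' => G t' (o' ++ u))).
Proof.
move=> zo /orP[]/eqP n0; move: zo; rewrite n0.
  move=> /size0nil-> /=; congr sepa; apply: funext => t; apply: funext => u.
  elim: t G => //= b t IH G; rewrite lev_unit //=.
  by rewrite -(IH (fun t => G (b :: t))).
case: o => [|a [|b []]] // _; rewrite [LHS]/=; congr sepa.
by apply: funext => t; apply: funext => u; rewrite slidew2.
Qed.

Lemma ends02 p : ((ends_left p == 0) || (ends_left p == 2)) *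
  ((ends_right p == 0) || (ends_right p == 2)).
Proof. by case: p. Qed.

Lemma sepa_lower p l1 l2 s G : ~~ is_puncture p ->
  size s = size (l1 ++ nseq (ends_left p) false ++ l2) ->
  lop p (size l1) (fun r => sepa (l1 ++ nseq (ends_right p) false ++ l2) r G) s =
  sepa (l1 ++ nseq (ends_left p) false ++ l2) s
    (fun t u => lop p (count_mem false l1) (G t) u).
Proof.
move=> np; elim: l1 s G => [|e l1 IH] s G /=.
  rewrite size_cat size_nseq => zs.
  rewrite -(cat_take_drop (ends_left p) s).
  set x := take _ _; set s2 := drop _ _.
  have zx : size x = ends_left p by rewrite size_takel //; lia.
  have z2 : size l2 = size s2 by rewrite size_drop zs addKn.
  rewrite lop0E // sepa_nseqF //; last by rewrite ends02.
  transitivity (lev (loc p x) (fun o => sepa l2 s2 (fun t u =>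
      slidew o t (fun t' o' => G t' (o' ++ u))))).
    apply: lev_ext => _ /mapP[v /loc_size/(_ zx) z ->].
    by rewrite sepa_nseqF // ends02.
  rewrite lev_sepa; last exact: loc_slc.
  apply: sepa_ext => [|t u _ _] //.
  by rewrite under_natural //; apply: slidew_ext => t' o' _ so; rewrite lop0E // so.
case: s => [|a s] //= [zs]; rewrite lop_peel; last by rewrite zs !size_cat size_nseq; lia.
case: e => /=; first by rewrite IH.
rewrite IH //; apply: sepa_ext => // t u _ _.
symmetry; exact: (slide_klin a t (fun t' a' u' => G t' (a' :: u')) (mlin_klin (@lop_mlin p _ u))).
Qed.

Lemma slide_run a y t H : (size y == 0)%N || (size y == 2)%N ->
  slide a (y ++ t) H = lev (run (rev (crosses (size y))) (a :: y))
    (fun r => slide (last false r) t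
      (fun t' => H (belast (head false r) (behead r) ++ t'))).
Proof.
move=> /orP[/eqP/size0nil->|]; first by rewrite lev_unit.
case: y => [|b [|c []]] //= _.
rewrite lev_bind //; apply: lev_ext => _ /mapP[u /loc_size/(_ erefl) z ->].
case: u.2 z => [|b' [|a' []]] //= _.
rewrite lev_bind //; apply: lev_ext => _ /mapP[v /loc_size/(_ erefl) z ->].
by case: v.2 z => [|c' [|a'' []]] //= _; rewrite lev_unit.
Qed.

Lemma over_natural p a x t G : ~~ is_puncture p -> size x = ends_left p ->
  lev (loc p x) (fun o => slide a (o ++ t) G) =
  slide a (x ++ t) (fun t' a' => lop p 0 (G^~ a') t').
Proof.
move=> np sx; rewrite slide_run sx ?ends02 //.
pose F r := slide (last false r) t (fun t' => G (belast (head false r) (behead r) ++ t')).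
transitivity (lev (run ((p, 1)%N :: rev (crosses (ends_right p))) (a :: x)) F).
  rewrite /= lev_bind // drop0 take_oversize ?sx //.
  apply: lev_ext => _ /mapP[u /loc_size/(_ sx) z ->].
  rewrite slide_run z ?ends02 // take0 drop_oversize ?cats0 //= sx; lia.
rewrite (@lev_check _ h _ (run (rev (crosses (ends_left p)) ++ [:: (p, 0)%N]) (a :: x))); last first.
  have : over_check by vm_compute.
  move=> /allP/(_ p); rewrite (_ : p \in _); last first.
    by move: np; case: (p) => [||[]|] //=; rewrite !inE eqxx ?orbT.
  by move=> /(_ isT)/allP; apply; apply: states_mem; rewrite /= sx.
rewrite run_cat; apply: lev_ext => r rr.
have : size r = (ends_left p).+1.
  apply: run_size rr; first by rewrite has_rev; exact: crosses_np.
  by rewrite /= sx; case: (ends02 p) => /orP[]/eqP-> _.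
case/lastP: r {rr} => // r c; rewrite size_rcons => -[sr].
rewrite last_rcons lev_bind //= drop0 take0 add0n.
rewrite -cats1 take_size_cat // drop_size_cat //.
transitivity (lev (loc p r) (fun o => slide c t (fun t' => G (o ++ t')))).
  by apply: lev_ext => o _; rewrite lev_unit cat0s /F last_cat; case: o => //= d o; rewrite cats1 belast_rcons.
rewrite lev_slide; last exact: loc_slc.
apply: slide_ext => t' a' _; rewrite (_ : belast _ _ = r) ?lop0E //.
by case: (r) => //= d r'; rewrite cats1 belast_rcons.
Qed.

Lemma slide_lop p c a t H : ~~ is_puncture p -> (c + ends_left p <= size t)%N ->
  lop p c (fun r => slide a r H) t =
  slide a t (fun t' a' => lop p c (H^~ a') t').
Proof.
move=> np; elim: c a t H => [|c IH] a t H zc.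
  rewrite -(cat_take_drop (ends_left p) t) lop0E ?over_natural //;
    by rewrite size_takel.
case: t zc => [|b t] //; rewrite addSn ltnS => zc; rewrite lop_peel //=.
transitivity (lev (loc (Cross true) [:: a; b]) (fun o => lop p c (fun r =>
    slide (nth false o 1) r (fun t' a' => H (nth false o 0 :: t') a')) t)).
  symmetry; exact: (lev_klin _ (@loc_slc _ _) (mlin_klin (@lop_mlin p c t))).
by apply: lev_ext => o _; rewrite IH.
Qed.

Lemma sepa_upper p l1 l2 s G : ~~ is_puncture p ->
  size s = size (l1 ++ nseq (ends_left p) true ++ l2) ->
  lop p (size l1) (fun r => sepa (l1 ++ nseq (ends_right p) true ++ l2) r G) s =
  sepa (l1 ++ nseq (ends_left p) true ++ l2) s
    (fun t u => lop p (count_mem true l1) (G^~ u) t).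
Proof.
have sepaT n l o s' G' : size o = n ->
    sepa (nseq n true ++ l) (o ++ s') G' = sepa l s' (fun t => G' (o ++ t)).
  by move=> <-; elim: o G' => //= a o IH G'; rewrite IH.
move=> np; elim: l1 s G => [|e l1 IH] s G /=.
  rewrite size_cat size_nseq => zs.
  rewrite -(cat_take_drop (ends_left p) s).
  set x := take _ _; set s2 := drop _ _.
  have zx : size x = ends_left p by rewrite size_takel //; lia.
  have z2 : size l2 = size s2 by rewrite size_drop zs addKn.
  rewrite lop0E // sepaT //.
  transitivity (lev (loc p x) (fun o => sepa l2 s2 (fun t u => G (o ++ t) u))).
    by apply: lev_ext => _ /mapP[v /loc_size/(_ zx) z ->]; rewrite sepaT.
  rewrite lev_sepa; last exact: loc_slc.
  by apply: sepa_ext => // t u _ _; rewrite lop0E.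
case: s => [|a s] //= [zs]; rewrite lop_peel; last by rewrite zs !size_cat size_nseq; lia.
case: e => /=; first by rewrite IH.
rewrite IH //; apply: sepa_ext => // t u zt _.
have zc : (count_mem true l1 + ends_left p <= size t)%N.
  by rewrite zt !count_cat count_nseq /= mul1n; lia.
exact: slide_lop.
Qed.

(** *** Punctures *)

Lemma exch_row k e0 e1 a b F : e1 ==> e0 ->
  rowt k [:: e0; e1] [:: a; b] (fun y => lev (loc (Cross true) y) F) =
  lev (loc (Cross true) [:: a; b]) (fun o => rowt k [:: e1; e0] o F).
Proof.
move=> e01; rewrite (rowl_rowt h0) rowl_min.
under [RHS]lev_ext => o _ do rewrite (rowl_rowt h0) rowl_min.
rewrite -!lev_bind //; apply: lev_check.
have : exch_check by vm_compute.
move=> /allP/(_ (minn k 3)); rewrite mem_iota add0n ltnS geq_minr.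
move=> /(_ isT)/allP/(_ [:: e0; e1]); rewrite (_ : _ \in _); last by case: e0 e1 e01 => [] [].
by move=> /(_ isT)/allP; apply; apply: states_mem.
Qed.

(** The exchange relation, one crossing after the other. The sliding strand starts below the strands
    t, so if it is above the puncture they all are; this is the condition on the flags. *)
Lemma slide_row k e0 es a t H : e0 || all (pred1 false) es ->
  tL k e0 a false * rowt k es t (fun t' => slide false t' H) +
  tL k e0 a true * rowt k es t (fun t' => slide true t' H) =
  slide a t (fun t' a' => rowt k es t' (fun t'' =>
    tL k e0 a' false * H t'' false + tL k e0 a' true * H t'' true)).
Proof.
elim: t es a H => [|b t IH] es a H ees //=.
pose e1 := head false es.
have e10 : e1 ==> e0.
  by move: ees; rewrite /e1; case: (e0) => //=; case: (es) => [|[] ?].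
have ees' : e0 || all (pred1 false) (behead es).
  by move: ees; case: (e0) => //=; case: (es) => // ? ? /andP[].
pose Phi y := rowt k (behead es) t (fun t' =>
  slide (nth false y 1) t' (fun t'' => H (nth false y 0 :: t''))).
have EL c : rowt k es (b :: t) (fun t' => slide c t' H) =
   tL k e1 b false * lev (loc (Cross true) [:: c; false]) Phi +
   tL k e1 b true * lev (loc (Cross true) [:: c; true]) Phi.
  by rewrite /=; congr (_ * _ + _ * _); symmetry; apply: lev_rowt => u y; exact: loc_comm.
transitivity (rowt k [:: e0; e1] [:: a; b] (fun y => lev (loc (Cross true) y) Phi)).
  by move: (EL false) (EL true) => /= -> ->.
rewrite exch_row //; apply: lev_ext => _ /mapP[u /loc_size/(_ erefl) z ->].
case: u.2 z => [|b' [|a' []]] //= _.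
rewrite /Phi /= -/e1.
by rewrite !IH // -slide2.
Qed.

Lemma rowt_sepa k es l s G : size l = size s -> size es = size s ->
  sorted (fun e e' => e' ==> e) es ->
  rowt k es s (fun r => sepa l r G) =
  sepa l s (fun t u => rowt k (mask l es) t (fun t' =>
    rowt k (mask (map negb l) es) u (G t'))).
Proof.
elim: l s es G => [|e l IH] [|a s] [|f es] G //= [zl] [ze] so.
have so' : sorted (fun e e' => e' ==> e) es by exact: path_sorted so.
case: e => /=; first by rewrite !IH // -sepa2.
rewrite !IH // -sepa2; apply: sepa_ext => // t u _ _.
have E c : rowt k (mask l es) t (fun t' => rowt k (mask (map negb l) es) u (fun u' =>
      slide c t' (fun t'' c' => G t'' (c' :: u')))) =
    rowt k (mask l es) t (fun t' => slide c t' (fun t'' c' =>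
      rowt k (mask (map negb l) es) u (fun u' => G t'' (c' :: u')))).
  apply: rowt_ext => t' _; symmetry.
  exact: (slide_klin c t' (fun t'' c' u' => G t'' (c' :: u')) (@rowt_klin k _ u)).
rewrite !E slide_row //; case: (f) so => //= so; apply/allP => x /mem_mask xes.
have := order_path_min _ so; rewrite /= => /(_ _)/allP/(_ _ xes); case: x {xes} => //.
by apply; move=> [] [] [].
Qed.

(** *** The state sum of a superposition *)

Definition comm_check : bool :=
  all (fun k => all (fun j => all (fun e => all (fun e' => all (fun x => all (fun y =>
    addp (mulp (tLp j e (nth false x 0) (nth false x 1))
               (tLp k e' (nth false y 0) (nth false y 1)))
         (negp (mulp (tLp k e' (nth false y 0) (nth false y 1))
                     (tLp j e (nth false x 0) (nth false x 1)))) == [::])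
    (states 2)) (states 2)) [:: true; false]) [:: true; false]) (iota 0 k)) (iota 0 4).

(** Distinct blocks commute. The bound by 4 guards against the truncation in [tLp], which would let
    two punctures share a block. *)
Lemma tL_comm j k e e' a c a' c' : (j < k < 4)%N ->
  GRing.comm (tL j e a c) (tL k e' a' c').
Proof.
move=> jk; apply: (pev_eq (h := h) (pevM h0 (erefl _) (erefl _)) (pevM h0 (erefl _) (erefl _))).
have : comm_check by vm_compute.
move=> /allP/(_ k); rewrite mem_iota add0n (_ : (_ <= _ < _)%N); last lia.
move=> /(_ isT)/allP/(_ j); rewrite mem_iota add0n (_ : (_ <= _ < _)%N); last lia.
move=> /(_ isT)/allP/(_ e); rewrite (_ : e \in _); last by case: (e).
move=> /(_ isT)/allP/(_ e'); rewrite (_ : e' \in _); last by case: (e').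
move=> /(_ isT)/allP/(_ [:: a; c]); rewrite states_mem //.
move=> /(_ isT)/allP/(_ [:: a'; c']); rewrite states_mem //.
by move=> /(_ isT)/eqP.
Qed.

Lemma Zw_comm j k w s e a c : (j < k)%N ->
  (k + count (fun s => is_puncture s.1) w <= 4)%N ->
  GRing.comm (tL j e a c) (Zw k w s).
Proof.
elim: w k s => [|[p i] w IH] k s jk kw /=.
  by case: s => *; rewrite /GRing.comm ?mulr1 ?mul1r ?mulr0 ?mul0r.
move: kw => /=; case: ifP => pp kw.
    have HF : forall t, GRing.comm (tL j e a c) (Zw k.+1 w t).
    by move=> t; apply: IH; lia.
  elim: s (nseq _ _) (Zw k.+1 w) HF => [|b s IHs] es F HF /=; first exact: HF.
  have c1 x : GRing.comm (tL j e a c) (tL k (head false es) b x).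
    by apply: tL_comm; lia.
  by apply: commrD; apply: commrM => //; apply: IHs => t; exact: HF.
rewrite /GRing.comm /lop lev_comm => [|t /loc_comm //].
rewrite [in RHS]/lev mulr_suml; apply: eq_big_seq => t tl.
by rewrite -mulrA IH.
Qed.

Lemma stack_count l x y w : stack l x y w ->
  let punctures := count (fun s : piece * nat => is_puncture s.1) in
  punctures x = punctures w /\ punctures y = punctures w.
Proof.
by elim=> //= {l x y w}; first [move=> h1 h2 p x y w /negPf-> _ [-> ->] |
  move=> h1 h2 x y w _ [-> ->]].
Qed.

(** Each constructor of [stack] lets one piece through the separating braid. At a puncture the
    transfer splits into that of the upper strands followed by that of the lower ones; the entries
    of the latter then move past the remaining state sum of y, which involves later blocks only. The
    upper diagram contributes the left factor, whence the opposite product. *)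
Lemma Zw_stack l x y w : stack l x y w -> forall k s, size s = size l ->
  (k + count (fun s => is_puncture s.1) w <= 4)%N ->
  Zw k w s = sepa l s (fun t u => Zw k y t * Zw k x u).
Proof.
elim=> {l x y w}.
- by move=> k [|//] _ _ /=; rewrite mulr1.
- move=> h1 h2 p x y w np _ IH k s zs /=; rewrite (negPf np) add0n => kw.
  transitivity (lop p (size h1) (fun r => sepa (h1 ++ nseq (ends_right p) false ++ h2) r
    (fun t u => Zw k y t * Zw k x u)) s).
    apply: (lop_ext h0 (erefl (size s))) => [|t zt].
      by rewrite zs !size_cat size_nseq; lia.
    by apply: IH => //; rewrite zt zs !size_cat !size_nseq; lia.
  rewrite sepa_lower //; apply: sepa_ext => // t u _ _.
  by rewrite /lop -lev_comm // => v /loc_comm.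
- move=> h1 h2 p x y w np _ IH k s zs /=; rewrite (negPf np) add0n => kw.
  transitivity (lop p (size h1) (fun r => sepa (h1 ++ nseq (ends_right p) true ++ h2) r
    (fun t u => Zw k y t * Zw k x u)) s).
    apply: (lop_ext h0 (erefl (size s))) => [|t zt].
      by rewrite zs !size_cat size_nseq; lia.
    by apply: IH => //; rewrite zt zs !size_cat !size_nseq; lia.
  rewrite sepa_upper //; apply: sepa_ext => // t u _ _.
  rewrite /lop /lev mulr_suml.
  by apply: eq_bigr => v _; rewrite mulrA.
- move=> h1 h2 x y w _ IH k s zs /=; rewrite add0n => kw.
  rewrite -sepa_cross_down; last by rewrite zs size_cat /=; lia.
  apply: (lop_ext h0 (erefl (size s))) => [|t zt].
    by rewrite zs !size_cat /=; lia.
  by apply: IH => //; rewrite zt zs !size_cat /=; lia.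
- move=> h1 h2 x y w _ IH k s zs /=; rewrite add0n => kw.
  rewrite -sepa_cross_up; last by rewrite zs size_cat /=; lia.
  apply: (lop_ext h0 (erefl (size s))) => [|t zt].
    by rewrite zs !size_cat /=; lia.
  by apply: IH => //; rewrite zt zs !size_cat /=; lia.
- move=> h1 h2 x y w st IH k s zs /= kw.
  pose es := nseq (size h1) true ++ nseq (size h2) false.
  rewrite (@rowt_es _ _ k _ es); last first.
    move=> i; rewrite nth_cat !nth_nseq size_nseq; case: ifP => // _.
    by rewrite ?if_same.
  rewrite [LHS](_ : _ = rowt k es s (fun r => sepa (h1 ++ h2) r
      (fun t u => Zw k.+1 y t * Zw k.+1 x u))); last first.
    apply: rowt_ext => t zt; apply: IH; first by rewrite zt.
    by move: kw; rewrite add1n addnS.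
  rewrite rowt_sepa //; last 2 first.
  + by rewrite zs !size_cat !size_nseq.
  + rewrite /es; elim: (size h1) => [|n IHn] /=.
      by elim: (size h2) => [|[|n] IHn] //=.
    by case: n IHn => [|n] //=; case: (size h2).
  have mE m n c : size m = n -> mask m (nseq n c) = nseq (count_mem true m) c.
    by move=> <-; elim: m => //= -[] m ->.
  have nE (m : seq bool) : count_mem true (map negb m) = count_mem false m.
    by rewrite count_map; apply: eq_count => -[].
  have esE m1 m2 t F : size m1 = size h1 -> size m2 = size h2 ->
      rowt k (mask (m1 ++ m2) es) t F = rowt k (nseq (count_mem true m1) true) t F.
    move=> z1 z2; rewrite mask_cat ?size_nseq // !mE //; apply: rowt_es => i _.
    by rewrite nth_cat !nth_nseq size_nseq; do 2!case: ifP => //.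
  apply: sepa_ext => // t u _ _; rewrite -rowt_mulr esE //.
  apply: rowt_ext => t' _; rewrite map_cat esE ?size_map // nE.
  apply: rowt_mull => e a c; apply: commr_sym; apply: Zw_comm => //.
  by have [_ ->] := stack_count st; rewrite addSnnS.
Qed.
End Stack.

(** * The skein algebra *)

HB.instance Definition _ (K : fieldType) (A : kalgType K) :=
  PzRing_isKAlgebra.Build K A^c
    (kscal1 (s := A)) (kscalD (s := A))
    (fun a b => etrans (kscalM a b) (kscalC a b%:K : _ = _ :> A))
    (fun a (x : A) => esym (kscalC a x)).

Definition kop (K : fieldType) (A : kalgType K) : kalgType K := A^c.

Lemma kopZ (K : fieldType) (A : kalgType K) a (x : A) :
  a%:K * x = (a%:K : kop A) * (x : kop A).
Proof. exact: kscalC. Qed.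

Definition npunct (w : word) : nat := count (fun s => is_puncture s.1) w.

Lemma npunct_cat u v : npunct (u ++ v) = (npunct u + npunct v)%N.
Proof. exact: count_cat. Qed.

Lemma strands_cat n u v :
  strands n (u ++ v) = if strands n u is Some m then strands m v else None.
Proof. by elim: u n => //= -[p i] u IH n; case: ifP. Qed.

Lemma move_strands l r n m : move l r -> strands n l = Some m -> strands n r = Some m.
Proof.
move=> lr; case: l r / lr => [i|i|a i b j nab ij|c i|c i|c i|c i|c i] /=;
  do ?[case: ifP => // ?] => -[<-]; first [congr Some; lia | exfalso; lia].
Qed.

Lemma move_npunct l r : move l r -> npunct l = npunct r.
Proof.
by case=> [i|i|a i b j nab ij|c i|c i|c i|c i|c i] //=; rewrite /npunct /= addnCA.
Qed.

Lemma is_diagram_sub u l r v : is_diagram (u ++ l ++ v) ->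
  npunct l = npunct r ->
  (forall n m, strands n l = Some m -> strands n r = Some m) ->
  is_diagram (u ++ r ++ v).
Proof.
rewrite /is_diagram -!/(npunct _) !npunct_cat => /andP[/eqP + /eqP<-] -> H.
rewrite eqxx andbT !strands_cat; case: (strands 0 u) => // n.
by rewrite !strands_cat; case e: (strands n l) => [m|//]; rewrite (H _ _ e) => ->.
Qed.

Section Skein.
Variables (K : fieldType) (h : K).
Hypothesis h0 : h != 0.
Notation torus := (torus K).
Notation Sk := (Sk h).
Notation q := (h ^+ 2).

(** The class of a word, with the value 0 off the diagrams, so that words can be rewritten without
    carrying proofs. *)
Definition skw (w : word) : Sk :=
  if insub w is Some D then pgen (skein_rel h) D else 0.

Lemma skwE (D : diagram) : skw (val D) = pgen (skein_rel h) D.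
Proof. by rewrite /skw valK. Qed.

Lemma skw_move u l r v : move l r -> is_diagram (u ++ l ++ v) ->
  skw (u ++ l ++ v) = skw (u ++ r ++ v).
Proof.
move=> lr dl.
have dr : is_diagram (u ++ r ++ v).
  apply: is_diagram_sub dl (move_npunct lr) _ => n m; exact: move_strands.
pose D : diagram := exist (fun w => is_diagram w) _ dl; pose D' : diagram := exist (fun w => is_diagram w) _ dr.
rewrite -[LHS]/(skw (val D)) -[RHS]/(skw (val D')) !skwE.
have := presalg_rel (@skein_isotopy _ h D D' _ _ _ _ lr erefl erefl).
by rewrite !fev_gen.
Qed.

Lemma skw_moveV u l r v : move l r -> is_diagram (u ++ l ++ v) ->
  is_diagram (u ++ r ++ v).
Proof.
move=> lr dl; apply: is_diagram_sub dl (move_npunct lr) _ => n m; exact: move_strands.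
Qed.

Lemma skw_circle u i v : is_diagram (u ++ [:: (Cup, i); (Cap, i)] ++ v) ->
  is_diagram (u ++ v) /\
  skw (u ++ [:: (Cup, i); (Cap, i)] ++ v) = (- q - q^-1)%:K * skw (u ++ v).
Proof.
move=> dl; have dr : is_diagram (u ++ [::] ++ v).
  apply: is_diagram_sub dl _ _ => // n m /=; case: ifP => // _; case: ifP => // _.
  by move=> [<-]; congr Some; lia.
split=> //; pose D : diagram := exist (fun w => is_diagram w) _ dl; pose D' : diagram := exist (fun w => is_diagram w) _ dr.
rewrite -[LHS]/(skw (val D)) -[skw (u ++ v)]/(skw (val D')) !skwE.
have := presalg_rel (@skein_circle _ h D D' _ _ _ erefl erefl).
by rewrite [in RHS]fevZ !fev_gen.
Qed.

Lemma skw_cross c u i v : is_diagram (u ++ [:: (Cross c, i)] ++ v) ->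
  [/\ is_diagram (u ++ v), is_diagram (u ++ [:: (Cap, i); (Cup, i)] ++ v) &
  exists a b, skw (u ++ [:: (Cross c, i)] ++ v) =
    a%:K * skw (u ++ v) + b%:K * skw (u ++ [:: (Cap, i); (Cup, i)] ++ v)].
Proof.
move=> dl; have d1 : is_diagram (u ++ [::] ++ v).
  apply: is_diagram_sub dl _ _ => // n m /=; case: ifP => // ?.
  by move=> [<-]; congr Some; lia.
have d2 : is_diagram (u ++ [:: (Cap, i); (Cup, i)] ++ v).
  apply: is_diagram_sub dl _ _ => // n m /=; case: ifP => // z [<-].
  by rewrite ifT; [congr Some|]; lia.
split=> //; pose D : diagram := exist (fun w => is_diagram w) _ dl.
pose D1 : diagram := exist (fun w => is_diagram w) _ d1; pose D2 : diagram := exist (fun w => is_diagram w) _ d2.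
rewrite -[skw _]/(skw (val D)) -[skw (u ++ v)]/(skw (val D1)).
rewrite -[skw (u ++ [:: (Cap, i); (Cup, i)] ++ v)]/(skw (val D2)) !skwE.
case: c dl @D => dl D.
  exists h, h^-1; have := presalg_rel (@skein_cross _ h D D1 D2 _ _ _ erefl erefl erefl).
  by rewrite [in RHS]fevZD !fev_gen.
exists h^-1, h.
have := presalg_rel (@skein_cross_turned _ h D D1 D2 _ _ _ erefl erefl erefl).
by rewrite [in RHS]fevZD !fev_gen => ->; rewrite [LHS]addrC.
Qed.

Lemma skw_empty : skw (nseq 4 (Puncture, 0%N)) = 1.
Proof.
have d : is_diagram (nseq 4 (Puncture, 0%N)) by [].
pose D : diagram := exist (fun w => is_diagram w) _ d; rewrite -[LHS]/(skw (val D)) skwE.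
have := presalg_rel (@skein_empty _ h D erefl).
by rewrite [in RHS](alghom1 (fev_alghom _)) fev_gen.
Qed.

Lemma skw_stack x y w : is_diagram x -> is_diagram y -> is_diagram w ->
  stack [::] x y w -> skw x * skw y = skw w.
Proof.
move=> dx dy dw st.
pose X : diagram := exist (fun w => is_diagram w) _ dx; pose Y : diagram := exist (fun w => is_diagram w) _ dy.
pose W : diagram := exist (fun w => is_diagram w) _ dw.
rewrite -[skw x]/(skw (val X)) -[skw y]/(skw (val Y)) -[RHS]/(skw (val W)) !skwE.
have := presalg_rel (@skein_stack _ h X Y W st).
by rewrite [in LHS]fevM !fev_gen.
Qed.

Lemma Zw_subst u l r v :
  (forall k s, strands (size s) (l ++ v) != None ->
     Zw h k (l ++ v) s = Zw h k (r ++ v) s) ->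
  is_diagram (u ++ l ++ v) ->
  Zw h 0 (u ++ l ++ v) [::] = Zw h 0 (u ++ r ++ v) [::].
Proof.
move=> H /andP[/eqP sd _].
rewrite (Zw_sub h0 (rs := [:: (1, r)])) ?sd //.
  by rewrite big_seq1 kscal1 mul1r.
by move=> k s ks; rewrite big_seq1 kscal1 mul1r; exact: H.
Qed.

Lemma theta0_ex : exists2 f : Sk -> kop torus,
  alghom f & forall D, f (pgen (skein_rel h) D) = Zw h 0 (val D) [::].
Proof.
apply: (presalg_hom (g := fun D => Zw h 0 (val D) [::] : kop torus)).
set g := fun D : diagram => _.
have DP (D : diagram) : strands 0 (val D) != None.
  by case/andP: (valP D) => /eqP->.
move=> l r [].
- move=> D D' u l' r' v lr eD eD'; rewrite !fev_gen /g eD eD'.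
  apply: Zw_subst => [k s|]; first exact: Zw_move.
  by rewrite -eD; exact: (valP D).
- move=> D D' u i v eD eD'.
  rewrite [in RHS]fevZ !fev_gen /g eD eD'.
  rewrite (Zw_sub h0 (rs := [:: (- q - q^-1, [::])])) ?big_seq1 /=;
    [exact: (kopZ _ (Zw h 0 (u ++ v) [::])) | | by rewrite -eD; exact: DP].
  move=> k s /=; case: ifP => // si _; rewrite big_seq1; apply: (Zw_circle h0); lia.
- move=> D D1 D2 u i v eD eD1 eD2.
  rewrite [in RHS]fevZD !fev_gen /g eD eD1 eD2.
  rewrite (Zw_sub h0 (rs := [:: (h, [::]); (h^-1, [:: (Cap, i); (Cup, i)])]));
    [by rewrite !big_cons big_nil addr0 -!kopZ | | by rewrite -eD; exact: DP].
  move=> k s /=; case: ifP => // si _; rewrite !big_cons big_nil addr0.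
  exact: (Zw_cross h0 true).
- move=> D D1 D2 u i v eD eD1 eD2.
  rewrite [in RHS]fevZD !fev_gen /g eD eD1 eD2.
  rewrite (Zw_sub h0 (rs := [:: (h, [:: (Cap, i); (Cup, i)]); (h^-1, [::])]));
    [by rewrite !big_cons big_nil addr0 -!kopZ | | by rewrite -eD; exact: DP].
  move=> k s /=; case: ifP => // si _; rewrite !big_cons big_nil addr0 addrC.
  exact: (Zw_cross h0 false).
- move=> D eD; rewrite fev_gen; symmetry; apply: (etrans (alghom1 (fev_alghom _))).
  by rewrite /g eD.
- move=> D D' D'' st; rewrite [in LHS]fevM !fev_gen /g.
  rewrite (Zw_stack h0 st) //.
  by case/andP: (valP D'') => _ /eqP e; rewrite add0n [count _ _]e.
Qed.
End Skein.

(** ** Every element of the skein algebra is a combination of diagrams *)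

Section Spanning.
Variables (K : fieldType) (h : K).
Hypothesis h0 : h != 0.
Notation skw := (@skw K h).
Notation q := (h ^+ 2).

Lemma stack_strands l x y w : stack l x y w ->
  strands (size l) w = Some 0%N /\ npunct w = npunct x.
Proof.
elim=> {l x y w} [|l1 l2 p x y w _ _ [IH IHp]|l1 l2 p x y w np _ [IH IHp]
  |l1 l2 x y w _ [IH IHp]|l1 l2 x y w _ [IH IHp]|l1 l2 x y w _ [IH IHp]] //.
- rewrite /= ifT ?IHp; last by rewrite !size_cat size_nseq; lia.
  by split=> //; rewrite -IH !size_cat !size_nseq; congr strands; lia.
- rewrite /= ifT; last by rewrite !size_cat size_nseq; lia.
  split; first by rewrite -IH !size_cat !size_nseq; congr strands; lia.
  by rewrite /npunct /= (negPf np).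
- rewrite /= ifT; last by rewrite !size_cat /=; lia.
  by split=> //; rewrite -IH !size_cat /=; congr strands; lia.
- rewrite /= ifT; last by rewrite !size_cat /=; lia.
  by split=> //; rewrite -IH !size_cat /=; congr strands; lia.
- rewrite /= ifT; last by rewrite !size_cat /=; lia.
  by rewrite subn0 addn0 /npunct /= -!/(npunct _) IHp.
Qed.

Definition stackable (l : seq bool) (x y : word) := exists w, stack l x y w.

Lemma stackable_swap x y l1 a b l2 :
  stackable (l1 ++ [:: a; b] ++ l2) x y -> stackable (l1 ++ [:: b; a] ++ l2) x y.
Proof.
move=> [w sw]; case: a b sw => -[] sw; try by exists w.
- by exists ((Cross true, size l1) :: w); apply: stack_cross_down.
- by exists ((Cross false, size l1) :: w); apply: stack_cross_up.
Qed.

Lemma stackable_front x y l l1 a l2 :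
  stackable (l ++ a :: l1 ++ l2) x y <-> stackable (l ++ l1 ++ a :: l2) x y.
Proof.
elim: l1 l => [|b l1 IH] l //=; have := IH (rcons l b); rewrite !cat_rcons => <-.
by split; [exact: (@stackable_swap _ _ l a b) | exact: (@stackable_swap _ _ l b a)].
Qed.

Lemma stackable_perm x y l l1 l2 : perm_eq l1 l2 ->
  stackable (l ++ l1) x y -> stackable (l ++ l2) x y.
Proof.
elim: l1 l2 l => [|a l1 IH] l2 l pl.
  by move: pl; rewrite perm_sym => /perm_nilP->.
have al2 : a \in l2 by rewrite -(perm_mem pl) mem_head.
case/splitPr: al2 pl => l3 l4 pl; move=> H; apply/stackable_front; move: H; rewrite -!cat_rcons.
apply: IH; rewrite -(perm_cons a); apply: perm_trans pl _.
by rewrite -cat1s perm_catCA.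
Qed.

Lemma perm_bool (l1 l2 : seq bool) :
  count_mem true l1 = count_mem true l2 ->
  count_mem false l1 = count_mem false l2 -> perm_eq l1 l2.
Proof. by move=> ct cf; apply/allP => -[] _; apply/eqP. Qed.

Lemma stackable_lower l1 l2 p i x y : ~~ is_puncture p -> count_mem false l1 = i ->
  stackable (l1 ++ nseq (ends_right p) false ++ l2) x y ->
  stackable (l1 ++ nseq (ends_left p) false ++ l2) ((p, i) :: x) y.
Proof. by move=> np <- [w sw]; exists ((p, size l1) :: w); constructor. Qed.

Lemma stackable_upper l1 l2 p i x y : ~~ is_puncture p -> count_mem true l1 = i ->
  stackable (l1 ++ nseq (ends_right p) true ++ l2) x y ->
  stackable (l1 ++ nseq (ends_left p) true ++ l2) x ((p, i) :: y).
Proof. by move=> np <- [w sw]; exists ((p, size l1) :: w); constructor. Qed.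

(** Crossings between the levels permute the strands freely, by [stackable_perm], so the strands of
    the next piece can be made adjacent. Only the punctures force the two words to advance together,
    hence the condition on their numbers. *)
Lemma stack_ex x y n m l :
  strands n x = Some 0%N -> strands m y = Some 0%N -> npunct x = npunct y ->
  count_mem false l = n -> count_mem true l = m -> stackable l x y.
Proof.
have [N] := ubnP (size x + size y)%N; elim: N x y n m l => // N IH x y n m l szN.
have LP l' : count_mem false l' = count_mem false l ->
    count_mem true l' = count_mem true l -> stackable l' x y -> stackable l x y.
  by move=> cf ct; apply: (@stackable_perm _ _ [::]); apply: perm_bool.
have cnt (b c : bool) k : count_mem b (nseq k c) = ((b == c) * k)%N.
  by rewrite count_nseq /= eq_sym.
have upper p i y' : ~~ is_puncture p -> y = (p, i) :: y' ->
    strands n x = Some 0%N -> strands m y = Some 0%N -> npunct x = npunct y ->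
    count_mem false l = n -> count_mem true l = m -> stackable l x y.
  move=> pp ey; rewrite ey in szN LP *; rewrite /=; case: ifP => // ip sx sy np cf ct.
  apply: (LP (nseq i true ++ nseq (ends_left p) true ++
     (nseq (m - i - ends_left p) true ++ nseq n false))).
  - by rewrite !count_cat !cnt /= !mul0n mul1n cf.
  - by rewrite !count_cat !cnt /= !mul1n mul0n ct; lia.
  apply: stackable_upper => //; first by rewrite cnt mul1n.
  apply: (IH _ _ n (m - ends_left p + ends_right p)%N) => //.
  - by move: szN => /=; lia.
  - by rewrite np /npunct /= (negPf pp).
  - by rewrite !count_cat !cnt /= !mul0n mul1n.
  - by rewrite !count_cat !cnt /= !mul1n mul0n; lia.
case: x IH szN LP upper => [|[p i] x] IH szN LP upper sx sy.
  case: y IH szN LP upper sy => [|[p i] y] IH szN LP upper sy np.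
    move: sx sy => [n0] [m0] cf ct; 
    have := count_predC (pred1 false) l; rewrite cf n0 (_ : count _ l = count_mem true l) ?ct.
      by rewrite m0 => e; rewrite (@size0nil _ l); [exists [::]; exact: stack_nil | rewrite -e].
    by rewrite -ct; apply: eq_count => -[].
  by apply: (upper p i y) => //; move: np; rewrite /npunct /=; case: is_puncture.
case pp: (is_puncture p); last first.
  move: sx => /=; case: ifP => // ip sx np cf ct.
  apply: (LP (nseq i false ++ nseq (ends_left p) false ++
     (nseq (n - i - ends_left p) false ++ nseq m true))).
  - by rewrite !count_cat !cnt /= !mul1n mul0n cf; lia.
  - by rewrite !count_cat !cnt /= !mul0n mul1n ct.
  apply: stackable_lower; rewrite ?pp //; first by rewrite cnt mul1n.
  apply: (IH _ _ (n - ends_left p + ends_right p)%N m) => //.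
  - by move: szN => /=; lia.
  - by rewrite !count_cat !cnt /= !mul1n mul0n; lia.
  - by rewrite !count_cat !cnt /= !mul0n mul1n.
case: p pp IH szN LP upper sx => // _ IH szN LP upper sx.
case: y IH szN LP upper sy => [|[p j] y] IH szN LP upper sy; first by [].
case pp: (is_puncture p); last by apply: (upper p j y); rewrite ?pp.
case: p pp {upper} IH szN LP sy => // _ IH szN LP.
move: sx => /=; rewrite !addn0; case: ifP => // ix sx; case: ifP => // jy sy [np] cf ct.
have cF : count_mem false (nseq i false ++ nseq j true) = i.
  by rewrite count_cat !cnt /= mul1n mul0n addn0.
have cT : count_mem true (nseq i false ++ nseq j true) = j.
  by rewrite count_cat !cnt /= mul1n mul0n.
apply: (LP ((nseq i false ++ nseq j true) ++ (nseq (n - i) false ++ nseq (m - j) true))).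
- by rewrite count_cat cF count_cat !cnt /= mul1n mul0n cf; lia.
- by rewrite count_cat cT count_cat !cnt /= mul1n mul0n ct; lia.
have [||||||w sw] := IH x y n m ((nseq i false ++ nseq j true) ++
  (nseq (n - i) false ++ nseq (m - j) true)).
- by move: szN => /=; lia.
- by move: sx; rewrite ?subn0 ?addn0.
- by move: sy; rewrite ?subn0 ?addn0.
- by [].
- by rewrite count_cat cF count_cat !cnt /= mul1n mul0n; lia.
- by rewrite count_cat cT count_cat !cnt /= mul1n mul0n; lia.
exists ((Puncture, size (nseq i false ++ nseq j true)) :: w).
by have := stack_puncture sw; rewrite cF cT.
Qed.

Lemma skw_mul x y : is_diagram x -> is_diagram y ->
  exists2 w, is_diagram w & skw x * skw y = skw w.
Proof.
move=> dx dy; case/andP: (dx) => /eqP sx /eqP px; case/andP: (dy) => /eqP sy /eqP py.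
have [w sw] : stackable [::] x y.
  by apply: (stack_ex sx sy) => //; rewrite [LHS]px.
have [s p] := stack_strands sw.
have dw : is_diagram w by rewrite /is_diagram s eqxx -/(npunct _) p [npunct _]px.
by exists w => //; apply: skw_stack.
Qed.

Lemma sk_diagrams (x : Sk h) : lspan (fun y => exists2 w, is_diagram w & y = skw w) x.
Proof.
apply: (gens_lspan _ _ (presalg_gens x)).
  by rewrite -(skw_empty h); apply: lspan_in; exists (nseq 4 (Puncture, 0%N)).
move=> _ _ [D ->] [w dw ->]; rewrite -skwE.
have [w' dw' ->] := skw_mul (valP D) dw.
by apply: lspan_in; exists w'.
Qed.

Lemma has_split (T : Type) (p : pred T) (w : seq T) : has p w ->
  exists u s v, w = u ++ s :: v /\ p s.
Proof.
elim: w => //= s w IH; case ps: (p s) => /=; first by exists [::], s, w.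
by case/IH=> u [t [v [-> pt]]]; exists (s :: u), t, v.
Qed.

Definition ncross (w : word) : nat := count (fun s => if s.1 is Cross _ then true else false) w.
Definition ncap (w : word) : nat := count (fun s => if s.1 is Cap then true else false) w.
Definition ncup (w : word) : nat := count (fun s => if s.1 is Cup then true else false) w.

Lemma sk_crossingless (x : Sk h) : lspan (fun y =>
  exists w, [/\ is_diagram w, ncross w = 0%N & y = skw w]) x.
Proof.
apply: lspanW (sk_diagrams x) => _ [w dw ->].
have [N] := ubnP (ncross w); elim: N w dw => // N IH w.
case: (posnP (ncross w)) => [cw dw _|].
  by apply: lspan_in; exists w.
rewrite -has_count => /has_split[u [[p i] [v [-> pc]]]] dw cN.
case: p pc dw cN => // c _ dw; rewrite /ncross !count_cat /= => cN.
have [d1 d2 [a [b ->]]] := skw_cross h0 dw.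
apply: lspanD; apply: lspanZ; apply: IH => //; rewrite /ncross !count_cat /=; lia.
Qed.
End Spanning.

(** * Normal words *)

(* [c] nested arcs to the right of a puncture having [i] strands below it. *)
Definition capsw (i c : nat) : word := [seq (Cap, (i - 1 - j)%N) | j <- iota 0 c].
Definition cupsw (r d : nat) : word := [seq (Cup, (r + j)%N) | j <- iota 0 d].

Lemma capswS i c : capsw i c.+1 = rcons (capsw i c) (Cap, (i - 1 - c)%N).
Proof. by rewrite /capsw -[c.+1]addn1 iotaD map_cat cats1. Qed.

Lemma cupswS r d : cupsw r d.+1 = (Cup, r) :: cupsw r.+1 d.
Proof.
rewrite /cupsw /= addn0; congr (_ :: _); rewrite (iotaDl 1 0) -map_comp.
by apply: eq_map => j /=; congr (_, _); lia.
Qed.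

(* [nword x y k w]: [w] is normal, with [k] punctures, starting just after a
   puncture with [x] strands below and [y] strands above. *)
Inductive nword : nat -> nat -> nat -> word -> Prop :=
| nw_end x : nword x x 0 (capsw x x)
| nw_cons x y k c r d w : (c <= x)%N -> (c <= y)%N -> (r <= (x - c) + (y - c))%N ->
    nword (r + d) ((x - c) + (y - c) - r + d) k w ->
    nword x y k.+1 (capsw x c ++ cupsw r d ++ (Puncture, r + d)%N :: w).

Section Normal.
Variables (K : fieldType) (h : K).
Hypothesis h0 : h != 0.
Notation skw := (skw h).

(** Replacement in every context; validity of the diagram is passed along, so that chains of moves
    need not establish it again. *)
Definition eqw (l r : word) : Prop :=
  forall u v, is_diagram (u ++ l ++ v) ->
    is_diagram (u ++ r ++ v) /\ skw (u ++ l ++ v) = skw (u ++ r ++ v).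

Lemma eqw_refl w : eqw w w. Proof. by []. Qed.

Lemma eqw_trans w1 w2 w3 : eqw w1 w2 -> eqw w2 w3 -> eqw w1 w3.
Proof. by move=> E F u v /E[/F[d e] ->]. Qed.

Lemma eqw_cat a b l r : eqw l r -> eqw (a ++ l ++ b) (a ++ r ++ b).
Proof.
by move=> E u v; have := E (u ++ a) (b ++ v); rewrite -!catA.
Qed.

Lemma eqw_move l r : move l r -> eqw l r.
Proof. by move=> lr u v d; split; [exact: skw_moveV lr d | exact: skw_move]. Qed.

Lemma eqw_far a i b j k : ~~ (is_puncture a && is_puncture b) ->
  (i + ends_left a <= j)%N -> k = (j - ends_left a + ends_right a)%N ->
  eqw [:: (b, j); (a, i)] [:: (a, i); (b, k)].
Proof. by move=> ab ij ->; apply: eqw_move; exact: move_far. Qed.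

Lemma eqw_farV a i b j k : ~~ (is_puncture a && is_puncture b) ->
  (i + ends_left a <= j)%N -> k = (j - ends_left a + ends_right a)%N ->
  eqw [:: (a, i); (b, k)] [:: (b, j); (a, i)].
Proof.
move=> ab ij -> u v d.
have d' : is_diagram (u ++ [:: (b, j); (a, i)] ++ v).
  apply: is_diagram_sub d _ _; first by rewrite /npunct /= addnCA.
  move=> n m /=; case: ifP => // h1; case: ifP => // h2 [<-].
  by rewrite !ifT; [congr Some|..]; lia.
by split=> //; rewrite (skw_move _ (move_far ab ij) d').
Qed.

Lemma eqw_catl a l r : eqw l r -> eqw (a ++ l) (a ++ r).
Proof. by move=> /(@eqw_cat a [::]); rewrite !cats0. Qed.

Lemma eqw_catr b l r : eqw l r -> eqw (l ++ b) (r ++ b).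
Proof. exact: (@eqw_cat [::]). Qed.

(** Each cap of the nest lowers by two the strands above it, whence the shift by [c.*2]. *)
Lemma eqw_caps_above i c b : (c <= i)%N -> (i <= b + c)%N ->
  eqw (capsw i c ++ [:: (Cap, b)]) ((Cap, b + c.*2)%N :: capsw i c).
Proof.
elim: c b => [|c IH] b ci ib; first by rewrite addn0; exact: eqw_refl.
rewrite capswS -cats1 -catA.
apply: (@eqw_trans _ (capsw i c ++ [:: (Cap, b.+2); (Cap, i - 1 - c)%N])).
  by apply: eqw_catl; apply: eqw_farV => //=; lia.
rewrite -cat1s catA -[X in eqw _ X]cat_cons.
apply: eqw_catr; rewrite (_ : b + _ = b.+2 + c.*2)%N; last lia.
apply: IH; lia.
Qed.

Lemma eqw_caps_below i c b : (b + c + 2 <= i)%N ->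
  eqw (capsw i c ++ [:: (Cap, b)]) ((Cap, b) :: capsw (i - 2) c).
Proof.
elim: c b => [|c IH] b ci; first exact: eqw_refl.
rewrite !capswS -!cats1 -catA.
apply: (@eqw_trans _ (capsw i c ++ [:: (Cap, b); (Cap, i - 1 - c - 2)%N])).
  by apply: eqw_catl; apply: eqw_far => //=; lia.
rewrite -cat1s catA -[X in eqw _ X]cat_cons (_ : i - 2 - 1 - c = i - 1 - c - 2)%N; last lia.
apply: eqw_catr; apply: IH; lia.
Qed.

Lemma eqw_cups_above r d b : (r <= b)%N ->
  eqw ((Cup, b) :: cupsw r d) (cupsw r d ++ [:: (Cup, b + d.*2)%N]).
Proof.
elim: d r b => [|d IH] r b rb; first by rewrite addn0; exact: eqw_refl.
rewrite cupswS.
apply: (@eqw_trans _ [:: (Cup, r), (Cup, b.+2) & cupsw r.+1 d]).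
  apply: (@eqw_catr (cupsw r.+1 d) [:: _; _] [:: _; _]).
  by apply: eqw_far => //=; lia.
rewrite cat_cons (_ : b + _ = b.+2 + d.*2)%N; last lia.
apply: (@eqw_catl [:: _]); apply: IH; lia.
Qed.

Lemma eqw_cups_below r d b : (b + 2 <= r)%N ->
  eqw ((Cup, b) :: cupsw r d) (cupsw (r - 2) d ++ [:: (Cup, b)]).
Proof.
elim: d r => [|d IH] r rb; first exact: eqw_refl.
rewrite !cupswS.
apply: (@eqw_trans _ [:: (Cup, r - 2)%N, (Cup, b) & cupsw r.+1 d]).
  apply: (@eqw_catr (cupsw r.+1 d) [:: _; _] [:: _; _]).
  by apply: eqw_farV => //=; lia.
rewrite cat_cons (_ : (r - 2).+1 = r.+1 - 2)%N; last lia.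
apply: (@eqw_catl [:: _]); apply: IH; lia.
Qed.

(* The number of pairs in the wrong order: caps are to move to the left and
   cups to the right. *)
Fixpoint disorder (w : word) : nat :=
  if w is (p, _) :: w' then
    (disorder w' + (if p is Cap then 0 else ncap w') +
     (if p is Cup then size w' - ncup w' else 0))%N
  else 0%N.

Lemma ncup_size w : (ncup w <= size w)%N. Proof. exact: count_size. Qed.

Lemma ncap_cat u v : ncap (u ++ v) = (ncap u + ncap v)%N.
Proof. exact: count_cat. Qed.
Lemma ncup_cat u v : ncup (u ++ v) = (ncup u + ncup v)%N.
Proof. exact: count_cat. Qed.
Lemma ncross_cat u v : ncross (u ++ v) = (ncross u + ncross v)%N.
Proof. exact: count_cat. Qed.

Lemma ncons p i w : (ncap ((p, i) :: w) = (if p is Cap then 1 else 0) + ncap w)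
  * (ncup ((p, i) :: w) = (if p is Cup then 1 else 0) + ncup w)
  * (ncross ((p, i) :: w) = (if p is Cross _ then 1 else 0) + ncross w)
  * (size ((p, i) :: w) = 1 + size w).
Proof. by case: p => [||[]|]. Qed.

Lemma disorder_cat u v : disorder (u ++ v) = (disorder u + disorder v +
  (size u - ncap u) * ncap v + ncup u * (size v - ncup v))%N.
Proof.
elim: u => [|[p i] u IH]; first by rewrite /= mul0n !addn0.
have cu : (ncap u <= size u)%N by exact: count_size.
have cv := ncup_size u; have cw := ncup_size v.
rewrite cat_cons !ncons /= {}IH ncap_cat ncup_cat size_cat.
have -> : (size u + size v - (ncup u + ncup v) = (size u - ncup u) + (size v - ncup v))%N by lia.
case: p => [||c|]; rewrite ?add0n.
- have -> : (1 + size u - ncap u = (size u - ncap u).+1)%N by lia.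
  by rewrite mulSn mulnDl mul1n; lia.
- have -> : (1 + size u - (1 + ncap u) = size u - ncap u)%N by lia.
  by lia.
- have -> : (1 + size u - ncap u = (size u - ncap u).+1)%N by lia.
  by rewrite mulSn; lia.
- have -> : (1 + size u - ncap u = (size u - ncap u).+1)%N by lia.
  by rewrite mulSn; lia.
Qed.

Lemma capsw_count i c : (ncap (capsw i c) = c) * (ncup (capsw i c) = 0)
  * (ncross (capsw i c) = 0) * (size (capsw i c) = c) * (disorder (capsw i c) = 0)
  * (npunct (capsw i c) = 0).
Proof.
have E : (ncap (capsw i c) = c) /\ (ncup (capsw i c) = 0) /\
  (ncross (capsw i c) = 0) /\ (size (capsw i c) = c) /\ (disorder (capsw i c) = 0)
  /\ (npunct (capsw i c) = 0).
  elim: c => // c [E1 [E2 [E3 [E4 [E5 E6]]]]]; rewrite capswS -cats1 disorder_cat.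
  rewrite ncap_cat ncup_cat ncross_cat npunct_cat size_cat E1 E2 E3 E4 E5 E6 /=.
  by rewrite /ncap /ncup /=; do !split; lia.
by case: E => ? [? [? [? [? ?]]]].
Qed.

Lemma cupsw_count i c : (ncup (cupsw i c) = c) * (ncap (cupsw i c) = 0)
  * (ncross (cupsw i c) = 0) * (size (cupsw i c) = c) * (disorder (cupsw i c) = 0)
  * (npunct (cupsw i c) = 0).
Proof.
have E : (ncup (cupsw i c) = c) /\ (ncap (cupsw i c) = 0) /\
  (ncross (cupsw i c) = 0) /\ (size (cupsw i c) = c) /\ (disorder (cupsw i c) = 0)
  /\ (npunct (cupsw i c) = 0).
  elim: c i => // c IH i; have [E1 [E2 [E3 [E4 [E5 E6]]]]] := IH i.+1.
  rewrite cupswS !ncons /= /npunct /= -/(npunct _) E1 E2 E3 E4 E5 E6.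
  by do !split; lia.
by case: E => ? [? [? [? [? ?]]]].
Qed.

(** A reduction can be performed behind any prefix and preserves the number of crossings. When the
    length does not drop, the numbers of cups and caps are kept as well, so that a decrease of
    [disorder] in a suffix is a decrease in the whole word. *)
Definition red (w w' : word) : Prop :=
  [/\ forall u, is_diagram (u ++ w) -> is_diagram (u ++ w') /\
        exists a, skw (u ++ w) = a%:K * skw (u ++ w'),
      ncross w' = ncross w &
      (size w' < size w)%N \/ [/\ size w' = size w, ncap w' = ncap w,
        ncup w' = ncup w & (disorder w' < disorder w)%N]].

Lemma red_cons s w w' : red w w' -> red (s :: w) (s :: w').
Proof.
case: s => p i [E c m]; split; last 1 first.
- case: m => [lt|[e1 e2 e3 lt]]; [by left | right].
  by rewrite !ncons /= e1 e2 e3; split=> //; lia.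
- by move=> u; have := E (rcons u (p, i)); rewrite -!cats1 -!catA.
- by rewrite !ncons c.
Qed.

Lemma red_eqw l r v : eqw l r -> ncross r = ncross l ->
  [/\ size r = size l, ncap r = ncap l, ncup r = ncup l & (disorder r < disorder l)%N]
  -> red (l ++ v) (r ++ v).
Proof.
move=> E c [e1 e2 e3 lt]; split.
- by move=> u /E [d ->]; split=> //; exists 1; rewrite kscal1 mul1r.
- by rewrite !ncross_cat c.
- right; rewrite !ncap_cat !ncup_cat !size_cat !disorder_cat e1 e2 e3.
  by split=> //; rewrite !ltn_add2r.
Qed.

(** The value excluded for b is the one that would continue the nest. Any other cap lies wholly
    above or below the nest and the puncture, and so moves to their left. *)
Lemma red_punct i c b v : (c <= i)%N -> (b + c).+1 <> i ->
  exists w, red ((Puncture, i) :: capsw i c ++ (Cap, b) :: v) w.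
Proof.
move=> ci bi.
have -> : (Puncture, i) :: capsw i c ++ (Cap, b) :: v =
  ([:: (Puncture, i)] ++ (capsw i c ++ [:: (Cap, b)])) ++ v.
  by rewrite -!catA.
case: (leqP i (b + c)) => [ib|bi'].
  exists (((Cap, b + c.*2)%N :: (Puncture, i) :: capsw i c) ++ v); apply: red_eqw.
  - apply: eqw_trans (@eqw_catl _ _ _ (eqw_caps_above ci ib)) _.
    apply: (@eqw_catr (capsw i c) [:: _; _] [:: _; _]); apply: eqw_farV => //=; lia.
  - by rewrite ?(ncross_cat, ncons, capsw_count).
  - rewrite ?(ncap_cat, ncup_cat, size_cat, disorder_cat, ncons, capsw_count) /=.
    by rewrite ?(ncons, capsw_count) /=; split; lia.
exists (((Cap, b)%N :: (Puncture, i - 2)%N :: capsw (i - 2) c) ++ v); apply: red_eqw.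
- apply: eqw_trans (@eqw_catl _ _ _ (@eqw_caps_below i c b _)) _; first lia.
  apply: (@eqw_catr (capsw (i - 2) c) [:: _; _] [:: _; _]); apply: eqw_far => //=; lia.
- by rewrite ?(ncross_cat, ncons, capsw_count).
- rewrite ?(ncap_cat, ncup_cat, size_cat, disorder_cat, ncons, capsw_count) /=.
  by rewrite ?(ncons, capsw_count) /=; split; lia.
Qed.

(** The excluded value is that of a cup enclosing the nest; any other cup misses the nest and the
    puncture and moves to their right. *)
Lemma red_cup r d b v : b.+1 <> r ->
  exists w, red ((Cup, b) :: cupsw r d ++ (Puncture, r + d)%N :: v) w.
Proof.
move=> br.
have -> : (Cup, b) :: cupsw r d ++ (Puncture, r + d)%N :: v =
  (((Cup, b) :: cupsw r d) ++ [:: (Puncture, r + d)%N]) ++ v.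
  by rewrite -!catA.
case: (leqP r b) => [rb|rb].
  exists ((cupsw r d ++ [:: (Puncture, r + d)%N; (Cup, b + d.*2)%N]) ++ v); apply: red_eqw.
  - apply: eqw_trans (@eqw_catr _ _ _ (@eqw_cups_above r d b rb)) _; rewrite -catA.
    apply: eqw_catl; apply: eqw_far => //=; lia.
  - by rewrite ?(ncross_cat, ncons, cupsw_count).
  - rewrite ?(ncap_cat, ncup_cat, size_cat, disorder_cat, ncons, cupsw_count) /=.
    by rewrite ?(ncons, cupsw_count) /=; split; lia.
exists ((cupsw (r - 2) d ++ [:: (Puncture, r - 2 + d)%N; (Cup, b)%N]) ++ v); apply: red_eqw.
- apply: eqw_trans (@eqw_catr _ _ _ (@eqw_cups_below r d b _)) _; first lia; rewrite -catA.
  apply: eqw_catl; apply: eqw_farV => //=; lia.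
- by rewrite ?(ncross_cat, ncons, cupsw_count).
- rewrite ?(ncap_cat, ncup_cat, size_cat, disorder_cat, ncons, cupsw_count) /=.
  by rewrite ?(ncons, cupsw_count) /=; split; lia.
Qed.

Lemma red_cup_cap i j v : exists w, red ((Cup, i) :: (Cap, j) :: v) w.
Proof.
case: (altP (i =P j)) => [<-|ij].
  exists v; split=> //; last by left => /=; lia.
  by move=> u d0; have [d ->] := skw_circle h0 d0; split=> //; eexists.
case: (altP (j =P i.+1)) => [->|ij1].
  exists v; split=> //; last by left => /=; lia.
  move=> u /(eqw_move (move_zigzag1 i)) [d e]; split=> //.
  by exists 1; rewrite kscal1 mul1r.
case: (altP (i =P j.+1)) => [->|ij2].
  exists v; split=> //; last by left => /=; lia.
  move=> u /(eqw_move (move_zigzag2 j)) [d e]; split=> //.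
  by exists 1; rewrite kscal1 mul1r.
case: (ltnP i j) => lt.
  exists ([:: (Cap, j - 2)%N; (Cup, i)] ++ v); apply: (@red_eqw [:: _; _]) => //.
  by apply: eqw_farV => //=; lia.
exists ([:: (Cap, j)%N; (Cup, i - 2)%N] ++ v); apply: (@red_eqw [:: _; _]) => //.
by apply: eqw_far => //=; lia.
Qed.

Definition is_cap (p : piece) : bool := if p is Cap then true else false.

Lemma caps_or i (cs : word) : all (fun s => is_cap s.1) cs ->
  (cs = capsw i (size cs) /\ (size cs <= i)%N) \/
  exists c b cs', [/\ cs = capsw i c ++ (Cap, b) :: cs', (c <= i)%N & (b + c).+1 <> i].
Proof.
elim/last_ind: cs => [|cs [p b] IH]; first by left.
rewrite all_rcons => /andP[]; case: p => //= _ /IH[[e ci]|[c [b' [cs' [-> ci bi]]]]]; last first.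
  by right; exists c, b', (rcons cs' (Cap, b)); rewrite -rcons_cons rcons_cat.
case: (altP ((b + size cs).+1 =P i)) => [bi|/eqP bi].
  left; rewrite size_rcons capswS -e; split; last by lia.
  by congr (rcons _ (_, _)); lia.
by right; exists (size cs), b, [::]; rewrite -e cats1.
Qed.

Lemma strands_capsw n i c : (i <= n)%N -> (c <= i)%N ->
  strands n (capsw i c) = (if (i + c <= n)%N then Some (n - c.*2)%N else None).
Proof.
move=> ni; elim: c => [|c IH] ci; first by rewrite addn0 ni subn0.
rewrite capswS -cats1 strands_cat IH; last by lia.
case: ifP => /= h1; last by rewrite ifF //; lia.
case: ifP => h2; last by rewrite ifF //; lia.
by rewrite ifT; [congr Some|]; lia.
Qed.

Lemma strands_cupsw n r d : (r <= n)%N -> strands n (cupsw r d) = Some (n + d.*2)%N.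
Proof.
elim: d r n => [|d IH] r n rn; first by rewrite addn0.
by rewrite cupswS /= addn0 subn0 rn IH; [congr Some|]; lia.
Qed.

Lemma nword_strands x y k w : nword x y k w ->
  strands (x + y) w = Some 0%N /\ npunct w = k.
Proof.
elim=> {x y k w} [x|x y k c r d w cx cy rc _ [IH1 IH2]].
  by rewrite capsw_count strands_capsw ?leq_addr // leqnn; split=> //; congr Some; lia.
split; last by rewrite !npunct_cat capsw_count cupsw_count -IH2.
rewrite strands_cat strands_capsw ?leq_addr //.
rewrite ifT; last lia.
rewrite strands_cat strands_cupsw /=; last lia.
rewrite ifT; last lia.
rewrite subn0 addn0.
by rewrite -IH1; congr strands; lia.
Qed.

Lemma normal_or_red v n : ncross v = 0%N -> strands n v = Some 0%N ->
  (exists w, red v w) \/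
  exists cs t, [/\ v = cs ++ t, all (fun s => is_cap s.1) cs &
    t = [::] \/ exists r d k w n', [/\ t = cupsw r d ++ (Puncture, r + d)%N :: w,
      strands n cs = Some n', (r <= n')%N & nword (r + d) (n' - r + d) k w]].
Proof.
elim: v n => [|[p i] v IH] n.
  by move=> _ _; right; exists [::], [::]; split=> //; left.
rewrite ncons /=; case: ifP => // ip cv sv.
have := IH _ (_ : ncross v = 0)%N sv; case; first lia.
  by move=> [w rw]; left; exists ((p, i) :: w); exact: red_cons.
case=> cs [t [ev acs ht]].
case: p ip cv sv ht => [||c|] //= ip cv sv ht.
- case: cs acs ev ht => [|[p j] cs] /= => [_ ev|]; last first.
    by case: p => //= _ -> _; left; exact: red_cup_cap.
  case=> [et|[r [d [k [w [n' [et [en] rn nw]]]]]]].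
    by move: sv; rewrite ev et /= => -[]; lia.
  case: (altP (i.+1 =P r)) => [ir|/eqP ir]; last by left; rewrite ev et; exact: red_cup.
  right; exists [::], ((Cup, i) :: t); split; rewrite ?ev //; right.
  exists i, d.+1, k, w, n; rewrite cupswS et -ir addnS addSn; split=> //; first lia.
  by move: nw; rewrite -ir addSn; congr nword; lia.
- right; exists ((Cap, i) :: cs), t; split=> //; first by rewrite ev.
  case: ht => [|[r [d [k [w [n' [et en rn nw]]]]]]]; [by left | right].
  by exists r, d, k, w, n'; rewrite /= ip.
- rewrite subn0 addn0 in sv; rewrite addn0 in ip.
  case: (caps_or i acs) => [[ecs ci]|[c [b [cs' [ecs ci bi]]]]]; last first.
    by left; rewrite ev ecs -catA; exact: red_punct.
  move: (size cs) ecs ci => c ecs ci; subst cs v.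
  right; exists [::], ((Puncture, i) :: capsw i c ++ t); split=> //; right.
  have := sv; rewrite strands_cat strands_capsw //; case: ifP => // icn.
  case: ht => [et|[r [d [k [w [n' [et en rn nw]]]]]]] st.
    move: st; rewrite et => -[n0].
    exists i, 0%N, 0%N, (capsw i c), n; rewrite cats0 !addn0; split=> //.
    have ci' : c = i by clear -icn ci n0 ip; lia.
    have -> : (n - i = i)%N by clear -icn ci n0 ip; lia.
    by rewrite ci'; exact: nw_end.
  exists i, 0%N, k.+1, (capsw i c ++ t), n; rewrite !addn0; split=> //.
  rewrite et; rewrite /= subn0 addn0 strands_capsw // icn in en.
  case: en => en; subst n'.
  apply: nw_cons => //; first lia; first lia.
  by move: nw; congr nword; lia.
Qed.

Lemma sk_normal (x : Sk h) :
  lspan (fun y => exists2 w, nword 0 0 4 w & y = skw w) x.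
Proof.
apply: lspanW (sk_crossingless h0 x) => _ [w [dw cw ->]].
have [N] := ubnP (size w); elim: N w dw cw => // N IHN w dw cw.
have [M] := ubnP (disorder w); elim: M w dw cw => // M IHM w dw cw Mw Nw.
have /andP[/eqP sw /eqP nw] := dw.
case: (normal_or_red cw sw) => [[w' [E c m]]|[cs [t [ew acs ht]]]].
  have [dw' [a ->]] := E [::] dw; apply: lspanZ.
  case: m => [lt|[e1 e2 e3 lt]]; first by apply: (IHN w'); rewrite ?c //; lia.
  by apply: (IHM w'); rewrite ?c ?e1 //; lia.
have ecs : cs = [::].
  move: sw acs; rewrite ew; case: cs {ew ht} => //= -[p i] cs /=.
  by case: p => //=; rewrite addn2.
move: ew ht; rewrite ecs => /= {}ew [et|[r [d [k [w' [n' [et [en] rn nw']]]]]]].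
  by move: nw; rewrite ew et.
apply: lspan_in; exists w => //.
have r0 : r = 0%N by lia.
have nwk : nword 0 0 k.+1 w.
  rewrite ew et r0; apply: (@nw_cons 0 0 k 0 0 d w') => //.
  by move: nw'; rewrite r0 -en.
have [_ e] := nword_strands nwk.
by have <- : k.+1 = 4%N by rewrite -e.
Qed.
End Normal.

(** * Leading monomials of normal words *)

(* [mism es s] counts the strands which are not in the state favoured by the
   puncture: 0 for the strands below it, 1 for the strands above. *)
Fixpoint mism (es s : seq bool) : nat :=
  if s is a :: s' then ((a == head false es) + mism (behead es) s')%N else 0%N.

Definition bvec (k : nat) (l y c : Z) : nat -> Z := vec (blk k l y c).

Lemma bvecD k l y c l' y' c' : vadd (bvec k l y c) (bvec k l' y' c') =
  bvec k (l + l') (y + y') (c + c').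
Proof.
apply: funext => i; rewrite /vadd /bvec /vec /blk !nth_cat !size_nseq.
case: ifP => i1; first by rewrite !nth_nseq i1.
case: (i - 3 * k)%N => [|[|[|j]]] //=; rewrite !nth_nseq; case: ifP => //.
Qed.

Lemma bvecE k l y c : [/\ bvec k l y c (3 * k)%N = l,
  bvec k l y c (3 * k + 1)%N = y & bvec k l y c (3 * k + 2)%N = c].
Proof.
rewrite /bvec /vec /blk; split; rewrite nth_cat size_nseq ltnNge.
- by rewrite leqnn subnn.
- by rewrite leq_addr /= addKn.
- by rewrite leq_addr /= addKn.
Qed.

Lemma bvec_out k l y c i : ~~ (3 * k <= i < 3 * k + 3)%N -> bvec k l y c i = 0%Z.
Proof.
move=> ni; rewrite /bvec /vec /blk nth_cat size_nseq.
case: ifP => i1; first by rewrite nth_nseq i1.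
have -> : (i - 3 * k = (i - 3 * k - 3).+3)%N by lia.
by rewrite /= nth_nseq; case: ifP.
Qed.

Lemma bvec0 k : bvec k 0 0 0 = fun=> 0%Z.
Proof.
apply: funext => i; rewrite /bvec /vec /blk nth_cat size_nseq; case: ifP => i1.
  by rewrite nth_nseq i1.
by case: (i - 3 * k)%N => [|[|[|j]]] //=; rewrite nth_nseq; case: ifP.
Qed.

(** In block k, F weighs 4 - k, Lambda twice as much and K^(1/2) nothing: the off-diagonal entries
    of both puncture matrices then lead with weight 4 - k and the diagonal ones have weight 0. As
    the weights decrease with k, correcting an unfavoured state at a puncture outweighs deferring it
    to the next one. *)
Definition wts : seq Z := [:: 8; 4; 0; 6; 3; 0; 4; 2; 0; 2; 1; 0]%Z.
Notation wt := (vdot wts).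

#[global] Arguments Z.mul : simpl never.

Lemma wtE v : wt v = (8 * v 0%N + 4 * v 1%N + 6 * v 3%N + 3 * v 4%N +
  4 * v 6%N + 2 * v 7%N + 2 * v 9%N + v 10%N)%Z.
Proof. by rewrite /vdot /=; lia. Qed.

Arguments vdot : simpl never.

Lemma wt_bvec k l y c : (k < 4)%N ->
  wt (bvec k l y c) = (Z.of_nat (4 - k) * (y + 2 * l))%Z.
Proof.
by rewrite wtE; case: k => [|[|[|[|]]]] // _; rewrite /bvec /vec /blk /=; lia.
Qed.

(* The part of [mism] coming from the strands above the puncture. *)
Fixpoint mabove (es s : seq bool) : nat :=
  if s is a :: s' then
    ((~~ a && ~~ head false es) + mabove (behead es) s')%N
  else 0%N.

(** The favoured states for the flags [es]; the leading term of a transfer is the one in which the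
    strands leave in these states. *)
Fixpoint outs (es : seq bool) (n : nat) : seq bool :=
  if n is n'.+1 then ~~ head false es :: outs (behead es) n' else [::].

Lemma outs_nseq i n : (i <= n)%N ->
  outs (nseq i true) n = nseq i false ++ nseq (n - i) true.
Proof.
have O m : outs [::] m = nseq m true by elim: m => //= m ->.
by elim: n i => [|n IH] [|i] //= ni; rewrite ?O // IH.
Qed.

Lemma mism_cat es s1 s2 :
  mism es (s1 ++ s2) = (mism es s1 + mism (drop (size s1) es) s2)%N.
Proof. by elim: s1 es => [|a s IH] [|e es] //=; rewrite IH addnA. Qed.

Lemma mabove_cat es s1 s2 :
  mabove es (s1 ++ s2) = (mabove es s1 + mabove (drop (size s1) es) s2)%N.
Proof. by elim: s1 es => [|a s IH] [|e es] //=; rewrite IH addnA. Qed.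

Lemma mism_below i s : (size s <= i)%N ->
  mism (nseq i true) s = count_mem true s.
Proof. by elim: s i => // a s IH [|i] //= si; rewrite IH. Qed.

Lemma mabove_below i s : (size s <= i)%N -> mabove (nseq i true) s = 0%N.
Proof. by elim: s i => // a s IH [|i] //= si; rewrite IH // andbF. Qed.

Lemma mism_out r p p' : (r <= p + p')%N ->
  mism (nseq r true) (nseq p false ++ nseq p' true) = (r - p + (p - r))%N /\
  mabove (nseq r true) (nseq p false ++ nseq p' true) = (p - r)%N.
Proof.
have M0 m : mism [::] (nseq m true) = 0%N /\ mabove [::] (nseq m true) = 0%N.
  by elim: m => //= m [-> ->].
elim: p r => [|p IH] [|r] //= rp.
- elim: p' r rp => //= p' IH' [|r] rp; last by have [-> ->] := IH' r rp; split; lia.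
  by have [-> ->] := M0 p'.
- by have [-> ->] := IH 0%N isT; split; lia.
- by have [-> ->] := IH r rp; split; lia.
Qed.

Lemma mism_lip r p s : (mism (nseq r true) s <=
  mism (nseq p true) s + (r - p + (p - r)))%N.
Proof.
elim: s r p => // a s IH [|r] [|p] /=.
- by lia.
- by have := IH 0%N p; rewrite /=; case: a; lia.
- by have := IH r 0%N; rewrite /=; case: a; lia.
- by have := IH r p; lia.
Qed.

Lemma mism_mid x c s : (c <= x)%N -> (x + c <= size s)%N ->
  (mism (nseq (x - c) true) (take (x - c) s ++ drop (x + c) s) <=
   mism (nseq x true) s)%N.
Proof.
move=> cx xs.
have s1 : size (take (x - c) s) = (x - c)%N by rewrite size_takel //; lia.
rewrite -[s in X in (_ <= X)%N](cat_take_drop (x - c)).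
rewrite -[drop (x - c) s](cat_take_drop (c + c)) drop_drop (_ : c + c + (x - c) = x + c)%N; last lia.
rewrite !mism_cat s1 !drop_nseq subnn.
have -> : mism (nseq (x - c) true) (take (x - c) s) = mism (nseq x true) (take (x - c) s).
  by rewrite !mism_below ?s1 //; lia.
rewrite leq_add2l size_takel ?size_drop; last lia.
by rewrite (_ : x - (x - c) - (c + c) = 0)%N; [exact: leq_addl | lia].
Qed.

Section Leads.
Variables (K : fieldType) (h : K).
Hypothesis h0 : h != 0.
Notation torus := (torus K).
Notation Zw := (Zw h).
Notation tfil := (tfil h wts).
Notation tlead := (tlead h wts).
Notation rowt := (rowt h).
Notation W k := (Z.of_nat (4 - k)).
Implicit Types F : seq bool -> torus.

Lemma tfilD n x y : tfil n x -> tfil n y -> tfil n (x + y).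
Proof. exact: lspanD. Qed.

Lemma filW m n x : tfil m x -> (m <= n)%Z -> tfil n x.
Proof. by move=> H mn; exact: tfilW mn H. Qed.

Lemma tev_lead v e c : c = 1%Z \/ c = (-1)%Z -> tlead (tev h (v, e, c)) (vec v).
Proof.
move=> c1; apply: tlead_mon; rewrite mulf_neq0 ?hz_neq0 //.
by case: c1 => ->; rewrite /zk /= ?oppr_eq0 oner_eq0.
Qed.

Lemma pev1_lead v e c : c = 1%Z \/ c = (-1)%Z -> tlead (pev h [:: (v, e, c)]) (vec v).
Proof. by move=> c1; rewrite /pev big_seq1; exact: tev_lead. Qed.

Definition mab (e a : bool) : Z := if ~~ a && ~~ e then 1%Z else 0%Z.
Definition mis (e a : bool) : Z := if a == e then 1%Z else 0%Z.

Lemma tL_lead k e a : (k < 4)%N -> tlead (tL h k e a (~~ e))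
  (bvec k (mab e a) (mis e a - 2 * mab e a) (1 - 2 * mab e a)).
Proof.
move=> k4; have mk : minn k 3 = k by lia.
rewrite /tL /tLp mk; case: e; case: a => /=; try by apply: pev1_lead; left.
rewrite !pev_cons /pev big_nil addr0 addrA addrC; apply: tleadD.
  by apply: tev_lead; right.
have B c : tfil (wt (vec (blk k 1 (-1) (-1))) - 1) (tev h (blk k 0 (-1) c, -4, 1)%Z)
   /\ tfil (wt (vec (blk k 1 (-1) (-1))) - 1) (tev h (blk k 0 (-1) c, 0, 1)%Z).
  rewrite -!/(bvec _ _ _ _) !wt_bvec //.
  by split; apply: lspanZ; apply: tfil_mon; rewrite -/(bvec _ _ _ _) wt_bvec //; lia.
by apply: tfilD; [case: (B (-3)%Z) | case: (B 1%Z)].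
Qed.

Lemma tL_same k e a : (k < 4)%N -> a != e -> tL h k e a e = 0.
Proof.
by rewrite /tL /tLp; case: e; case: a => //= _ _; rewrite /pev big_nil.
Qed.

Lemma tL_fil k e a c : (k < 4)%N ->
  tfil (W k * (if c == e then 0 else mis e a)) (tL h k e a c).
Proof.
move=> k4; case: (altP (c =P e)) => [->|ce].
  case: (altP (a =P e)) => [->|ae]; last by rewrite tL_same //; exact: lspan0.
  rewrite /tL /tLp; have -> : minn k 3 = k by lia.
  case: e => /=; rewrite /pev big_seq1; apply: lspanZ; apply: tfil_mon;
    by rewrite -/(bvec _ _ _ _) wt_bvec //; lia.
have -> : c = ~~ e by case: c ce; case: e.
have X := tlead_fil h0 (tL_lead e a k4); rewrite wt_bvec // in X.
by apply: filW X _; lia.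
Qed.

Lemma rowt_fil k es s F g w : (k < 4)%N -> (0 <= w <= W k)%Z ->
  (forall t, size t = size s -> tfil (g + w * Z.of_nat (mism es t)) (F t)) ->
  tfil (g + W k * Z.of_nat (mism es s)) (rowt k es s F).
Proof.
move=> k4 wW; elim: s es F g => [|a s IH] es F g H /=.
  by apply: filW (H [::] erefl) _; rewrite /=; lia.
set e := head false es.
have T c : tfil (g + W k * Z.of_nat ((a == e) + mism (behead es) s))
  (tL h k e a c * rowt k (behead es) s (fun t => F (c :: t))).
  case: (altP (c =P e)) => [->|ce].
    case: (altP (a =P e)) => [->|ae]; last first.
      by rewrite tL_same // mul0r; exact: lspan0.
    apply: (@filW (W k * 0 + ((g + w) + W k * Z.of_nat (mism (behead es) s)))%Z); last by lia.
    apply: tfilM => //; first by have := tL_fil e e e k4; rewrite eqxx.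
    apply: IH => t st; have := H (e :: t); rewrite /= st -/e eqxx => /(_ erefl).
    by move=> X; apply: filW X _; lia.
  apply: (@filW (W k * mis e a + (g + W k * Z.of_nat (mism (behead es) s)))%Z); last first.
    by rewrite /mis; case: (a == e); lia.
  apply: tfilM => //; first by have := tL_fil e a c k4; rewrite (negPf ce).
  apply: IH => t st; have := H (c :: t); rewrite /= st -/e (negPf ce) => /(_ erefl).
  by move=> X; apply: filW X _; lia.
by apply: tfilD; exact: T.
Qed.

(** A strand arriving in an unfavoured state yields weight W k when it leaves in the favoured one;
    if it leaves unchanged it yields 0 now and at most w < W k afterwards. A strand in the favoured
    state keeps it, the other entry being 0. So only the outgoing state [outs] reaches the
    maximum. *)
Lemma rowt_lead k es s F g w v : (k < 4)%N -> (0 <= w < W k)%Z ->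
  (forall t, size t = size s -> tfil (g + w * Z.of_nat (mism es t)) (F t)) ->
  tlead (F (outs es (size s))) v -> wt v = g ->
  tlead (rowt k es s F) (vadd (bvec k (Z.of_nat (mabove es s))
    (Z.of_nat (mism es s) - 2 * Z.of_nat (mabove es s))
    (Z.of_nat (size s) - 2 * Z.of_nat (mabove es s))) v).
Proof.
move=> k4 wW; elim: s es F g v => [|a s IH] es F g v H lF wv /=.
  by rewrite bvec0 vadd0.
move: lF; rewrite [outs _ _]/=; set e := head false es => lF.
have lead c : c = ~~ e -> tlead (tL h k e a c * rowt k (behead es) s (fun t => F (c :: t)))
  (vadd (bvec k (Z.of_nat ((~~ a && ~~ e) + mabove (behead es) s))
   (Z.of_nat ((a == e) + mism (behead es) s) - 2 * Z.of_nat ((~~ a && ~~ e) + mabove (behead es) s))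
   (Z.of_nat (size s).+1 - 2 * Z.of_nat ((~~ a && ~~ e) + mabove (behead es) s))) v).

  move=> ->; have lF' : tlead (rowt k (behead es) s (fun t => F (~~ e :: t)))
     (vadd (bvec k (Z.of_nat (mabove (behead es) s))
    (Z.of_nat (mism (behead es) s) - 2 * Z.of_nat (mabove (behead es) s))
    (Z.of_nat (size s) - 2 * Z.of_nat (mabove (behead es) s))) v).
    apply: (IH _ (fun t => F (~~ e :: t)) g v _ lF wv) => t st.
    have := H (~~ e :: t); rewrite /= st -/e => /(_ erefl) X; apply: filW X _.
    by case: (e); lia.
  have := tleadM h0 (tL_lead e a k4) lF'; rewrite vaddA bvecD.
  congr (tlead _ (vadd (bvec _ _ _ _) _)).
  - by rewrite /mab; case: (~~ a && ~~ e); lia.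
  - by rewrite /mab /mis; case: (~~ a && ~~ e); case: (a == e); lia.
  - by rewrite /mab; case: (~~ a && ~~ e); lia.
have fil : tfil (g + W k * Z.of_nat ((a == e) + mism (behead es) s) - 1)
    (tL h k e a e * rowt k (behead es) s (fun t => F (e :: t))).
  case: (altP (a =P e)) => [->|ae]; last by rewrite tL_same // mul0r; exact: lspan0.
  apply: (@filW (W k * 0 + ((g + w) + W k * Z.of_nat (mism (behead es) s)))%Z); last lia.
  apply: tfilM => //; first by have := tL_fil e e e k4; rewrite eqxx.
  apply: (@rowt_fil _ _ _ _ _ w) => //; first lia.
  move=> t st; have := H (e :: t); rewrite /= st -/e eqxx => /(_ erefl) X.
  by apply: filW X _; lia.
have E : wt (vadd (bvec k (Z.of_nat ((~~ a && ~~ e) + mabove (behead es) s))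
   (Z.of_nat ((a == e) + mism (behead es) s) - 2 * Z.of_nat ((~~ a && ~~ e) + mabove (behead es) s))
   (Z.of_nat (size s).+1 - 2 * Z.of_nat ((~~ a && ~~ e) + mabove (behead es) s))) v) =
   (g + W k * Z.of_nat ((a == e) + mism (behead es) s))%Z.
  by rewrite vdotD wt_bvec // wv; lia.
case: (e) lead fil E => lead fil E.
  by apply: tleadD; [exact: lead | rewrite E].
by rewrite addrC; apply: tleadD; [exact: lead | rewrite E].
Qed.

(** Of the two states of a cup around the puncture, [[:: true; false]] is unfavoured on both
    strands, and this makes it the heavier one. The two off-diagonal entries together lead with
    Lambda, so each cup of the nest adds 1 to the exponent of Lambda and nothing else. *)
Lemma Zw_cup_lead k r d n s w v g : (k < 4)%N -> size s = n -> (r <= n)%N ->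
  (forall t, size t = (n + d.*2)%N ->
     tfil (g + W k.+1 * Z.of_nat (mism (nseq (r + d) true) t)) (Zw k.+1 w t)) ->
  tlead (Zw k.+1 w (outs (nseq (r + d) true) (n + d.*2))) v -> wt v = g ->
  tlead (Zw k (cupsw r d ++ (Puncture, r + d)%N :: w) s)
    (vadd (bvec k (Z.of_nat (mabove (nseq r true) s + d))
      (Z.of_nat (mism (nseq r true) s) - 2 * Z.of_nat (mabove (nseq r true) s))
      (Z.of_nat n - 2 * Z.of_nat (mabove (nseq r true) s))) v).
Proof.
move=> k4; elim: d r n s => [|d IH] r n s sn rn H lF wv.
  rewrite !addn0 in H lF * => /=; rewrite -sn; apply: (@rowt_lead _ _ _ _ g (W k.+1)) => //; first lia.
    by move=> t st; apply: H; rewrite st.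
  by rewrite sn.
rewrite cupswS /=.
have IH' t : size t = n.+2 -> tlead (Zw k (cupsw r.+1 d ++ (Puncture, r + d.+1)%N :: w) t)
    (vadd (bvec k (Z.of_nat (mabove (nseq r.+1 true) t + d))
      (Z.of_nat (mism (nseq r.+1 true) t) - 2 * Z.of_nat (mabove (nseq r.+1 true) t))
      (Z.of_nat n.+2 - 2 * Z.of_nat (mabove (nseq r.+1 true) t))) v).
  move=> st; rewrite -addSnnS; apply: (IH r.+1 n.+2 t st _ _ _ wv); rewrite ?(addSnnS r); [lia | |].
    by move=> u su; apply: H; rewrite su; lia.
  by rewrite (_ : n.+2 + d.*2 = n + d.+1.*2)%N //; lia.
set G := Zw k _ in IH' *.
rewrite /lop /= take0 /lev big_cons big_seq1 /= addn0 pev_tone mul1r pev_tscal addrC.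
set s1 := take r s; set s2 := drop r s.
have s1r : size s1 = r by rewrite size_takel // sn.
have es : s = s1 ++ s2 by rewrite cat_take_drop.
have C1 a b : mism (nseq r.+1 true) (s1 ++ [:: a, b & s2]) =
    (mism (nseq r true) s + (a + ~~ b))%N.
  rewrite [in RHS]es !mism_cat s1r !drop_nseq subSnn subnn /=.
  rewrite (mism_below (i := r.+1)) ?s1r // (mism_below (i := r)) ?s1r //.
  by case: a; case: b; rewrite /=; lia.
have C2 a b : mabove (nseq r.+1 true) (s1 ++ [:: a, b & s2]) =
    (mabove (nseq r true) s + ~~ b)%N.
  rewrite [in RHS]es !mabove_cat s1r !drop_nseq subSnn subnn /=.
  rewrite (mabove_below (i := r.+1)) ?s1r // (mabove_below (i := r)) ?s1r //.
  by case: a; case: b; rewrite /=; lia.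
have sz a b : size (s1 ++ [:: a, b & s2]) = n.+2.
  by rewrite -sn [in RHS]es !size_cat /=; lia.
have X := IH' _ (sz true false); have Y := IH' _ (sz false true).
have X' : tlead (G (s1 ++ [:: true, false & s2])) (vadd (bvec k
      (Z.of_nat (mabove (nseq r true) s + d.+1))
      (Z.of_nat (mism (nseq r true) s) - 2 * Z.of_nat (mabove (nseq r true) s))
      (Z.of_nat n - 2 * Z.of_nat (mabove (nseq r true) s))) v).
  by move: X; congr (tlead _ (vadd (bvec _ _ _ _) _)); rewrite ?C1 ?C2; lia.
apply: tleadD.
  by apply: tleadZ X'; rewrite mulf_neq0 ?hz_neq0 // /zk /= oppr_eq0 oner_eq0.
by apply: filW (tlead_fil h0 Y) _; rewrite !vdotD !wt_bvec // ?C1 ?C2; lia.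
Qed.

Lemma Zw_cap k i v s : (i + 2 <= size s)%N ->
  exists2 a : K, (take 2 (drop i s) = [:: false; true] -> a != 0) &
    Zw k ((Cap, i) :: v) s = a%:K * Zw k v (take i s ++ drop i.+2 s).
Proof.
move=> si; rewrite /= /lop /= addn2.
have : size (take 2 (drop i s)) = 2%N by rewrite size_takel // size_drop; lia.
case: (take _ _) => [|a [|b [|? ?]]] // _.
case: a; case: b; rewrite /= /lev ?big_nil ?big_seq1 /=.
- by exists 0 => //; rewrite kscal0 mul0r.
- by exists 1 => //; rewrite pev_tone kscal1.
- rewrite pev_tscal; eexists; last by [].
  by rewrite mulf_neq0 ?hz_neq0 // /zk /= oppr_eq0 oner_eq0.
- by exists 0 => //; rewrite kscal0 mul0r.
Qed.

(** On the favoured state every cap of the nest meets a 0 below a 1, where its value is a non-zero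
    scalar. *)
Lemma Zw_caps k x c v s : (c <= x)%N -> (x + c <= size s)%N ->
  exists2 a : K, (s = nseq x false ++ nseq (size s - x) true -> a != 0) &
    Zw k (capsw x c ++ v) s = a%:K * Zw k v (take (x - c) s ++ drop (x + c) s).
Proof.
elim: c v => [|c IH] v cx xs.
  exists 1; first by rewrite oner_eq0.
  by rewrite subn0 addn0 cat_take_drop kscal1 mul1r.
rewrite capswS -cats1 -catA.
have [||a a0 ->] := IH ([:: (Cap, (x - 1 - c)%N)] ++ v); [lia | lia |].
set s' := take _ _ ++ _.
have ts : size (take (x - c) s) = (x - c)%N by rewrite size_takel //; lia.
have [|b b0] := @Zw_cap k (x - 1 - c) v s'; first by rewrite size_cat size_drop ts; lia.
rewrite -cat1s => ->; exists (a * b).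
  move=> e; apply: mulf_neq0; first exact: a0.
  apply: b0; have Ns j : nth false s j = (x <= j < size s)%N.
    rewrite {1}e nth_cat size_nseq !nth_nseq; case: ltnP => jx //=.
    by rewrite ltn_sub2rE //; case: ltnP.
  have sz : size s' = (x - c + (size s - (x + c)))%N by rewrite size_cat ts size_drop.
  rewrite (drop_nth false) ?sz; last lia.
  rewrite (drop_nth false) ?sz; last lia.
  rewrite /= take0 /s' !nth_cat ts ifT; last lia.
  rewrite ifF; last lia.
  rewrite nth_take ?nth_drop ?Ns; last lia.
  by congr [:: _; _]; lia.
rewrite mulrA -kscalM; congr (_ * Zw k v (_ ++ _)).
  rewrite /s' take_cat ts ifT; last lia.
  by rewrite take_takel; [congr take; lia | lia].
rewrite /s' drop_cat ts; case: ltnP => lt; last first.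
  by rewrite drop_drop; congr drop; lia.
by lia.
Qed.

(** ** Normal words given by their data *)

End Leads.

Fixpoint nwd (x y : nat) (ds : seq (nat * nat * nat)) : word :=
  if ds is (c, r, d) :: ds' then
    capsw x c ++ cupsw r d ++
      (Puncture, r + d)%N :: nwd (r + d) (x - c + (y - c) - r + d) ds'
  else capsw x x.

Fixpoint nvalid (x y : nat) (ds : seq (nat * nat * nat)) : bool :=
  if ds is (c, r, d) :: ds' then
    [&& c <= x, c <= y, r <= x - c + (y - c) &
      nvalid (r + d) (x - c + (y - c) - r + d) ds']%N
  else x == y.

Fixpoint nvec (k x y : nat) (ds : seq (nat * nat * nat)) : nat -> Z :=
  if ds is (c, r, d) :: ds' then
    vadd (bvec k (Z.of_nat (x - c - r + d)) (Z.of_nat r - Z.of_nat (x - c))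
           (Z.of_nat (x - c + (y - c)) - 2 * Z.of_nat (x - c - r)))
      (nvec k.+1 (r + d) (x - c + (y - c) - r + d) ds')
  else fun=> 0%Z.

Lemma nword_data x y k w : nword x y k w ->
  exists ds, [/\ size ds = k, nvalid x y ds & w = nwd x y ds].
Proof.
elim=> {x y k w} [x|x y k c r d w cx cy rc _ [ds [sds vds ->]]].
  by exists [::]; rewrite /= eqxx.
by exists ((c, r, d) :: ds); rewrite /= sds cx cy rc vds.
Qed.

Lemma nvec_low k x y ds i : (i < 3 * k)%N -> nvec k x y ds i = 0%Z.
Proof.
elim: ds k x y => //= -[[c r] d] ds IH k x y ik.
by rewrite /vadd IH ?bvec_out //; lia.
Qed.

(** In the first block the exponent of F gives r - (x - c), hence also its negative part; the
    exponent of K^(1/2) then gives the number of strands left by the caps, so c; then r and d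
    follow. The next block starts with known numbers of strands. *)
Lemma nvec_inj k x y ds ds' : size ds = size ds' -> nvalid x y ds -> nvalid x y ds' ->
  nvec k x y ds = nvec k x y ds' -> ds = ds'.
Proof.
elim: ds ds' k x y => [|[[c r] d] ds IH] [|[[c' r'] d'] ds'] k x y //= [sd].
move=> /and4P[cx cy rc vd] /and4P[cx' cy' rc' vd'] e.
have E i : (i < 3)%N -> bvec k (Z.of_nat (x - c - r + d)) (Z.of_nat r - Z.of_nat (x - c))
           (Z.of_nat (x - c + (y - c)) - 2 * Z.of_nat (x - c - r)) (3 * k + i)%N =
  bvec k (Z.of_nat (x - c' - r' + d')) (Z.of_nat r' - Z.of_nat (x - c'))
           (Z.of_nat (x - c' + (y - c')) - 2 * Z.of_nat (x - c' - r')) (3 * k + i)%N.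
  by move=> i3; have := congr1 (fun f => f (3 * k + i)%N) e; rewrite /vadd !nvec_low; lia.
have [A1 A2 A3] := bvecE k (Z.of_nat (x - c - r + d)) (Z.of_nat r - Z.of_nat (x - c))
           (Z.of_nat (x - c + (y - c)) - 2 * Z.of_nat (x - c - r)).
have [B1 B2 B3] := bvecE k (Z.of_nat (x - c' - r' + d')) (Z.of_nat r' - Z.of_nat (x - c'))
           (Z.of_nat (x - c' + (y - c')) - 2 * Z.of_nat (x - c' - r')).
have := E 0%N isT; have := E 1%N isT; have := E 2%N isT.
rewrite addn0 A1 A2 A3 B1 B2 B3 => e3 e2 e1.
have ? : c = c' by lia.
subst c'; have ? : r = r' by lia.
subst r'; have ? : d = d' by lia.
subst d'; congr (_ :: _); apply: (IH _ k.+1 _ _ sd vd vd').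
apply: funext => i; have := congr1 (fun f => f i) e; rewrite /vadd; lia.
Qed.

Section NormalLeads.
Variables (K : fieldType) (h : K).
Hypothesis h0 : h != 0.
Notation torus := (torus K).
Notation Zw := (Zw h).
Notation tfil := (tfil h wts).
Notation tlead := (tlead h wts).

(** The bound for every incoming state accompanies the leading term because [rowt_lead] requires it
    when the previous puncture is treated. *)
Lemma Zw_normal k x y ds : (k + size ds = 4)%N -> nvalid x y ds ->
  tlead (Zw k (nwd x y ds) (nseq x false ++ nseq y true)) (nvec k x y ds) /\
  forall s, size s = (x + y)%N ->
    tfil (wt (nvec k x y ds) + Z.of_nat (4 - k) * Z.of_nat (mism (nseq x true) s))
      (Zw k (nwd x y ds) s).
Proof.
elim: ds k x y => [|[[c r] d] ds IH] k x y /=.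
  move=> k4 /eqP<-; have -> : (4 - k = 0)%N by lia.
  have Z s : size s = (x + x)%N -> exists2 a : K,
     (s = nseq x false ++ nseq x true -> a != 0) & Zw k (capsw x x) s = a%:K.
    move=> ss; have [||a a0] := @Zw_caps _ h h0 k x x [::] s; [by [] | by rewrite ss|].
    rewrite cats0 subnn take0 drop_oversize ?ss //= mulr1 => ->; exists a => // e.
    by apply: a0; rewrite {1}e ss addKn.
  split.
    have [|a a0 ->] := Z (nseq x false ++ nseq x true); first by rewrite size_cat !size_nseq.
    rewrite -[_%:K]mulr1; apply: tleadZ (a0 erefl) _; exact: tlead1.
  move=> s ss; have [a _ ->] := Z s ss.
  have X : tfil 0 (a%:K : torus) by exact: tfil_scal.
  apply: (filW h0 X).
  by rewrite /vdot /=; lia.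
move=> k4 /and4P[cx cy rc vd]; set n := (x - c + (y - c))%N in rc vd *.
have kk : (k < 4)%N by lia.
have [L F] := IH k.+1 _ _ (ltac:(lia) : k.+1 + size ds = 4)%N vd.
set v := nvec k.+1 _ _ _ in L F *; set w := nwd _ _ _ in L F *.
have lead s : size s = n -> tlead (Zw k (cupsw r d ++ (Puncture, r + d)%N :: w) s)
    (vadd (bvec k (Z.of_nat (mabove (nseq r true) s + d))
      (Z.of_nat (mism (nseq r true) s) - 2 * Z.of_nat (mabove (nseq r true) s))
      (Z.of_nat n - 2 * Z.of_nat (mabove (nseq r true) s))) v).
  move=> sn; apply: (Zw_cup_lead h0 kk sn rc (g := wt v)) => //.
    by move=> t st; apply: F; rewrite st; lia.
  rewrite outs_nseq; last lia.
  by rewrite (_ : n + d.*2 - (r + d) = n - r + d)%N //; lia.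
have caps s : size s = (x + y)%N -> exists2 a : K,
    (s = nseq x false ++ nseq y true -> a != 0) &
    Zw k (capsw x c ++ cupsw r d ++ (Puncture, r + d)%N :: w) s =
      a%:K * Zw k (cupsw r d ++ (Puncture, r + d)%N :: w)
        (take (x - c) s ++ drop (x + c) s).
  move=> ss; have [||a a0 ->] := @Zw_caps _ h h0 k x c (cupsw r d ++ (Puncture, r + d)%N :: w) s.
  - by [].
  - by rewrite ss; lia.
  by exists a => // e; apply: a0; rewrite {1}e ss addKn.
have sz (s : seq bool) : size s = (x + y)%N -> size (take (x - c) s ++ drop (x + c) s) = n.
  by move=> ss; rewrite size_cat size_takel ?size_drop ss /n; lia.
have [M1 M2] := @mism_out r (x - c) (y - c) rc.
split.
  have so : size (nseq x false ++ nseq y true) = (x + y)%N by rewrite size_cat !size_nseq.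
  have [a a0 ->] := caps _ so; apply: tleadZ (a0 erefl) _.
  rewrite (_ : take _ _ ++ _ = nseq (x - c) false ++ nseq (y - c) true); last first.
    case: (posnP c) => [->|c1].
      by rewrite !subn0 addn0 take_size_cat ?size_nseq // drop_size_cat ?size_nseq.
    rewrite take_cat size_nseq ifT; last lia.
    rewrite drop_cat size_nseq ifF; last lia.
    by rewrite drop_nseq addKn take_nseq //; lia.
  have := lead (nseq (x - c) false ++ nseq (y - c) true); rewrite M1 M2.
  rewrite size_cat !size_nseq => /(_ erefl); congr (tlead _ (vadd (bvec _ _ _ _) _)); lia.
move=> s ss; have [a _ ->] := caps s ss.
have Zf m b z : tfil m z -> tfil m (b%:K * z) by exact: lspanZ.
apply: Zf.
apply: (tfilW h0 _ (tlead_fil h0 (lead _ (sz s ss)))); rewrite !vdotD !wt_bvec //.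
set s' := take _ _ ++ _.
have H1 : (mism (nseq r true) s' <= mism (nseq (x - c) true) s' + (r - (x - c) + (x - c - r)))%N.
  exact: mism_lip.
have H2 : (mism (nseq (x - c) true) s' <= mism (nseq x true) s)%N.
  by apply: mism_mid => //; rewrite ss; lia.
(* Stated without the factor 4 - k, which is multiplied in afterwards to keep the arithmetic
   linear. *)
have key : (Z.of_nat (mism (nseq r true) s') - 2 * Z.of_nat (mabove (nseq r true) s') +
    2 * Z.of_nat (mabove (nseq r true) s' + d) <= Z.of_nat r - Z.of_nat (x - c) +
    2 * Z.of_nat (x - c - r + d) + Z.of_nat (mism (nseq x true) s))%Z by lia.
have W0 : (0 <= Z.of_nat (4 - k))%Z by lia.
have := Z.mul_le_mono_nonneg_l _ _ _ W0 key.
by rewrite !Z.mul_add_distr_l; lia.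
Qed.

Lemma normal_lead ds : size ds = 4%N -> nvalid 0 0 ds ->
  tlead (Zw 0 (nwd 0 0 ds) [::]) (nvec 0 0 0 ds).
Proof. by move=> s4 vd; case: (@Zw_normal 0 0 0 ds _ vd). Qed.

Definition ndata := {ds : seq (nat * nat * nat) | (size ds == 4%N) && nvalid 0 0 ds}.

Lemma ndata_inj : injective (fun D : ndata => nvec 0 0 0 (val D)).
Proof.
move=> D E /nvec_inj e; apply: val_inj; apply: e.
- by case/andP: (valP D) => /eqP-> _; case/andP: (valP E) => /eqP->.
- by case/andP: (valP D).
- by case/andP: (valP E).
Qed.

Lemma ndata_lead (D : ndata) : tlead (Zw 0 (nwd 0 0 (val D)) [::]) (nvec 0 0 0 (val D)).
Proof. by case/andP: (valP D) => /eqP s4 vd; exact: normal_lead. Qed.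

Lemma sk_ndata (x : Sk h) :
  lspan (fun y => exists D : ndata, y = skw h (nwd 0 0 (val D))) x.
Proof.
apply: lspanW (sk_normal h0 x) => _ [w /nword_data[ds [s4 vd ->]] ->].
have dd : (size ds == 4%N) && nvalid 0 0 ds by rewrite s4 vd.
by apply: lspan_in; exists (exist _ ds dd).
Qed.

End NormalLeads.

(** * The relations between the loops *)

Section Theta.
Variables (K : fieldType) (h : K).
Hypothesis h0 : h != 0.
Notation torus := (torus K).
Notation Sk := (Sk h).

Definition theta0 : Sk -> kop torus := s2val (cid2 (theta0_ex h0)).

Lemma theta0_alghom : alghom theta0.
Proof. by rewrite /theta0; case: cid2. Qed.

Lemma theta0_skw w : is_diagram w -> theta0 (skw h w) = Zw h 0 w [::].
Proof.
move=> dw; pose D : diagram := exist (fun w => is_diagram w) _ dw.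
rewrite -[w]/(val D) skwE; rewrite /theta0; case: cid2 => f fh /= -> //.
Qed.

Lemma nwd_diagram (D : ndata) : is_diagram (nwd 0 0 (val D)).
Proof.
have nw x y ds : nvalid x y ds -> nword x y (size ds) (nwd x y ds).
  elim: ds x y => [|[[c r] d] ds IH] x y /= => [/eqP->|]; first exact: nw_end.
  by move=> /and4P[cx cy rc /IH]; exact: nw_cons.
case/andP: (valP D) => /eqP s4 vd; have [e1 e2] := nword_strands h0 (nw _ _ _ vd).
rewrite s4 in e2.
by rewrite /is_diagram e1 eqxx -/(npunct _) e2.
Qed.

Lemma theta0L a x y : theta0 (a%:K * x + y) = a%:K * (theta0 x : torus) + theta0 y.
Proof.
by rewrite (alghomD theta0_alghom) (alghomM theta0_alghom) (alghomK theta0_alghom) kopZ.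
Qed.

(** No strand arrives at the first puncture other than those of its own nest of cups, so in the
    first block the leading exponent of a normal word involves Lambda only. *)
Lemma theta0_coef x :
  (forall u, u 1%N = 0%Z -> u 2%N = 0%Z -> tcoef u (theta0 x : torus) = 0) -> x = 0.
Proof.
move=> H; apply: (tlead_coef h0 (f := theta0 : Sk -> torus) (c := wts)
  (b := fun D : ndata => skw h (nwd 0 0 (val D))) (v := fun D => nvec 0 0 0 (val D))).
- exact: (alghom0 theta0_alghom).
- exact: theta0L.
- exact: sk_ndata.
- exact: ndata_inj.
- by move=> D; rewrite theta0_skw ?nwd_diagram //; exact: ndata_lead.
move=> D; case/andP: (valP D); case: (val D) => [|[[c r] d] ds] //= _.
rewrite leqn0 sub0n addn0 leqn0 => /and4P[/eqP-> _ /eqP-> _].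
by apply: H; rewrite /vadd (nvec_low (k := 1)) // -?[2%N]/(3 * 0 + 2)%N -?[1%N]/(3 * 0 + 1)%N.
Qed.

Definition veq (x y : torus) : Prop :=
  forall u, u 1%N = 0%Z -> u 2%N = 0%Z -> tcoef u x = tcoef u y.

Lemma theta0_veq x y : veq (theta0 x) (theta0 y) -> x = y.
Proof.
move=> H; apply/eqP; rewrite -subr_eq0; apply/eqP/theta0_coef => u u1 u2.
rewrite (alghomB theta0_alghom) tcoefD H // -tcoefD.
by rewrite (_ : _ + _ = 0 :> torus) //; exact: subrr.
Qed.

Lemma theta0_inj : injective theta0.
Proof. by move=> x y e; apply: theta0_veq; rewrite e. Qed.

End Theta.

(** ** Loops *)

Definition code : Type := seq bool.
Definition codes : seq code := states 4.
Definition code_of (X : {set 'I_4}) : code := [seq k \in X | k <- enum 'I_4].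
Definition cset (c : code) : {set 'I_4} := [set k : 'I_4 | nth false c k].
Definition loopw (c : code) : word :=
  (Cup, 0%N) :: rcons [seq (Puncture, if b then 1%N else 2%N) | b <- c] (Cap, 0%N).

Lemma code_ofK X : cset (code_of X) = X.
Proof.
by apply/setP=> k; rewrite inE (nth_map k) ?size_enum_ord // nth_ord_enum.
Qed.

Lemma code_of_in X : code_of X \in codes.
Proof. by apply: states_mem; rewrite size_map size_enum_ord. Qed.

Lemma nth_code X (k : 'I_4) : nth false (code_of X) k = (k \in X).
Proof. by rewrite (nth_map k) ?size_enum_ord // nth_ord_enum. Qed.

Lemma loop_wordE X : loop_word X = loopw (code_of X).
Proof. by rewrite /loopw -map_comp. Qed.

Lemma codes_size c : c \in codes -> size c = 4%N.
Proof.
have : all (fun c => size c == 4%N) codes by [].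
by move=> /allP/[apply]/eqP.
Qed.

Lemma csetK c : c \in codes -> code_of (cset c) = c.
Proof.
move=> /codes_size c4; apply: (@eq_from_nth _ false).
  by rewrite size_map size_enum_ord.
rewrite size_map size_enum_ord => i i4.
by rewrite -[i]/(val (Ordinal i4)) nth_code inE.
Qed.

(** ** Polynomials *)

Fixpoint addpairs (ls : seq (seq term)) : seq (seq term) :=
  if ls is a :: b :: ls' then addp a b :: addpairs ls' else ls.
(** Pairwise merging as in a merge sort: eight rounds divide the number of lists by about 2^8, and
    the rest is added in turn. *)
Definition addall (ls : seq (seq term)) : seq term :=
  foldr addp [::] (iter 8 addpairs ls).
Definition mulb (p q : seq term) : seq term :=
  addall [seq [seq mult s t | t <- q] | s <- p].

(* The leading monomials of the values of [theta0] involve neither F nor K of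
   the first puncture, hence relations are only compared on such terms. *)
Definition keep (t : term) : bool :=
  Z.eqb (nth 0%Z t.1.1 1) 0 && Z.eqb (nth 0%Z t.1.1 2) 0.
Definition keep2 (s t : term) : bool :=
  Z.eqb (nth 0%Z s.1.1 1 + nth 0%Z t.1.1 1) 0 &&
  Z.eqb (nth 0%Z s.1.1 2 + nth 0%Z t.1.1 2) 0.
Definition prune (p : seq term) : seq term := filter keep p.
Definition mulk (p q : seq term) : seq term :=
  addall [seq [seq mult s t | t <- q & keep2 s t] | s <- p].

Definition lcsum (l : lc) (F : seq bool -> seq term) : seq term :=
  addall [seq mulb t.1 (F t.2) | t <- l].

Fixpoint zpol (k : nat) (w : word) (s : seq bool) : seq term :=
  match w with
  | [::] => if s is [::] then tone else [::]
  | (p, i) :: w' =>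
      if is_puncture p then lcsum (rowl k (nseq i true) s) (zpol k.+1 w')
      else lcsum (loc p (take (ends_left p) (drop i s)))
        (fun o => zpol k w' (take i s ++ o ++ drop (i + ends_left p) s))
  end.

Definition lpol (c : code) : seq term := zpol 0 (loopw c) [::].

(** ** Expressions in the loops *)

Inductive kx := Kq of nat | Kqi of nat | Knat of nat | Kadd of kx & kx
  | Kopp of kx | Kmul of kx & kx.
Inductive ex (V : Type) := Lv of V | Lk of kx | Ladd of ex V & ex V
  | Lopp of ex V | Lmul of ex V & ex V | Lexp of ex V & nat.
Arguments Lk {V} k.
Definition lx : Type := ex code.

Fixpoint keval (e : kx) : spoly :=
  match e with
  | Kq n => [:: (2 * Z.of_nat n, 1)%Z]
  | Kqi n => [:: (- (2 * Z.of_nat n), 1)%Z]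
  | Knat n => [:: (0%Z, Z.of_nat n)]
  | Kadd a b => keval a ++ keval b
  | Kopp a => sopp (keval a)
  | Kmul a b => smul (keval a) (keval b)
  end.

Section Expr.
Variables (K : fieldType) (q : K).

(** The exponent 1 and the numeral 1 are treated apart so that denotations are the scalars of the
    relations as written. *)
Fixpoint kden (e : kx) : K :=
  match e with
  | Kq 1 => q
  | Kq n => q ^+ n
  | Kqi 1 => q^-1
  | Kqi n => q ^- n
  | Knat 1 => 1
  | Knat n => n%:R
  | Kadd a b => kden a + kden b
  | Kopp a => - kden a
  | Kmul a b => kden a * kden b
  end.

Variables (A : kalgType K) (V : Type) (s : V -> A).

Fixpoint den (e : ex V) : A :=
  match e with
  | Lv c => s c
  | Lk k => (kden k)%:K
  | Ladd a b => den a + den b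
  | Lopp a => - den a
  | Lmul a b => den a * den b
  | Lexp a n => den a ^+ n
  end.

End Expr.

Lemma den_alghom (K : fieldType) (q : K) (A B : kalgType K) (f : A -> B) (V : Type)
    (s : V -> A) e : alghom f -> f (den q s e) = den q (f \o s) e.
Proof.
move=> hf; elim: e => [c|k|a IHa b IHb|a IHa|a IHa b IHb|a IHa n] /=.
- by [].
- exact: alghomK.
- by rewrite (alghomD hf) IHa IHb.
- by rewrite (alghomN hf) IHa.
- by rewrite (alghomM hf) IHa IHb.
- by rewrite (alghomX hf) IHa.
Qed.

Lemma den_ext (K : fieldType) (q : K) (A : kalgType K) (V : Type) (s s' : V -> A) e :
  s =1 s' -> den q s e = den q s' e.
Proof. by move=> ss; congr (den q _ e); apply: funext. Qed.

Section Values.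
Variables (K : fieldType) (h : K).
Hypothesis h0 : h != 0.
Notation torus := (torus K).
Notation pev := (pev h).
Notation q := (h ^+ 2).

Lemma keval_kden e : sev h (keval e) = kden q e.
Proof.
have hzq n : hz h (2 * Z.of_nat n) = q ^+ n.
  rewrite /hz -exprM (_ : int_of_Z _ = (2 * n)%N :> int) //; lia.
elim: e => [n|n|n|a IHa b IHb|a IHa|a IHa b IHb].
- have -> : kden q (Kq n) = q ^+ n by case: n => [|[|n]].
  by rewrite -hzq (sev_hz h).
- have -> : kden q (Kqi n) = q ^- n by case: n => [|[|n]].
  by rewrite -hzq -hzN (sev_hz h).
- have -> : kden q (Knat n) = n%:R by case: n => [|[|n]].
  by symmetry; exact: sev_nat.
- by rewrite /= -IHa -IHb; symmetry; exact: sev_add.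
- by rewrite /= -IHa; symmetry; exact: sev_opp.
- by rewrite /= -IHa -IHb; symmetry; exact: sev_mul.
Qed.

Lemma pev_addall ls : pev (addall ls) = \sum_(p <- ls) pev p.
Proof.
have H l : \sum_(p <- addpairs l) pev p = \sum_(p <- l) pev p.
  have [n] := ubnP (size l); elim: n l => // n IH [|a [|b l]] //= sl.
  by rewrite !big_cons IH ?pev_addp ?addrA //; lia.
rewrite /addall; elim: (8%N) ls => [|n IH] ls; last by rewrite iterSr IH H.
by elim: ls => [|p ls IH] /=; rewrite ?big_nil ?big_cons ?pev_addp ?IH // /pev big_nil.
Qed.

Lemma pev_mulb p r : pev (mulb p r) = pev p * pev r.
Proof.
rewrite pev_addall big_map /pev mulr_suml; apply: eq_bigr => s _.
by rewrite big_map mulr_sumr; apply: eq_bigr => t _; exact: tev_mult.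
Qed.

Lemma lcsumE l F : pev (lcsum l F) = lev h l (fun o => pev (F o)).
Proof.
by rewrite pev_addall big_map; apply: eq_bigr => t _; rewrite pev_mulb.
Qed.

Lemma zpolE k w s : pev (zpol k w s) = Zw h k w s.
Proof.
elim: w k s => [|[p i] w IH] k s /=.
  by case: s => [|? ?]; rewrite ?(pev_tone h) // /pev big_nil.
case: ifP => _; rewrite lcsumE.
  rewrite rowl_rowt //; apply: lev_ext => o _; exact: IH.
by apply: lev_ext => o _; exact: IH.
Qed.

Notation veq := (@veq K).

Lemma veqD x y x' y' : veq x x' -> veq y y' -> veq (x + y) (x' + y').
Proof. by move=> H H' u u1 u2; rewrite !tcoefD H ?H'. Qed.
Lemma veqN x x' : veq x x' -> veq (- x) (- x').
Proof.
move=> H u u1 u2; apply: (addrI (tcoef u x)); rewrite -tcoefD subrr.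
by rewrite H // -tcoefD subrr.
Qed.
Lemma veq_trans x y z : veq x y -> veq y z -> veq x z.
Proof. by move=> H H' u u1 u2; rewrite H ?H'. Qed.

Lemma veq_drop t : ~~ keep t -> veq (tev h t) 0.
Proof.
move=> nk u u1 u2; rewrite /tev tcoefZ tcoef_mon tcoef0.
case: asboolP => [e|_]; last by rewrite mulr0.
move: nk u1 u2; rewrite /keep -e /vec.
by move=> nk e1 e2; move: nk; rewrite e1 e2.
Qed.

Lemma veq_prune p : veq (pev p) (pev (prune p)).
Proof.
elim: p => [|t p IH] //; rewrite pev_cons /=; case: ifP => kt.
  by rewrite pev_cons; apply: veqD.
by rewrite -[X in veq _ X]add0r; apply: veqD => //; apply: veq_drop; rewrite kt.
Qed.

Lemma nth_addl (a b : seq Z) i : nth 0%Z (addl a b) i = (nth 0 a i + nth 0 b i)%Z.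
Proof. by have := congr1 (fun f => f i) (vec_addl a b). Qed.

Lemma veq_mulk p r : veq (pev p * pev r) (pev (mulk p r)).
Proof.
rewrite pev_addall big_map /pev mulr_suml.
elim: p => [|s p IH]; first by rewrite !big_nil.
rewrite !big_cons; apply: veqD => // {IH p}.
elim: r => [|t r IH]; first by rewrite !big_nil mulr0.
rewrite big_cons mulrDr /=; have E : keep (mult s t) = keep2 s t.
  by rewrite /keep /keep2 /mult /= !nth_addl.
case: ifP => k2; rewrite /= ?big_cons.
  by apply: veqD => //; rewrite tev_mult.
rewrite -[X in veq _ X]add0r; apply: veqD => //.
by rewrite -tev_mult //; apply: veq_drop; rewrite E k2.
Qed.

Variable T : code -> seq term.

(* The algebra of loops maps to the opposite of the torus. *)
Fixpoint leval (e : lx) : seq term :=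
  match e with
  | Lv c => T c
  | Lk k => constp (keval k)
  | Ladd a b => addp (leval a) (leval b)
  | Lopp a => negp (leval a)
  | Lmul a b => mulb (leval b) (leval a)
  | Lexp a n => iter n (mulb (leval a)) tone
  end.

(** Only the outermost product is pruned: terms of the factors involving F or K of the first
    puncture can still combine to terms without them. *)
Fixpoint pval (e : lx) : seq term :=
  match e with
  | Ladd a b => addp (pval a) (pval b)
  | Lopp a => negp (pval a)
  | Lmul a b => mulk (leval b) (leval a)
  | _ => prune (leval e)
  end.

Definition chk (r : lx * lx) : bool := nilp (addp (pval r.1) (negp (pval r.2))).

Notation den := (den q (fun c => pev (T c) : kop torus)).

Lemma levalE e : pev (leval e) = den e.
Proof.
elim: e => [c|k|a IHa b IHb|a IHa|a IHa b IHb|a IHa n] /=.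
- by [].
- by symmetry; apply: (pev_const (h := h)); rewrite keval_kden.
- by rewrite pev_addp IHa IHb.
- by rewrite pev_negp IHa.
- by rewrite pev_mulb IHa IHb.
- elim: n => [|n IH]; first by rewrite (pev_tone h) expr0.
  by rewrite iterS pev_mulb IH IHa; symmetry; apply: (etrans (exprSr (den a : kop torus) n)).
Qed.

Lemma pvalE e : veq (den e) (pev (pval e)).
Proof.
elim: e => [c|k|a IHa b IHb|a IHa|a IHa b IHb|a IHa n].
- exact: veq_prune.
- rewrite -levalE; exact: veq_prune.
- by rewrite [pval _]/= pev_addp; apply: veqD.
- by rewrite [pval _]/= pev_negp; apply: veqN.
- by rewrite -[den _]/((den b : torus) * den a) -!levalE; exact: veq_mulk.
- rewrite -levalE; exact: veq_prune.
Qed.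

Lemma chkP r : chk r -> veq (den r.1) (den r.2).
Proof.
move=> /nilP e; apply: veq_trans (pvalE _) _.
have -> : pev (pval r.1) = pev (pval r.2) by exact: pev_eq e.
by move=> u u1 u2; rewrite pvalE.
Qed.

End Values.

(** ** Checking the relations *)

Local Notation p1 := (@Ordinal 4 0 isT).
Local Notation p2 := (@Ordinal 4 1 isT).
Local Notation p3 := (@Ordinal 4 2 isT).
Local Notation p4 := (@Ordinal 4 3 isT).

Definition lsets : seq {set 'I_4} := [::
  [set p1]; [set p2]; [set p3]; [set p4];
  [set p1; p2]; [set p1; p3]; [set p1; p4]; [set p2; p3]; [set p2; p4]; [set p3; p4];
  [set p1; p2; p3]; [set p1; p2; p4]; [set p1; p3; p4]; [set p2; p3; p4];
  [set p1; p2; p3; p4]]%SET.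

Definition lcodes : seq code := [seq [seq k \in l | k <- iota 0 4] | l <-
  [:: [:: 0]; [:: 1]; [:: 2]; [:: 3];
      [:: 0; 1]; [:: 0; 2]; [:: 0; 3]; [:: 1; 2]; [:: 1; 3]; [:: 2; 3];
      [:: 0; 1; 2]; [:: 0; 1; 3]; [:: 0; 2; 3]; [:: 1; 2; 3]; [:: 0; 1; 2; 3]]]%N.

Lemma lsetsE : lsets = map cset lcodes.
Proof.
rewrite /lsets /lcodes /=; do ![congr (_ :: _)];
  by apply/setP=> -[[|[|[|[|j]]]] i]; rewrite !inE.
Qed.

(** The value of s at the set coded by c, looked up in a list of sets in the form used by the
    relations: on a concrete code it reduces to s of that very expression, where [cset] would give a
    different term for the same set. *)
Definition lit (A : Type) (s : {set 'I_4} -> A) (c : code) : A :=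
  nth (s (cset c)) (map s lsets) (index c lcodes).

Lemma litE A (s : {set 'I_4} -> A) c : lit s c = s (cset c).
Proof.
rewrite /lit lsetsE; case: (boolP (c \in lcodes)) => cl.
  by rewrite -map_comp (nth_map [::]) ?index_mem //= nth_index.
by rewrite nth_default // !size_map leqNgt index_mem.
Qed.

Ltac reify_scalar q t :=
  lazymatch t with
  | q => constr:(Kq 1)
  | @GRing.inv _ q => constr:(Kqi 1)
  | @GRing.inv _ (@GRing.exp _ q ?n) => constr:(Kqi n)
  | @GRing.exp _ q ?n => constr:(Kq n)
  | @GRing.one _ => constr:(Knat 1)
  | @GRing.natmul _ (@GRing.one _) ?n => constr:(Knat n)
  | @GRing.add _ ?a ?b =>
      let a := reify_scalar q a in let b := reify_scalar q b in constr:(Kadd a b)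
  | @GRing.mul _ ?a ?b =>
      let a := reify_scalar q a in let b := reify_scalar q b in constr:(Kmul a b)
  | @GRing.opp _ ?a => let a := reify_scalar q a in constr:(Kopp a)
  end.

Ltac reify_set X :=
  lazymatch X with
  | finset.setU ?A ?B =>
      let a := reify_set A in let b := reify_set B in constr:(a ++ b)
  | finset.set1 (Ordinal (m := ?i) _) => constr:([:: i])
  end.

Ltac reify_loop q s t :=
  lazymatch t with
  | @GRing.add _ ?a ?b =>
      let a := reify_loop q s a in let b := reify_loop q s b in constr:(@Ladd code a b)
  | @GRing.mul _ ?a ?b =>
      let a := reify_loop q s a in let b := reify_loop q s b in constr:(@Lmul code a b)
  | @GRing.opp _ ?a => let a := reify_loop q s a in constr:(@Lopp code a)
  | @GRing.exp _ ?a ?n => let a := reify_loop q s a in constr:(@Lexp code a n)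
  | kscal ?a => let a := reify_scalar q a in constr:(@Lk code a)
  | s ?X =>
      let l := reify_set X in
      let c := eval vm_compute in [seq k \in l | k <- iota 0 4] in
      constr:(@Lv code c)
  end.

Ltac reify_list q s l :=
  lazymatch l with
  | ?x :: ?l' =>
      lazymatch x with
      | (?a, ?b) =>
        let a := reify_loop q s a in let b := reify_loop q s b in
        let l' := reify_list q s l' in constr:((a, b) :: l')
      end
  | [::] => constr:(@nil (lx * lx))
  end.

Section Explicit.
Variables (K : fieldType) (q : K) (A : kalgType K) (s : {set 'I_4} -> A).

Definition explicit_relations : seq (A * A) :=
  cubic_relations q s ++ cubic_triple_relations q s ++ quartic_relations q s ++
  crossing_relations q s ++ triple_loop_relations q s ++ triple_link_relations q s ++
  double_triple_relations q s.

Definition explicit_exprs : seq (lx * lx) := ltac:(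
  let l := eval cbv [explicit_relations cubic_relations cubic_triple_relations
    quartic_relations crossing_relations triple_loop_relations
    triple_link_relations double_triple_relations cat] in explicit_relations in
  let e := reify_list q s l in exact e).

(** Conversion against the relations as stated certifies the reification, so none of the tactics is
    trusted. *)
Lemma explicitE : explicit_relations =
  [seq (den q (lit s) e.1, den q (lit s) e.2) | e <- explicit_exprs].
Proof. reflexivity. Qed.

End Explicit.

Definition cop (op : bool -> bool -> bool) (c d : code) : code :=
  mkseq (fun i => op (nth false c i) (nth false d i)) 4.

Lemma code_op op (f : {set 'I_4} -> {set 'I_4} -> {set 'I_4}) X Y :
  (forall k, (k \in f X Y) = op (k \in X) (k \in Y)) ->
  code_of (f X Y) = cop op (code_of X) (code_of Y).
Proof.
move=> H; apply: (@eq_from_nth _ false).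
  by rewrite size_map size_enum_ord size_mkseq.
rewrite size_map size_enum_ord => i i4; rewrite nth_mkseq //.
by rewrite -[i]/(val (Ordinal i4)) !nth_code H.
Qed.

Lemma code_card (X : {set 'I_4}) : #|X| = count id (code_of X).
Proof.
by rewrite /code_of count_map -size_filter cardE /enum_mem filter_predT.
Qed.

Definition commx (c d : code) : lx * lx :=
  (Lmul (Lv c) (Lv d), Lmul (Lv d) (Lv c)).

Definition minus (a b : bool) : bool := a && ~~ b.

Definition qcommx (c d : code) : lx * lx :=
  let i := cop andb c d in let u := cop orb c d in
  (Ladd (Lmul (Lmul (Lk (Kq 1)) (Lv c)) (Lv d))
        (Lopp (Lmul (Lmul (Lk (Kqi 1)) (Lv d)) (Lv c))),
   Ladd (Lmul (Lk (Kadd (Kq 2) (Kopp (Kqi 2)))) (Lv (cop minus u i)))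
        (Lmul (Lk (Kadd (Kq 1) (Kopp (Kqi 1))))
              (Ladd (Lmul (Lv i) (Lv u))
                    (Lmul (Lv (cop minus c i)) (Lv (cop minus d i)))))).

Definition commuting (c d : code) : bool :=
  [|| count id c == 1, count id c == 4,
      [&& count id c == 2, count id d == 3 & cop minus c d == nseq 4 false],
      (c == [:: true; true; false; false]) && (d == [:: false; false; true; true])
    | (c == [:: false; true; true; false]) && (d == [:: true; false; false; true])]%N.

Definition commpairs : seq (code * code) :=
  [seq p <- [seq (c, d) | c <- codes, d <- codes] | commuting p.1 p.2].

Definition prec (c d : code) : bool :=
  all (fun i => all (fun j => nth false c i && nth false d j ==> (i < j)%N) (iota 0 4))
    (iota 0 4).

Definition qcommtriple (a1 a2 a3 a4 : code) : seq (code * code) :=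
  let u := cop orb in
  [:: (u (u a1 a2) a4, u a2 a3); (u a2 a3, u (u a1 a3) a4);
      (u (u a1 a3) a4, u (u a1 a2) a4)].

Definition qcommpairs : seq (code * code) := undup (flatten
  [seq flatten [seq flatten [seq flatten [seq qcommtriple a1 a2 a3 a4
    | a4 <- codes & [&& prec a1 a4, prec a2 a4 & prec a3 a4]]
    | a3 <- codes & prec a1 a3 && prec a2 a3]
    | a2 <- codes & prec a1 a2]
    | a1 <- codes]).

Fixpoint look (tab : seq (code * seq term)) (c : code) : seq term :=
  if tab is (d, p) :: tab' then if d == c then p else look tab' c
  else lpol (mkseq (nth false c) 4).

Definition ltab : seq (code * seq term) :=
  [seq (c, lpol (mkseq (nth false c) 4)) | c <- codes].

Lemma empty_check :
  nilp (addp (look ltab (nseq 4 false)) (constp [:: (2, 1); (-2, 1)]%Z)).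
Proof. by vm_compute. Qed.

Lemma explicit_check : all (chk (look ltab)) explicit_exprs.
Proof. by vm_compute. Qed.

Lemma loop_comm_check : all (fun p => chk (look ltab) (commx p.1 p.2)) commpairs.
Proof. by vm_compute. Qed.

Lemma loop_qcomm_check : all (fun p => chk (look ltab) (qcommx p.1 p.2)) qcommpairs.
Proof. by vm_compute. Qed.

Lemma lookE c : look ltab c =
  lpol (code_of (cset c)).
Proof.
have -> : code_of (cset c) = mkseq (nth false c) 4.
  apply: (@eq_from_nth _ false); first by rewrite size_map size_enum_ord size_mkseq.
  rewrite size_map size_enum_ord => i i4; rewrite nth_mkseq //.
  by rewrite -[i]/(val (Ordinal i4)) nth_code inE.
by rewrite /ltab; elim: codes => //= d l ->; case: eqP => [->|].
Qed.

Lemma mem_codes_pair c d : c \in codes -> d \in codes ->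
  (c, d) \in [seq (c, d) | c <- codes, d <- codes].
Proof. by move=> cc dc; apply/allpairsP; exists (c, d). Qed.

Lemma prec_code X Y : precedes X Y -> prec (code_of X) (code_of Y).
Proof.
move=> H; apply/allP=> i; rewrite mem_iota => i4.
apply/allP=> j; rewrite mem_iota => j4; apply/implyP.
rewrite -[i]/(val (Ordinal i4)) -[j]/(val (Ordinal j4)) !nth_code => /andP[].
exact: H.
Qed.

Lemma commpairsP c d : c \in codes -> d \in codes -> commuting c d ->
  (c, d) \in commpairs.
Proof. by move=> cc dc cd; rewrite /commpairs mem_filter cd; exact: mem_codes_pair. Qed.

Lemma qcommpairsP a1 a2 a3 a4 p : a1 \in codes -> a2 \in codes -> a3 \in codes ->
  a4 \in codes -> prec a1 a2 -> prec a1 a3 -> prec a1 a4 -> prec a2 a3 ->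
  prec a2 a4 -> prec a3 a4 -> p \in qcommtriple a1 a2 a3 a4 -> p \in qcommpairs.
Proof.
move=> c1 c2 c3 c4 p12 p13 p14 p23 p24 p34 pp; rewrite /qcommpairs mem_undup.
apply/flatten_mapP; exists a1 => //.
apply/flatten_mapP; exists a2; first by rewrite mem_filter p12.
apply/flatten_mapP; exists a3; first by rewrite mem_filter p13 p23.
by apply/flatten_mapP; exists a4; first by rewrite mem_filter p14 p24 p34.
Qed.

Lemma lcode i : (i < 15)%N -> code_of (nth finset.set0 lsets i) = nth [::] lcodes i.
Proof.
move=> i15; rewrite lsetsE (nth_map [::]) // csetK //.
have : all (fun c => c \in codes) lcodes by [].
by move=> /allP; apply; apply: mem_nth.
Qed.

Lemma code_of0 : code_of finset.set0 = nseq 4 false.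
Proof.
apply: (@eq_from_nth _ false); first by rewrite size_map size_enum_ord.
rewrite size_map size_enum_ord => i i4.
by rewrite -[i]/(val (Ordinal i4)) nth_code nth_nseq inE if_same.
Qed.

Lemma code12 : code_of [set p1; p2]%SET = [:: true; true; false; false].
Proof. exact: (lcode (i := 4)). Qed.
Lemma code34 : code_of [set p3; p4]%SET = [:: false; false; true; true].
Proof. exact: (lcode (i := 9)). Qed.
Lemma code23 : code_of [set p2; p3]%SET = [:: false; true; true; false].
Proof. exact: (lcode (i := 7)). Qed.
Lemma code14 : code_of [set p1; p4]%SET = [:: true; false; false; true].
Proof. exact: (lcode (i := 6)). Qed.

Lemma code_csetE c : code_of (cset c) = mkseq (nth false c) 4.
Proof.
apply: (@eq_from_nth _ false); first by rewrite size_map size_enum_ord size_mkseq.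
rewrite size_map size_enum_ord => i i4; rewrite nth_mkseq //.
by rewrite -[i]/(val (Ordinal i4)) nth_code inE.
Qed.

Opaque chk ltab look lpol zpol leval pval explicit_exprs commpairs qcommpairs
  cubic_relations cubic_triple_relations quartic_relations crossing_relations
  triple_loop_relations triple_link_relations double_triple_relations.

Lemma mem_catl (T : eqType) (a b : seq T) x : x \in a -> x \in a ++ b.
Proof. by rewrite mem_cat => ->. Qed.

Lemma mem_catr (T : eqType) (a b : seq T) x : x \in b -> x \in a ++ b.
Proof. by rewrite mem_cat orbC => ->. Qed.

Lemma all_map_mem (T : Type) (U : eqType) (f : T -> U) (P : pred T) (Q : U -> Prop) l :
  (forall e, P e -> Q (f e)) -> all P l -> forall x, x \in map f l -> Q x.
Proof.
move=> PQ; elim: l => //= e l IH /andP[Pe Pl] x; rewrite inE.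
by case/predU1P => [->|]; [exact: PQ | exact: IH].
Qed.

(* [good] stands for a test of relations by computation in the torus. *)
Section Relations.
Variables (K : fieldType) (q : K) (A : kalgType K) (s : {set 'I_4} -> A).
Variable good : lx * lx -> bool.
Hypothesis s0 : s finset.set0 = - (q + q^-1)%:K.
Hypothesis good_den : forall e, good e ->
  den q (s \o cset) e.1 = den q (s \o cset) e.2.
Hypothesis good_explicit : all good explicit_exprs.
Hypothesis good_comm : all (fun p => good (commx p.1 p.2)) commpairs.
Hypothesis good_qcomm : all (fun p => good (qcommx p.1 p.2)) qcommpairs.
Let g (i : loop_index) : A := s (val i).

Lemma fev_free_loop X : fev g (free_loop q X) = s X.
Proof.
rewrite /free_loop; case: insubP => [i _ <-|]; first by rewrite fev_gen.
by rewrite negbK => /eqP->; rewrite (alghomN (fev_alghom g)) (alghomK (fev_alghom g)).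
Qed.

Let rel_den e : good e ->
  fev g (den q (free_loop q \o cset) e.1) = fev g (den q (free_loop q \o cset) e.2).
Proof.
move=> /good_den E; rewrite !(den_alghom _ _ _ (fev_alghom g)).
rewrite !(den_ext q (s' := s \o cset)) // => c; exact: fev_free_loop.
Qed.

Lemma loop_rel_good l r : loop_rel q (free_loop q) l r -> fev g l = fev g r.
Proof.
move=> lr; have Hc := allP good_comm; have Hq := allP good_qcomm.
have comm X Y : commuting (code_of X) (code_of Y) ->
    fev g (free_loop q X * free_loop q Y) = fev g (free_loop q Y * free_loop q X).
  move=> cXY; have m := commpairsP (code_of_in X) (code_of_in Y) cXY.
  by have := rel_den (Hc _ m); rewrite /= !code_ofK.
have expl : (l, r) \in explicit_relations q (free_loop q) -> fev g l = fev g r.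
  rewrite explicitE => m; apply: (all_map_mem (Q := fun x => fev g x.1 = fev g x.2) _ good_explicit m) => e ce.
  by rewrite /= !(den_ext q _ (litE (free_loop q))); exact: rel_den.
have sd X Y : code_of (X :\: Y)%SET = cop minus (code_of X) (code_of Y).
  by apply: (@code_op minus (fun X Y => X :\: Y)%SET) => k; rewrite inE andbC.
have si X Y : code_of (X :&: Y)%SET = cop andb (code_of X) (code_of Y).
  by apply: (@code_op andb (fun X Y => X :&: Y)%SET) => k; rewrite inE.
have su X Y : code_of (X :|: Y)%SET = cop orb (code_of X) (code_of Y).
  by apply: (@code_op orb (fun X Y => X :|: Y)%SET) => k; rewrite inE.
have qcomm X Y : (code_of X, code_of Y) \in qcommpairs ->
    fev g (q%:K * free_loop q X * free_loop q Y - (q^-1)%:K * free_loop q Y * free_loop q X) =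
    fev g ((q ^+ 2 - q ^- 2)%:K * free_loop q ((X :|: Y) :\: (X :&: Y))%SET
       + (q - q^-1)%:K * (free_loop q (X :&: Y)%SET * free_loop q (X :|: Y)%SET
            + free_loop q (X :\: (X :&: Y))%SET * free_loop q (Y :\: (X :&: Y))%SET)).
  move=> /Hq /rel_den; rewrite /qcommx /=.
  by rewrite -!si -!su -!sd !code_ofK.
move: expl; case: l r / lr => [X Y cX Y0|X Y cX cY XY|||A1 A2 A3 A4 X Y H12 H13 H14 H23 H24 H34 H
   |l r m|l r m|l r m|l r m|l r m|l r m|l r m] expl.
- by apply: comm; rewrite /commuting -!code_card; case/orP: cX => ->; rewrite ?orbT.
- apply: comm; rewrite /commuting -!code_card cX cY -sd.
  move: XY; rewrite -finset.setD_eq0 => /eqP->.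
  by rewrite code_of0 eqxx !eqxx orbT.
- by apply: comm; rewrite code12 code34.
- by apply: comm; rewrite code23 code14.
- apply: qcomm; have m : (code_of X, code_of Y) \in
      qcommtriple (code_of A1) (code_of A2) (code_of A3) (code_of A4).
    rewrite /qcommtriple -!su; case: H => -[-> ->]; rewrite inE; apply/orP.
    - by left.
    - by right; rewrite inE; apply/orP; left.
    - by right; rewrite inE; apply/orP; right; rewrite inE.
  exact: (qcommpairsP (code_of_in A1) (code_of_in A2) (code_of_in A3) (code_of_in A4)
    (prec_code H12) (prec_code H13) (prec_code H14) (prec_code H23) (prec_code H24)
    (prec_code H34) m).
- exact: expl (mem_catl _ m).
- exact: expl (mem_catr _ (mem_catl _ m)).
- exact: expl (mem_catr _ (mem_catr _ (mem_catl _ m))).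
- exact: expl (mem_catr _ (mem_catr _ (mem_catr _ (mem_catl _ m)))).
- exact: expl (mem_catr _ (mem_catr _ (mem_catr _ (mem_catr _ (mem_catl _ m))))).
- exact: expl (mem_catr _ (mem_catr _ (mem_catr _ (mem_catr _ (mem_catr _ (mem_catl _ m)))))).
- exact: expl (mem_catr _ (mem_catr _ (mem_catr _ (mem_catr _ (mem_catr _ (mem_catr _ m)))))).
Qed.

End Relations.

Lemma kopX (K : fieldType) (A : kalgType K) (x : A) n : (x : kop A) ^+ n = x ^+ n :> A.
Proof. by elim: n => // n IH; rewrite [RHS]exprSr -IH; exact: (exprS (x : kop A) n). Qed.

(** * The morphism from the presented algebra to the skein algebra *)

Section Phi.
Variables (K : fieldType) (h : K).
Hypothesis h0 : h != 0.
Notation torus := (torus K).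
Notation Sk := (Sk h).
Notation q := (h ^+ 2).

Lemma theta0_loop X : theta0 h0 (sk_loop h X) = pev h (lpol (code_of X)).
Proof.
by rewrite /sk_loop -skwE theta0_skw ?loop_wordP // zpolE // -loop_wordE.
Qed.

Lemma lpol_empty : pev h (lpol (nseq 4 false)) = - (q + q^-1)%:K.
Proof.
have /nilP e := empty_check.
have q2 : q + q^-1 = sev h [:: (2, 1); (-2, 1)]%Z.
  by rewrite /sev big_cons big_seq1 /= !mul1r.
have -> : lpol (nseq 4 false) = look ltab (nseq 4 false) by rewrite lookE csetK.
 have := pev_addp h (look ltab (nseq 4 false))
  (constp [:: (2, 1); (-2, 1)]%Z).
rewrite e -(pev_const q2) {1}/pev big_nil => /esym/eqP.
by rewrite addr_eq0 => /eqP->.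
Qed.

Lemma sk_loop0 : sk_loop h finset.set0 = - (q + q^-1)%:K.
Proof.
apply: (theta0_inj (h0 := h0)); rewrite theta0_loop code_of0 lpol_empty //.
by rewrite (alghomN (theta0_alghom h0)) (alghomK (theta0_alghom h0)).
Qed.

Lemma chk_den e : chk (look ltab) e ->
  den q (sk_loop h \o cset) e.1 = den q (sk_loop h \o cset) e.2.
Proof.
move=> ce; apply: (@theta0_veq _ _ h0).
have E x : theta0 h0 (den q (sk_loop h \o cset) x) = den q
   (fun c => pev h (look ltab c) : kop torus) x.
  by rewrite (den_alghom _ _ _ (theta0_alghom h0)); apply: den_ext => c; rewrite lookE -theta0_loop.
by have := chkP h0 ce; rewrite -!E.
Qed.

Lemma phi_ex : exists2 phi : loop_presentation q -> Sk, alghom phi &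
  forall i, phi (loop_gen q i) = sk_loop h (val i).
Proof.
apply: (presalg_hom (g := fun i => sk_loop h (val i))) => l r lr.
exact: (loop_rel_good sk_loop0 chk_den explicit_check loop_comm_check loop_qcomm_check lr).
Qed.

(** * The relations with the punctures in reverse order *)

Fixpoint erev (e : lx) : lx :=
  match e with
  | Lv c => Lv (rev (mkseq (nth false c) 4))
  | Lk k => Lk k
  | Ladd a b => Ladd (erev a) (erev b)
  | Lopp a => Lopp (erev a)
  | Lmul a b => Lmul (erev b) (erev a)
  | Lexp a n => Lexp (erev a) n
  end.

Definition chk_rev (e : lx * lx) : bool := chk (look ltab) (erev e.1, erev e.2).

Lemma explicit_check_rev : all chk_rev explicit_exprs.
Proof. by vm_compute. Qed.

Lemma loop_comm_check_rev : all (fun p => chk_rev (commx p.1 p.2)) commpairs.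
Proof. by vm_compute. Qed.

Lemma loop_qcomm_check_rev : all (fun p => chk_rev (qcommx p.1 p.2)) qcommpairs.
Proof. by vm_compute. Qed.

Definition rset (X : {set 'I_4}) : {set 'I_4} := cset (rev (code_of X)).

Lemma rsetK : involutive rset.
Proof.
move=> X; rewrite /rset csetK ?revK ?code_ofK //.
by apply: states_mem; rewrite size_rev; exact: codes_size (code_of_in X).
Qed.

Lemma rset0 : rset finset.set0 = finset.set0.
Proof. by rewrite -[RHS]code_ofK /rset code_of0. Qed.

Lemma chk_rev_den e : chk_rev e ->
  den (A := kop Sk) q (sk_loop h \o rset \o cset) e.1 =
  den (A := kop Sk) q (sk_loop h \o rset \o cset) e.2.
Proof.
have E x : den (A := kop Sk) q (sk_loop h \o rset \o cset) x =
    den q (sk_loop h \o cset) (erev x).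
  elim: x => [c|k|a IHa b IHb|a IHa|a IHa b IHb|a IHa n].
  - rewrite /= /rset; congr (sk_loop h (cset (rev _))).
    exact: code_csetE.
  - by [].
  - by rewrite /= -IHa -IHb.
  - by rewrite /= -IHa.
  - by rewrite /= -IHa -IHb.
  - by rewrite /= -IHa kopX.
by move=> /chk_den; rewrite !E.
Qed.

(** Reversing both the punctures and the products turns each relation into an identity that is again
    checked in the torus; the symmetry is thus obtained without describing it on diagrams. *)
Lemma phi_rev_ex : exists2 phi : loop_presentation q -> kop Sk, alghom phi &
  forall i, phi (loop_gen q i) = sk_loop h (rset (val i)).
Proof.
apply: (presalg_hom (g := fun i => sk_loop h (rset (val i)) : kop Sk)) => l r lr.
apply: (loop_rel_good _ chk_rev_den explicit_check_rev loop_comm_check_rev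
  loop_qcomm_check_rev lr).
by rewrite /= rset0; exact: sk_loop0.
Qed.

End Phi.

Transparent chk ltab look lpol zpol leval pval explicit_exprs commpairs qcommpairs
  cubic_relations cubic_triple_relations quartic_relations crossing_relations
  triple_loop_relations triple_link_relations double_triple_relations.

(** * A spanning set of the algebra presented by the loop relations *)

Fixpoint lets (e : lx) : seq code :=
  match e with
  | Lv c => [:: c]
  | Lmul a b => lets a ++ lets b
  | _ => [::]
  end.

Fixpoint pure (e : lx) : bool :=
  match e with Lv _ => true | Lmul a b => pure a && pure b | _ => false end.

(* With these weights, every relation expresses its left-hand side by products
   of smaller weight, up to the order of the factors. *)
Definition wl (c : code) : nat :=
  nth 0 [:: 0; 0; 0; 0; 4; 7; 4; 4; 7; 4; 7; 7; 7; 7; 4]%N (index c lcodes).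
Definition wtw (w : seq code) : nat := sumn (map wl w).

Fixpoint wtb (e : lx) : nat :=
  match e with
  | Lv c => wl c
  | Lk _ => 0
  | Ladd a b => maxn (wtb a) (wtb b)
  | Lopp a => wtb a
  | Lmul a b => wtb a + wtb b
  | Lexp a n => n * wtb a
  end.

Fixpoint okv (e : lx) : bool :=
  match e with
  | Lv c => (c \in lcodes) || (c == nseq 4 false)
  | Lk _ => true
  | Ladd a b | Lmul a b => okv a && okv b
  | Lopp a | Lexp a _ => okv a
  end.

(** The left-hand sides of the explicit relations are products of distinct loops; a set of loops is
    a face when it contains none of them. *)
Definition nonfaces : seq (seq code) := [seq lets e.1 | e <- explicit_exprs].

Lemma explicit_lower : all (fun e => [&& pure e.1, okv e.2,
    (wtb e.2 < wtw (lets e.1))%N, all (mem lcodes) (lets e.1) & uniq (lets e.1)])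
  explicit_exprs.
Proof. by vm_compute. Qed.

Definition qlower (c d : code) : bool :=
  [&& (c, d) \in qcommpairs, okv (qcommx c d).2 & (wtb (qcommx c d).2 < wl c + wl d)%N].

Lemma pairs_check : all (fun a => all (fun b =>
  [|| (a == b) || commuting a b, commuting b a, qlower a b, qlower b a
    | [:: a; b] \in nonfaces]) lcodes) lcodes.
Proof. by vm_compute. Qed.

Definition wof (m : seq nat) : seq code :=
  flatten [seq nseq (nth 0 m (index c lcodes)) c | c <- lcodes].
Definition face (m : seq nat) : bool :=
  all (has (fun c => nth 0 m (index c lcodes) == 0)) nonfaces.

Lemma count_nseqs (T : eqType) (f : T -> nat) l c : uniq l ->
  count_mem c (flatten [seq nseq (f x) x | x <- l]) = if c \in l then f c else 0%N.
Proof.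
elim: l => //= x l IH /andP[xl ul]; rewrite count_cat count_nseq IH // inE /= [x == c]eq_sym.
case: (altP (c =P x)) => [->|_]; first by rewrite (negPf xl) mul1n addn0.
by rewrite mul0n.
Qed.

Lemma perm_submultiset (T : eqType) (u w : seq T) : uniq u -> {subset u <= w} ->
  exists r, perm_eq w (u ++ r).
Proof.
elim: u w => [|x u IH] w; first by exists w.
move=> /= /andP[xu uu] xw; have xi : x \in w by apply: xw; exact: mem_head.
case/splitPr: xi xw => v1 v2 xw.
have [|r p] := IH (v1 ++ v2) uu.
  move=> y yu; have := xw y; rewrite !inE yu orbT mem_cat inE => /(_ isT).
  by rewrite mem_cat; case: (y =P x) => // e; rewrite -e yu in xu.
exists r; rewrite -cat1s perm_catCA /= perm_cons; apply: perm_trans p _.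
by rewrite perm_refl.
Qed.

Section Span.
Variables (K : fieldType) (q : K) (A : kalgType K) (s : code -> A).
Hypothesis q0 : q != 0.
Hypothesis s0 : s (nseq 4 false) = (- (q + q^-1))%:K.
Hypothesis HE : forall i, (i < size explicit_exprs)%N ->
  let e := nth (Lk (Knat 0), Lk (Knat 0)) explicit_exprs i in den q s e.1 = den q s e.2.
Hypothesis HC : forall c d, c \in lcodes -> d \in lcodes -> commuting c d -> s c * s d = s d * s c.
Hypothesis HQ : forall c d, (c, d) \in qcommpairs ->
  den q s (qcommx c d).1 = den q s (qcommx c d).2.

Definition wmon (w : seq code) : A := \prod_(c <- w) s c.

Definition low (n : nat) : A -> Prop := lspan (fun x => exists w,
  [/\ all (mem lcodes) w, (wtw w < n)%N & x = wmon w]).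

Lemma wmon_cat u v : wmon (u ++ v) = wmon u * wmon v.
Proof. exact: big_cat. Qed.

Lemma wtw_cat u v : wtw (u ++ v) = (wtw u + wtw v)%N.
Proof. by rewrite /wtw map_cat sumn_cat. Qed.

Lemma lowW m n x : (m <= n)%N -> low m x -> low n x.
Proof.
move=> mn; apply: lspanW => _ [w [aw lw ->]]; apply: lspan_in.
by exists w; split=> //; exact: leq_trans mn.
Qed.

Lemma lowM m n x y : low m.+1 x -> low n y -> low (m + n) (x * y).
Proof.
apply: lspanM => _ _ [u [au lu ->]] [v [av lv ->]]; apply: lspan_in.
by exists (u ++ v); rewrite all_cat au av wtw_cat wmon_cat; split=> //; lia.
Qed.

Lemma lowMr m n x y : low m x -> low n.+1 y -> low (m + n) (x * y).
Proof.
apply: lspanM => _ _ [u [au lu ->]] [v [av lv ->]]; apply: lspan_in.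
by exists (u ++ v); rewrite all_cat au av wtw_cat wmon_cat; split=> //; lia.
Qed.

Lemma low_word w : all (mem lcodes) w -> low (wtw w).+1 (wmon w).
Proof. by move=> aw; apply: lspan_in; exists w. Qed.

Lemma low_letter c : c \in lcodes -> low (wl c).+1 (s c).
Proof.
move=> cl; have := @low_word [:: c]; rewrite /= cl => /(_ isT).
by rewrite /wmon big_seq1 /wtw /= addn0.
Qed.

Lemma low_scal a : low 1 a%:K.
Proof.
rewrite -[_%:K]mulr1; apply: lspanZ; apply: lspan_in; exists [::].
by rewrite /wmon big_nil.
Qed.

Lemma low_den e : okv e -> low (wtb e).+1 (den q s e).
Proof.
elim: e => [c|k|a IHa b IHb|a IHa|a IHa b IHb|a IHa n] /=.
- case/orP=> [|/eqP->]; first exact: low_letter.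
  by rewrite s0; apply: lowW (low_scal _).
- by move=> _; exact: low_scal.
- move=> /andP[/IHa la /IHb lb]; apply: lspanD.
    by apply: lowW la; lia.
  by apply: lowW lb; lia.
- by move=> /IHa; exact: lspanN.
- by move=> /andP[/IHa la /IHb lb]; rewrite -addnS; exact: lowM.
- move=> /IHa la; elim: n => [|n IH]; first by rewrite expr0 -(kscal1 (s := A)); exact: low_scal.
  by rewrite exprS mulSn -addnS; exact: lowM.
Qed.

Lemma den_pure e : pure e -> den q s e = wmon (lets e).
Proof.
elim: e => //= [c _|a IHa b IHb /andP[pa pb]]; first by rewrite /wmon big_seq1.
by rewrite wmon_cat IHa ?IHb.
Qed.

Lemma nonfaceP nf : nf \in nonfaces ->
  [/\ low (wtw nf) (wmon nf), all (mem lcodes) nf & uniq nf].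
Proof.
move=> /(nthP [::])[i]; rewrite size_map => ie.
rewrite (nth_map (Lk (Knat 0), Lk (Knat 0))) // => <-.
have /(all_nthP (Lk (Knat 0), Lk (Knat 0)))/(_ i ie)/and5P[pe oe lt al un] := explicit_lower.
split=> //; rewrite -den_pure // HE //; apply: lowW (low_den oe).
exact: lt.
Qed.

(** A commutator relation exchanges the factors up to q^-2 or q^2 and lighter terms, according to
    the order in which it lists them. If the pair is a nonface, the product itself is lighter and
    the scalar 0 serves. *)
Lemma swap_low a b : a \in lcodes -> b \in lcodes ->
  exists c, low (wl a + wl b) (s a * s b - c%:K * (s b * s a)).
Proof.
move=> al bl; have /allP/(_ a al)/allP/(_ b bl)/or4P[] := pairs_check.
- move=> ab; exists 1; rewrite kscal1 mul1r.
  have -> : s a * s b = s b * s a by case/predU1P: ab => [->|/HC->].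
  by rewrite subrr; exact: lspan0.
- move=> ba; exists 1; rewrite kscal1 mul1r (HC bl al) // subrr; exact: lspan0.
- case/and3P=> ab ok lt; exists (q^-1 * q^-1).
  have -> : s a * s b - (q^-1 * q^-1)%:K * (s b * s a) =
    (q^-1)%:K * den q s (qcommx a b).1.
    by rewrite /= mulrBr -!mulrA ![(q^-1)%:K * (_%:K * _)]mulrA -!kscalM mulVf // kscal1 mul1r.
  by rewrite HQ //; apply: lspanZ; apply: lowW (low_den ok).
case/orP.
  case/and3P=> ab ok lt; exists (q * q).
  have -> : s a * s b - (q * q)%:K * (s b * s a) =
    (- q)%:K * den q s (qcommx b a).1.
    rewrite /= mulrBr -!mulrA ![(- q)%:K * (_%:K * _)]mulrA -!kscalM !mulNr divff //.
    by rewrite !kscalN kscal1 !mulNr mul1r opprK [RHS]addrC.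
  by rewrite HQ //; apply: lspanZ; apply: lowW (low_den ok); rewrite addnC.
move=> /nonfaceP[l _ _]; exists 0; rewrite kscal0 mul0r subr0.
by move: l; rewrite /wmon big_cons big_seq1 /wtw /= addn0.
Qed.

(** The scalar may be 0, so this is not a symmetric relation: w reduces to w' modulo lighter
    words. *)
Definition same (w w' : seq code) : Prop := exists c, low (wtw w) (wmon w - c%:K * wmon w').

Lemma same_refl w : same w w.
Proof. by exists 1; rewrite kscal1 mul1r subrr; exact: lspan0. Qed.

Lemma same_trans w1 w2 w3 : wtw w1 = wtw w2 -> same w1 w2 -> same w2 w3 -> same w1 w3.
Proof.
move=> e [a la] [b lb]; exists (a * b).
rewrite -(subrK (a%:K * wmon w2) (wmon w1)) -addrA kscalM -mulrA -mulrBr.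
by apply: lspanD => //; apply: lspanZ; rewrite e.
Qed.

Lemma same_cons x w w' : x \in lcodes -> same w w' -> same (x :: w) (x :: w').
Proof.
move=> xl [a la]; exists a; rewrite /wmon !big_cons -!/(wmon _).
rewrite [_%:K * _]mulrA kscalC -mulrA -mulrBr /wtw /=.
by apply: lowM la; exact: low_letter.
Qed.

Lemma same_front u a v : all (mem lcodes) (u ++ a :: v) ->
  same (u ++ a :: v) (a :: u ++ v).
Proof.
elim: u => [|x u IH] /=; first by move=> _; exact: same_refl.
move=> /andP[xl auv]; have [av al uvl] : [/\ all (mem lcodes) (u ++ a :: v), a \in lcodes & all (mem lcodes) (u ++ v)].
  by move: (auv); rewrite !all_cat /= => /and3P[-> -> ->].
apply: (same_trans _ (same_cons xl (IH av))).
  by rewrite /wtw /= !map_cat !sumn_cat /=; lia.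
have [c lc] := swap_low xl al; exists c.
have -> : wmon [:: x, a & u ++ v] - c%:K * wmon [:: a, x & u ++ v] =
    (s x * s a - c%:K * (s a * s x)) * wmon (u ++ v).
  by rewrite /wmon !big_cons mulrBl !mulrA.
rewrite (_ : wtw [:: x, a & u ++ v] = wl x + wl a + wtw (u ++ v))%N; last first.
  by rewrite /wtw /= addnA.
by apply: lowMr lc _; exact: low_word.
Qed.

Lemma wtw_perm w w' : perm_eq w w' -> wtw w = wtw w'.
Proof. by move=> p; apply: perm_sumn; exact: perm_map. Qed.

Lemma same_perm w w' : perm_eq w w' -> all (mem lcodes) w -> same w w'.
Proof.
elim: w' w => [|a t IH] w; first by move=> /perm_nilP->; move=> _; exact: same_refl.
move=> p aw; have ai : a \in w by rewrite (perm_mem p) mem_head.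
case/splitPr: ai p aw => u v p aw.
have p' : perm_eq (u ++ v) t.
  by move: p; rewrite -cat1s perm_catCA /= perm_cons.
have al : a \in lcodes by move: aw; rewrite all_cat /= => /and3P[].
have uvl : all (mem lcodes) (u ++ v) by move: aw; rewrite !all_cat /= => /and3P[-> _ ->].
apply: same_trans (same_front aw) (same_cons al (IH _ p' uvl)).
by apply: wtw_perm; rewrite -cat1s perm_catCA.
Qed.

(** Induction on the weight. Reordering a word costs only lighter words; if its letters contain a
    nonface, these are brought to the front, where the relation with that left-hand side replaces
    them by lighter terms. *)
Lemma span_word n w : all (mem lcodes) w -> (wtw w < n)%N ->
  lspan (fun y => exists m, (size m == 15%N) && face m /\ y = wmon (wof m)) (wmon w).
Proof.
elim: n w => // n IH w aw wn.
have L x : low (wtw w) x ->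
    lspan (fun y => exists m, (size m == 15%N) && face m /\ y = wmon (wof m)) x.
  by apply: lspanW => _ [w' [aw' lw' ->]]; apply: IH => //; lia.
have step w' : perm_eq w w' ->
    lspan (fun y => exists m, (size m == 15%N) && face m /\ y = wmon (wof m)) (wmon w') ->
    lspan (fun y => exists m, (size m == 15%N) && face m /\ y = wmon (wof m)) (wmon w).
  move=> p l; have [c lc] := same_perm p aw.
  rewrite -(subrK (c%:K * wmon w') (wmon w)); apply: lspanD; first exact: L.
  exact: lspanZ.
pose m := [seq count_mem c w | c <- lcodes].
have ul : uniq lcodes by [].
have mE c : c \in lcodes -> nth 0%N m (index c lcodes) = count_mem c w.
  by move=> cl; rewrite (nth_map [::]) ?index_mem // nth_index.
have p : perm_eq w (wof m).
  apply/allP => c _ /=; rewrite /wof (count_nseqs _ _ ul); case: ifP => cl; rewrite ?mE //.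
  by apply/eqP/count_memPn; apply/negP => cw; have := allP aw c cw; rewrite /= cl.
case: (boolP (face m)) => fm.
  by apply: step p _; apply: lspan_in; exists m; rewrite fm.
have /allPn[nf nfn /hasPn hn] : ~~ all (has (fun c => nth 0%N m (index c lcodes) == 0%N)) nonfaces := fm.
have [lnf anf unf] := nonfaceP nfn.
have [|r pr] := @perm_submultiset _ nf w unf.
  move=> c cn; have := hn c cn; rewrite mE; last exact: (allP anf).
  by rewrite -lt0n -has_count has_pred1.
apply: (step _ pr); rewrite wmon_cat; apply: L; rewrite (wtw_perm pr) wtw_cat.
apply: lowMr lnf _; apply: low_word.
by apply/allP => c cr; apply: (allP aw); rewrite (perm_mem pr) mem_cat cr orbT.
Qed.

Lemma span_faces x : gens (fun y => exists2 c, c \in lcodes & y = s c) x ->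
  lspan (fun y => exists m, (size m == 15%N) && face m /\ y = wmon (wof m)) x.
Proof.
move=> gx; have : lspan (fun y => exists2 w, all (mem lcodes) w & y = wmon w) x.
  apply: gens_lspan gx.
    by apply: lspan_in; exists [::]; rewrite // /wmon big_nil.
  move=> _ _ [c cl ->] [w aw ->]; apply: lspan_in; exists (c :: w).
    by rewrite /= cl.
  by rewrite /wmon big_cons.
by apply: lspanW => _ [w aw ->]; exact: (@span_word (wtw w).+1).
Qed.

End Span.

(** * Leading monomials of the spanning set *)

Fixpoint ldot (c l : seq Z) : Z :=
  match c, l with
  | a :: c', b :: l' => (a * b + ldot c' l')%Z
  | _, _ => 0%Z
  end.

Lemma ldotE c l : ldot c l = vdot c (vec l).
Proof.
have z n : vdot n (fun=> 0%Z) = 0%Z.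
  by elim: n => // d n IHn; rewrite /vdot /= -/(vdot _ _) IHn; lia.
elim: c l => [|a c IH] [|b l] //; last by rewrite /= IH.
have -> : vec [::] = fun=> 0%Z by apply: funext => i; rewrite /vec nth_nil.
by rewrite z.
Qed.

Definition unit_coef (t : term) : bool := Z.eqb t.2 1 || Z.eqb t.2 (-1).

Definition leadok (c : seq Z) (v : seq Z) (p : seq term) : bool :=
  all (fun t => (t.1.1 == v) || Z.ltb (ldot c t.1.1) (ldot c v)) p &&
  (if [seq t <- p | t.1.1 == v] is [:: t] then unit_coef t else false).

Section LeadOk.
Variables (K : fieldType) (h : K).
Hypothesis h0 : h != 0.

Lemma leadokP c v p : leadok c v p -> tlead h c (pev h p) (vec v).
Proof.
move=> /andP[/allP lo]; case ef: [seq _ <- _ | _] => [|t [|? ?]] // ut.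
rewrite /pev (bigID (fun t => t.1.1 == v)) /= -big_filter ef big_seq1.
have tv : t.1.1 = v.
  have : t \in [seq t <- p | t.1.1 == v] by rewrite ef mem_head.
  by rewrite mem_filter => /andP[/eqP].
apply: tleadD.
  rewrite -tv; apply: tlead_mon; rewrite mulf_neq0 ?hz_neq0 //.
  by case/orP: ut => /Z.eqb_eq ->; rewrite /zk /= ?oppr_eq0 oner_eq0.
rewrite big_seq_cond; apply: lspan_sum => u /andP[up /negPf uv].
apply: lspanZ; apply: tfil_mon => //; have := lo u up; rewrite uv !ldotE => /Z.ltb_lt lt.
exact: (proj1 (Z.lt_le_pred _ _) lt).
Qed.

End LeadOk.

(** For this weight the state sum of each loop has exactly one heaviest term, with coefficient 1 or
    -1 up to a power of h; its exponents are in [lvecs]. *)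
Definition wsr : seq Z := [:: 512; -20; 320; 512; 624; 320; 512; 1279; 320; 512; 1920; 320]%Z.

(** The leading monomial of s_A is Lambda_i if A = {i}. If A has at least two elements, with minimum
    i and maximum j, it is F_i^-1 F_j K_j times K_m^-1 for each m strictly between i and j outside
    A, up to the order of the factors. *)
Definition lvecs : seq (seq Z) := ([::
  [:: 1; 0; 0; 0; 0; 0; 0; 0; 0; 0; 0; 0]; [:: 0; 0; 0; 1; 0; 0; 0; 0; 0; 0; 0; 0];
  [:: 0; 0; 0; 0; 0; 0; 1; 0; 0; 0; 0; 0]; [:: 0; 0; 0; 0; 0; 0; 0; 0; 0; 1; 0; 0];
  [:: 0; -1; 0; 0; 1; 2; 0; 0; 0; 0; 0; 0]; [:: 0; -1; 0; 0; 0; -2; 0; 1; 2; 0; 0; 0];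
  [:: 0; -1; 0; 0; 0; -2; 0; 0; -2; 0; 1; 2]; [:: 0; 0; 0; 0; -1; 0; 0; 1; 2; 0; 0; 0];
  [:: 0; 0; 0; 0; -1; 0; 0; 0; -2; 0; 1; 2]; [:: 0; 0; 0; 0; 0; 0; 0; -1; 0; 0; 1; 2];
  [:: 0; -1; 0; 0; 0; 0; 0; 1; 2; 0; 0; 0]; [:: 0; -1; 0; 0; 0; 0; 0; 0; -2; 0; 1; 2];
  [:: 0; -1; 0; 0; 0; -2; 0; 0; 0; 0; 1; 2]; [:: 0; 0; 0; 0; -1; 0; 0; 0; 0; 0; 1; 2];
  [:: 0; -1; 0; 0; 0; 0; 0; 0; 0; 0; 1; 2]])%Z.

Definition lvec (c : code) : seq Z := nth [::] lvecs (index c lcodes).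

Lemma lvec_check : all (fun c => leadok wsr (lvec c) (lpol c)) lcodes.
Proof. by vm_compute. Qed.

Definition wlead (w : seq code) : nat -> Z := foldr (fun c => vadd (vec (lvec c))) (fun=> 0%Z) w.

Lemma wlead_cat u v : wlead (u ++ v) = vadd (wlead u) (wlead v).
Proof. by elim: u => //= c u ->; rewrite vaddA. Qed.

Lemma wlead_nseq n c i : wlead (nseq n c) i = (Z.of_nat n * nth 0%Z (lvec c) i)%Z.
Proof.
elim: n => [|n IH]; first by [].
by rewrite Nat2Z.inj_succ Z.mul_succ_l /= /vadd IH /vec; lia.
Qed.

Definition zsum (s : seq Z) : Z := foldr Z.add 0%Z s.

Lemma wlead_wof m i : wlead (wof m) i =
  zsum [seq (Z.of_nat (nth 0%N m j) * nth 0%Z (nth [::] lvecs j) i)%Z | j <- iota 0 15].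
Proof.
have -> : iota 0 15 = [seq index c lcodes | c <- lcodes] by [].
rewrite -map_comp /wof.
have G l : wlead (flatten [seq nseq (nth 0%N m (index c lcodes)) c | c <- l]) i =
    zsum [seq ((fun j => (Z.of_nat (nth 0%N m j) * nth 0%Z (nth [::] lvecs j) i)%Z)
      \o index^~ lcodes) c | c <- l].
  by elim: l => //= c l IH; rewrite wlead_cat /vadd IH wlead_nseq.
exact: G.
Qed.

(** Positions in [lcodes]: 4 to 9 are the loops around two punctures, 10 to 13 those around three.
    The central loops, at 0 to 3 and 14, belong to every facet and are left out. *)
Definition facets : seq (seq nat) := ([::
  [:: 4; 5; 6; 10]; [:: 4; 5; 6; 12]; [:: 4; 5; 9; 10]; [:: 4; 5; 9; 12];
  [:: 4; 6; 7; 10]; [:: 4; 6; 7; 11]; [:: 4; 6; 9; 11]; [:: 4; 6; 9; 12];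
  [:: 4; 7; 8; 11]; [:: 4; 7; 8; 13]; [:: 4; 7; 9; 10]; [:: 4; 7; 9; 13];
  [:: 4; 8; 9; 11]; [:: 4; 8; 9; 13]; [:: 5; 6; 7; 10]; [:: 5; 6; 7; 12];
  [:: 5; 7; 9; 10]; [:: 5; 7; 9; 12]; [:: 6; 7; 8; 11]; [:: 6; 7; 8; 13];
  [:: 6; 7; 9; 12]; [:: 6; 7; 9; 13]; [:: 6; 8; 9; 11]; [:: 6; 8; 9; 13]])%N.

(* The support of a face is contained in a facet together with the central
   loops. *)
Lemma facets_check : all (fun b =>
  all (has (fun c => ~~ nth false b (index c lcodes - 4))) nonfaces ==>
  has (fun f => all (fun j => nth false b j ==> (j + 4 \in f)%N) (iota 0 10)) facets)
  (states 10).
Proof. by vm_compute. Qed.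

Lemma nonfaces_noncentral : all (all (fun c => 4 <= index c lcodes < 14)%N) nonfaces.
Proof. by vm_compute. Qed.

Lemma face_facet m : face m ->
  has (fun f => all (fun j => (j \in f) || (nth 0%N m j == 0%N)) (iota 4 10)) facets.
Proof.
move=> fm; pose b := mkseq (fun j => nth 0%N m (j + 4) != 0%N) 10.
have bi : b \in states 10 by apply: states_mem; rewrite size_mkseq.
have := allP facets_check b bi; have -> : all (has (fun c => ~~ nth false b (index c lcodes - 4))) nonfaces.
  apply/allP => nf nfn; have /hasP[c cn z] := allP fm nf nfn; apply/hasP; exists c => //.
  have /andP[c4 c14] := allP (allP nonfaces_noncentral nf nfn) c cn.
  by rewrite nth_mkseq ?subnK ?z //; lia.
move=> /hasP[f ff H]; apply/hasP; exists f => //; apply/allP => j; rewrite mem_iota => /andP[j4 j14].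
have /(allP H) : (j - 4)%N \in iota 0 10 by rewrite mem_iota; lia.
rewrite nth_mkseq ?subnK //; last lia.
by case: (nth 0%N m j == 0%N); rewrite ?orbT ?orbF.
Qed.

Lemma cofacets_eq : [seq [seq j <- iota 4 10 | j \notin f] | f <- facets] =
  ([:: [:: 7; 8; 9; 11; 12; 13]; [:: 7; 8; 9; 10; 11; 13]; [:: 6; 7; 8; 11; 12; 13]; [:: 6; 7; 8; 10; 11; 13]; [:: 5; 8; 9; 11; 12; 13]; [:: 5; 8; 9; 10; 12; 13]; [:: 5; 7; 8; 10; 12; 13]; [:: 5; 7; 8; 10; 11; 13]; [:: 5; 6; 9; 10; 12; 13]; [:: 5; 6; 9; 10; 11; 12]; [:: 5; 6; 8; 11; 12; 13]; [:: 5; 6; 8; 10; 11; 12]; [:: 5; 6; 7; 10; 12; 13]; [:: 5; 6; 7; 10; 11; 12]; [:: 4; 8; 9; 11; 12; 13]; [:: 4; 8; 9; 10; 11; 13]; [:: 4; 6; 8; 11; 12; 13]; [:: 4; 6; 8; 10; 11; 13]; [:: 4; 5; 9; 10; 12; 13]; [:: 4; 5; 9; 10; 11; 12]; [:: 4; 5; 8; 10; 11; 13]; [:: 4; 5; 8; 10; 11; 12]; [:: 4; 5; 7; 10; 12; 13]; [:: 4; 5; 7; 10; 11; 12]]%N).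
Proof. by []. Qed.

Lemma face_cofacet m : face m ->
  has (all (fun j => nth 0%N m j == 0%N)) [seq [seq j <- iota 4 10 | j \notin f] | f <- facets].
Proof.
move=> /face_facet/hasP[f ff H]; rewrite has_map; apply/hasP; exists f => //.
rewrite -[preim _ _ f]/(all (fun j => nth 0%N m j == 0%N) [seq j <- iota 4 10 | j \notin f]).
apply/allP => j; rewrite mem_filter => /andP[/negPf jf /(allP H)].
by rewrite jf.
Qed.

Ltac split_faces tac :=
  match goal with
  | |- is_true (_ || _) -> _ => case/orP; [split_faces tac | split_faces tac]
  | |- is_true (_ && _) -> _ => case/andP; split_faces tac
  | |- is_true (_ == _) -> _ => let e := fresh in move=> /eqP e; split_faces tac
  | |- is_true true -> _ => move=> _; split_faces tac
  | |- is_true false -> _ => by []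
  | |- _ => tac
  end.

Lemma wlead_inj m m' : size m = 15%N -> size m' = 15%N -> face m -> face m' ->
  wlead (wof m) = wlead (wof m') -> m = m'.
Proof.
move=> sm sm' /face_cofacet fm /face_cofacet fm' e.
have E i : zsum [seq (Z.of_nat (nth 0%N m j) * nth 0%Z (nth [::] lvecs j) i)%Z | j <- iota 0 15] =
  zsum [seq (Z.of_nat (nth 0%N m' j) * nth 0%Z (nth [::] lvecs j) i)%Z | j <- iota 0 15].
  by rewrite -!wlead_wof e.
have E0 := E 0%N; have E1 := E 1%N; have E3 := E 3%N; have E4 := E 4%N.
have E5 := E 5%N; have E6 := E 6%N; have E7 := E 7%N; have E8 := E 8%N.
have E9 := E 9%N; have E10 := E 10%N; have E11 := E 11%N => {E e}.
case: m sm fm E0 E1 E3 E4 E5 E6 E7 E8 E9 E10 E11 => [|m0 [|m1 [|m2 [|m3 [|m4 [|m5 [|m6 [|m7 [|m8 [|m9 [|m10 [|m11 [|m12 [|m13 [|m14 [|? ?]]]]]]]]]]]]]]]] // _ fm.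
case: m' sm' fm' => [|n0 [|n1 [|n2 [|n3 [|n4 [|n5 [|n6 [|n7 [|n8 [|n9 [|n10 [|n11 [|n12 [|n13 [|n14 [|? ?]]]]]]]]]]]]]]]] // _ fm'.
rewrite /zsum /= => E0 E1 E3 E4 E5 E6 E7 E8 E9 E10 E11.
have -> : m0 = n0 by lia.
have -> : m1 = n1 by lia.
have -> : m2 = n2 by lia.
have -> : m3 = n3 by lia.
(* The first four equations count, for each puncture, the loops around it among those with at least
   two punctures inside; [X2] and [X3] compare, up to sign, the exponents of F at punctures 2 and 3.
   For each pair of facets these six equations leave only the trivial solution. *)
have K1 : (m4 + m5 + m6 + m10 + m11 + m12 + m14 = n4 + n5 + n6 + n10 + n11 + n12 + n14)%N by lia.
have K2 : (m4 + m7 + m8 + m10 + m11 + m13 + m14 = n4 + n7 + n8 + n10 + n11 + n13 + n14)%N by lia.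
have K3 : (m5 + m7 + m9 + m10 + m12 + m13 + m14 = n5 + n7 + n9 + n10 + n12 + n13 + n14)%N by lia.
have K4 : (m6 + m8 + m9 + m11 + m12 + m13 + m14 = n6 + n8 + n9 + n11 + n12 + n13 + n14)%N by lia.
have X2 : (m7 + m8 + m13 + n4 = n7 + n8 + n13 + m4)%N by lia.
have X3 : (m9 + n5 + n7 + n10 = n9 + m5 + m7 + m10)%N by lia.
clear E0 E1 E3 E4 E5 E6 E7 E8 E9 E10 E11.
suff [-> [-> [-> [-> [-> [-> [-> [-> [-> [-> ->]]]]]]]]]] : m4 = n4 /\ m5 = n5 /\
    m6 = n6 /\ m7 = n7 /\ m8 = n8 /\ m9 = n9 /\ m10 = n10 /\ m11 = n11 /\
    m12 = n12 /\ m13 = n13 /\ m14 = n14 by [].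
rewrite cofacets_eq /= in fm fm'; move: fm fm'.
split_faces ltac:(split_faces ltac:(lia)).
Qed.

Lemma wlead_cons c w : wlead (c :: w) = vadd (wlead w) (vec (lvec c)).
Proof. by apply: funext => i; rewrite /= /vadd; lia. Qed.

Lemma wof_lcodes m : all (mem lcodes) (wof m).
Proof.
apply/allP => c /flattenP[_ /mapP[d dl ->]]; rewrite mem_nseq => /andP[_ /eqP->].
exact: dl.
Qed.

Lemma qcommpairs_ex c d : (c, d) \in qcommpairs -> exists a1 a2 a3 a4,
  [/\ prec a1 a2, prec a1 a3, prec a1 a4, [/\ prec a2 a3, prec a2 a4 & prec a3 a4] &
    [\/ (c, d) = (cop orb (cop orb a1 a2) a4, cop orb a2 a3),
        (c, d) = (cop orb a2 a3, cop orb (cop orb a1 a3) a4)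
      | (c, d) = (cop orb (cop orb a1 a3) a4, cop orb (cop orb a1 a2) a4)]].
Proof.
rewrite /qcommpairs mem_undup => /flatten_mapP[a1 _].
move=> /flatten_mapP[a2]; rewrite mem_filter => /andP[p12 _].
move=> /flatten_mapP[a3]; rewrite mem_filter => /andP[/andP[p13 p23] _].
move=> /flatten_mapP[a4]; rewrite mem_filter => /andP[/and3P[p14 p24 p34] _].
rewrite /qcommtriple !inE => H; exists a1, a2, a3, a4; split=> //.
by case/or3P: H => /eqP e; [apply: Or31 | apply: Or32 | apply: Or33].
Qed.

(** * The presentation maps injectively to the skein algebra *)

Opaque wlead wof face lvecs.

Lemma cset_cop op (f : {set 'I_4} -> {set 'I_4} -> {set 'I_4}) c d :
  (forall X Y k, (k \in f X Y) = op (k \in X) (k \in Y)) ->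
  cset (cop op c d) = f (cset c) (cset d).
Proof. by move=> H; apply/setP => k; rewrite H !inE nth_mkseq. Qed.

Lemma cset0 : cset (nseq 4 false) = finset.set0.
Proof. by rewrite -code_of0 code_ofK. Qed.

Lemma lcodes_codes c : (c \in lcodes) = (c \in codes) && (c != nseq 4 false).
Proof.
have H1 : all (fun c => (c \in codes) && (c != nseq 4 false)) lcodes by [].
have H2 : all (fun c => (c == nseq 4 false) || (c \in lcodes)) codes by [].
apply/idP/idP => [/(allP H1) //|/andP[/(allP H2) + /negPf n0]].
by rewrite n0.
Qed.

Lemma cset_neq0 c : c \in lcodes -> cset c != finset.set0.
Proof.
rewrite lcodes_codes => /andP[cc c0]; apply: contra c0 => /eqP e.
by rewrite -(csetK cc) e code_of0.
Qed.

Lemma card_cset c : c \in codes -> #|cset c| = count id c.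
Proof. by move=> cc; rewrite code_card csetK. Qed.

Lemma prec_cset c d : prec c d -> precedes (cset c) (cset d).
Proof.
move=> /allP H i j; rewrite !inE => ci dj.
have i4 : val i \in iota 0 4 by rewrite mem_iota ltn_ord.
have j4 : val j \in iota 0 4 by rewrite mem_iota ltn_ord.
by have := allP (H _ i4) _ j4; rewrite ci dj.
Qed.

Lemma explicit_loop_rel (K : fieldType) (q : K) (A : kalgType K)
    (s : {set 'I_4} -> A) l r :
  (l, r) \in explicit_relations q s -> loop_rel q s l r.
Proof.
rewrite /explicit_relations; rewrite mem_cat => /orP[|]; first exact: loop_rel_cubic.
rewrite mem_cat => /orP[|]; first exact: loop_rel_cubic_triple.
rewrite mem_cat => /orP[|]; first exact: loop_rel_quartic.
rewrite mem_cat => /orP[|]; first exact: loop_rel_crossing.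
rewrite mem_cat => /orP[|]; first exact: loop_rel_triple_loop.
rewrite mem_cat => /orP[|]; first exact: loop_rel_triple_link.
exact: loop_rel_double_triple.
Qed.

Lemma map_mem_nth (T : Type) (U : eqType) (f : T -> U) (l : seq T) x i :
  (i < size l)%N -> f (nth x l i) \in map f l.
Proof.
move=> il; apply/(nthP (f x)); exists i; first by rewrite size_map.
by rewrite (nth_map x).
Qed.

Section PhiInj.
Variables (K : fieldType) (h : K).
Hypothesis h0 : h != 0.
Notation torus := (torus K).
Notation Sk := (Sk h).
Notation q := (h ^+ 2).
Notation P := (loop_presentation q).
Let rel := loop_rel q (free_loop q).
Let G : freealg K loop_index -> P := fev (pgen rel).
Let s (c : code) : P := G (free_loop q (cset c)).

Let G_alghom : alghom G. Proof. exact: fev_alghom. Qed.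

Let G_rel l r : rel l r -> G l = G r. Proof. exact: presalg_rel. Qed.

Let denG e : den q s e = G (den q (free_loop q \o cset) e).
Proof. by rewrite (den_alghom _ _ _ G_alghom). Qed.

Let s_empty : s (nseq 4 false) = (- (q + q^-1))%:K.
Proof.
rewrite /s cset0 /free_loop; case: insubP => [i /negP|_]; first by rewrite eqxx.
by rewrite (alghomN G_alghom) (alghomK G_alghom) kscalN.
Qed.

Let s_explicit i : (i < size explicit_exprs)%N ->
  let e := nth (Lk (Knat 0), Lk (Knat 0)) explicit_exprs i in den q s e.1 = den q s e.2.
Proof.
move=> ie e; rewrite !denG; apply: G_rel; apply: explicit_loop_rel.
rewrite -!(den_ext q _ (litE (free_loop q))) explicitE.
exact: (map_mem_nth (fun e => (den q (lit (free_loop q)) e.1, den q (lit (free_loop q)) e.2))).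
Qed.

Let s_comm c d : c \in lcodes -> d \in lcodes -> commuting c d -> s c * s d = s d * s c.
Proof.
move=> cl dl cd; set x := free_loop q (cset c); set y := free_loop q (cset d).
apply: etrans (esym (alghomM G_alghom x y)) (etrans _ (alghomM G_alghom y x)).
apply: G_rel; rewrite /x /y.
have cc : c \in codes by move: cl; rewrite lcodes_codes => /andP[].
have dc : d \in codes by move: dl; rewrite lcodes_codes => /andP[].
move: cd; rewrite /commuting -!card_cset // orbA => /or4P[c1|/and3P[/eqP c2 /eqP d3 /eqP z]|/andP[/eqP-> /eqP->]|/andP[/eqP-> /eqP->]].
- by apply: loop_rel_central c1 _; exact: cset_neq0.
- apply: loop_rel_nested c2 d3 _; rewrite -finset.setD_eq0.
  rewrite -(@cset_cop minus (fun X Y => X :\: Y)%SET) ?z ?cset0 //.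
  by move=> X Y k; rewrite inE andbC.
- by rewrite -code12 -code34 !code_ofK; exact: loop_rel_12_34.
- by rewrite -code23 -code14 !code_ofK; exact: loop_rel_23_14.
Qed.

Let s_qcomm c d : (c, d) \in qcommpairs ->
  den q s (qcommx c d).1 = den q s (qcommx c d).2.
Proof.
move=> /qcommpairs_ex[a1 [a2 [a3 [a4 [p12 p13 p14 [p23 p24 p34] m]]]]].
rewrite !denG; apply: G_rel.
have sd x y : cset (cop minus x y) = (cset x :\: cset y)%SET.
  by apply: (@cset_cop minus (fun X Y => X :\: Y)%SET) => X Y k; rewrite inE andbC.
have si x y : cset (cop andb x y) = (cset x :&: cset y)%SET.
  by apply: (@cset_cop andb (fun X Y => X :&: Y)%SET) => X Y k; rewrite inE.
have su x y : cset (cop orb x y) = (cset x :|: cset y)%SET.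
  by apply: (@cset_cop orb (fun X Y => X :|: Y)%SET) => X Y k; rewrite inE.
rewrite /qcommx /= !sd !si !su.
apply: (loop_rel_commutator _ _ (prec_cset p12) (prec_cset p13) (prec_cset p14)
  (prec_cset p23) (prec_cset p24) (prec_cset p34)).
by case: m => -[-> ->]; rewrite !su; [apply: Or31 | apply: Or32 | apply: Or33].
Qed.

Let s_gen i : pgen rel i = s (code_of (val i)).
Proof. by rewrite /s code_ofK /free_loop valK /G fev_gen. Qed.

Lemma P_span (x : P) : lspan (fun y => exists m : seq nat,
  (size m == 15%N) && face m /\ y = wmon s (wof m)) x.
Proof.
have q0 : q != 0 by rewrite expf_neq0.
apply: (span_faces q0 s_empty s_explicit s_comm s_qcomm).
have : gens (fun y => exists i, y = pgen rel i) x by exact: presalg_gens.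
apply: gensW => _ [i ->]; apply: gens_in; exists (code_of (val i)); last exact: s_gen.
rewrite lcodes_codes code_of_in; apply: contra (valP i) => /eqP e.
by rewrite -(code_ofK (val i)) e cset0.
Qed.

Lemma phi_inj (phi : P -> Sk) : alghom phi ->
  (forall i, phi (loop_gen q i) = sk_loop h (val i)) -> injective phi.
Proof.
move=> hphi gphi; apply: alghom_inj0 => // x phix.
have sE c : c \in lcodes -> theta0 h0 (phi (s c)) = pev h (lpol c).
  move=> cl; have cc : c \in codes by move: cl; rewrite lcodes_codes => /andP[].
  have -> : s c = pgen rel (exist _ (cset c) (cset_neq0 cl)) by rewrite s_gen /= csetK.
  by rewrite gphi theta0_loop /= csetK.
have lead w : all (mem lcodes) w ->
    tlead h wsr (theta0 h0 (phi (wmon s w)) : torus) (wlead w).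
  elim: w => [|c w IH] /=.
    move=> _; rewrite /wmon big_nil (alghom1 hphi) (alghom1 (theta0_alghom h0)).
    exact: (tlead1 h wsr).
  move=> /andP[cl /IH lw]; rewrite /wmon big_cons -/(wmon s w).
  rewrite (alghomM hphi) (alghomM (theta0_alghom h0)).
  have lc : tlead h wsr (theta0 h0 (phi (s c)) : torus) (vec (lvec c)).
    by rewrite sE //; apply: leadokP => //; exact: (allP lvec_check).
  have -> : wlead (c :: w) = vadd (wlead w) (vec (lvec c)) by exact: wlead_cons.
  have L := tleadM h0 lw lc; exact L.
pose I := {m : seq nat | (size m == 15%N) && face m}.
apply: (tlead_inj h0 (f := fun x => theta0 h0 (phi x) : torus) (c := wsr)
   (b := fun m : I => wmon s (wof (val m))) (v := fun m => wlead (wof (val m)))).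
- by rewrite (alghom0 hphi); exact: (alghom0 (theta0_alghom h0)).
- by move=> a y z; rewrite (alghomD hphi) (alghomM hphi) (alghomK hphi) theta0L.
- move=> y; apply: lspanW (P_span y) => _ [m [sm ->]]; apply: lspan_in.
  by exists (exist _ m sm).
- move=> m m' e; apply: val_inj; case/andP: (valP m) => /eqP sm fm.
  by case/andP: (valP m') => /eqP sm' fm'; exact: wlead_inj e.
- by move=> m; apply: lead; exact: wof_lcodes.
- by rewrite phix; exact: (alghom0 (theta0_alghom h0)).
Qed.

End PhiInj.

Transparent wlead wof face lvecs.

(** * Generation by the loops *)

#[global] Arguments Z.add : simpl never.
#[global] Arguments Z.sub : simpl never.
#[global] Arguments Z.opp : simpl never.
#[global] Arguments Z.of_nat : simpl never.

Opaque nvec nwd.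

(* A pair of strands, [b] of which are below the punctures, is followed from
   left to right: [bs] lists the successive values of [b] until the two strands
   are joined. *)
Definition bstep (k b b' : nat) : nat -> Z :=
  bvec k (Z.of_nat (b - b')) (Z.of_nat b' - Z.of_nat b) (2 - 2 * Z.of_nat (b - b')).

Fixpoint pvec (k b : nat) (bs : seq nat) : nat -> Z :=
  if bs is b' :: bs' then vadd (bstep k b b') (pvec k.+1 b' bs') else fun=> 0%Z.

Fixpoint pathok (n b : nat) (bs : seq nat) : bool :=
  if bs is b' :: bs' then [&& 0 < n, b' <= 2 & pathok n.-1 b' bs']%N else b == 1%N.

Transparent nvec.

Lemma nvec_cons k x y c r d ds : nvec k x y ((c, r, d) :: ds) =
  vadd (bvec k (Z.of_nat (x - c - r + d)) (Z.of_nat r - Z.of_nat (x - c))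
           (Z.of_nat (x - c + (y - c)) - 2 * Z.of_nat (x - c - r)))
      (nvec k.+1 (r + d) (x - c + (y - c) - r + d) ds).
Proof. by []. Qed.

Lemma nvec_nil k x y : nvec k x y [::] = fun=> 0%Z.
Proof. by []. Qed.

Opaque nvec.

(** The pairs that may be followed: one strand on each side, or two on a side holding at least two
    strands more than the other. *)
Definition avail (b x y : nat) : bool :=
  [|| (b == 1) && (0 < x) && (0 < y), (b == 2) && (y + 2 <= x) | (b == 0) && (x + 2 <= y)]%N.

(** The point of the choice of b' is that b - b' and the corresponding difference for the remaining
    strands never have opposite signs: the truncated differences in the exponent of the block then
    add up. Since x + y is even, a majority on one side is a majority by at least two. *)
Lemma choose_step e b x y c r d : (c <= x)%N -> (c <= y)%N -> (r <= x - c + (y - c))%N ->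
  (x + y = e.*2)%N -> avail b x y -> ~~ ((b == 1) && (0 < c))%N ->
  exists b', [/\ (b' <= 2)%N, avail b' (r + d) (x - c + (y - c) - r + d),
    [/\ c <= x - b, c <= y - (2 - b), b' <= r & r - b' <= x - b - c + (y - (2 - b) - c)]%N &
    [/\ (r - b' + d = r + d - b')%N, ((x - b - c) + (y - (2 - b) - c) - (r - b') + d = x - c + (y - c) - r + d - (2 - b'))%N &
    [/\ (Z.of_nat (x - c - r + d) = Z.of_nat (b - b') + Z.of_nat (x - b - c - (r - b') + d))%Z,
      (Z.of_nat r - Z.of_nat (x - c) = Z.of_nat b' - Z.of_nat b + (Z.of_nat (r - b') - Z.of_nat (x - b - c)))%Z &
      (Z.of_nat (x - c + (y - c)) - 2 * Z.of_nat (x - c - r) = 2 - 2 * Z.of_nat (b - b') +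
        (Z.of_nat (x - b - c + (y - (2 - b) - c)) - 2 * Z.of_nat (x - b - c - (r - b'))))%Z]]].
Proof.
move=> cx cy rc ev; rewrite /avail.
case/or3P => [/andP[/andP[/eqP-> x0] y0]|/andP[/eqP-> yx]|/andP[/eqP-> xy]] /=.
- rewrite -eqn0Ngt => /eqP c0; subst c; rewrite !subn0 in rc *.
  case: (boolP ((x < r) && (y < r))%N) => [/andP[xr yr]|n1].
    by exists 2%N; split; rewrite ?/avail; do ?split; lia.
  case: (boolP ((r < x) && (r < y))%N) => [/andP[xr yr]|n2].
    by exists 0%N; split; rewrite ?/avail; do ?split; lia.
  by exists 1%N; split; rewrite ?/avail; do ?split; lia.
- move=> _; case: (ltnP (x - c + (y - c)) (r.*2)) => l1.
    by exists 2%N; split; rewrite ?/avail; do ?split; lia.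
  case: (ltnP (r.*2) (x - c + (y - c))) => l2.
    by exists 0%N; split; rewrite ?/avail; do ?split; lia.
  by exists 1%N; split; rewrite ?/avail; do ?split; lia.
- move=> _; case: (ltnP (x - c + (y - c)) (r.*2)) => l1.
    by exists 2%N; split; rewrite ?/avail; do ?split; lia.
  case: (ltnP (r.*2) (x - c + (y - c))) => l2.
    by exists 0%N; split; rewrite ?/avail; do ?split; lia.
  by exists 1%N; split; rewrite ?/avail; do ?split; lia.
Qed.

(** Splits a pair of strands off a normal word, so that its exponent is the sum of that of the pair
    and that of the remaining normal word. *)
Lemma peel k x y e ds b : nvalid x y ds -> (x + y = e.*2)%N -> avail b x y ->
  exists bs ds', [/\ size ds' = size ds, nvalid (x - b) (y - (2 - b)) ds',
    pathok (size ds) b bs &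
    nvec k x y ds = vadd (pvec k b bs) (nvec k (x - b) (y - (2 - b)) ds')].
Proof.
elim: ds k x y e b => [|[[c r] d] ds IH] k x y e b /=.
  move=> /eqP<- ev; rewrite /avail => /or3P[/andP[/andP[/eqP-> x0] _]|/andP[_]|/andP[_]]; try lia.
  by exists [::], [::]; split=> //=; rewrite vadd0.
move=> /and4P[cx cy rc vd] ev av.
case: (boolP ((b == 1) && (0 < c))%N) => [/andP[/eqP b1 c0]|nb].
  (* With one strand on each side and a cap available, the pair is closed here: the nest loses one
     cap and nothing else changes. *)
  subst b; exists [::], ((c.-1, r, d) :: ds).
  have e1 : (x - 1 - c.-1 = x - c)%N by lia.
  have e2 : (y - 1 - c.-1 = y - c)%N by lia.
  by rewrite /= vadd0 !nvec_cons e1 e2 rc vd; split=> //; rewrite andbT; lia.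
have [b' [b2 av' [h1 h2 h3 h4] [e1 e2 [z1 z2 z3]]]] := choose_step d cx cy rc ev av nb.
have ev' : (r + d + (x - c + (y - c) - r + d) = (e - c + d).*2)%N.
  by clear -ev cx cy rc; lia.
have [bs [ds' [sd vd' pk e']]] := IH k.+1 _ _ _ _ vd ev' av'.
exists (b' :: bs), ((c, (r - b')%N, d) :: ds'); split.
- by rewrite /= sd.
- by rewrite /= h1 h2 h4 e1 e2 vd'.
- by rewrite /= b2.
rewrite !nvec_cons e' e1 e2 /= /bstep z1 z2 z3 -bvecD -!vaddA.
by congr vadd; apply: funext => i; rewrite /vadd; lia.
Qed.

(** The pair is opened by a cup of the leftmost non-empty nest, around puncture j, which accounts
    for the factor Lambda of block j. Without cups there are no strands, and the exponent is 0. *)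
Lemma start k ds : nvalid 0 0 ds -> (nvec k 0 0 ds = fun=> 0%Z) \/
  exists j bs ds', [/\ (k <= j < k + size ds)%N, pathok (k + size ds - j.+1) 1 bs,
    size ds' = size ds, nvalid 0 0 ds' &
    nvec k 0 0 ds = vadd (vadd (bvec j 1 0 0) (pvec j.+1 1 bs)) (nvec k 0 0 ds')].
Proof.
elim: ds k => [|[[c r] d] ds IH] k; first by left.
rewrite /= leqn0 => /and4P[/eqP-> _]; rewrite leqn0 => /eqP->.
rewrite subn0 !add0n => vd; case: (posnP d) => [d0|d0].
  subst d; case: (IH k.+1 vd) => [z|[j [bs [ds' [j1 pk sd vd' e]]]]].
    by left; rewrite nvec_cons z bvec0 vadd0.
  right; exists j, bs, ((0, 0, 0)%N :: ds'); rewrite /= sd vd' !nvec_cons e bvec0 !vadd0.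
  by split=> //; [lia | rewrite addnS -addSn].
right; have av : avail 1 d d by rewrite /avail eqxx d0.
have [bs [ds' [sd vd' pk e]]] := peel k.+1 vd (addnn d) av.
exists k, bs, ((0, 0, d.-1)%N :: ds'); rewrite /= sd.
have e1 : (d - 1 = d.-1)%N by lia.
split=> //; first lia.
- by move: pk; rewrite addnS subSS addKn.
- by move: vd'; rewrite e1.
rewrite !nvec_cons.
have E : nvec k.+1 (0 + d) (0 - 0 + (0 - 0) - 0 + d) ds = nvec k.+1 d d ds.
  by congr nvec; lia.
have E' : nvec k.+1 (0 + d.-1) (0 - 0 + (0 - 0) - 0 + d.-1) ds' =
    nvec k.+1 (d - 1) (d - (2 - 1)) ds'.
  by congr nvec; lia.
have B : bvec k (Z.of_nat (0 - 0 - 0 + d)) (Z.of_nat 0 - Z.of_nat (0 - 0))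
    (Z.of_nat (0 - 0 + (0 - 0)) - 2 * Z.of_nat (0 - 0 - 0)) =
  vadd (bvec k 1 0 0) (bvec k (Z.of_nat (0 - 0 - 0 + d.-1)) (Z.of_nat 0 - Z.of_nat (0 - 0))
    (Z.of_nat (0 - 0 + (0 - 0)) - 2 * Z.of_nat (0 - 0 - 0))).
  by rewrite bvecD; congr bvec; lia.
rewrite ?E ?E' e B; apply: funext => i; rewrite /vadd; lia.
Qed.

Fixpoint paths (n b : nat) : seq (seq nat) :=
  (if b == 1%N then [:: [::]] else [::]) ++
  (if n is n'.+1 then
     flatten [seq [seq b' :: bs | bs <- paths n' b'] | b' <- [:: 0; 1; 2]%N]
   else [::]).

Lemma pathsP n b bs : pathok n b bs -> bs \in paths n b.
Proof.
elim: bs n b => [|b' bs IH] n b /=.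
  by move=> /eqP->; case: n => [|n]; rewrite /= mem_head.
case: n => // n /and3P[_ b2 /IH m]; rewrite /= mem_cat; apply/orP; right.
have f c : b' = c -> (b' :: bs) \in [seq c :: bs | bs <- paths n c].
  by move=> <-; exact: map_f.
rewrite !mem_cat; case: b' b2 f {IH m} => [|[|[|b']]] // _ f.
- by rewrite f.
- by rewrite (f 1%N) ?orbT.
- by rewrite (f 2%N) ?orbT.
Qed.

(* Loops and twisted loops, up to a scalar, as polynomials in the loops. *)
Definition gexprs : seq lx :=
  let v l := Lv [seq k \in l | k <- iota 1 4] in
  let qq := Lk (Kq 1) in let qi := Lk (Kqi 1) in
  let sub a b := Ladd a (Lopp b) in
  let twist a b t i u x y := Lmul qq (sub (sub (sub (Lmul a b) (Lmul qq t)) (Lmul i u)) (Lmul x y)) in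
  let s1 := v [:: 1] in let s2 := v [:: 2] in let s3 := v [:: 3] in let s4 := v [:: 4] in
  let s12 := v [:: 1; 2] in let s34 := v [:: 3; 4] in let s23 := v [:: 2; 3] in
  let s123 := v [:: 1; 2; 3] in let s234 := v [:: 2; 3; 4] in let s1234 := v [:: 1; 2; 3; 4] in
  let t13 := twist s12 s23 (v [:: 1; 3]) s2 s123 s1 s3 in
  let t24 := twist s23 s34 (v [:: 2; 4]) s3 s234 s2 s4 in
  let t134 := twist s12 s234 (v [:: 1; 3; 4]) s2 s1234 s1 s34 in
  let t124 := twist s123 s34 (v [:: 1; 2; 4]) s3 s1234 s12 s4 in
  let b1 := Ladd (Lmul s3 t134) (Lmul s1 s4) in
  let b2 := Ladd (Lmul s2 t124) (Lmul s1 s4) in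
  let ab := sub (Lmul t13 s34) b1 in let ba := sub (Lmul s34 t13) b1 in
  let cd := sub (Lmul s12 t24) b2 in let dc := sub (Lmul t24 s12) b2 in
  [seq Lv c | c <- lcodes] ++ [:: t13; t24; t134; t124;
    sub (Lmul qq ab) (Lmul qi ba); sub (Lmul qi ab) (Lmul qq ba);
    sub (Lmul qq cd) (Lmul qi dc)].

(** Up to sign, a power of h, or a difference of two powers whose exponents differ by 8; the latter
    is non-zero because h^8 differs from 1. *)
Definition lead_coef_ok (p : seq term) : bool :=
  match p with
  | [:: t] => unit_coef t
  | [:: t; u] => [&& unit_coef t, Z.eqb u.2 (- t.2)%Z &
      Z.eqb t.1.2 (u.1.2 + 8)%Z || Z.eqb u.1.2 (t.1.2 + 8)%Z]
  | _ => false
  end.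

Definition leadok2 (c : seq Z) (v : seq Z) (p : seq term) : bool :=
  all (fun t => (t.1.1 == v) || Z.ltb (ldot c t.1.1) (ldot c v)) p &&
  lead_coef_ok [seq t <- p | t.1.1 == v].

Fixpoint plist (k b : nat) (bs : seq nat) : seq Z :=
  if bs is b' :: bs' then
    addl (blk k (Z.of_nat (b - b')) (Z.of_nat b' - Z.of_nat b) (2 - 2 * Z.of_nat (b - b')))
      (plist k.+1 b' bs')
  else [::].

Definition glist (j : nat) (bs : seq nat) : seq Z := addl (blk j 1 0 0) (plist j.+1 1 bs).

Lemma plistE k b bs : vec (plist k b bs) = pvec k b bs.
Proof.
elim: bs k b => [|b' bs IH] k b /=; last by rewrite vec_addl IH.
by apply: funext => i; rewrite /vec nth_nil.
Qed.

Lemma glistE j bs : vec (glist j bs) = vadd (bvec j 1 0 0) (pvec j.+1 1 bs).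
Proof. by rewrite /glist vec_addl plistE. Qed.

Definition gens_check : bool :=
  let ps := [seq leval (look ltab) e | e <- gexprs] in
  all (fun j => all (fun bs => has (leadok2 wts (glist j bs)) ps) (paths (3 - j) 1))
    (iota 0 4).

Lemma gens_checked : gens_check.
Proof. by vm_compute. Qed.

Section Generation.
Variables (K : fieldType) (h : K).
Hypothesis h0 : h != 0.
Hypothesis h8 : h ^+ 8 != 1.
Notation torus := (torus K).
Notation Sk := (Sk h).
Notation q := (h ^+ 2).

Lemma leadok2P c v p : leadok2 c v p -> tlead h c (pev h p) (vec v).
Proof.
move=> /andP[/allP lo ut].
rewrite /pev (bigID (fun t => t.1.1 == v)) /= -big_filter; apply: tleadD; last first.
  rewrite big_seq_cond; apply: lspan_sum => u /andP[up /negPf uv].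
  apply: lspanZ; apply: tfil_mon => //; have := lo u up; rewrite uv !ldotE => /Z.ltb_lt lt.
  exact: (proj1 (Z.lt_le_pred _ _) lt).
have tv t : t \in [seq t <- p | t.1.1 == v] -> t.1.1 = v.
  by rewrite mem_filter => /andP[/eqP].
case ef: [seq _ <- _ | _] ut tv => [|t [|u [|? ?]]] //=.
  move=> ut tv; rewrite big_seq1 -(tv t (mem_head _ _)).
  apply: tlead_mon; rewrite mulf_neq0 ?hz_neq0 //.
  by case/orP: ut => /Z.eqb_eq ->; rewrite /zk /= ?oppr_eq0 oner_eq0.
move=> /and3P[ut /Z.eqb_eq cu e8] tv; rewrite big_cons big_seq1 /tev.
rewrite (tv t (mem_head _ _)) (tv u _); last by rewrite !inE eqxx orbT.
rewrite -mulrDl -kscalD; apply: tlead_mon.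
rewrite cu zkN mulNr -mulrBr mulf_neq0 //.
  by case/orP: ut => /Z.eqb_eq ->; rewrite /zk /= ?oppr_eq0 oner_eq0.
have z8 : hz h 8 = h ^+ 8 by [].
rewrite subr_eq0; case/orP: e8 => /Z.eqb_eq ->; rewrite hzD // z8.
  rewrite -[X in _ != X]mulr1; apply: contra h8 => /eqP/(mulfI (hz_neq0 h0 _)) ->.
  by rewrite eqxx.
rewrite -[X in X != _]mulr1; apply: contra h8 => /eqP/(mulfI (hz_neq0 h0 _)) <-.
by rewrite eqxx.
Qed.

Let L (x : Sk) : Prop := gens (fun y => exists X, y = sk_loop h X) x.

Lemma gen_lead j bs : (j < 4)%N -> pathok (3 - j) 1 bs ->
  exists2 t, L t & tlead h wts (theta0 h0 t : torus) (vadd (bvec j 1 0 0) (pvec j.+1 1 bs)).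
Proof.
move=> j4 /pathsP pk; have jI : j \in iota 0 4 by rewrite mem_iota.
have : has (fun e => leadok2 wts (glist j bs) (leval (look ltab) e)) gexprs.
  by have := allP (allP gens_checked j jI) bs pk; rewrite has_map.
move=> /has_split[_ [e [_ [_ ok]]]].
exists (den q (fun c => sk_loop h (cset c)) e).
  elim: (e) => [c|k|a la b lb|a la|a la b lb|a la n] /=.
  - by apply: gens_in; exists (cset c).
  - exact: gens_scal.
  - exact: gens_add.
  - exact: gens_opp.
  - exact: gens_mul.
  - exact: gens_exp.
rewrite (den_alghom _ _ _ (theta0_alghom h0)) -glistE.
rewrite (den_ext q (s' := fun c => pev h (look ltab c) : kop torus)); last first.
  by move=> c; rewrite lookE -(theta0_loop h0).
by rewrite -levalE //; exact: leadok2P.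
Qed.

Lemma tlead_sub c (x y : torus) v : tlead h c x v -> tlead h c y v ->
  exists a, tfil h c (vdot c v - 1) (x - a%:K * y).
Proof.
move=> [a a0 Hx] [b b0 Hy]; exists (a / b).
have -> : x - (a / b)%:K * y = (x - a%:K * tmon h v) - (a / b)%:K * (y - b%:K * tmon h v).
  by rewrite mulrBr mulrA -kscalM mulfVK // opprB addrA subrK.
by apply: lspanB => //; exact: lspanZ.
Qed.

(** As normal words have distinct leading exponents, cancellation cannot hide a heavy word: the
    filtration of the torus induces on the skein algebra the one given by the weights of normal
    words. *)
Lemma sk_fil n (x : Sk) : tfil h wts n (theta0 h0 x : torus) ->
  lspan (fun y => exists D : ndata, y = skw h (nwd 0 0 (val D)) /\
    (wt (nvec 0 0 0 (val D)) <= n)%Z) x.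
Proof.
have [s [a [us sa ->]]] := lspan_uniq (sk_ndata h0 x) => fx.
pose e (D : ndata) := theta0 h0 (skw h (nwd 0 0 (val D))) : torus.
have le D : tlead h wts (e D) (nvec 0 0 0 (val D)).
  by rewrite /e theta0_skw ?(nwd_diagram h0) //; exact: (ndata_lead h0 D).
have fs : theta0 h0 (\sum_(i <- s) (a i)%:K * skw h (nwd 0 0 (val i))) =
    \sum_(i <- s) (a i)%:K * e i.
  elim: (s) => [|i r IH]; first by rewrite !big_nil; exact: (alghom0 (theta0_alghom h0)).
  by rewrite !big_cons theta0L IH.
rewrite fs in fx; have := tlead_family h0 (@ndata_inj) le us sa fx => lo.
rewrite big_seq; apply: lspan_sum => i si; apply: lspanZ; apply: lspan_in.
by exists i; split=> //; exact: lo.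
Qed.

Lemma nvec_wt k x y ds : (k + size ds <= 4)%N -> (0 <= wt (nvec k x y ds))%Z.
Proof.
elim: ds k x y => [|[[c r] d] ds IH] k x y kd; first by rewrite nvec_nil wtE; lia.
have := IH k.+1 (r + d)%N (x - c + (y - c) - r + d)%N _; rewrite nvec_cons vdotD wt_bvec; last first.
  by move: kd => /=; lia.
move=> /(_ _)H; have {}H := H (ltac:(move: kd => /=; lia)).
have : (0 <= Z.of_nat (4 - k) * (Z.of_nat r - Z.of_nat (x - c) + 2 * Z.of_nat (x - c - r + d)))%Z.
  by apply: Z.mul_nonneg_nonneg; lia.
lia.
Qed.

Lemma pvec_wt n k b bs : pathok n b bs -> (k + n <= 4)%N -> (0 <= wt (pvec k b bs))%Z.
Proof.
elim: bs n k b => [|b' bs IH] n k b /=; first by rewrite wtE; lia.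
case: n => // n /and3P[_ _ /IH H] kn; have {}H := H k.+1 (ltac:(lia)).
rewrite vdotD wt_bvec; last lia.
have : (0 <= Z.of_nat (4 - k) * (Z.of_nat b' - Z.of_nat b + 2 * Z.of_nat (b - b')))%Z.
  by apply: Z.mul_nonneg_nonneg; lia.
lia.
Qed.

(** Induction on the weight of the leading exponent of a normal word. By [start] this exponent is
    the sum of one realized by a polynomial in the loops and of that of another normal word, which
    is lighter because Lambda has positive weight. Subtracting a multiple of the product of the two
    leaves lighter words, by [sk_fil]. *)
Lemma loops_generate (x : Sk) : L x.
Proof.
have span n : (forall D : ndata, (wt (nvec 0 0 0 (val D)) <= n)%Z -> L (skw h (nwd 0 0 (val D)))) ->
    forall y, tfil h wts n (theta0 h0 y : torus) -> L y.
  move=> H y /sk_fil; elim=> [|a _ z [D [-> lD]] _ Lz]; first exact: gens0.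
  by apply: gens_add => //; apply: gens_mul; [exact: gens_scal | exact: H].
suff H : forall D : ndata, L (skw h (nwd 0 0 (val D))).
  elim: (sk_ndata h0 x) => [|a _ z [D ->] _ Lz]; first exact: gens0.
  by apply: gens_add => //; apply: gens_mul; [exact: gens_scal | exact: H].
move=> D; have [N] : exists N, (wt (nvec 0 0 0 (val D)) < Z.of_nat N)%Z.
  by exists (Z.to_nat (wt (nvec 0 0 0 (val D)) + 1)%Z); lia.
elim: N D => [|N IH] D DN.
  have := @nvec_wt 0 0 0 (val D); case/andP: (valP D) => /eqP-> _ /(_ isT); lia.
have lD : tlead h wts (theta0 h0 (skw h (nwd 0 0 (val D))) : torus) (nvec 0 0 0 (val D)).
  by rewrite theta0_skw ?(nwd_diagram h0) //; exact: (ndata_lead h0 D).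
have low y : tfil h wts (wt (nvec 0 0 0 (val D)) - 1) (theta0 h0 y : torus) -> L y.
  by apply: span => E lE; apply: IH; lia.
have red t : L t -> tlead h wts (theta0 h0 t : torus) (nvec 0 0 0 (val D)) ->
    L (skw h (nwd 0 0 (val D))).
  move=> Lt lt; have [a fa] := tlead_sub lD lt.
  rewrite -(subrK (a%:K * t) (skw h (nwd 0 0 (val D)))); apply: gens_add; last first.
    by apply: gens_mul => //; exact: gens_scal.
  apply: low; rewrite -mulNr -kscalN addrC theta0L kscalN mulNr addrC.
  exact: fa.
case/andP: (valP D) => /eqP s4 vD.
case: (start 0 vD) => [z|[j [bs [ds' [j1 pk sd vd' e]]]]].
  apply: (red 1); first by rewrite -(kscal1 (s := Sk)); exact: gens_scal.
  rewrite z (alghom1 (theta0_alghom h0)); exact: (tlead1 h wts).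
have dd : (size ds' == 4%N) && nvalid 0 0 ds' by rewrite sd s4 vd'.
pose D' : ndata := exist _ ds' dd.
have j4 : (j < 4)%N by move: j1; rewrite s4.
have pk' : pathok (3 - j) 1 bs by move: pk; rewrite s4 add0n subSS.
have [t Lt lt] := gen_lead j4 pk'.
apply: (red (t * skw h (nwd 0 0 (val D')))).
  apply: gens_mul => //; apply: IH; move: DN; rewrite e vdotD.
  have := pvec_wt pk' (ltac:(lia) : j.+1 + (3 - j) <= 4)%N; rewrite vdotD wt_bvec //=; lia.
rewrite (alghomM (theta0_alghom h0)) e.
have lD' : tlead h wts (theta0 h0 (skw h (nwd 0 0 (val D'))) : torus) (nvec 0 0 0 ds').
  by rewrite theta0_skw ?(nwd_diagram h0) //; exact: (ndata_lead h0 D').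
have X := tleadM h0 lD' lt.
rewrite (_ : vadd (vadd _ _) _ = vadd (nvec 0 0 0 ds') (vadd (bvec j 1 0 0) (pvec j.+1 1 bs))).
  exact X.
by apply: funext => i; rewrite /vadd; lia.
Qed.

Lemma phi_surj (phi : loop_presentation q -> Sk) : alghom phi ->
  (forall i, phi (loop_gen q i) = sk_loop h (val i)) -> forall y, exists x, phi x = y.
Proof.
move=> hphi gphi y; elim: (loops_generate y) => {y}.
- by move=> a; exists a%:K; exact: (alghomK hphi).
- move=> _ [X ->]; case: (altP (X =P finset.set0)) => [->|X0].
    by exists (- (q + q^-1)%:K); rewrite (sk_loop0 h0) (alghomN hphi) (alghomK hphi).
  by exists (loop_gen q (exist _ X X0)); rewrite gphi.
- by move=> x y _ [a <-] _ [b <-]; exists (a + b); exact: (alghomD hphi).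
- by move=> x y _ [a <-] _ [b <-]; exists (a * b); exact: (alghomM hphi).
Qed.

Theorem phi_bij : exists phi : loop_presentation q -> Sk,
  [/\ alghom phi, bijective phi & forall i, phi (loop_gen q i) = sk_loop h (val i)].
Proof.
have [phi hphi gphi] := phi_ex h0; exists phi; split=> //.
have pinj := phi_inj h0 hphi gphi; have psur := phi_surj hphi gphi.
exists (fun y => sval (cid (psur y))) => [x|y]; last by case: cid.
by case: cid => z /= /pinj.
Qed.

End Generation.

Transparent nvec nwd.

(** * The antiautomorphism reversing the punctures *)

Section Reversal.
Variables (K : fieldType) (h : K).
Hypothesis h0 : h != 0.
Hypothesis h8 : h ^+ 8 != 1.
Notation Sk := (Sk h).
Notation q := (h ^+ 2).

(** [phi_rev_ex] is transported through the isomorphism; that its square is the identity need only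
    be seen on the loops, which generate. *)
Lemma rho_ex : exists rho : Sk -> kop Sk,
  [/\ alghom rho, involutive (rho : Sk -> Sk)
    & forall X, rho (sk_loop h X) = sk_loop h (rset X)].
Proof.
have [phi [hphi bphi gphi]] := phi_bij h0 h8.
have [phr hphr gphr] := phi_rev_ex h0.
have [k hk kK] : exists2 k : Sk -> loop_presentation q, alghom k & forall x, phi (k x) = x.
  apply: (alghom_lift (f := idfun : Sk -> Sk) (alghom_id Sk) hphi (bij_inj bphi)).
  by case: bphi => g _ gK x; exists (g x).
pose rho : Sk -> kop Sk := fun x => phr (k x).
have hrho : alghom rho := alghom_comp hk hphr.
have grho X : rho (sk_loop h X) = sk_loop h (rset X).
  case: (altP (X =P finset.set0)) => [->|X0].
    rewrite rset0 (sk_loop0 h0) (alghomN hrho) (alghomK hrho) //.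
  have -> : sk_loop h X = phi (loop_gen q (exist _ X X0)) by rewrite gphi.
  by rewrite /rho (bij_inj bphi (kK _)) gphr.
exists rho; split=> //.
have hrr : alghom (fun x : Sk => rho (rho x) : Sk).
  split; first by move=> x y; rewrite !(alghomD hrho).
  - split; first by rewrite (alghom1 hrho) (alghom1 hrho).
    by move=> x y; rewrite !(alghomM hrho).
  - by move=> a; rewrite !(alghomK hrho).
move=> x; apply: (gens_ext hrr (alghom_id Sk) _ (loops_generate h0 h8 x)).
by move=> _ [X ->]; rewrite !grho rsetK.
Qed.

End Reversal.

(** * Tensor products *)

Section Tensor.
Variables (K : fieldType) (A B : kalgType K).

Lemma tensDl (a a' : A) (b : B) : tens (a + a') b = tens a b + tens a' b.
Proof.
have := presalg_rel (tensor_rel_addl a a' b).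
by rewrite (alghomD (fev_alghom _)) !fev_gen.
Qed.

Lemma tensDr (a : A) (b b' : B) : tens a (b + b') = tens a b + tens a b'.
Proof.
have := presalg_rel (tensor_rel_addr a b b').
by rewrite (alghomD (fev_alghom _)) !fev_gen.
Qed.

Lemma tensZl c (a : A) (b : B) : tens (c%:K * a) b = c%:K * tens a b.
Proof. by have := presalg_rel (tensor_rel_scall c a b); rewrite fevZ !fev_gen. Qed.

Lemma tensZr c (a : A) (b : B) : tens a (c%:K * b) = c%:K * tens a b.
Proof. by have := presalg_rel (tensor_rel_scalr c a b); rewrite fevZ !fev_gen. Qed.

Lemma tensM (a a' : A) (b b' : B) : tens a b * tens a' b' = tens (a * a') (b * b').
Proof. by have := presalg_rel (tensor_rel_mul a a' b b'); rewrite fevM !fev_gen. Qed.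

Lemma tens1 : tens 1 1 = 1 :> tensor A B.
Proof.
by have := presalg_rel (tensor_rel_one A B); rewrite (alghom1 (fev_alghom _)) fev_gen.
Qed.

Lemma tens0l (b : B) : tens (0 : A) b = 0.
Proof. by apply: (addrI (tens 0 b)); rewrite -tensDl !addr0. Qed.

Lemma tens0r (a : A) : tens a (0 : B) = 0.
Proof. by apply: (addrI (tens a 0)); rewrite -tensDr !addr0. Qed.

Lemma tensor_hom (C : kalgType K) (F : A -> B -> C) :
  (forall a a' b, F (a + a') b = F a b + F a' b) ->
  (forall a b b', F a (b + b') = F a b + F a b') ->
  (forall c a b, F (c%:K * a) b = c%:K * F a b) ->
  (forall c a b, F a (c%:K * b) = c%:K * F a b) ->
  (forall a a' b b', F a b * F a' b' = F (a * a') (b * b')) -> F 1 1 = 1 ->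
  exists2 f : tensor A B -> C, alghom f & forall a b, f (tens a b) = F a b.
Proof.
move=> FDl FDr FZl FZr FM F1.
pose g (ab : (A * B)%type) := F ab.1 ab.2; have hg := fev_alghom g.
have [|f hf fE] := @presalg_hom K _ (@tensor_rel K A B) C g.
  move=> l r [a a' b|a b b'|c a b|c a b|a a' b b'|].
  - by rewrite (alghomD hg) !(fev_gen g); exact: FDl.
  - by rewrite (alghomD hg) !(fev_gen g); exact: FDr.
  - by rewrite (fevZ g) !(fev_gen g); exact: FZl.
  - by rewrite (fevZ g) !(fev_gen g); exact: FZr.
  - by rewrite (fevM g) !(fev_gen g); exact: FM.
  - by rewrite (alghom1 hg) (fev_gen g); exact: F1.
by exists f => // a b; exact: (fE (a, b)).
Qed.

Lemma tensor_ext (C : kalgType K) (f g : tensor A B -> C) : alghom f -> alghom g ->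
  (forall a b, f (tens a b) = g (tens a b)) -> f =1 g.
Proof. by move=> hf hg fg; apply: presalg_ext => // -[a b]; exact: fg. Qed.

Lemma tens_span (I J : Type) (a : I -> A) (b : J -> B) :
  (forall x, lspan (fun y => exists i, y = a i) x) ->
  (forall x, lspan (fun y => exists j, y = b j) x) ->
  forall x : tensor A B, lspan (fun y => exists ij : I * J, y = tens (a ij.1) (b ij.2)) x.
Proof.
move=> sA sB x.
have pure y z : lspan (fun y => exists ij : I * J, y = tens (a ij.1) (b ij.2)) (tens y z).
  move: y (sA y); apply: (@lspan_lin _ _ _ (fun y => tens y z)); first exact: tens0l.
    by move=> c u v; rewrite tensDl tensZl.
  move=> _ [i ->]; move: z (sB z); apply: (@lspan_lin _ _ _ (tens (a i))); first exact: tens0r.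
    by move=> c u v; rewrite tensDr tensZr.
  by move=> _ [j ->]; apply: lspan_in; exists (i, j).
apply: (lspanW (S := fun y => exists ab : A * B, y = tens ab.1 ab.2)).
  by move=> _ [[y z] ->]; exact: pure.
apply: (gens_lspan _ _ (presalg_gens x)).
  by rewrite -tens1; apply: lspan_in; exists (1, 1).
move=> _ _ [[y z] ->] [[y' z'] ->]; apply: lspan_in; exists (y * y', z * z').
exact: tensM.
Qed.

End Tensor.

Lemma tens_mapP (K : fieldType) (A B A' B' : kalgType K) (f : A -> A') (g : B -> B') : alghom f -> alghom g ->
  alghom (tens_map f g) /\ forall a b, tens_map f g (tens a b) = tens (f a) (g b).
Proof.
move=> hf hg; apply: the_alghomP.
have [||||||F hF FE] := @tensor_hom K A B (tensor A' B') (fun a b => tens (f a) (g b)).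
- by move=> a a' b; rewrite (alghomD hf) tensDl.
- by move=> a b b'; rewrite (alghomD hg) tensDr.
- by move=> c a b; rewrite (alghomM hf) (alghomK hf) tensZl.
- by move=> c a b; rewrite (alghomM hg) (alghomK hg) tensZr.
- by move=> a a' b b'; rewrite (alghomM hf) (alghomM hg) tensM.
- by rewrite (alghom1 hf) (alghom1 hg) tens1.
by exists F.
Qed.

(** * Embeddings of algebras and of their tensor products in blocks of the torus *)

Definition supp (k n : nat) (u : nat -> Z) : Prop :=
  forall i, ~~ (3 * k <= i < 3 * (k + n))%N -> u i = 0%Z.

Lemma supp_vbil k m n u w N : supp k m u -> supp (k + m) n w ->
  vbil N u w = 0%Z /\ vbil N w u = 0%Z.
Proof.
move=> su sw; elim: N => // N [IH1 IH2].
rewrite -[vbil N.+1 u w]/(u (3 * N + 2)%N * w (3 * N + 1)%N * -2 + vbil N u w)%Z.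
rewrite -[vbil N.+1 w u]/(w (3 * N + 2)%N * u (3 * N + 1)%N * -2 + vbil N w u)%Z.
rewrite IH1 IH2; case: (boolP (3 * k <= 3 * N + 2 < 3 * (k + m))%N) => b.
  have w1 : w (3 * N + 1)%N = 0%Z by apply: sw; lia.
  by have w2 : w (3 * N + 2)%N = 0%Z by [apply: sw; lia]; rewrite w1 w2; split; lia.
have u1 : u (3 * N + 1)%N = 0%Z by apply: su; lia.
by have u2 : u (3 * N + 2)%N = 0%Z by [apply: su; lia]; rewrite u1 u2; split; lia.
Qed.

Section Embedding.
Variables (K : fieldType) (h : K).
Hypothesis h0 : h != 0.
Notation torus := (torus K).
Notation tmon := (tmon h).

Definition tsupp (k n : nat) : torus -> Prop :=
  lspan (fun z => exists2 u, z = tmon u & supp k n u).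

Lemma tsupp_comm k m n x y : tsupp k m x -> tsupp (k + m) n y -> x * y = y * x.
Proof.
elim=> [|a _ z [u -> su] _ IH] ty; first by rewrite mul0r mulr0.
rewrite mulrDl mulrDr IH //; congr (_ + _); rewrite -mulrA kscalAC; congr (_ * _).
elim: ty {IH} => [|b _ t [w -> sw] _ IH]; first by rewrite mul0r mulr0.
rewrite mulrDl mulrDr IH //; congr (_ + _); rewrite -mulrA kscalAC; congr (_ * _).
rewrite !tmonM //; have [-> ->] := supp_vbil 4 su sw.
by congr (_ * tmon _); apply: funext => i; rewrite /vadd Z.add_comm.
Qed.

(* [f] is injective with image in the subalgebra of the blocks k, ..., k + n - 1:
   its values at a linear basis have distinct leading monomials. *)
Definition embeds (A : kalgType K) (f : A -> torus) (k n : nat) : Prop :=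
  [/\ alghom f, forall x, tsupp k n (f x)
    & exists (I : eqType) (b : I -> A) (v : I -> nat -> Z),
      [/\ forall x, lspan (fun y => exists i, y = b i) x, injective v,
          forall i, supp k n (v i) & forall i, tlead h wts (f (b i)) (v i)]].

Lemma embeds_inj (A : kalgType K) (f : A -> torus) k n : embeds f k n -> injective f.
Proof.
move=> [hf _ [I [b [v [sp iv _ lf]]]]]; apply: alghom_inj0 => // x fx.
apply: (tlead_inj h0 _ _ sp iv lf fx); first exact: alghom0.
by move=> a y z; rewrite (alghomD hf) (alghomM hf) (alghomK hf).
Qed.

(** Elements of disjoint blocks commute, so the product of two morphisms is one. Leading exponents
    add with disjoint supports, so each pair of them is recovered from the sum. *)
Lemma embeds_tensor (A B : kalgType K) (f : A -> torus) (g : B -> torus) k m n :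
  embeds f k m -> embeds g (k + m) n ->
  exists2 F : tensor A B -> torus, embeds F k (m + n) &
    forall a b, F (tens a b) = f a * g b.
Proof.
move=> [hf sf [I [a [v [sA iv sv lv]]]]] [hg sg [J [b [w [sB iw sw lw]]]]].
have [||||||F hF FE] := @tensor_hom K A B torus (fun x y => f x * g y).
- by move=> x x' y; rewrite (alghomD hf) mulrDl.
- by move=> x y y'; rewrite (alghomD hg) mulrDr.
- by move=> c x y; rewrite (alghomM hf) (alghomK hf) mulrA.
- by move=> c x y; rewrite (alghomM hg) (alghomK hg) kscalAC.
- move=> x x' y y'; rewrite (alghomM hf) (alghomM hg) -!mulrA; congr (_ * _).
  by rewrite !mulrA; congr (_ * _); symmetry; exact: tsupp_comm (sf x') (sg y).
- by rewrite (alghom1 hf) (alghom1 hg) mulr1.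
have spl (u : nat -> Z) k' n' : supp k' n' u -> (k <= k')%N -> (k' + n' <= k + (m + n))%N ->
    supp k (m + n) u.
  by move=> su k1 k2 i i1; apply: su; lia.
have tw x k' n' : tsupp k' n' x -> (k <= k')%N -> (k' + n' <= k + (m + n))%N ->
    tsupp k (m + n) x.
  move=> tx k1 k2; apply: lspanW tx => _ [u -> su]; apply: lspan_in; exists u => //.
  exact: spl su k1 k2.
exists F => //; split=> //.
  move=> x; move: x (tens_span sA sB x); apply: lspan_lin; first exact: alghom0.
    by move=> c y z; rewrite (alghomD hF) (alghomM hF) (alghomK hF).
  move=> _ [[i j] ->]; rewrite FE; apply: lspanM (tw _ _ _ (sf _) _ _) (tw _ _ _ (sg _) _ _);
    try lia.
  move=> _ _ [u -> su] [u' -> su']; rewrite tmonM //; apply/lspanZ/lspan_in.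
  by exists (vadd u u') => // l nl; rewrite /vadd su // su'.
exists (I * J)%type, (fun ij => tens (a ij.1) (b ij.2)), (fun ij => vadd (v ij.1) (w ij.2)).
split; first exact: tens_span.
- move=> [i j] [i' j'] /= e.
  have ee l : (v i l + w j l = v i' l + w j' l)%Z by exact: (congr1 (@^~ l) e).
  congr (_, _); [apply: iv | apply: iw]; apply: funext => l.
    case: (boolP (3 * k <= l < 3 * (k + m))%N) => lk; last by rewrite !sv.
    have := ee l; rewrite !sw; lia.
  case: (boolP (3 * (k + m) <= l < 3 * (k + m + n))%N) => lk; last by rewrite !sw.
  have := ee l; rewrite !sv; lia.
- move=> [i j] l /= nl; rewrite /vadd (spl _ _ _ (sv i)) ?(spl _ _ _ (sw j)) //; lia.
by move=> [i j] /=; rewrite FE; exact: tleadM.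
Qed.

End Embedding.

(** * The quantum group in the quantum torus *)

Section TorusValues.
Variables (K : fieldType) (h : K).
Hypothesis h0 : h != 0.
Notation q := (h ^+ 2).
Notation torus := (torus K).
Variables (V : Type) (T : V -> seq term).

Fixpoint tval (e : ex V) : seq term :=
  match e with
  | Lv c => T c
  | Lk k => constp (keval k)
  | Ladd a b => addp (tval a) (tval b)
  | Lopp a => negp (tval a)
  | Lmul a b => mulp (tval a) (tval b)
  | Lexp a n => iter n (mulp (tval a)) tone
  end.

Lemma tvalE e : pev h (tval e) = den q (fun c => pev h (T c)) e.
Proof.
elim: e => [c|k|a IHa b IHb|a IHa|a IHa b IHb|a IHa n] /=.
- by [].
- by symmetry; apply: pev_const; rewrite keval_kden.
- by rewrite pev_addp IHa IHb.
- by rewrite pev_negp IHa.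
- by rewrite pev_mulp // IHa IHb.
- elim: n => [|n IH]; first by rewrite (pev_tone h) expr0.
  by rewrite iterS (pev_mulp h0) IH IHa; symmetry; exact: exprS.
Qed.

Definition teq (r : ex V * ex V) : bool := nilp (addp (tval r.1) (negp (tval r.2))).

Lemma teqP r : teq r -> den q (fun c => pev h (T c)) r.1 = den q (fun c => pev h (T c)) r.2.
Proof. by move=> /nilP e; rewrite -!tvalE; exact: (pev_eq (h := h) erefl erefl e). Qed.

End TorusValues.

Definition ugen (k : nat) (g : Ugenerator) : seq term :=
  match g with
  | gK => [:: (blk k 0 0 2, 0, 1)]
  | gKi => [:: (blk k 0 0 (-2), 0, 1)]
  | gF => [:: (blk k 0 1 0, 0, 1)]
  | gE => addp [:: (blk k 1 (-1) 0, 0, 1)] (addp [:: (blk k 0 (-1) 2, 2, -1)]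
            [:: (blk k 0 (-1) (-2), -2, -1)])
  end%Z.

Notation "a '*e' b" := (Lmul a b) (at level 40, left associativity).
Notation "a '+e' b" := (Ladd a b) (at level 50, left associativity).
Definition kd : kx := Kadd (Kq 1) (Kopp (Kqi 1)).
Notation eK := (Lv gK).
Notation eKi := (Lv gKi).
Notation eE := (Lv gE).
Notation eF := (Lv gF).

(* [gE] and [gF] stand for (q - q^-1) E and (q - q^-1) F. *)
Definition urels : seq (ex Ugenerator * ex Ugenerator) :=
  [:: (eK *e eKi, Lk (Knat 1)); (eKi *e eK, Lk (Knat 1));
      (eK *e eE, Lk (Kq 2) *e eE *e eK); (eK *e eF, Lk (Kqi 2) *e eF *e eK);
      (eE *e eF +e Lopp (eF *e eE), Lk kd *e (eK +e Lopp eKi))].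

Definition eCas : ex Ugenerator :=
  eF *e eE +e Lk (Kq 1) *e eK +e Lk (Kqi 1) *e eKi.

Lemma urels_check : all (fun k => all (teq (ugen k)) urels) (seq.iota 0 4).
Proof. by vm_compute. Qed.

Lemma bvecZ k l y c n : (fun i => (Z.of_nat n * bvec k l y c i)%Z) =
  bvec k (Z.of_nat n * l) (Z.of_nat n * y) (Z.of_nat n * c).
Proof.
elim: n => [|n IH].
  by rewrite !(Z.mul_0_l) bvec0; apply: funext => i; rewrite Z.mul_0_l.
rewrite (_ : (fun i => _) = vadd (bvec k l y c) (fun i => (Z.of_nat n * bvec k l y c i)%Z)).
  by rewrite IH bvecD; congr (bvec _ _ _ _); lia.
by apply: funext => i; rewrite /vadd; lia.
Qed.

Lemma bvec_supp k l y c : supp k 1 (bvec k l y c).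
Proof. by move=> i ni; apply: bvec_out; lia. Qed.

Lemma bvec_inj k l y c l' y' c' : bvec k l y c = bvec k l' y' c' ->
  [/\ l = l', y = y' & c = c'].
Proof.
move=> e; have [e1 e2 e3] := bvecE k l y c; have [f1 f2 f3] := bvecE k l' y' c'.
by split; [rewrite -e1 -f1 e | rewrite -e2 -f2 e | rewrite -e3 -f3 e].
Qed.

(** An integer power for which y plays the part of the inverse of x, without having to be one. *)
Definition zp (A : pzRingType) (x y : A) (b : Z) : A :=
  if Z.leb 0 b then x ^+ Z.to_nat b else y ^+ Z.to_nat (- b).

Lemma zpE (A : pzRingType) (x y : A) b :
  zp x y b = x ^+ Z.to_nat b * y ^+ Z.to_nat (- b).
Proof.
rewrite /zp; case: Z.leb_spec0 => b0.
  by rewrite (_ : Z.to_nat (- b) = 0%N) ?mulr1 //; lia.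
by rewrite (_ : Z.to_nat b = 0%N) ?mul1r //; lia.
Qed.

Lemma zpS (A : pzRingType) (x y : A) b : x * y = 1 -> x * zp x y b = zp x y (b + 1).
Proof.
move=> xy; rewrite !zpE; case: (Z.le_gt_cases 0 b) => b0.
  have -> : Z.to_nat (- (b + 1)) = 0%N by lia.
  have -> : Z.to_nat (- b) = 0%N by lia.
  by rewrite !mulr1 -exprS; congr (_ ^+ _); lia.
have -> : Z.to_nat (b + 1) = 0%N by lia.
have -> : Z.to_nat b = 0%N by lia.
have -> : Z.to_nat (- b) = (Z.to_nat (- (b + 1))).+1 by lia.
by rewrite !mul1r exprS mulrA xy mul1r.
Qed.

Lemma zpP (A : pzRingType) (x y : A) b : y * x = 1 -> y * zp x y b = zp x y (b - 1).
Proof.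
move=> yx; rewrite !zpE; case: (Z.le_gt_cases b 0) => b0.
  have -> : Z.to_nat (b - 1) = 0%N by lia.
  have -> : Z.to_nat b = 0%N by lia.
  by rewrite !mul1r -exprS; congr (_ ^+ _); lia.
have -> : Z.to_nat (- b) = 0%N by lia.
have -> : Z.to_nat (- (b - 1)) = 0%N by lia.
have -> : Z.to_nat b = (Z.to_nat (b - 1)).+1 by lia.
by rewrite !mulr1 exprS mulrA yx mul1r.
Qed.

Lemma qcommX (K : fieldType) (A : kalgType K) c (z x : A) n :
  z * x = c%:K * (x * z) -> z * x ^+ n = (c ^+ n)%:K * (x ^+ n * z).
Proof.
move=> zx; elim: n => [|n IH]; first by rewrite !expr0 kscal1 !mul1r mulr1.
by rewrite !exprSr mulrA IH -!mulrA zx [x ^+ n * _]kscalAC kscalM -!mulrA.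
Qed.

Lemma tlead_zp (K : fieldType) (h : K) c (x y : torus K) (v w : nat -> Z) b : h != 0 ->
  tlead h c x v -> tlead h c y w -> (forall i, w i = - v i)%Z ->
  tlead h c (zp x y b) (fun i => (b * v i)%Z).
Proof.
move=> h0 lx ly wv; have X := tleadM h0 (tleadX h0 (Z.to_nat b) lx) (tleadX h0 (Z.to_nat (- b)) ly).
rewrite zpE (_ : (fun i => _) = vadd (fun i => (Z.of_nat (Z.to_nat b) * v i)%Z)
   (fun i => (Z.of_nat (Z.to_nat (- b)) * w i)%Z)) //.
apply: funext => i; rewrite /vadd wv.
case: (Z.le_gt_cases 0 b) => b0.
  by rewrite Z2Nat.id // (_ : Z.to_nat (- b) = 0%N); lia.
by rewrite (_ : Z.to_nat b = 0%N) ?Z2Nat.id; lia.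
Qed.

Lemma alghom_zp (K : fieldType) (A B : kalgType K) (f : A -> B) x y b : alghom f ->
  f (zp x y b) = zp (f x) (f y) b.
Proof. by move=> hf; rewrite !zpE (alghomM hf) !(alghomX hf). Qed.

Lemma zp0 (A : pzRingType) (x y : A) : zp x y 0 = 1.
Proof. by rewrite zpE mulr1. Qed.

Lemma qcomm_zp (K : fieldType) (A : kalgType K) c c' (x y z : A) b :
  z * x = c%:K * (x * z) -> z * y = c'%:K * (y * z) ->
  exists c'', z * zp x y b = c''%:K * (zp x y b * z).
Proof.
move=> /qcommX zx /qcommX zy; exists (c ^+ Z.to_nat b * c' ^+ Z.to_nat (- b)).
by rewrite zpE mulrA zx -!mulrA zy [x ^+ _ * _]kscalAC kscalM -!mulrA.
Qed.

Section ExPresentation.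
Variables (K : fieldType) (q : K) (V : choiceType) (rels : seq (ex V * ex V)).
Let r0 : ex V * ex V := (Lk (Knat 0), Lk (Knat 0)).

(** All indices are allowed, because past the end of the list the default relation equates an
    expression with itself. *)
Definition exrel (l r : freealg K V) : Prop := exists i,
  l = den q fgen (nth r0 rels i).1 /\ r = den q fgen (nth r0 rels i).2.

Definition satisfies (A : kalgType K) (s : V -> A) : Prop :=
  forall i, den q s (nth r0 rels i).1 = den q s (nth r0 rels i).2.

Lemma exrel_sat : satisfies (pgen exrel).
Proof.
move=> i; have r : exrel (den q fgen (nth r0 rels i).1) (den q fgen (nth r0 rels i).2).
  by exists i.
have := presalg_rel r; rewrite !(den_alghom q fgen _ (fev_alghom (pgen exrel))).
by rewrite !(den_ext q (s' := pgen exrel)) // => v; exact: (fev_gen (pgen exrel)).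
Qed.

Lemma exrel_hom (A : kalgType K) (s : V -> A) : satisfies s ->
  exists2 f : presalg exrel -> A, alghom f & forall v, f (pgen exrel v) = s v.
Proof.
move=> H; apply: presalg_hom => l r [i [-> ->]].
rewrite !(den_alghom q fgen _ (fev_alghom s)).
by rewrite !(den_ext q (s' := s)) // => v; exact: (fev_gen s).
Qed.

Lemma sat_all (P : pred (ex V * ex V)) (A : kalgType K) (s : V -> A) :
  (forall r, P r -> den q s r.1 = den q s r.2) -> all P rels -> satisfies s.
Proof.
move=> H /(all_nthP r0) a i; case: (ltnP i (size rels)) => i1; first exact/H/a.
by rewrite nth_default.
Qed.

Lemma sat_inj (A B : kalgType K) (f : A -> B) (s : V -> A) : alghom f -> injective f ->
  satisfies (f \o s) -> satisfies s.
Proof. by move=> hf fi H i; apply: fi; rewrite !(den_alghom q s _ hf). Qed.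

End ExPresentation.

Section FreeValues.
Variables (K : fieldType) (I : choiceType) (A : kalgType K) (g : I -> A).
Let hg := fev_alghom g.

Lemma fev_gen2 i j : fev g (fgen i * fgen j) = g i * g j.
Proof. exact: (etrans (alghomM hg _ _) (congr2 *%R (fev_gen g i) (fev_gen g j))). Qed.
Lemma fev_scal_gen2 a i j : fev g (a%:K * fgen i * fgen j) = a%:K * g i * g j.
Proof.
apply: (etrans (alghomM hg _ _) (congr2 *%R _ (fev_gen g j))).
exact: (etrans (fevZ g _ _) (congr1 ( *%R _) (fev_gen g i))).
Qed.
Lemma fev_comm i j : fev g (fgen i * fgen j - fgen j * fgen i) = g i * g j - g j * g i.
Proof.
exact: (etrans (alghomB hg _ _) (congr2 (fun x y => x - y) (fev_gen2 _ _) (fev_gen2 _ _))).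
Qed.
Lemma fev_scal_sub a i j : fev g (a%:K * (fgen i - fgen j)) = a%:K * (g i - g j).
Proof.
apply: (etrans (fevZ g _ _) (congr1 ( *%R _) _)).
exact: (etrans (alghomB hg _ _) (congr2 (fun x y => x - y) (fev_gen g i) (fev_gen g j))).
Qed.

End FreeValues.

Lemma qcomm_swap (K : fieldType) (A : kalgType K) c (x y : A) : c != 0 ->
  x * y = c%:K * y * x -> y * x = (c^-1)%:K * (x * y).
Proof. by move=> c0 ->; rewrite -mulrA mulrA -kscalM mulVf ?kscal1 ?mul1r. Qed.

Lemma qcomm_inv (K : fieldType) (A : kalgType K) c (x y z : A) : x * y = 1 -> y * x = 1 ->
  x * z = c%:K * z * x -> z * y = c%:K * (y * z).
Proof.
move=> xy yx xz; rewrite -[LHS]mul1r -yx -!mulrA [x * (_ * _)]mulrA xz -!mulrA xy mulr1.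
exact: kscalAC.
Qed.

Lemma kscal_cancelV (K : fieldType) (A : kalgType K) a (x : A) : a != 0 ->
  (a^-1)%:K * (a%:K * x) = x.
Proof. by move=> a0; rewrite mulrA -kscalM mulVf // kscal1 mul1r. Qed.

Lemma casimir_scale (K : fieldType) (A : kalgType K) d a b (F E X Ki : A) :
  (d ^+ 2)%:K * F * E + a%:K * X + b%:K * Ki =
  (d%:K * F) * (d%:K * E) + a%:K * (1%:K * X) + b%:K * (1%:K * Ki).
Proof. by rewrite kscalMM expr2 !kscal1 !mul1r mulrA. Qed.

Section PBW.
Variables (K : fieldType) (A : kalgType K) (X Ki E F : A) (c dd : K).
Hypothesis c0 : c != 0.
Hypothesis XKi : X * Ki = 1.
Hypothesis KiX : Ki * X = 1.
Hypothesis XE : X * E = c%:K * E * X.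
Hypothesis XF : X * F = (c^-1)%:K * F * X.
Hypothesis EF : E * F - F * E = dd%:K * (X - Ki).

Let U_EK : E * X = (c^-1)%:K * (X * E). Proof. exact: qcomm_swap. Qed.
Let U_EKi : E * Ki = c%:K * (Ki * E). Proof. exact: qcomm_inv XE. Qed.
Let U_KiF : Ki * F = c%:K * (F * Ki).
Proof.
have := qcomm_inv XKi KiX XF; rewrite mulrA => /qcomm_swap.
by rewrite invr_eq0 invrK; apply.
Qed.

Definition pbw (i : nat * Z * nat) : A := F ^+ i.1.1 * zp X Ki i.1.2 * E ^+ i.2.
Let spbw := lspan (fun y => exists i, y = pbw i).

(** The letters X, Ki and F act on the left of an ordered monomial up to scalars. Only E requires an
    induction, on the power of F: moving it past one F leaves a term with one F less. *)
Lemma pbw_span x : gens (fun y => [\/ y = X, y = Ki, y = E | y = F]) x -> spbw x.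
Proof.
have inp a z b : spbw (F ^+ a * zp X Ki z * E ^+ b).
  by apply: lspan_in; exists (a, z, b).
move=> gx; apply: (gens_lspan _ _ gx).
  by have := inp 0 0%Z 0; rewrite zp0 !mulr1.
have lin y : (forall i, spbw (y * pbw i)) -> forall w, spbw w -> spbw (y * w).
  move=> H; apply: (@lspan_lin _ _ _ ( *%R y)); first exact: mulr0.
    by move=> r u v; rewrite mulrDr kscalAC.
  by move=> _ [i ->]; exact: H.
have HF i : spbw (F * pbw i) by rewrite /pbw !mulrA -exprS; exact: inp.
have HK i : spbw (X * pbw i).
  have e : X * F = (c^-1)%:K * (F * X) by rewrite XF mulrA.
  rewrite /pbw !mulrA (qcommX _ e) -!mulrA; apply: lspanZ.
  by rewrite [X * _]mulrA (zpS _ XKi) !mulrA; exact: inp.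
have HKi i : spbw (Ki * pbw i).
  rewrite /pbw !mulrA (qcommX _ U_KiF) -!mulrA; apply: lspanZ.
  by rewrite [Ki * _]mulrA (zpP _ KiX) !mulrA; exact: inp.
move=> _ w [] -> [[[a z] b] ->]; [exact: HK | exact: HKi | | exact: HF].
rewrite /pbw /=; elim: a => [|a IH].
  have [c' e] := qcomm_zp z U_EK U_EKi.
  rewrite expr0 mul1r mulrA e -!mulrA -exprS; apply: lspanZ.
  by have := inp 0 z b.+1; rewrite expr0 mul1r.
have -> : E * (F ^+ a.+1 * zp X Ki z * E ^+ b) =
    F * (E * (F ^+ a * zp X Ki z * E ^+ b)) +
    (dd)%:K * (X * pbw (a, z, b) - Ki * pbw (a, z, b)).
  rewrite -mulrBl [dd%:K * _]mulrA -EF /pbw /= mulrBl exprS !mulrA.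
  by rewrite addrC subrK.
apply: lspanD; first exact: (lin _ HF).
by apply: lspanZ; apply: lspanB; [exact: HK | exact: HKi].
Qed.

End PBW.

Section Iota.
Variables (K : fieldType) (h : K).
Hypothesis h0 : h != 0.
Notation q := (h ^+ 2).
Notation d := (q - q^-1).
Hypothesis d0 : d != 0.
Notation torus := (torus K).
Notation U := (U q).
Notation UK := (UK q).
Notation UKi := (UKi q).
Notation UE := (UE q).
Notation UF := (UF q).

Let g0 := pgen (U_rel q).

Lemma U_KKi : UK * UKi = 1.
Proof.
exact: (etrans (esym (fev_gen2 g0 gK gKi))
  (etrans (presalg_rel (U_rel_KKi q)) (alghom1 (fev_alghom g0)))).
Qed.
Lemma U_KiK : UKi * UK = 1.
Proof.
exact: (etrans (esym (fev_gen2 g0 gKi gK))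
  (etrans (presalg_rel (U_rel_KiK q)) (alghom1 (fev_alghom g0)))).
Qed.
Lemma U_KE : UK * UE = (q ^+ 2)%:K * UE * UK.
Proof.
exact: (etrans (esym (fev_gen2 g0 gK gE))
  (etrans (presalg_rel (U_rel_KE q)) (fev_scal_gen2 g0 _ gE gK))).
Qed.
Lemma U_KF : UK * UF = (q ^- 2)%:K * UF * UK.
Proof.
exact: (etrans (esym (fev_gen2 g0 gK gF))
  (etrans (presalg_rel (U_rel_KF q)) (fev_scal_gen2 g0 _ gF gK))).
Qed.
Lemma U_EF : UE * UF - UF * UE = (d^-1)%:K * (UK - UKi).
Proof.
apply: (etrans (esym (fev_comm g0 gE gF))).
exact: (etrans (presalg_rel (U_rel_EF q)) (fev_scal_sub g0 _ gK gKi)).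
Qed.

(** After scaling, the relations and the images in the torus have integral coefficients in h and
    h^-1, as the computations require. *)
Definition uscale (g : Ugenerator) : K := if g is (gE | gF) then d else 1.
Definition us (g : Ugenerator) : U := (uscale g)%:K * pgen (U_rel q) g.

Lemma uscale0 g : uscale g != 0.
Proof. by case: g; rewrite /= ?oner_neq0. Qed.

Lemma U_us g : pgen (U_rel q) g = ((uscale g)^-1)%:K * us g.
Proof. by rewrite /us kscal_cancelV ?uscale0. Qed.

Lemma U_hom (A : kalgType K) (s : Ugenerator -> A) : satisfies q urels s ->
  exists2 f : U -> A, alghom f & forall g, f (us g) = s g.
Proof.
move=> ss; have := (ss 0, ss 1, ss 2, ss 3, ss 4)%N.
rewrite /= !kscal1; set xK := s gK; set xKi := s gKi; set xE := s gE; set xF := s gF.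
move=> [[[[r1 r2] r3] r4] r5].
pose g x := ((uscale x)^-1)%:K * s x.
have hg := fev_alghom g.
have [gKE gKiE] : g gK = xK /\ g gKi = xKi by rewrite /g /= invr1 kscal1 !mul1r.
have [|f hf fg] := @presalg_hom K _ (U_rel q) A g.
  move=> l r [||||].
  - apply: (etrans (fev_gen2 g gK gKi) (etrans _ (esym (alghom1 hg)))).
    by rewrite gKE gKiE.
  - apply: (etrans (fev_gen2 g gKi gK) (etrans _ (esym (alghom1 hg)))).
    by rewrite gKE gKiE.
  - apply: (etrans (fev_gen2 g gK gE) (etrans _ (esym (fev_scal_gen2 g _ gE gK)))).
    by rewrite gKE /g /= -/xE kscalAC r3 mulrA kscalAC !mulrA.
  - apply: (etrans (fev_gen2 g gK gF) (etrans _ (esym (fev_scal_gen2 g _ gF gK)))).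
    by rewrite gKE /g /= -/xF kscalAC r4 mulrA kscalAC !mulrA.
  - apply: (etrans (fev_comm g gE gF) (etrans _ (esym (fev_scal_sub g _ gK gKi)))).
    rewrite gKE gKiE /g /= -/xE -/xF !kscalMM -mulrBr r5 mulrA -kscalM.
    by congr (_%:K * _); rewrite -mulrA mulVf ?mulr1.
exists f => // x; rewrite /us (alghomM hf) (alghomK hf) fg.
by rewrite kscal_cancel ?uscale0.
Qed.

Definition iotaU (k : nat) : U -> torus := the_alghom (fun f =>
  forall g, f (us g) = pev h (ugen k g)).

Lemma iotaUP k : (k < 4)%N -> alghom (iotaU k) /\
  forall g, iotaU k (us g) = pev h (ugen k g).
Proof.
move=> k4; apply: the_alghomP.
have rk : all (teq (ugen k)) urels.
  by have := allP urels_check k; rewrite mem_iota; apply.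
by have [f hf fE] := U_hom (sat_all (@teqP _ _ h0 _ _) rk); exists f.
Qed.

Section Block.
Variable k : nat.
Hypothesis k4 : (k < 4)%N.
Let hi := (iotaUP k4).1.

Lemma iotaU_us g : iotaU k (us g) = pev h (ugen k g).
Proof. exact: (iotaUP k4).2. Qed.

Lemma iotaU_gen g : iotaU k (pgen (U_rel q) g) = ((uscale g)^-1)%:K * pev h (ugen k g).
Proof. by rewrite U_us (alghomM hi) (alghomK hi) iotaU_us. Qed.

Lemma iotaU_den e : iotaU k (den q us e) = pev h (tval (ugen k) e).
Proof.
by rewrite (den_alghom _ _ _ hi) tvalE //; apply: den_ext => g /=; exact: iotaU_us.
Qed.

Lemma Casimir_den : Casimir q = den q us eCas.
Proof.
exact: casimir_scale.
Qed.

Lemma ugen_E_lead : tlead h wts (pev h (ugen k gE)) (bvec k 1 (-1) 0).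
Proof.
rewrite /ugen !pev_addp /pev !big_seq1 /tev /=; apply: tleadD.
  by apply: tlead_mon; rewrite mul1r oner_neq0.
have w1 c : (wt (bvec k 0 (-1) c) <= wt (bvec k 1 (-1) 0) - 1)%Z.
  by rewrite !wt_bvec //; lia.
by apply: lspanD; apply/lspanZ/lspan_in; [exists (bvec k 0 (-1) 2) | exists (bvec k 0 (-1) (-2))].
Qed.

Lemma blk_lead l y c : tlead h wts (pev h [:: (blk k l y c, 0, 1)%Z]) (bvec k l y c).
Proof.
rewrite /pev !big_seq1 /tev /=.
by apply: tlead_mon; rewrite mul1r oner_neq0.
Qed.

Lemma ugen_supp g : tsupp h k 1 (pev h (ugen k g)).
Proof.
have H l y c e n : tsupp h k 1 (pev h [:: (blk k l y c, e, n)%Z]).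
  rewrite /pev big_seq1 /tev /=; apply/lspanZ/lspan_in; exists (bvec k l y c) => //.
  exact: bvec_supp.
by case: g; rewrite /ugen ?pev_addp; [exact: H | exact: H | do 2?apply: lspanD; exact: H | exact: H].
Qed.

Lemma tsupp_gens (A : kalgType K) (f : A -> torus) (S : A -> Prop) n : alghom f ->
  (forall x, S x -> tsupp h k n (f x)) -> forall x, gens S x -> tsupp h k n (f x).
Proof.
move=> hf fS x; have t1 : tsupp h k n 1.
  by rewrite -(tmon0 h); apply: lspan_in; exists (fun=> 0%Z).
elim=> [a|y /fS //|y z _ IHy _ IHz|y z _ IHy _ IHz].
- by rewrite (alghomK hf) -[_%:K]mulr1; apply: lspanZ.
- by rewrite (alghomD hf); apply: lspanD.
rewrite (alghomM hf); apply: lspanM IHy IHz => _ _ [u -> su] [w -> sw].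
rewrite tmonM //; apply/lspanZ/lspan_in; exists (vadd u w) => // i ni.
by rewrite /vadd su // sw.
Qed.

(** The leading monomial of F^a K^z E^c is Lambda^c F^(a-c) K^z, which determines a, z and c;
    independence of the PBW monomials is thus a by-product. *)
Lemma iotaU_embeds : embeds h (iotaU k) k 1.
Proof.
split=> //.
  move=> x; apply: (tsupp_gens hi _ (presalg_gens x)) => _ [g ->].
  by rewrite iotaU_gen; apply: lspanZ; exact: ugen_supp.
exists (nat * Z * nat)%type, (pbw UK UKi UE UF),
  (fun i => bvec k (Z.of_nat i.2) (Z.of_nat i.1.1 - Z.of_nat i.2) (2 * i.1.2)).
split.
- move=> x; apply: (pbw_span _ U_KKi U_KiK U_KE U_KF U_EF); first by rewrite !expf_neq0.
  apply: gensW (presalg_gens x) => _ [[] ->]; apply: gens_in;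
    [exact: Or41 | exact: Or42 | exact: Or43 | exact: Or44].
- by move=> [[a z] c] [[a' z'] c'] /= /bvec_inj[*]; congr (_, _, _); lia.
- by move=> i; exact: bvec_supp.
move=> [[a z] c] /=; rewrite /pbw /= !(alghomM hi) !(alghomX hi) (alghom_zp UK UKi z hi).
have gen g v : tlead h wts (pev h (ugen k g)) v -> tlead h wts (iotaU k (pgen (U_rel q) g)) v.
  by move=> lg; rewrite iotaU_gen; apply: tleadZ => //; rewrite invr_eq0 uscale0.
have X1 := tleadX h0 a (gen gF _ (blk_lead 0 1 0)).
have X2 := tlead_zp z h0 (gen gK _ (blk_lead 0 0 2)) (gen gKi _ (blk_lead 0 0 (-2))).
have X3 := tleadX h0 c (gen gE _ ugen_E_lead).
have zb : (fun i => (z * bvec k 0 0 2 i)%Z) = bvec k 0 0 (2 * z).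
  apply: funext => i; rewrite /bvec /vec /blk !nth_cat; case: ifP => _; first by rewrite !nth_nseq; case: ifP; lia.
  by case: (i - _)%N => [|[|[|j]]] /=; rewrite ?nth_nseq; try case: ifP; lia.
have X := tleadM h0 (tleadM h0 X1 (X2 _)) X3.
rewrite !bvecZ zb !bvecD in X.
rewrite (_ : bvec _ _ _ _ = bvec k (Z.of_nat a * 0 + 0 + Z.of_nat c * 1)
  (Z.of_nat a * 1 + 0 + Z.of_nat c * -1) (Z.of_nat a * 0 + 2 * z + Z.of_nat c * 0)); last first.
  by congr (bvec _ _ _ _); lia.
apply: X => i; have := congr1 (@^~ i) (bvecD k 0 0 2 0 0 (-2)).
by rewrite /vadd /= bvec0; lia.
Qed.

End Block.
End Iota.

(** * The coideal subalgebra *)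

Variant Lgenerator := lE | lF | lK | lC.
HB.instance Definition _ := gen_eqMixin Lgenerator.
HB.instance Definition _ := gen_choiceMixin Lgenerator.

(* (q - q^-1) E, (q - q^-1) F K, K and the Casimir element. *)
Definition elx (g : Lgenerator) : ex Ugenerator :=
  match g with lE => eE | lF => eF *e eK | lK => eK | lC => eCas end.

Definition lgen (k : nat) (g : Lgenerator) : seq term := tval (ugen k) (elx g).

(** A generalized Weyl algebra over the polynomials in K and the Casimir element: both products of E
    and FK are such polynomials. That no further relation holds is shown by [IL_hom]. *)
Definition irels : seq (ex Lgenerator * ex Lgenerator) :=
  let e := Lv lE in let f := Lv lF in let x := Lv lK in let c := Lv lC in
  [:: (x *e e, Lk (Kq 2) *e e *e x); (x *e f, Lk (Kqi 2) *e f *e x);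
      (c *e e, e *e c); (c *e f, f *e c); (c *e x, x *e c);
      (f *e e, Lk (Kq 2) *e (c *e x) +e Lopp (Lk (Kq 3) *e (x *e x)) +e Lopp (Lk (Kq 1)));
      (e *e f, c *e x +e Lopp (Lk (Kqi 1) *e (x *e x)) +e Lopp (Lk (Kq 1)))].

Lemma irels_check : all (fun k => all (teq (lgen k)) irels) (seq.iota 0 4).
Proof. by vm_compute. Qed.

Lemma lgen_check : all (fun k => nilp (addp (lgen k lC) (negp [:: (blk k 1 0 0, 0, 1)%Z])) &&
  nilp (addp (lgen k lF) (negp [:: (blk k 0 1 2, 0, 1)%Z]))) (seq.iota 0 4).
Proof. by vm_compute. Qed.

Section Span.
Variables (K : fieldType) (A : kalgType K) (q : K) (e f x c : A).
Hypothesis q0 : q != 0.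
Hypothesis xe : x * e = (q ^+ 2)%:K * e * x.
Hypothesis xf : x * f = (q ^- 2)%:K * f * x.
Hypothesis ce : c * e = e * c.
Hypothesis cf : c * f = f * c.
Hypothesis cx : c * x = x * c.
Hypothesis fe : f * e = (q ^+ 2)%:K * (c * x) - (q ^+ 3)%:K * (x * x) - q%:K.
Hypothesis ef : e * f = c * x - (q^-1)%:K * (x * x) - q%:K.

(** The usual basis of a generalized Weyl algebra: by the last two relations, powers of f and of e
    need not occur together, so one signed exponent suffices. *)
Definition gwa (i : nat * nat * Z) : A := c ^+ i.1.1 * x ^+ i.1.2 * zp f e i.2.
Let S := lspan (fun y => exists i, y = gwa i).

Lemma gwa_span y : gens (fun y => [\/ y = e, y = f, y = x | y = c]) y -> S y.
Proof.
have inp j b z : S (c ^+ j * x ^+ b * zp f e z) by apply: lspan_in; exists (j, b, z).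
have inp2 j b z (u : A) : (exists j' b' k, u = k%:K * (c ^+ j' * x ^+ b')) ->
    S (c ^+ j * x ^+ b * (u * zp f e z)).
  move=> [j' [b' [k ->]]]; have cX : x ^+ b * c ^+ j' = c ^+ j' * x ^+ b.
    by symmetry; apply: commrX; apply: commr_sym; apply: commrX.
  rewrite -!mulrA 2!kscalAC; apply: lspanZ.
  rewrite [x ^+ b * (c ^+ j' * _)]mulrA cX.
  rewrite !mulrA -exprD -[c ^+ _ * _ * _]mulrA -exprD; exact: inp.
have fx : f * x = (q ^+ 2)%:K * (x * f).
  by rewrite (qcomm_swap _ xf) ?invrK // invr_eq0 expf_neq0.
have ex : e * x = (q ^- 2)%:K * (x * e) by rewrite (qcomm_swap _ xe) // expf_neq0.
have zpD (u v : A) n : zp u v (Z.of_nat n) = u ^+ n.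
  by rewrite zpE Nat2Z.id (_ : Z.to_nat _ = 0%N) ?mulr1 //; lia.
have zpN (u v : A) n : zp u v (- Z.of_nat n) = v ^+ n.
  by rewrite zpE Z.opp_involutive Nat2Z.id (_ : Z.to_nat _ = 0%N) ?mul1r //; lia.
have zcase z : (exists n, z = Z.of_nat n) \/ (exists n, z = - Z.of_nat n.+1)%Z.
  case: (Z.le_gt_cases 0 z) => z0; first by left; exists (Z.to_nat z); lia.
  by right; exists (Z.to_nat (- z)).-1; lia.
have skip (u : A) k j b z : c * u = u * c -> u * x = k%:K * (x * u) ->
    S (c ^+ j * x ^+ b * (u * zp f e z)) -> S (u * (c ^+ j * x ^+ b * zp f e z)).
  move=> cu ux H; have cuj : u * c ^+ j = c ^+ j * u by apply: commrX; exact: esym.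
  rewrite mulrA [u * (c ^+ j * _)]mulrA cuj -[_ * u * _]mulrA (qcommX b ux) kscalAC.
  rewrite -!mulrA; apply: lspanZ; move: H; rewrite -!mulrA; exact.
move=> gy; apply: (gens_lspan _ _ gy).
  by have := inp 0 0 0%Z; rewrite zp0 !mulr1.
move=> _ w [] -> [[[j b] z] ->]; rewrite /gwa /=.
- apply: (skip _ _ _ _ _ ce ex); case: (zcase z) => -[n ->].
    case: n => [|n]; first by rewrite zp0 mulr1; have := inp j b (-1)%Z; rewrite -[(-1)%Z]/(- Z.of_nat 1)%Z zpN expr1.
    rewrite zpD exprS [e * (f * _)]mulrA ef -(zpD f e) !mulrBl !mulrBr; apply: lspanB; first apply: lspanB; apply: inp2.
    - by exists 1%N, 1%N, 1; rewrite kscal1 mul1r !expr1.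
    - by exists 0%N, 2%N, q^-1; rewrite expr0 mul1r expr2.
    - by exists 0%N, 0%N, q; rewrite !expr0 !mulr1.
  by rewrite zpN -exprS -(zpN f e); exact: inp.
- apply: (skip _ _ _ _ _ cf fx); case: (zcase z) => -[n ->].
    by rewrite zpD -exprS -(zpD f e); exact: inp.
  rewrite zpN exprS [f * (e * _)]mulrA fe -(zpN f e) !mulrBl !mulrBr; apply: lspanB; first apply: lspanB; apply: inp2.
  - by exists 1%N, 1%N, (q ^+ 2); rewrite !expr1.
  - by exists 0%N, 2%N, (q ^+ 3); rewrite expr0 mul1r expr2.
  - by exists 0%N, 0%N, q; rewrite !expr0 !mulr1.
- have xc : x * c ^+ j = c ^+ j * x by apply: commrX; exact: esym.
  by rewrite !mulrA xc -[_ * x * _]mulrA -exprS; exact: inp.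
- by rewrite !mulrA -exprS; exact: inp.
Qed.

End Span.

Section Coideal.
Variables (K : fieldType) (h : K).
Hypothesis h0 : h != 0.
Notation q := (h ^+ 2).
Notation d := (q - q^-1).
Hypothesis d0 : d != 0.
Notation torus := (torus K).
Notation satisfies := (satisfies q irels).

Lemma irels_torus k : (k < 4)%N -> satisfies (fun g => pev h (lgen k g)).
Proof.
move=> k4; apply: (sat_all (P := teq (lgen k))); first exact: teqP.
by have := allP irels_check k; rewrite mem_iota; apply.
Qed.

Section Embed.
Variables (k : nat) (A : kalgType K) (s : Lgenerator -> A) (f : A -> torus).
Hypothesis k4 : (k < 4)%N.
Hypothesis hs : satisfies s.
Hypothesis gs : forall x, gens (fun y => exists g, y = s g) x.
Hypothesis hf : alghom f.
Hypothesis fs : forall g, f (s g) = pev h (lgen k g).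

(** Stated for any algebra generated by elements satisfying [irels], since it serves both for the
    coideal subalgebra and for the abstract algebra presented by [irels]. *)
Lemma gwa_embeds : embeds h f k 1.
Proof.
have /andP[/nilP eC /nilP eF] : nilp (addp (lgen k lC) (negp [:: (blk k 1 0 0, 0, 1)%Z])) &&
    nilp (addp (lgen k lF) (negp [:: (blk k 0 1 2, 0, 1)%Z])).
  by have := allP lgen_check k; rewrite mem_iota; apply.
have pC := pev_eq (h := h) erefl erefl eC; have pF := pev_eq (h := h) erefl erefl eF.
have lead l y c : tlead h wts (pev h [:: (blk k l y c, 0, 1)%Z]) (bvec k l y c) := blk_lead h k l y c.
have sup l y c : tsupp h k 1 (pev h [:: (blk k l y c, 0, 1)%Z]).
  rewrite /pev big_seq1 /tev /=; apply/lspanZ/lspan_in; exists (bvec k l y c) => //.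
  exact: bvec_supp.
split=> //.
  move=> x; apply: (tsupp_gens h0 hf _ (gs x)) => _ [g ->]; rewrite fs.
  case: g; [exact: (ugen_supp h k gE) | rewrite pF; exact: sup | exact: (ugen_supp h k gK)
    | rewrite pC; exact: sup].
exists (nat * nat * Z)%type, (gwa (s lE) (s lF) (s lK) (s lC)),
  (fun i => bvec k (Z.of_nat i.1.1 + Z.max 0 (- i.2)) i.2 (2 * Z.of_nat i.1.2 + 2 * Z.max 0 i.2)).
split.
- move=> x; apply: (gwa_span (q := q) _ (hs 0) (hs 1) (hs 2) (hs 3) (hs 4) (hs 5) (hs 6)).
    by rewrite expf_neq0.
  apply: gensW (gs x) => _ [[] ->]; apply: gens_in;
    [exact: Or41 | exact: Or42 | exact: Or43 | exact: Or44].
- by move=> [[a b] z] [[a' b'] z'] /= /bvec_inj[*]; congr (_, _, _); lia.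
- by move=> i; exact: bvec_supp.
move=> [[j b] z]; rewrite /gwa /= !(alghomM hf) !(alghomX hf) (alghom_zp (s lF) (s lE) z hf) !fs zpE pF pC.
have X1 := tleadX h0 j (lead 1 0 0)%Z; have X2 := tleadX h0 b (lead 0 0 2)%Z.
have X3 := tleadX h0 (Z.to_nat z) (lead 0 1 2)%Z.
have X4 := tleadX h0 (Z.to_nat (- z)) (ugen_E_lead h k4).
have X := tleadM h0 (tleadM h0 X1 X2) (tleadM h0 X3 X4).
rewrite !bvecZ !bvecD in X.
rewrite [bvec _ _ _ _](_ : _ = bvec k (Z.of_nat j * 1 + Z.of_nat b * 0 + (Z.of_nat (Z.to_nat z) * 0 + Z.of_nat (Z.to_nat (- z)) * 1))
  (Z.of_nat j * 0 + Z.of_nat b * 0 + (Z.of_nat (Z.to_nat z) * 1 + Z.of_nat (Z.to_nat (- z)) * -1))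
  (Z.of_nat j * 0 + Z.of_nat b * 2 + (Z.of_nat (Z.to_nat z) * 2 + Z.of_nat (Z.to_nat (- z)) * 0))) //.
by congr (bvec _ _ _ _); lia.
Qed.

End Embed.

Notation IL := (IL q).
Notation iota := (@iotaU K h).

Lemma inclIL_alghom : alghom (@inclIL K q).
Proof. by []. Qed.

Lemma inclIL_inj : injective (@inclIL K q).
Proof. exact: val_inj. Qed.

Definition lscale (g : Lgenerator) : K := if g is (lE | lF) then d else 1.
Definition IL_gen (g : Lgenerator) : IL :=
  match g with lE => ILE q | lF => ILFK q | lK => ILK q | lC => ILCasimir q end.
Definition ls (g : Lgenerator) : IL := (lscale g)%:K * IL_gen g.

Lemma inclIL_ls g : inclIL (ls g) = den q (us h) (elx g).
Proof.
have scal (A : kalgType K) (a : K) (y z : A) : a%:K * (y * z) = a%:K * y * (1%:K * z).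
  by rewrite kscal1 mul1r mulrA.
apply: (etrans (alghomM inclIL_alghom _ _)).
apply: (etrans (congr1 (fun z => z * inclIL (IL_gen g)) (alghomK inclIL_alghom (lscale g)))).
case: g; [exact: erefl | exact: (scal _ d) | exact: erefl |].
apply: (etrans (congr1 (fun z => z * Casimir q) (kscal1 (s := U q)))).
exact: (etrans (mul1r _) (Casimir_den h)).
Qed.

Lemma iotaU_ls k g : (k < 4)%N -> iota k (inclIL (ls g)) = pev h (lgen k g).
Proof. by move=> k4; rewrite inclIL_ls iotaU_den. Qed.

Lemma ls_gens (x : IL) : gens (fun y => exists g, y = ls g) x.
Proof.
have l0 g : lscale g != 0 by case: g; rewrite /= ?oner_neq0.
have gg g : gens (fun y => exists g, y = ls g) (IL_gen g).
  rewrite -(kscal_cancelV (IL_gen g) (l0 g)).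
  by apply: gens_mul; [exact: gens_scal | apply: gens_in; exists g].
suff [y e gy] : exists2 y, inclIL y = inclIL x & gens (fun y => exists g, y = ls g) y.
  by rewrite -(inclIL_inj e).
have : gens (@IL_generators K q) (inclIL x).
  by apply/subalg_genE; have := subalg_valP x; rewrite unfold_in => /asboolP.
elim=> [a|_ []->|u v _ [y <- gy] _ [z <- gz]|u v _ [y <- gy] _ [z <- gz]].
- by exists a%:K => //; exact: gens_scal.
- by exists (IL_gen lE).
- by exists (IL_gen lF).
- by exists (IL_gen lK).
- by exists (IL_gen lC).
- by exists (y + z) => //; exact: gens_add.
- by exists (y * z) => //; exact: gens_mul.
Qed.

Lemma iotaL_alghom k : (k < 4)%N -> alghom (fun x : IL => iota k (inclIL x)).
Proof. by move=> k4; exact: (alghom_comp inclIL_alghom (iotaUP h0 d0 k4).1). Qed.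

Lemma ls_sat : satisfies ls.
Proof.
apply: (sat_inj (iotaL_alghom (isT : 0 < 4)%N)).
  by move=> x y /(embeds_inj h0 (iotaU_embeds h0 d0 (isT : 0 < 4)%N))/inclIL_inj.
have := irels_torus (isT : 0 < 4)%N.
by rewrite (_ : (fun g => pev h (lgen 0 g)) = (fun x : IL => iota 0 (inclIL x)) \o ls) //; apply: funext => g; rewrite /= iotaU_ls.
Qed.

Lemma iotaL_embeds k : (k < 4)%N -> embeds h (fun x : IL => iota k (inclIL x)) k 1.
Proof.
move=> k4; apply: (gwa_embeds k4 ls_sat ls_gens); first exact: iotaL_alghom.
by move=> g; exact: iotaU_ls.
Qed.

(** The algebra presented by [irels] embeds in the torus through its map r to the coideal
    subalgebra. So r is injective; being surjective as well, it shows that [irels] is a complete set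
    of relations, and morphisms may be defined on the generators. *)
Lemma IL_hom (A : kalgType K) (s : Lgenerator -> A) : satisfies s ->
  exists2 f : IL -> A, alghom f & forall g, f (ls g) = s g.
Proof.
move=> ss; have [f hf fE] := exrel_hom ss.
have [r hr rE] := exrel_hom ls_sat.
have [p hp pE] := exrel_hom (irels_torus (isT : 0 < 4)%N).
have pr x : p x = iota 0 (inclIL (r x)).
  apply: (presalg_ext hp (alghom_comp hr (iotaL_alghom (isT : 0 < 4)%N))) => g.
  by rewrite pE -(iotaU_ls g (isT : 0 < 4)%N) -rE.
have pi : injective p.
  apply: (embeds_inj h0 (k := 0) (n := 1)).
  by apply: (gwa_embeds (isT : 0 < 4)%N (@exrel_sat _ _ _ _) (@presalg_gens _ _ _) hp pE).
have ri : injective r by move=> x y e; apply: pi; rewrite !pr e.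
have [k hk kE] : exists2 k : IL -> presalg (exrel q irels), alghom k & forall x, r (k x) = x.
  apply: (alghom_lift (f := idfun : IL -> IL) (alghom_id IL) hr ri) => x.
  suff [y yx] : exists y, r y = x by exists y.
  elim: (ls_gens x) => [a|_ [g ->]|y z _ [u <-] _ [v <-]|y z _ [u <-] _ [v <-]].
  - by exists a%:K; exact: (alghomK hr).
  - by exists (pgen _ g); rewrite rE.
  - by exists (u + v); exact: (alghomD hr).
  - by exists (u * v); exact: (alghomM hr).
exists (f \o k); first exact: alghom_comp.
by move=> g; rewrite /= -fE; congr f; apply: ri; rewrite kE rE.
Qed.

End Coideal.

(** * The coactions *)

Section Powers.
Variables (K : fieldType) (h : K).
Hypothesis h0 : h != 0.
Notation q := (h ^+ 2).
Notation d := (q - q^-1).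
Hypothesis d0 : d != 0.
Notation torus := (torus K).
Notation iota := (@iotaU K h).
Variables (B : kalgType K) (g : nat -> B -> torus).
Hypothesis hg : forall k, (k < 4)%N -> embeds h (g k) k 1.

Fixpoint tiota (n k : nat) : tpow q n B -> torus :=
  match n with
  | 0 => g k
  | n'.+1 => the_alghom (fun f : tensor (U q) (tpow q n' B) -> torus =>
      forall a b, f (tens a b) = iota k a * tiota (n := n') k.+1 b)
  end.

Lemma tiotaP n k : (k + n < 4)%N ->
  embeds h (@tiota n k) k n.+1 /\
  match n return (tpow q n B -> torus) -> Prop with
  | 0 => fun=> True
  | n'.+1 => fun f => forall a b, f (tens a b) = iota k a * @tiota n' k.+1 b
  end (@tiota n k).
Proof.
elim: n k => [|n IH] k kn; first by split=> //; apply: hg; rewrite addn0 in kn.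
have [ec _] := IH k.+1 (ltac:(lia) : k.+1 + n < 4)%N.
have k4 : (k < 4)%N by lia.
have ec' : embeds h (@tiota n k.+1) (k + 1) n.+1 by rewrite addn1.
have [F eF FE] := embeds_tensor h0 (iotaU_embeds h0 d0 k4) ec'.
have [hF _ _] := eF.
have [ht tE] : alghom (@tiota n.+1 k) /\
    forall a b, @tiota n.+1 k (tens a b) = iota k a * @tiota n k.+1 b.
  by apply: the_alghomP; exists F.
split=> //; suff -> : @tiota n.+1 k = F by [].
by apply: funext; apply: (tensor_ext ht hF) => a b; rewrite tE FE.
Qed.

Lemma tiotaS n k a b : (k + n.+1 < 4)%N ->
  tiota k (tens a b : tpow q n.+1 B) = iota k a * @tiota n k.+1 b.
Proof. by move=> kn; exact: (tiotaP kn).2. Qed.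

Lemma tiota_embeds n k : (k + n < 4)%N -> embeds h (@tiota n k) k n.+1.
Proof. by move=> kn; exact: (tiotaP kn).1. Qed.

Lemma tiota_alghom n k : (k + n < 4)%N -> alghom (@tiota n k).
Proof. by move=> /tiota_embeds[]. Qed.

Lemma tiota_inj n k : (k + n < 4)%N -> injective (@tiota n k).
Proof. by move=> /tiota_embeds; exact: embeds_inj. Qed.

End Powers.
Arguments tiota {K h B} g n k _ : simpl never.

(* Lists of pure tensors in U (x) IL, to be summed. *)
Definition tsum : Type := seq (ex Ugenerator * Lgenerator).

Definition tsum_pol (l : tsum) : seq term :=
  foldr (fun p r => addp (mulp (tval (ugen 0) p.1) (lgen 1 p.2)) r) [::] l.

Definition e1 : ex Ugenerator := Lk (Knat 1).
Definition kqq : kx := Kmul (Kq 1) (Kadd (Kq 1) (Kqi 1)).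

(** For [true], the coproduct of a generator of the coideal subalgebra, rewritten with all
    right-hand factors in that subalgebra; for [false], the map tau_L. The generators are the scaled
    ones, which accounts for the differences from the usual coefficients. *)
Definition coact_sum (b : bool) (g : Lgenerator) : tsum :=
  match b, g with
  | true, lE => [:: (eE, lK); (e1, lE)]
  | true, lF => [:: (eF *e eK, lK); (e1, lF)]
  | true, lK => [:: (eK, lK)]
  | true, lC => [:: (eCas +e Lopp (Lk (Kadd (Kq 1) (Kqi 1)) *e eKi), lK); (eKi, lC);
                    (eF, lE); (eKi *e eE, lF)]
  | false, lE => [:: (eK, lE)]
  | false, lF => [:: (eKi, lF); (Lk (Kopp (Kq 1)) *e eF, lC); (Lk kqq *e eF, lK);
                    (Lk (Kopp (Kqi 1)) *e (eF *e eF *e eK), lE)]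
  | false, lK => [:: (e1, lK); (Lk (Kopp (Kqi 1)) *e (eF *e eK), lE)]
  | false, lC => [:: (e1, lC)]
  end.

Definition Delta_ex (g : Ugenerator) : ex (nat * Ugenerator) :=
  match g with
  | gK => Lv (0%N, gK) *e Lv (1%N, gK)
  | gKi => Lv (0%N, gKi) *e Lv (1%N, gKi)
  | gE => Lv (0%N, gE) *e Lv (1%N, gK) +e Lv (1%N, gE)
  | gF => Lv (0%N, gF) +e Lv (0%N, gKi) *e Lv (1%N, gF)
  end.

Definition Delta_pol (g : Ugenerator) : seq term :=
  tval (fun v => ugen v.1 v.2) (Delta_ex g).

Lemma Delta_check : all (teq Delta_pol) urels.
Proof. by vm_compute. Qed.

Lemma DeltaL_check : all (fun g => nilp (addp (tval Delta_pol (elx g))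
  (negp (tsum_pol (coact_sum true g))))) [:: lE; lF; lK; lC].
Proof. by vm_compute. Qed.

Lemma tauL_check : all (teq (fun g => tsum_pol (coact_sum false g))) irels.
Proof. by vm_compute. Qed.

Lemma kscalZZ (K : fieldType) (A : kalgType K) a b (x : A) :
  a%:K * (b%:K * x) = (a * b)%:K * x.
Proof. by rewrite mulrA -kscalM. Qed.

Lemma scal_sum2 (K : fieldType) (A : kalgType K) (e : K) (t t' : A) :
  t + ((- e)%:K * t' + 0) = t - e%:K * t'.
Proof. by rewrite addr0 kscalN mulNr. Qed.

Lemma scal_sum4 (K : fieldType) (A : kalgType K) (a k e d : K) (t1 t2 t3 t4 : A) : d != 0 ->
  (d^-1)%:K * (d%:K * t1 + ((- a * d)%:K * t2 + ((k * d)%:K * t3 + ((- e * d)%:K * t4 + 0)))) =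
  t1 - a%:K * t2 + k%:K * t3 - e%:K * t4.
Proof.
move=> d0; have z x : d^-1 * (x * d) = x by rewrite mulrCA mulVf // mulr1.
by rewrite addr0 !mulrDr !kscalZZ !z mulVf // kscal1 mul1r !addrA !kscalN !mulNr.
Qed.

Lemma scal_fk (K : fieldType) (A : kalgType K) a d (F X : A) :
  a%:K * ((d%:K * F) * (1%:K * X)) = (a * d)%:K * (F * X).
Proof. by rewrite kscal1 mul1r -mulrA kscalZZ. Qed.

Lemma kscal_inv1 (K : fieldType) (A : kalgType K) (x : A) : (1^-1)%:K * x = x.
Proof. by rewrite invr1 kscal1 mul1r. Qed.

Lemma tens_one (K : fieldType) (A B : kalgType K) (y : B) :
  tens (1%:K : A) (1%:K * y) = tens 1 y.
Proof. by rewrite !kscal1 mul1r. Qed.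

Lemma scal_ffk (K : fieldType) (A : kalgType K) a d (F X : A) :
  (- a)%:K * ((d%:K * F) * (d%:K * F) * (1%:K * X)) = (- (a * d ^+ 2))%:K * (F ^+ 2 * X).
Proof.
rewrite kscal1 mul1r -!mulrA [F * (d%:K * _)]kscalAC !kscalZZ !mulNr !expr2.
by rewrite !mulrA.
Qed.

Lemma tensZZ (K : fieldType) (A B : kalgType K) a b (x : A) (y : B) :
  tens (a%:K * x) (b%:K * y) = (a * b)%:K * tens x y.
Proof.
apply: (etrans (tensZl a x _)); apply: (etrans (congr1 ( *%R _) (tensZr b x y))).
exact: kscalZZ.
Qed.

Lemma tens_scal (K : fieldType) (A B : kalgType K) a b c (x x' : A) (y : B) :
  x' = a%:K * x -> a * b = c -> tens x' (b%:K * y) = c%:K * tens x y.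
Proof. by move=> -> <-; exact: tensZZ. Qed.

Section Coaction.
Variables (K : fieldType) (h : K).
Hypothesis h0 : h != 0.
Notation q := (h ^+ 2).
Notation d := (q - q^-1).
Hypothesis d0 : d != 0.
Notation torus := (torus K).
Notation iota := (@iotaU K h).
Notation U := (U q).
Notation IL := (IL q).
Notation us := (us h).
Notation il := (ls h).
Notation UK := (UK q).
Notation UKi := (UKi q).
Notation UE := (UE q).
Notation UF := (UF q).
Notation inclIL := (@inclIL K q).

Notation TU := (@tiota K h U iota).
Notation TL := (@tiota K h IL (fun k x => iota k (inclIL x))).

Let hU k := @iotaU_embeds K h h0 d0 k.
Let hL k := @iotaL_embeds K h h0 d0 k.

Let tiU : (0 + 1 < 4)%N := isT.

Definition tsum_den (l : tsum) : tensor U IL :=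
  \sum_(p <- l) tens (den q us p.1) (il p.2).

Lemma TL_tens a (b : IL) : TL 1 0 (tens a b) = iota 0 a * iota 1 (inclIL b).
Proof. exact: (tiotaS h0 d0 hL (n := 0) (k := 0) a b tiU). Qed.

Lemma TU_tens a b : TU 1 0 (tens a b) = iota 0 a * iota 1 b.
Proof. exact: (tiotaS h0 d0 hU (n := 0) (k := 0) a b tiU). Qed.

Lemma TL_tsum l : TL 1 0 (tsum_den l) = pev h (tsum_pol l).
Proof.
have ht := tiota_alghom h0 d0 hL tiU.
rewrite /tsum_den; elim: l => [|p l IH]; first by rewrite big_nil (alghom0 ht) /pev big_nil.
rewrite big_cons (alghomD ht) IH /= pev_addp (pev_mulp h0); congr (_ + _).
by rewrite TL_tens (iotaU_den h0 d0 (isT : 0 < 4)%N) (iotaU_ls h0 d0 _ (isT : 1 < 4)%N).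
Qed.

Let Dg (g : Ugenerator) : tensor U U :=
  match g with
  | gK => tens (us gK) (us gK)
  | gKi => tens (us gKi) (us gKi)
  | gE => tens (us gE) (us gK) + tens 1 (us gE)
  | gF => tens (us gF) 1 + tens (us gKi) (us gF)
  end.

Let TU_Dg g : TU 1 0 (Dg g) = pev h (Delta_pol g).
Proof.
have ht := tiota_alghom h0 d0 hU tiU.
have h1 k : (k < 4)%N -> iota k 1 = 1 by move=> k4; exact: (alghom1 (iotaUP h0 d0 k4).1).
have iu k x : (k < 4)%N -> iota k (us x) = pev h (ugen k x) by move=> k4; exact: (iotaU_us h0 d0 k4).
have tt x y u v : iota 0 x = u -> iota 1 y = v -> TU 1 0 (tens x y) = u * v.
  by move=> <- <-; exact: TU_tens.
have [h10 h11] := (h1 0%N isT, h1 1%N isT).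
rewrite /Delta_pol tvalE //; case: g.
- exact: (tt _ _ _ _ (iu 0%N gK isT) (iu 1%N gK isT)).
- exact: (tt _ _ _ _ (iu 0%N gKi isT) (iu 1%N gKi isT)).
- apply: (etrans (alghomD ht _ _)); apply: (congr2 +%R (tt _ _ _ _ (iu 0%N gE isT) (iu 1%N gK isT))).
  exact: (etrans (tt _ _ _ _ h10 (iu 1%N gE isT)) (mul1r _)).
- apply: (etrans (alghomD ht _ _)).
  apply: (congr2 +%R _ (tt _ _ _ _ (iu 0%N gKi isT) (iu 1%N gF isT))).
  exact: (etrans (tt _ _ _ _ (iu 0%N gF isT) h11) (mulr1 _)).
Qed.

Lemma Delta_ex_hom : exists2 f : U -> tensor U U, alghom f & forall g, f (us g) = Dg g.
Proof.
apply: (U_hom d0); apply: (sat_inj (tiota_alghom h0 d0 hU tiU) (tiota_inj h0 d0 hU tiU)).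
rewrite (_ : _ \o _ = fun g => pev h (Delta_pol g)); last by apply: funext => g; exact: TU_Dg.
exact: (sat_all (@teqP _ _ h0 _ _) Delta_check).
Qed.

(** The value at K^-1 is forced, being inverse to the value at K. *)
Lemma U_ext (A : kalgType K) (f g : U -> A) : alghom f -> alghom g ->
  f UK = g UK -> f UE = g UE -> f UF = g UF -> f =1 g.
Proof.
move=> hf hg eK eE eF; apply: (presalg_ext hf hg) => -[]; [exact: eK | | exact: eE | exact: eF].
have e1 : f UK * f UKi = 1 by rewrite -(alghomM hf) U_KKi (alghom1 hf).
have e2 : g UKi * g UK = 1 by rewrite -(alghomM hg) U_KiK (alghom1 hg).
by rewrite -[LHS]mul1r -e2 -eK -mulrA e1 mulr1.
Qed.

Lemma Delta_us : alghom (Delta (K := K) (q := q)) /\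
  forall g, Delta (us g) = Dg g.
Proof.
have [f hf fE] := Delta_ex_hom.
have fg g : f (pgen (U_rel q) g) = ((uscale h g)^-1)%:K * Dg g.
  by rewrite (U_us d0) (alghomM hf) (alghomK hf) fE.
have s1 (A B : kalgType K) (x : A) (y : B) : (1^-1)%:K * tens (1%:K * x) (1%:K * y) = tens x y.
  by rewrite tensZZ invr1 mulr1 !kscal1 !mul1r.
have s2 (A B : kalgType K) (x : A) (y : B) : (d^-1)%:K * tens (d%:K * x) (1%:K * y) = tens x y.
  by rewrite tensZZ mulr1 kscal_cancelV.
have s3 (A B : kalgType K) (x : A) (y : B) : (d^-1)%:K * tens (1%:K * x) (d%:K * y) = tens x y.
  by rewrite tensZZ mul1r kscal_cancelV.
have s4 (A B : kalgType K) (x : A) (y : B) : (d^-1)%:K * tens x (d%:K * y) = tens x y.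
  by rewrite tensZr kscal_cancelV.
have s5 (A B : kalgType K) (x : A) (y : B) : (d^-1)%:K * tens (d%:K * x) y = tens x y.
  by rewrite tensZl kscal_cancelV.
have fK : f UK = tens UK UK by exact: (etrans (fg gK) (s1 _ _ _ _)).
have fEE : f UE = tens UE UK + tens 1 UE.
  apply: (etrans (fg gE)); apply: (etrans (mulrDr _ _ _)).
  exact: (congr2 +%R (s2 _ _ _ _) (s4 _ _ _ _)).
have fF : f UF = tens UF 1 + tens UKi UF.
  apply: (etrans (fg gF)); apply: (etrans (mulrDr _ _ _)).
  exact: (congr2 +%R (s5 _ _ _ _) (s3 _ _ _ _)).
have [hD [DK DE DF]] : alghom (Delta (K := K) (q := q)) /\ [/\ Delta UK = tens UK UK,
    Delta UE = tens UE UK + tens 1 UE & Delta UF = tens UF 1 + tens UKi UF].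
  by apply: the_alghomP; exists f.
split=> // g; rewrite -fE; apply: (U_ext hD hf); by rewrite ?DK ?DE ?DF.
Qed.

Lemma TU_tens_map x : TU 1 0 (tens_map idfun inclIL x) = TL 1 0 x.
Proof.
have [hm mE] := tens_mapP (alghom_id U) (inclIL_alghom h).
apply: (tensor_ext (alghom_comp hm (tiota_alghom h0 d0 hU tiU)) (tiota_alghom h0 d0 hL tiU)).
by move=> a b; rewrite /= mE TU_tens TL_tens.
Qed.

Lemma tens_map_coact_sum g :
  tens_map idfun inclIL (tsum_den (coact_sum true g)) = Delta (inclIL (il g)).
Proof.
have [hD DE] := Delta_us; apply: (tiota_inj h0 d0 hU tiU).
rewrite TU_tens_map TL_tsum (inclIL_ls h) (den_alghom _ _ _ hD).
rewrite (den_alghom _ _ _ (tiota_alghom h0 d0 hU tiU)).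
rewrite (den_ext q (s' := fun g => pev h (Delta_pol g))); last first.
  by move=> x; rewrite /= DE; exact: TU_Dg.
rewrite -tvalE //; symmetry.
have ck : all (fun g => nilp (addp (tval Delta_pol (elx g))
  (negp (tsum_pol (coact_sum true g))))) [:: g].
  by have := DeltaL_check => /and5P[*]; case: g; rewrite all_seq1.
move: ck; rewrite all_seq1 => /nilP.
exact: (pev_eq (h := h) erefl erefl).
Qed.

(** The tensor product of U with the coideal subalgebra injects into that of U with itself, as both
    are embedded compatibly in two blocks. The coproduct of each generator lies in the image, by the
    computation in the torus, and hence so does that of every element. *)
Lemma DeltaL_ls : alghom (DeltaL (K := K) (q := q)) /\
  forall g, DeltaL (il g) = tsum_den (coact_sum true g).
Proof.
have [hD _] := Delta_us; have [hm _] := tens_mapP (alghom_id U) (inclIL_alghom h).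
have im : injective (tens_map idfun inclIL : tensor U IL -> tensor U U).
  move=> x y e; apply: (tiota_inj h0 d0 hL tiU); by rewrite -!TU_tens_map e.
have [hL' LE] : alghom (DeltaL (K := K) (q := q)) /\
    forall x, tens_map idfun inclIL (DeltaL x) = Delta (inclIL x).
  apply: the_alghomP; apply: (alghom_lift (alghom_comp (inclIL_alghom h) hD) hm im) => x.
  suff [y yx] : exists y, tens_map idfun inclIL y = Delta (inclIL x) by exists y.
  elim: (ls_gens d0 x) => [a|_ [g ->]|y z _ [u yu] _ [v zv]|y z _ [u yu] _ [v zv]].
  - by exists a%:K; rewrite (alghomK hm) (alghomK (inclIL_alghom h)) (alghomK hD).
  - by exists (tsum_den (coact_sum true g)); exact: tens_map_coact_sum.
  - by exists (u + v); rewrite (alghomD hm) yu zv (alghomD (inclIL_alghom h)) (alghomD hD).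
  - by exists (u * v); rewrite (alghomM hm) yu zv (alghomM (inclIL_alghom h)) (alghomM hD).
by split=> // g; apply: im; rewrite LE tens_map_coact_sum.
Qed.

(** The proposed values satisfy [irels] because their images in the torus do; the remaining steps
    undo the scaling of the generators to recover the defining formulas. *)
Lemma tauL_ls : alghom (tauL (K := K) (q := q)) /\
  forall g, tauL (il g) = tsum_den (coact_sum false g).
Proof.
have [f hf fE] : exists2 f : IL -> tensor U IL, alghom f &
    forall g, f (il g) = tsum_den (coact_sum false g).
  apply: (IL_hom h0 d0); apply: (sat_inj (tiota_alghom h0 d0 hL tiU) (tiota_inj h0 d0 hL tiU)).
  rewrite (_ : _ \o _ = fun g => pev h (tsum_pol (coact_sum false g))); last first.
    by apply: funext => g; exact: TL_tsum.
  exact: (sat_all (@teqP _ _ h0 _ _) tauL_check).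
have l0 g : lscale h g != 0 by case: g; rewrite /= ?oner_neq0.
have fg g : f (IL_gen h g) = ((lscale h g)^-1)%:K * tsum_den (coact_sum false g).
  by rewrite -fE /ls (alghomM hf) (alghomK hf) kscal_cancelV.
have f1 : f (ILE q) = tens UK (ILE q).
  rewrite (fg lE) /tsum_den big_seq1 [den _ _ _]/(1%:K * UK) [il _]/(d%:K * ILE q).
  by rewrite tensZZ mul1r kscal_cancelV.
have f2 : f (ILFK q) = tens UKi (ILFK q) - q%:K * tens UF (ILCasimir q)
               + (q * (q + q^-1))%:K * tens UF (ILK q)
               - (q^-1 * d ^+ 2)%:K * tens (UF ^+ 2 * UK) (ILE q).
  rewrite (fg lF) /tsum_den !big_cons big_nil.
  have FFK : den q us (Lk (Kopp (Kqi 1)) *e (eF *e eF *e eK)) =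
      (- (q^-1 * d ^+ 2))%:K * (UF ^+ 2 * UK).
    exact: scal_ffk.
  have T1 : tens (den q us eKi) (il lF) = d%:K * tens UKi (ILFK q).
    exact: (@tens_scal K U IL 1 d d UKi (1%:K * UKi) (ILFK q) erefl (mul1r d)).
  have T2 : tens (den q us (Lk (Kopp (Kq 1)) *e eF)) (il lC) = (- q * d)%:K * tens UF (ILCasimir q).
    exact: (@tens_scal K U IL (- q * d) 1 _ UF _ (ILCasimir q) (kscalZZ (- q) d UF) (mulr1 _)).
  have T3 : tens (den q us (Lk kqq *e eF)) (il lK) = (q * (q + q^-1) * d)%:K * tens UF (ILK q).
    exact: (@tens_scal K U IL (q * (q + q^-1) * d) 1 _ UF _ (ILK q) (kscalZZ (q * (q + q^-1)) d UF) (mulr1 _)).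
  have T4 := @tens_scal K U IL _ d _ _ _ (ILE q) FFK erefl.
  exact: (etrans (congr1 ( *%R _) (congr2 +%R T1 (congr2 +%R T2 (congr2 +%R T3
    (congr1 (fun t => t + 0) T4))))) (scal_sum4 q _ _ _ _ _ _ d0)).
have f3 : f (ILK q) = tens 1 (ILK q) - (q^-1 * d ^+ 2)%:K * tens (UF * UK) (ILE q).
  rewrite (fg lK) /tsum_den !big_cons big_nil.
  have T1 : tens (den q us e1) (il lK) = tens 1 (ILK q) by exact: (@tens_one K U IL (ILK q)).
  have T2 : tens (den q us (Lk (Kopp (Kqi 1)) *e (eF *e eK))) (il lE) =
      (- (q^-1 * d ^+ 2))%:K * tens (UF * UK) (ILE q).
    apply: (@tens_scal K U IL (- q^-1 * d) d _ (UF * UK) _ (ILE q) (scal_fk (- q^-1) d UF UK)).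
    by rewrite expr2 !mulNr mulrA.
  apply: (etrans (kscal_inv1 _)).
  exact: (etrans (congr2 +%R T1 (congr1 (fun t => t + 0) T2)) (scal_sum2 _ _ _)).
have f4 : f (ILCasimir q) = tens 1 (ILCasimir q).
  rewrite (fg lC) /tsum_den big_seq1; apply: (etrans (kscal_inv1 _)).
  exact: (@tens_one K U IL (ILCasimir q)).
have [ht [t1 t2 t3 t4]] : alghom (tauL (K := K) (q := q)) /\
  [/\ tauL (ILE q) = tens UK (ILE q),
      tauL (ILFK q) = tens UKi (ILFK q) - q%:K * tens UF (ILCasimir q)
               + (q * (q + q^-1))%:K * tens UF (ILK q)
               - (q^-1 * d ^+ 2)%:K * tens (UF ^+ 2 * UK) (ILE q),
      tauL (ILK q) = tens 1 (ILK q) - (q^-1 * d ^+ 2)%:K * tens (UF * UK) (ILE q)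
    & tauL (ILCasimir q) = tens 1 (ILCasimir q)].
  by apply: the_alghomP; exact: (ex_intro2 _ _ f hf (And4 f1 f2 f3 f4)).
split=> // g; rewrite -fE.
have e x : tauL (IL_gen h x) = f (IL_gen h x).
  by case: x; [exact: (etrans t1 (esym f1)) | exact: (etrans t2 (esym f2))
    | exact: (etrans t3 (esym f3)) | exact: (etrans t4 (esym f4))].
exact: (etrans (alghomM ht _ _) (etrans (congr2 *%R (etrans (alghomK ht _)
  (esym (alghomK hf _))) (e g)) (esym (alghomM hf _ _)))).
Qed.

End Coaction.

(** * The Askey--Wilson generators in the quantum torus *)

(** A pure tensor: its factors in U from left to right, followed by a generator of the coideal
    subalgebra. *)
Definition pterm : Type := (seq (ex Ugenerator) * Lgenerator)%type.

Definition coact_step (b : bool) (l : seq pterm) : seq pterm :=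
  flatten [seq [seq (rcons t.1 p.1, p.2) | p <- coact_sum b t.2] | t <- l].

Fixpoint coact_iter (c : code) (n : nat) : seq pterm :=
  if n is j.+1 then coact_step (nth false c j) (coact_iter c j) else [:: ([::], lC)].

Fixpoint pterm_pol (k n : nat) (l : seq (ex Ugenerator)) (g : Lgenerator) : seq term :=
  if n is n'.+1 then
    mulp (tval (ugen k) (head e1 l)) (pterm_pol k.+1 n' (behead l) g)
  else lgen k g.

Definition pterms_pol (n : nat) (l : seq pterm) : seq term :=
  foldr (fun t r => addp (pterm_pol 0 n t.1 t.2) r) [::] l.

Definition code_max (c : code) : nat :=
  foldr maxn 0%N [seq if nth false c k then k else 0%N | k <- seq.iota 0 4].

(** The two values are added, not subtracted: an Askey-Wilson generator is minus the state sum of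
    the loop. *)
Lemma Lambda_check : all (fun c => nilp (addp (pterms_pol (code_max c) (coact_iter c (code_max c)))
  (lpol c))) lcodes.
Proof. by vm_compute. Qed.

Lemma code_max_lt : all (fun c => code_max c < 4)%N codes.
Proof. by []. Qed.

Lemma code_maxE (X : {set 'I_4}) : (\max_(i in X) i)%N = code_max (code_of X).
Proof.
rewrite big_mkcond (eq_bigr (fun i : 'I_4 => if nth false (code_of X) i then val i else 0%N)).
  by rewrite !big_ord_recl big_ord0.
by move=> i _; rewrite nth_code.
Qed.

Lemma coact_iter_size c n t : t \in [seq size u.1 | u <- coact_iter c n] ->
  t = n.
Proof.
elim: n t => [|n IH] t /=; first by rewrite inE => /eqP.
rewrite /coact_step; elim: (coact_iter c n) IH => //= u l IHl IH.
rewrite map_cat mem_cat => /orP[|/IHl]; last first.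
  by apply => v vl; apply: IH; rewrite inE vl orbT.
have un : size u.1 = n by apply: IH; rewrite mem_head.
rewrite -map_comp; elim: (coact_sum _ _) => //= p ps IHp.
by rewrite inE size_rcons un => /predU1P[|/IHp].
Qed.

Lemma tens_scal1 (K : fieldType) (A B : kalgType K) a : tens (a%:K : A) (1 : B) = a%:K.
Proof.
apply: (etrans (congr1 (fun x => tens x (1 : B)) (esym (mulr1 (a%:K : A))))).
exact: (etrans (tensZl a 1 1) (etrans (congr1 _ (tens1 A B)) (mulr1 _))).
Qed.

Section Pure.
Variables (K : fieldType) (h : K).
Hypothesis h0 : h != 0.
Notation q := (h ^+ 2).
Notation d := (q - q^-1).
Hypothesis d0 : d != 0.
Notation torus := (torus K).
Notation iota := (@iotaU K h).
Notation U := (U q).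
Notation IL := (IL q).
Notation us := (us h).
Notation il := (ls h).
Notation inclIL := (@inclIL K q).
Notation TU := (@tiota K h U iota).
Let hU k := @iotaU_embeds K h h0 d0 k.

Fixpoint pure_tens (n : nat) (l : seq U) (x : IL) : tpow q n IL :=
  if n is n'.+1 then tens (head 1 l) (pure_tens n' (behead l) x) else x.

Fixpoint tens_tail (n : nat) (l : seq U) (t : tensor U IL) : tpow q n.+1 IL :=
  if n is n'.+1 then tens (head 1 l) (tens_tail n' (behead l) t) else t.

Lemma tens_tail_add n l : tens_tail n l 0 = 0 /\
  forall s t, tens_tail n l (s + t) = tens_tail n l s + tens_tail n l t.
Proof.
elim: n l => [|n IH] l; first by split.
have [i0 iD] := IH (behead l); split=> [|s t].
  exact: (etrans (congr1 (tens (head 1 l)) i0) (tens0r _ _)).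
exact: (etrans (congr1 (tens (head 1 l)) (iD s t)) (tensDr _ _ _)).
Qed.

Lemma tens_tail_sum n l (I : Type) (r : seq I) (F : I -> tensor U IL) :
  tens_tail n l (\sum_(i <- r) F i) = \sum_(i <- r) tens_tail n l (F i).
Proof. have [i0 iD] := tens_tail_add n l; exact: (big_morph (tens_tail n l) iD i0). Qed.

Lemma tens_tail_tens n l a x : size l = n ->
  tens_tail n l (tens a x) = pure_tens n.+1 (rcons l a) x.
Proof.
elim: n l => [|n IH] l; first by move=> /size0nil->.
case: l => [|b l] sl; first by discriminate sl.
exact: (congr1 (tens b) (IH l (succn_inj sl))).
Qed.

Section Coact.
Variable alpha : IL -> tensor U IL.
Hypothesis ha : alghom alpha.

Lemma coact_alghom n : alghom (coact alpha (n := n)).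
Proof.
elim: n => [|n IH]; [exact: ha | exact: (tens_mapP (alghom_id U) IH).1].
Qed.

Lemma coact_pure_tens n l x : coact alpha (pure_tens n l x) = tens_tail n l (alpha x).
Proof.
elim: n l => [|n IH] l; first exact: erefl.
apply: (etrans ((tens_mapP (alghom_id U) (coact_alghom n)).2 _ _)).
exact: (congr1 (tens (head 1 l)) (IH (behead l))).
Qed.

End Coact.

Lemma iter_coactE X n : (n <= 4)%N -> iter_coact q X n =
  \sum_(t <- coact_iter (code_of X) n) pure_tens n (map (den q us) t.1) (il t.2).
Proof.
elim: n => [_|n IH n4].
  by rewrite big_seq1 /=; symmetry; apply: (etrans (congr1 ( *%R^~ _) (kscal1 (s := IL)))); exact: mul1r.
have -> : iter_coact q X n.+1 =
  coact (if nth false (code_of X) n then DeltaL (q := q) else tauL (q := q)) (iter_coact q X n).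
  by rewrite /= -[nth _ _ n]/(nth false (code_of X) (Ordinal n4)) nth_code
    (_ : inord n = Ordinal n4) //; apply: val_inj; rewrite /= inordK.
rewrite IH 1?ltnW //; set b := nth _ _ _; pose al := if b then DeltaL (q := q) else tauL (q := q).
have [ha aE] : alghom al /\ forall g, al (il g) = tsum_den h (coact_sum b g).
  by rewrite /al; case: (b); [exact: DeltaL_ls | exact: tauL_ls].
rewrite -/al (alghom_sum (coact_alghom ha n)) /= -/b.
have sz := @coact_iter_size (code_of X) n; rewrite /coact_step.
elim: (coact_iter (code_of X) n) sz => [|t l IHl] sz /=; first by rewrite !big_nil.
rewrite big_cons big_cat IHl => [|v vl]; last by apply: sz; rewrite inE vl orbT.
congr (_ + _); rewrite (coact_pure_tens ha) aE /tsum_den big_map.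
rewrite tens_tail_sum; apply: eq_bigr => p _; rewrite tens_tail_tens ?map_rcons //.
by rewrite size_map; apply: sz; rewrite mem_head.
Qed.

Lemma pad1_alghom m : alghom (pad1 (q := q) m).
Proof.
case: m => [|m]; first exact: inclIL_alghom.
split=> [x y||a].
- exact: tensDl.
- by split=> [|x y]; [exact: tens1 | rewrite /= tensM mulr1].
- exact: tens_scal1.
Qed.

Lemma pad_alghom n m : alghom (pad (q := q) (n := n) m).
Proof.
elim: n => [|n IH]; first exact: pad1_alghom.
exact: (tens_mapP (alghom_id U) IH).1.
Qed.

Lemma TU_pad k n m l g : (k + (n + m) < 4)%N -> size l = n ->
  TU (n + m) k (pad m (pure_tens n (map (den q us) l) (il g))) = pev h (pterm_pol k n l g).
Proof.
elim: n k l => [|n IH] k l kn.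
  move=> _ /=; have k4 : (k < 4)%N by lia.
  case: m kn => [|m] kn; first exact: iotaU_ls.
  apply: (etrans (tiotaS h0 d0 hU _ _ kn)); rewrite (iotaU_ls h0 d0 _ k4).
  by rewrite (alghom1 (tiota_alghom h0 d0 hU _)) ?mulr1 //; lia.
case: l => [|a l] //= [sl].
apply: (etrans (congr1 _ ((tens_mapP (alghom_id U) (pad_alghom n m)).2 _ _))).
apply: (etrans (tiotaS h0 d0 hU _ _ kn)).
rewrite IH //; last by lia.
by rewrite (pev_mulp h0) iotaU_den //; lia.
Qed.

Lemma TU_iter X n m : (n + m = 3)%N ->
  TU (n + m) 0 (pad m (iter_coact q X n)) = pev h (pterms_pol n (coact_iter (code_of X) n)).
Proof.
move=> nm; have nm4 : (0 + (n + m) < 4)%N by lia.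
rewrite iter_coactE; last by lia.
rewrite (alghom_sum (pad_alghom n m)) (alghom_sum (tiota_alghom h0 d0 hU nm4)).
have := @coact_iter_size (code_of X) n; elim: (coact_iter _ _) => [|t l IHl] sz.
  by rewrite big_nil /pev big_nil.
rewrite big_cons IHl => [|v vl]; last by apply: sz; rewrite inE vl orbT.
rewrite /= pev_addp; congr (_ + _); apply: TU_pad => //.
by apply: sz; rewrite mem_head.
Qed.

Lemma TU_Lambda X : X != finset.set0 ->
  TU 3 0 (Lambda q X) = - pev h (lpol (code_of X)).
Proof.
move=> X0; have lX : code_of X \in lcodes.
  have : all (fun c => (c == nseq 4 false) || (c \in lcodes)) codes by [].
  move=> /allP/(_ _ (code_of_in X))/orP[/eqP e|//].
  by move: X0; rewrite -[X]code_ofK e -code_of0 code_ofK eqxx.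
have := allP Lambda_check _ lX; have := allP code_max_lt _ (code_of_in X).
rewrite /Lambda code_maxE; move: (code_max _) => n n4 /nilP e.
have {e} e : pev h (pterms_pol n (coact_iter (code_of X) n)) = - pev h (lpol (code_of X)).
  by apply/eqP; rewrite -addr_eq0 -pev_addp e /pev big_nil.
by case: n n4 e => [|[|[|[|]]]] // _ <-; exact: TU_iter.
Qed.

End Pure.

(** * The maps from the skein algebra onto the Askey-Wilson algebra *)

Section Main.
Variables (K : fieldType) (h : K).
Hypothesis h0 : h != 0.
Hypothesis h8 : h ^+ 8 != 1.
Notation q := (h ^+ 2).
Notation d := (q - q^-1).
Hypothesis d0 : d != 0.
Notation torus := (torus K).
Notation Sk := (Sk h).
Notation U4 := (U4 q).
Notation TU := (@tiota K h (U q) (@iotaU K h) 3 0).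
Let hU k := @iotaU_embeds K h h0 d0 k.
Let hT : alghom TU := tiota_alghom h0 d0 hU (isT : 0 + 3 < 4)%N.

(** On the loops, hence everywhere, [theta0] takes values in the image of the fourfold tensor power
    of U, which is embedded in the torus; so it lifts. Both sides are replaced by opposite algebras
    in order to lift it as a morphism. *)
Lemma theta_ex : exists theta : Sk -> U4,
  [/\ alg_antihom theta, injective theta, range theta = AW4 q
    & forall X : {set 'I_4}, X != finset.set0 -> theta (sk_loop h X) = - Lambda q X].
Proof.
have hTo : alghom (TU : kop U4 -> kop torus).
  split; first exact: (alghomD hT).
    by split; [exact: (alghom1 hT) | move=> x y; exact: (alghomM hT y x)].
  exact: (alghomK hT).
have iT : injective TU by exact: (tiota_inj h0 d0 hU (isT : 0 + 3 < 4)%N).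
have TUL X : X != finset.set0 -> TU (- Lambda q X) = theta0 h0 (sk_loop h X).
  by move=> X0; rewrite (alghomN hT) (TU_Lambda h0 d0 X0) theta0_loop; exact: opprK.
have hth := theta0_alghom h0.
have [k hk kE] : exists2 k : Sk -> kop U4, alghom k & forall x, TU (k x) = theta0 h0 x.
  apply: (alghom_lift hth hTo iT) => x.
  elim: (loops_generate h0 h8 x) => [a|_ [X ->]|y z _ [u yu] _ [v zv]|y z _ [u yu] _ [v zv]].
  - by exists a%:K; rewrite (alghomK hTo) (alghomK hth).
  - case: (altP (X =P finset.set0)) => [->|X0]; last by exists (- Lambda q X); exact: TUL.
    exists (- (q + q^-1)%:K); rewrite (sk_loop0 h0).
    by rewrite (alghomN hTo) (alghomK hTo) (alghomN hth) (alghomK hth).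
  - by exists (u + v); rewrite (alghomD hTo) yu zv (alghomD hth).
  - by exists (u * v); rewrite (alghomM hTo) yu zv (alghomM hth).
have kL X : X != finset.set0 -> k (sk_loop h X) = - Lambda q X.
  by move=> X0; apply: iT; rewrite kE; symmetry; exact: TUL.
exists k; split=> //.
- split; [exact: (alghomD hk) | exact: (alghomM hk) | exact: (alghomK hk)].
- by move=> x y e; apply: (theta0_inj (h0 := h0)); rewrite -!kE e.
pose S (x : U4) := exists2 X : {set 'I_4}, X != finset.set0 & x = Lambda q X.
have SE x : AW4 q x <-> gens S x by exact: (subalg_genE (A := U4)).
apply/seteqP; split=> [_ [x _ <-]|y /SE gy].
  apply/SE; elim: (loops_generate h0 h8 x) => [a|_ [X ->]|y z _ yu _ zv|y z _ yu _ zv].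
  - by rewrite (alghomK hk); exact: (gens_scal (A := U4)).
  - case: (altP (X =P finset.set0)) => [->|X0].
      rewrite (sk_loop0 h0) (alghomN hk) (alghomK hk).
      by apply: (gens_opp (A := U4)); exact: (gens_scal (A := U4)).
    by rewrite kL //; apply: (gens_opp (A := U4)); apply: gens_in; exists X.
  - by rewrite (alghomD hk); exact: (gens_add (A := U4)).
  - by rewrite (alghomM hk); exact: (gens_mul (A := U4)).
elim: gy => [a|_ [X X0 ->]|y1 z _ [u _ <-] _ [v _ <-]|y1 z _ [u _ <-] _ [v _ <-]].
- by exists a%:K => //; exact: (alghomK hk).
- by exists (- sk_loop h X) => //; rewrite (alghomN hk) kL //; exact: opprK.
- by exists (u + v) => //; exact: (alghomD hk).
- by exists (v * u) => //; exact: (alghomM hk).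
Qed.

Lemma psi_ex : exists psi : Sk -> U4,
  [/\ alghom psi, injective psi & range psi = AW4 q].
Proof.
have [theta [[tD tM tK] it rt _]] := theta_ex; have [rho [hr rK _]] := rho_ex h0 h8.
have t1 : theta 1 = 1 by rewrite -(kscal1 (s := Sk)) tK; exact: (kscal1 (s := U4)).
exists (fun x => theta (rho x)); split.
- split=> [x y||a].
  + by rewrite (alghomD hr); exact: tD.
  + split=> [|x y]; first by rewrite (alghom1 hr).
    by rewrite (alghomM hr); exact: tM.
  + by rewrite (alghomK hr); exact: tK.
- by move=> x y /it /(can_inj rK).
rewrite -rt; apply/seteqP; split=> [_ [x _ <-]|_ [x _ <-]].
  by exists (rho x).
by exists (rho x : Sk) => //; rewrite rK.
Qed.

End Main.

Theorem theorem1p4 (R : realType) :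
  let h : Cq R := q4 R ^+ 2 in
  let q : Cq R := h ^+ 2 in
  [/\ exists phi : loop_presentation q -> Sk h,
        [/\ alghom phi, bijective phi
          & forall i : loop_index, phi (loop_gen q i) = sk_loop h (val i)],
      exists psi : Sk h -> U4 q,
        [/\ alghom psi, injective psi & range psi = AW4 q]
    & exists theta : Sk h -> U4 q,
        [/\ alg_antihom theta, injective theta, range theta = AW4 q
          & forall X : {set 'I_4}, X != finset.set0 ->
              theta (sk_loop h X) = - Lambda q X]].
Proof.
move=> h q.
have x0 : q4 R != 0 by rewrite /q4 tofrac_eq0 polyX_eq0.
have h0 : h != 0 by rewrite expf_neq0.
have h8 : h ^+ 8 != 1.
  (* Here h^8 is the sixteenth power of the variable, so the degrees differ. *)
  rewrite /h -exprM /q4 -tofracXn -tofrac1 tofrac_eq; apply/eqP => /(congr1 (fun p : {poly _} => size p)).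
  by rewrite size_polyXn size_poly1.
(* Otherwise q^2 = 1, and then h^8 = q^4 = 1. *)
have d0 : q - q^-1 != 0.
  apply: contra h8; rewrite subr_eq0 => /eqP e.
  have q0 : q != 0 by rewrite expf_neq0.
  have q2 : q ^+ 2 = 1 by rewrite expr2 {2}e mulfV.
  by rewrite -[8%N]/(2 * 4)%N exprM -/q -[4%N]/(2 * 2)%N exprM q2 expr1n.
split; [exact: phi_bij | exact: psi_ex | exact: theta_ex].
Qed.
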